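(* Let $K$ be a primitive quartic CM field whose real quadratic subfield $K_0$ has class number one. Let $\ell\geq 3$ be a prime number such that $\ell\mathcal{O}_{K_0}=\mathfrak{l}_1\mathfrak{l}_2$ with $\mathfrak{l}_1\neq\mathfrak{l}_2$ prime ideals of norm $\ell$, each generated by a totally positive element of $\mathcal{O}_{K_0}$, and let $\mathbb{F}_q$ be a finite field of characteristic different from $\ell$. Then every $\ell$-isogeny between principally polarized ordinary abelian surfaces defined over $\mathbb{F}_q$, with complex multiplication by orders of $K$ having locally maximal real multiplication at $\ell$, is a composition of an $\mathfrak{l}_1$-isogeny with an $\mathfrak{l}_2$-isogeny.
   Context: A quartic CM field is primitive if it contains no imaginary quadratic subfield. An order $\mathcal{O}$ of $K$ has locally maximal real multiplication at $\ell$ if $\mathcal{O}_{K_0}\otimes\mathbb{Z}_\ell\subset\mathcal{O}\otimes\mathbb{Z}_\ell$. An abelian surface $A$ has complex multiplication by $\mathcal{O}$ if there is an embedding $\iota:K\hookrightarrow\mathrm{End}(A)\otimes\mathbb{Q}$ which restricts to a ring isomorphism between $\mathcal{O}$ and $\mathrm{End}(A)$. Isogenies $I:A\to B$ between such varieties are required to be compatible with the embeddings $\iota_A,\iota_B$, i.e. $I\iota_A(x)=\iota_B(x)I$ for $x\in K$. An isogeny $I:(A,\lambda_A)\to(B,\lambda_B)$ between principally polarized abelian varieties is an $\ell$-isogeny if $\hat I\circ\lambda_B\circ I=\ell\lambda_A$ (equivalently, $\ker I$ is maximal isotropic in $A[\ell]$ for the $\ell$-Weil pairing). For a prime ideal $\mathfrak{l}$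 of $\mathcal{O}_{K_0}$ above $\ell$ and an ordinary abelian surface $A$ defined over $\mathbb{F}_q$ with complex multiplication by an order of $K$ having locally maximal real multiplication at $\ell$, let $\mathcal{O}_0=\mathrm{End}(A)\cap K_0$ (where $\mathrm{End}(A)$ is identified with an order of $K$ via $\iota$) and set $A[\mathfrak{l}]=\{x\in A(\overline{\mathbb{F}}_q):\beta x=0\ \forall\beta\in\mathfrak{l}\cap\mathcal{O}_0\}$. An $\mathfrak{l}$-isogeny is an isogeny starting from $A$ whose kernel is a cyclic subgroup of $A[\mathfrak{l}]$ of order $\ell$. *)

(* Defs.v *)
From HB Require Import structures.
From mathcomp Require Import all_boot all_order all_algebra all_field.
From mathcomp Require Import mpoly.

Set Implicit Arguments.
Unset Strict Implicit.
Unset Printing Implicit Defensive.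

Import Order.TTheory GRing.Theory Num.Theory.
Local Open Scope ring_scope.

(* Varieties are reduced, and are given by their points over an algebraically *)
(* closed field L, together with homogeneous coordinates.  A set S of scalars *)
(* tells which polynomials may be used: S := in_base e (the image of the      *)
(* finite base field) for objects defined over the base field, and S := anyL  *)
(* for geometric objects.                                                     *)
Section Varieties.
Variable L : closedFieldType.
Implicit Type S : L -> Prop.

Definition anyL : L -> Prop := fun _ => True.

Definition in_base (k : finFieldType) (e : {rmorphism k -> L}) : L -> Prop :=
  fun x => exists a, x = e a.

Definition peq N (u v : 'rV[L]_N) : Prop := exists2 c : L, c != 0 & u = c *: v.

Definition ev N (v : 'rV[L]_N) (p : {mpoly L[N]}) : L := p.@[fun i => v 0 i].

Definition form S N d (p : {mpoly L[N]}) : Prop :=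
  p \is d.-homog /\ forall m, S p@_m.

Definition forms S N (E : {mpoly L[N]} -> Prop) : Prop :=
  forall p, E p -> exists d, form S d p.

(* [crd x] is a vector of homogeneous coordinates of x in P^(amb - 1). *)
Record pspace := PSpace
  { pts :> Type; amb : nat; crd : pts -> 'rV[L]_amb }.

Definition embedded (X : pspace) : Prop :=
  (forall x : X, crd x != 0) /\
  (forall x y : X, peq (crd x) (crd y) -> x = y).

Definition projective S (X : pspace) : Prop :=
  embedded X /\
  exists E : {mpoly L[amb X]} -> Prop, forms S E /\
    forall v : 'rV[L]_(amb X), v != 0 ->
      (forall p, E p -> ev v p = 0) <-> exists x : X, peq v (crd x).

Definition quasi_projective S (X : pspace) : Prop :=
  embedded X /\
  exists E F : {mpoly L[amb X]} -> Prop, [/\ forms S E, forms S F &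
    forall v : 'rV[L]_(amb X), v != 0 ->
      ((forall p, E p -> ev v p = 0) /\ (exists2 p, F p & ev v p != 0)) <->
      exists x : X, peq v (crd x)].

Definition zclosed S (X : pspace) (Z : X -> Prop) : Prop :=
  exists E : {mpoly L[amb X]} -> Prop,
    forms S E /\ forall x : X, Z x <-> forall p, E p -> ev (crd x) p = 0.

Definition zopen S (X : pspace) (U : X -> Prop) : Prop :=
  zclosed S (fun x => ~ U x).

Definition irreducible (X : pspace) (Z : X -> Prop) : Prop :=
  (exists x, Z x) /\
  forall Z1 Z2 : X -> Prop, zclosed anyL Z1 -> zclosed anyL Z2 ->
    (forall x, Z x -> Z1 x \/ Z2 x) ->
    (forall x, Z x -> Z1 x) \/ (forall x, Z x -> Z2 x).

Definition dim_ge (X : pspace) (d : nat) : Prop :=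
  exists Z : nat -> X -> Prop,
    (forall i, (i <= d)%N -> zclosed anyL (Z i) /\ irreducible (Z i)) /\
    (forall i, (i < d)%N ->
       (forall x, Z i x -> Z i.+1 x) /\ exists2 x, Z i.+1 x & ~ Z i x).

Definition has_dim (X : pspace) (d : nat) : Prop :=
  dim_ge X d /\ ~ dim_ge X d.+1.

(* Regularity of a function on the subspace U of X.  Multiplying p and q by   *)
(* a form that vanishes outside a smaller neighbourhood shows that asking for *)
(* f = p / q wherever q is nonzero on U is no restriction.                    *)
Definition regular S (X : pspace) (U : X -> Prop) (f : X -> L) : Prop :=
  forall x, U x -> exists d (p q : {mpoly L[amb X]}),
    [/\ form S d p, form S d q, ev (crd x) q != 0 &
      forall y, U y -> ev (crd y) q != 0 ->
        f y = ev (crd y) p / ev (crd y) q].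

Definition regular_unit S (X : pspace) (U : X -> Prop) (f : X -> L) : Prop :=
  regular S U f /\ forall x, U x -> f x != 0.

Definition morph S (X Y : pspace) (f : X -> Y) : Prop :=
  forall x : X, exists d (F : 'I_(amb Y) -> {mpoly L[amb X]}),
    let Fv (y : X) := \row_i ev (crd y) (F i) in
    [/\ forall i, form S d (F i), Fv x != 0 &
      forall y, Fv y != 0 -> peq (Fv y) (crd (f y))].

(* Product variety, through the Segre embedding. *)
Definition pprod (X Y : pspace) : pspace :=
  @PSpace (X * Y)%type _ (fun u => mxvec ((crd u.1)^T *m crd u.2)).

(* A line bundle given by transition functions on a finite open cover:        *)
(* [g i j] turns the j-th trivialization into the i-th one, i.e., a section   *)
(* is a family (s_i) with s_i = g i j * s_j on U i and U j.                   *)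
Record lbdata (X : pspace) := LBData
  { ix : finType; lU : ix -> X -> Prop; lg : ix -> ix -> X -> L }.

Definition line_bundle S (X : pspace) (D : lbdata X) : Prop :=
  [/\ forall i, zopen S (@lU X D i),
      forall x, exists i, @lU X D i x,
      forall i j, regular_unit S (fun x => lU i x /\ lU j x) (@lg X D i j) &
      forall i j l x, @lU X D i x -> lU j x -> lU l x ->
        lg i j x * lg j l x = lg i l x].

Definition lb_iso (X : pspace) (D E : lbdata X) : Prop :=
  exists h : ix D -> ix E -> X -> L,
    (forall i j, regular_unit anyL (fun x => lU i x /\ lU j x) (h i j)) /\
    (forall i i' j j' x, lU i x -> lU i' x -> lU j x -> lU j' x ->
       lg i i' x * h i' j' x = h i j x * lg j j' x).

Definition lb_one (X : pspace) : lbdata X :=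
  @LBData X unit (fun _ _ => True) (fun _ _ _ => 1).

Definition lb_mul (X : pspace) (D E : lbdata X) : lbdata X :=
  @LBData X (ix D * ix E)%type
    (fun i x => lU i.1 x /\ lU i.2 x)
    (fun i j x => lg i.1 j.1 x * lg i.2 j.2 x).

Definition lb_inv (X : pspace) (D : lbdata X) : lbdata X :=
  @LBData X (ix D) (@lU X D) (fun i j x => (lg i j x)^-1).

Definition lb_exp (X : pspace) (D : lbdata X) (n : nat) : lbdata X :=
  @LBData X (ix D) (@lU X D) (fun i j x => lg i j x ^+ n).

Definition lb_pull (X Y : pspace) (f : X -> Y) (D : lbdata Y) : lbdata X :=
  @LBData X (ix D) (fun i x => lU i (f x)) (fun i j x => lg i j (f x)).

(* O(1): the coordinate X_m is the section (X_m / X_i)_i. *)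
Definition lb_O1 (X : pspace) : lbdata X :=
  @LBData X 'I_(amb X)
    (fun i x => crd x 0 i != 0) (fun i j x => crd x 0 j / crd x 0 i).

(* A positive power is the O(1) of a projective embedding Y of X. *)
Definition ample (X : pspace) (D : lbdata X) : Prop :=
  exists2 n, (0 < n)%N &
  exists N (c : X -> 'rV[L]_N), let Y := PSpace c in
    [/\ projective anyL Y, @morph anyL X Y id, @morph anyL Y X id &
        lb_iso (lb_exp D n) (@lb_pull X Y id (lb_O1 Y))].

Record avar := AVar
  { grp :> zmodType; av_amb : nat; av_crd : grp -> 'rV[L]_av_amb }.

Definition asp (A : avar) : pspace := PSpace (@av_crd A).

Definition abelian_variety S (A : avar) : Prop :=
  [/\ projective S (asp A),
      @irreducible (asp A) (fun _ => True),
      exists2 v, peq v (av_crd (0 : A)) & forall i, S (v 0 i),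
      @morph S (pprod (asp A) (asp A)) (asp A) (fun u => u.1 + u.2 : A) &
      @morph S (asp A) (asp A) (fun x => - x : A)].

Definition abelian_surface S (A : avar) : Prop :=
  abelian_variety S A /\ has_dim (asp A) 2%N.

(* p is the characteristic: A[p] has p ^ dim A geometric points. *)
Definition ordinary_surface (p : nat) (A : avar) : Prop :=
  exists s : seq A, [/\ uniq s, size s = (p ^ 2)%N &
    forall a : A, a \in s <-> a *+ p = 0].

Definition hom S (A B : avar) (f : A -> B) : Prop :=
  @morph S (asp A) (asp B) f /\ {morph f : x y / x + y}.

Definition isogeny S (A B : avar) (f : A -> B) : Prop :=
  [/\ hom S f, forall b, exists a, f a = b &
      exists s : seq A, forall a, f a = 0 -> a \in s].

Definition pic0 (A : avar) (D : lbdata (asp A)) : Prop :=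
  line_bundle anyL D /\
  forall a : A, lb_iso (@lb_pull (asp A) (asp A) (fun x => x + a : A) D) D.

Definition fibre (A : avar) (T : pspace) (t : T)
    (Q : lbdata (pprod (asp A) T)) : lbdata (asp A) :=
  @lb_pull (asp A) (pprod (asp A) T) (fun x => (x, t)) Q.

Definition at_origin (A : avar) (T : pspace)
    (Q : lbdata (pprod (asp A) T)) : lbdata T :=
  @lb_pull T (pprod (asp A) T) (fun t => (0 : A, t)) Q.

(* (B, P) is the dual abelian variety of A with its Poincare bundle, in the   *)
(* sense of the universal property among families of elements of Pic^0 that   *)
(* are trivial along the origin.                                              *)
Definition dual_variety S (A B : avar) (P : lbdata (pprod (asp A) (asp B))) :
    Prop :=
  [/\ abelian_variety S B /\ line_bundle S P,
      forall b : B, pic0 (@fibre A (asp B) b P),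
      lb_iso (at_origin P) (lb_one (asp B)),
      forall b b' : B, lb_iso (@fibre A (asp B) (b + b' : B) P)
        (lb_mul (@fibre A (asp B) b P) (@fibre A (asp B) b' P)) &
      forall (T : pspace) (Q : lbdata (pprod (asp A) T)),
        quasi_projective anyL T -> line_bundle anyL Q ->
        (forall t : T, pic0 (fibre t Q)) ->
        lb_iso (at_origin Q) (lb_one T) ->
        exists! phi : T -> B, @morph anyL T (asp B) phi /\
          lb_iso (@lb_pull (pprod (asp A) T) (pprod (asp A) (asp B))
                    (fun u => (u.1, phi u.2)) P) Q].

Record pavar := PAVar {
  pav :> avar;
  pdual : avar;
  poincare : lbdata (pprod (asp pav) (asp pdual));
  polar : pav -> pdual }.

(* The polarization is defined over the base field, and is geometrically of   *)
(* the form phi_M : a |-> t_a^* M (x) M^-1 for an ample line bundle M.        *)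
Definition principally_polarized S (A : pavar) : Prop :=
  [/\ dual_variety S (poincare A),
      hom S (@polar A),
      exists2 mu : pdual A -> A, hom S mu &
        cancel (@polar A) mu /\ cancel mu (@polar A) &
      exists M : lbdata (asp A), [/\ line_bundle anyL M, ample M &
        forall a : A,
          lb_iso (@fibre A (asp (pdual A)) (polar a) (poincare A))
            (lb_mul (@lb_pull (asp A) (asp A) (fun x => x + a : A) M)
                    (lb_inv M))]].

Definition dual_hom S (A B : pavar) (f : A -> B) (fd : pdual B -> pdual A) :
    Prop :=
  hom S fd /\
  forall y : pdual B,
    lb_iso (@fibre A (asp (pdual A)) (fd y) (poincare A))
      (@lb_pull (asp A) (asp B) f
         (@fibre B (asp (pdual B)) y (poincare B))).

Definition ell_isogeny S (l : nat) (A B : pavar) (f : A -> B) : Prop :=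
  isogeny S f /\
  exists2 fd : pdual B -> pdual A, dual_hom S f fd &
    forall a : A, fd (polar (f a)) = polar a *+ l.

(* (f, n) with 0 < n stands for f (x) 1/n. *)
Definition qhom (A B : avar) : Type := ((A -> B) * nat)%type.

Definition qhom_wf S (A B : avar) (u : qhom A B) : Prop :=
  hom S u.1 /\ (0 < u.2)%N.

Definition qeq (A B : avar) (u v : qhom A B) : Prop :=
  exists2 t, (0 < t)%N &
    forall a, u.1 a *+ (t * v.2) = v.1 a *+ (t * u.2).

Definition qint (A B : avar) (f : A -> B) : qhom A B := (f, 1%N).

Definition qadd (A B : avar) (u v : qhom A B) : qhom A B :=
  (fun a => u.1 a *+ v.2 + v.1 a *+ u.2, (u.2 * v.2)%N).

Definition qcomp (A B C : avar) (u : qhom B C) (v : qhom A B) : qhom A C :=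
  (u.1 \o v.1, (u.2 * v.2)%N).

End Varieties.

Arguments anyL {L}.

Definition integer_of (F : fieldExtType rat) (x : F) : Prop :=
  integralOver (intr : int -> F) x.

Definition totally_real (F : fieldExtType rat) : Prop :=
  forall (f : {rmorphism F -> algC}) (x : F), f x \is Num.real.

Definition totally_imaginary (F : fieldExtType rat) : Prop :=
  forall f : {rmorphism F -> algC}, exists x : F, f x \isn't Num.real.

Definition totally_positive (F : fieldExtType rat) (x : F) : Prop :=
  forall f : {rmorphism F -> algC}, 0 < f x.

Definition quartic_CM (K : fieldExtType rat) (K0 : {subfield K}) : Prop :=
  [/\ \dim {:K} = 4%N, \dim K0 = 2%N, totally_real (subvs_of K0) &
      totally_imaginary K].

Definition primitive_CM (K : fieldExtType rat) : Prop :=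
  forall F : {subfield K}, \dim F = 2%N -> ~ totally_imaginary (subvs_of F).

Definition ideal_of (F : fieldExtType rat) (I : F -> Prop) : Prop :=
  [/\ forall x, I x -> integer_of x, I 0,
      forall x y, I x -> I y -> I (x + y) &
      forall a x, integer_of a -> I x -> I (a * x)].

Definition nonzero_ideal (F : fieldExtType rat) (I : F -> Prop) : Prop :=
  ideal_of I /\ exists2 x, I x & x != 0.

(* There is only one class of nonzero ideals for I ~ J <-> a I = b J. *)
Definition class_number_one (F : fieldExtType rat) : Prop :=
  forall I J : F -> Prop, nonzero_ideal I -> nonzero_ideal J ->
  exists a b : F, [/\ integer_of a, integer_of b, a != 0, b != 0 &
    forall z, (exists2 x, I x & z = a * x) <-> (exists2 y, J y & z = b * y)].

Definition prime_ideal_of (F : fieldExtType rat) (I : F -> Prop) : Prop :=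
  [/\ nonzero_ideal I, ~ I 1 &
      forall x y, integer_of x -> integer_of y -> I (x * y) -> I x \/ I y].

Definition ideal_norm (F : fieldExtType rat) (I : F -> Prop) (n : nat) : Prop :=
  exists r : 'I_n -> F, (forall i, integer_of (r i)) /\
    forall x, integer_of x -> exists! i, I (x - r i).

Definition ideal_mul (F : fieldExtType rat) (I J : F -> Prop) : F -> Prop :=
  fun z => exists n (a b : 'I_n -> F),
    [/\ forall i, I (a i), forall i, J (b i) & z = \sum_i a i * b i].

Definition principal (F : fieldExtType rat) (a : F) : F -> Prop :=
  fun z => exists2 x, integer_of x & z = a * x.

(* A subring that is the Z-span of a Q-basis. *)
Definition order_of (K : fieldExtType rat) (O : K -> Prop) : Prop :=
  [/\ O 1, forall x y, O x -> O y -> O (x * y) &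
      exists2 b : (\dim {:K}).-tuple K, basis_of {:K} b &
        forall x, O x <-> exists c : 'I_(\dim {:K}) -> int,
          x = \sum_(i < \dim {:K}) b`_i *~ c i].

(* O_{K0} (x) Z_l is contained in O (x) Z_l: the inclusion is expressed over  *)
(* the localization of Z at l, of which Z_l is the (faithfully flat)          *)
(* completion.                                                                *)
Definition loc_max_RM (K : fieldExtType rat) (K0 : {subfield K}) (l : nat)
    (O : K -> Prop) : Prop :=
  forall x : subvs_of K0, integer_of x ->
    exists2 m, ~~ (l %| m)%N & O (vsval x *+ m).

Section CM.
Variables (L : closedFieldType) (S : L -> Prop) (K : fieldExtType rat).

Definition has_CM (A : avar L) (O : K -> Prop) (iota : K -> qhom A A) : Prop :=
  [/\ (forall x, qhom_wf S (iota x)) /\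
      (forall x y, qeq (iota x) (iota y) -> x = y),
      qeq (iota 1) (qint id),
      (forall x y, qeq (iota (x + y)) (qadd (iota x) (iota y))) /\
      (forall x y, qeq (iota (x * y)) (qcomp (iota x) (iota y))),
      forall x, O x -> exists2 f, hom S f & qeq (iota x) (qint f) &
      forall f, hom S f -> exists2 x, O x & qeq (iota x) (qint f)].

Definition compatible (A B : avar L) (iA : K -> qhom A A) (iB : K -> qhom B B)
    (f : A -> B) : Prop :=
  forall x, qeq (qcomp (qint f) (iA x)) (qcomp (iB x) (qint f)).

Definition cm_surface (p l : nat) (K0 : {subfield K}) (A : avar L)
    (O : K -> Prop) (iota : K -> qhom A A) : Prop :=
  [/\ abelian_surface S A, ordinary_surface p A, order_of O,
      loc_max_RM K0 l O & has_CM O iota].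

(* A[I]: the elements of I that lie in O_0 are those b for which iota b is    *)
(* the class of some f in End(A).                                             *)
Definition ideal_torsion (K0 : {subfield K}) (I : subvs_of K0 -> Prop)
    (A : avar L) (iota : K -> qhom A A) (a : A) : Prop :=
  forall b f, I b -> hom S f -> qeq (iota (vsval b)) (qint f) -> f a = 0.

(* B is the quotient of A by the (reduced) group of points of ker f; this     *)
(* excludes an infinitesimal part of the kernel, invisible on points.         *)
Definition quotient_by_kernel (A B : avar L) (f : A -> B) : Prop :=
  forall (T : pspace L) (h : A -> T), quasi_projective anyL T ->
    @morph L anyL (asp A) T h -> (forall a b, f a = f b -> h a = h b) ->
    exists2 h' : B -> T, @morph L anyL (asp B) T h' & forall a, h a = h' (f a).

Definition ideal_isogeny (l : nat) (K0 : {subfield K}) (I : subvs_of K0 -> Prop)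
    (A B : avar L) (iA : K -> qhom A A) (f : A -> B) : Prop :=
  [/\ isogeny S f, quotient_by_kernel f &
      exists g : A,
        [/\ ideal_torsion I iA g,
            forall a, f a = 0 <-> exists n, a = g *+ n &
            forall n, g *+ n = 0 <-> (l %| n)%N]].

End CM.

(* Main.v *)
From HB Require Import structures.
From mathcomp Require Import all_boot all_order all_fingroup all_algebra all_field.
From mathcomp Require Import mpoly.
From mathcomp Require boolp classical_sets.
From mathcomp Require Import ring lra zify.
Require Import Defs.
Set Implicit Arguments.
Unset Strict Implicit.
Unset Printing Implicit Defensive.
Import Order.TTheory GRing.Theory Num.Theory.
Local Open Scope ring_scope.

(* The isogeny f : A -> B has a dual g : B -> A with g f = l.  Let l1 = (a) and
   l2 = (b) with ab = l, ax + by = 1, and let m, prime to l, be such that ma, mb,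
   mx, my act on A and B, say by al, be, xi, eta.  The kernel of f is the direct
   sum of its intersections G1 and G2 with ker al and ker be, and C, the image of
   (f, al) : A -> B x A, is A / G1; the first projection C -> B has kernel
   isomorphic to G2.  The image is closed and defined over the base field because
   it is {(b, a') : al b = f a', be a' = m^2 g b}, and CM is transported to C
   along x |-> (f x, al x).

   It remains to see that G1 and G2 have order l.  The Rosati involution is an
   involution of K; it is the identity on K0 because K is primitive, so al and be
   are self-adjoint.  Hence the pairing between ker f and ker g, obtained from
   characters of ker f, pairs G1 with ker g \cap ker al, and these two groups
   have the same order; therefore #(A[l] \cap ker al) = #G1^2 and
   #A[l] = (#G1 #G2)^2.  This is at most l^4.  Neither group is trivial: if
   A[l] \cap ker al were, then be would vanish on A[l], so be / l would be an
   endomorphism and mb/l = m/a would be integral.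

   Geometry is done with homogeneous coordinates.  Since [l] acts on cotangent
   spaces as multiplication by l, a homomorphism pi with g pi = [l] is unramified
   when l is invertible, and by Nakayama regular functions descend along it.  The
   bound #A[l] <= l^4 compares the growth of the homogeneous coordinate ring with
   [l]^*M = M^(l^2) for a symmetric ample M; the theorem of the square and the
   adjoints come from the universal property of the Poincare bundle.  Morphisms
   that commute with Frobenius are defined over the base field. *)

(** * The Nullstellensatz *)

(** Varieties are bare sets of points with coordinates, so no quotient is ever constructed: [C]
    lives inside [B x A], where closedness is tested by equations. Likewise a line bundle is
    replaced by a cocycle on pairs of points, and an isomorphism of bundles becomes an identity
    between functions near each point. Finite characteristic shapes the rest. Endomorphisms are
    those over the base field, so adjoints, which the universal property supplies only
    geometrically, have to descend before they come from elements of [K]. Multiplication by p is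
    ramified, so its surjectivity on points rests on ordinarity; divisibility of the group of points
    then removes denominators from the action of [K]. The orders contain O_K0 only locally at l,
    whence the factor m in every identity. The Nullstellensatz is used mostly through one
    consequence, [proj_null]: a graded ideal of forms without common zero on a projective variety
    contains all forms of large degree. Finiteness of fibres, closed images, growth of the
    coordinate ring and quasi-compactness all come from choosing that ideal. *)

Lemma zorn_subset (T : Type) (P : (T -> Prop) -> Prop) (A0 : T -> Prop) :
  P A0 ->
  (forall F : (T -> Prop) -> Prop, (exists A, F A) -> (forall A, F A -> P A) ->
     (forall A B, F A -> F B -> (forall x, A x -> B x) \/ (forall x, B x -> A x)) ->
     P (fun x => exists2 A, F A & A x)) ->
  exists A, [/\ P A, forall x, A0 x -> A x &
    forall B, P B -> (forall x, A x -> B x) -> forall x, B x -> A x].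
Proof.
move=> P0 Pch.
pose Q (A : T -> Prop) := P A /\ forall x, A0 x -> A x.
pose U := {A : T -> Prop | Q A}.
pose u0 : U := exist Q A0 (conj P0 (fun x h => h)).
pose R (u v : U) := boolp.asbool (forall x, sval u x -> sval v x).
have Rr u : R u u by apply/boolp.asboolP.
have Rt u v w : R u v -> R v w -> R u w.
  by move=> /boolp.asboolP h1 /boolp.asboolP h2; apply/boolp.asboolP => x /h1 /h2.
case: (@classical_sets.ZL_preorder U u0 R Rr Rt).
  move=> F tot.
  (* The empty chain is bounded by [A0], so the closure hypothesis is only asked for nonempty
     chains. *)
  case: (boolp.pselect (exists u, F u)) => [[u1 Fu1]|noF]; last first.
    by exists u0 => s Fs; case: noF; exists s.
  pose F' A := exists2 u : U, F u & sval u = A.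
  have [] : P (fun x => exists2 A, F' A & A x) /\ forall x, A0 x -> exists2 A, F' A & A x.
    split.
      apply: Pch.
      - by exists (sval u1), u1.
      - by move=> A [u _ <-]; case: (svalP u).
      - move=> A B [u Fu <-] [v Fv <-].
        case: (tot _ _ Fu Fv) => /boolp.asboolP h; [left|right]; exact: h.
    move=> x h; exists (sval u1); first by exists u1.
    by case: (svalP u1) => _; apply.
  move=> h1 h2; exists (exist Q _ (conj h1 h2)) => s Fs.
  by apply/boolp.asboolP => x sx /=; exists (sval s) => //; exists s.
move=> u mx; exists (sval u); case: (svalP u) => Pu u0u; split=> // B PB uB.
have h : forall x, A0 x -> B x by move=> x /u0u /uB.
have /boolp.asboolP := mx (exist Q B (conj PB h)) (introT (boolp.asboolP _) uB).
by [].
Qed.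

Lemma least_nat (P : nat -> Prop) : (exists n, P n) ->
  exists n, P n /\ forall m, P m -> (n <= m)%N.
Proof.
move=> ex; have ex' : exists n, boolp.asbool (P n).
  by case: ex => n h; exists n; apply/boolp.asboolP.
case: (ex_minnP ex') => n /boolp.asboolP h mn; exists n; split=> // m Pm.
by apply: mn; apply/boolp.asboolP.
Qed.

Definition is_ideal (R : comNzRingType) (J : R -> Prop) :=
  [/\ J 0, forall x y, J x -> J y -> J (x + y) & forall a x, J x -> J (a * x)].

Definition is_prime (R : comNzRingType) (J : R -> Prop) :=
  [/\ is_ideal J, ~ J 1 & forall x y, J (x * y) -> J x \/ J y].

Lemma ideal_sum (R : comNzRingType) (J : R -> Prop) (I : Type) (r : seq I)
  (P : pred I) (F : I -> R) :
  is_ideal J -> (forall i, P i -> J (F i)) -> J (\sum_(i <- r | P i) F i).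
Proof. by case=> J0 JD _ h; elim/big_ind: _. Qed.

Lemma idealN (R : comNzRingType) (J : R -> Prop) x : is_ideal J -> J x -> J (- x).
Proof. by case=> _ _ JM Jx; rewrite -mulN1r; apply: JM. Qed.

Lemma prime_over (R : comNzRingType) (I : R -> Prop) :
  is_ideal I -> ~ I 1 -> exists2 J, is_prime J & forall x, I x -> J x.
Proof.
move=> idI nI1.
pose P (A : R -> Prop) := is_ideal A /\ ~ A 1.
case: (@zorn_subset R P I) => //.
  move=> F [A0 FA0] FP tot; split; last by case=> A /FP[].
  split.
  - by exists A0 => //; case: (FP _ FA0) => -[].
  - move=> x y [A FA Ax] [B FB By].
    case: (tot _ _ FA FB) => h; [exists B|exists A] => //.
      by case: (FP _ FB) => -[_ hD _] _; apply: hD => //; apply: h.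
    by case: (FP _ FA) => -[_ hD _] _; apply: hD => //; apply: h.
  - by move=> a x [A FA Ax]; exists A => //; case: (FP _ FA) => -[_ _ hM] _; apply: hM.
move=> J [[idJ nJ1] IJ mx]; exists J => //; split=> // x y Jxy.
case: (boolp.pselect (J x)) => [|nJx]; [by left|right].
case: (idJ) => J0 JD JM.
(* [B] is the ideal generated by [J] and [x]; by maximality it contains 1 as soon as [x] is outside
   [J]. *)
pose B z := exists a j, J j /\ z = a * x + j.
have idB : is_ideal B.
  split.
  - by exists 0, 0; rewrite mul0r addr0.
  - move=> u v [a [j [Jj ->]]] [b [k [Jk ->]]]; exists (a + b), (j + k).
    by rewrite mulrDl addrACA; split=> //; apply: JD.
  - move=> c u [a [j [Jj ->]]]; exists (c * a), (c * j).
    by rewrite mulrDr mulrA; split=> //; apply: JM.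
have JB z : J z -> B z by exists 0, z; rewrite mul0r add0r.
case: (boolp.pselect (B 1)) => [[a [j [Jj e1]]]|nB1].
  by rewrite -[y]mul1r e1 mulrDl -mulrA (mulrC j); apply: JD; apply: JM.
case: nJx; apply: (mx B) => //; exists 1, 0.
by rewrite mul1r addr0.
Qed.

Lemma size_drop_lead (P : nzRingType) (f : {poly P}) : f != 0 ->
  (size (f - (lead_coef f)%:P * 'X^((size f).-1))%R < size f)%N.
Proof.
rewrite -size_poly_gt0 => szf; rewrite -[X in (_ < X)%N](prednK szf) ltnS; apply/leq_sizeP => j lej.
rewrite coefB coefCM coefXn; case: ltngtP lej => // [lt_j _|<- _].
  by rewrite mulr0 subr0 nth_default // -(prednK szf).
by rewrite mulr1 lead_coefE subrr.
Qed.

Section Extension.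
Variables (P : idomainType) (L : closedFieldType) (J : {poly P} -> Prop).
Hypothesis prJ : is_prime J.
Let J0 a := J a%:P.
Let idJ : is_ideal J. Proof. by case: prJ. Qed.
Let JM f g : J (f * g) -> J f \/ J g. Proof. by case: prJ => _ _; apply. Qed.
Let JD f g : J f -> J g -> J (f + g). Proof. by case: idJ => _ h _; apply: h. Qed.
Let Jm f g : J g -> J (f * g). Proof. by case: idJ => _ _ h; apply: h. Qed.
Let JN f : J f -> J (- f). Proof. exact: idealN. Qed.

Let small (f : {poly P}) := forall i, J0 f`_i.

Let small_J f : small f -> J f.
Proof.
move=> sf; rewrite -[f]coefK poly_def; apply: ideal_sum => // i _.
by rewrite -mul_polyC mulrC; apply: Jm; apply: sf.
Qed.

Let J0X a k : J (a ^+ k)%:P -> ~ J0 a -> False.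
Proof.
elim: k => [|k IH]; first by case: prJ.
by rewrite exprS polyCM => /JM[].
Qed.

Let trunc f : ~ J f -> exists g, [/\ J (f - g), ~ J0 (lead_coef g) & (size g <= size f)%N].
Proof.
have [n] := ubnP (size f); elim: n f => // n IH f lef nJf.
case: (boolp.pselect (J0 (lead_coef f))) => [Jl|nl]; last first.
  by exists f; rewrite subrr; split=> //; case: idJ.
have f0 : f != 0 by apply/eqP => f0; apply: nJf; rewrite f0; case: idJ.
pose h := f - (lead_coef f)%:P * 'X^((size f).-1).
have Jfh : J (f - h) by rewrite /h opprB addrCA subrr addr0 mulrC; apply: Jm.
have szh : (size h < size f)%N by exact: size_drop_lead.
case: (IH h) => [||g [Jhg nl szg]].
- by apply: leq_trans szh _; rewrite -ltnS.
- by move=> Jh; apply: nJf; rewrite -[f](subrK h); apply: JD.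
exists g; split=> //; last by apply: leq_trans szg (ltnW szh).
by rewrite -[f](subrK h) -addrA; apply: JD.
Qed.

(** The elimination step: a point of P modulo [J0] at which [c'] does not vanish extends to a point
    of P[X] modulo [J] at which [c] does not vanish. Pseudo-division replaces the passage to the
    fraction field of P modulo [J0], over which [J] is either zero or generated by one irreducible
    polynomial. *)
Lemma extend_point (c : {poly P}) : ~ J c ->
  exists2 c' : P, ~ J c'%:P & forall chi : {rmorphism P -> L},
    (forall a, J a%:P -> chi a = 0) -> chi c' != 0 ->
    exists2 r : L, forall f, J f -> (map_poly chi f).[r] = 0 &
      (map_poly chi c).[r] != 0.
Proof.
move=> nJc.
(* If no element of [J] has its leading coefficient outside [J0], then [J] consists of the
   polynomials with coefficients in [J0]; any coefficient of [c] outside [J0] serves as [c'], and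
   any nonroot of the image of [c] as [r]. *)
case: (boolp.pselect (exists n Q, [/\ J Q, ~ J0 (lead_coef Q) & size Q = n])); last first.
  move=> noQ.
  have allS f : J f -> small f.
    have [n] := ubnP (size f); elim: n f => // n IH f lef Jf i.
    have Jl : J0 (lead_coef f).
      by apply: boolp.contrapT => nl; apply: noQ; exists (size f), f.
    have [->|f0] := eqVneq f 0; first by rewrite coef0; case: idJ.
    pose h := f - (lead_coef f)%:P * 'X^((size f).-1).
    have szh : (size h < size f)%N by exact: size_drop_lead.
    have sh : small h.
      apply: IH; first by apply: leq_trans szh _; rewrite -ltnS.
      by rewrite /h; apply: JD => //; apply: JN; rewrite mulrC; apply: Jm.
    rewrite -[f](subrK ((lead_coef f)%:P * 'X^((size f).-1))) -/h coefD /J0 polyCD.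
    apply: JD; first exact: sh.
    by rewrite coefCM coefXn polyCM mulrC; apply: Jm.
  case: (boolp.pselect (small c)) => [/small_J//|].
  move=> /boolp.existsNP [i nci]; exists c`_i => // chi chi0 chii.
  have : map_poly chi c != 0.
    by apply/eqP => /(congr1 (fun p : {poly L} => p`_i)); rewrite coef_map coef0; apply/eqP.
  move=> /closed_nonrootP[r /rootP/eqP nr]; exists r => // f /allS sf.
  rewrite (_ : map_poly chi f = 0) ?horner0 //.
  by apply/polyP => j; rewrite coef_map coef0; apply: chi0; apply: sf.
move=> /least_nat [n [[Q [JQ nlQ szQ]] minQ]].
have {}minQ f : J f -> ~ J0 (lead_coef f) -> (size Q <= size f)%N.
  by move=> Jf nl; rewrite szQ; apply: minQ; exists f.
have Q0 : Q != 0 by apply/eqP => Q0; apply: nlQ; rewrite Q0 lead_coef0; case: idJ.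
have szQ1 : (1 < size Q)%N.
  rewrite ltnNge; apply/negP => /size1_polyC Qc; apply: nlQ.
  by rewrite Qc lead_coefC /J0 -Qc.
have sm f : J f -> (size f < size Q)%N -> small f.
  move=> + + i; have [m] := ubnP (size f); elim: m f => // m IH f lef Jf ltf.
  have Jl : J0 (lead_coef f).
    by apply: boolp.contrapT => nl; have := minQ _ Jf nl; rewrite leqNgt ltf.
  have [->|f0] := eqVneq f 0; first by rewrite coef0; case: idJ.
  pose h := f - (lead_coef f)%:P * 'X^((size f).-1).
  have szh : (size h < size f)%N by exact: size_drop_lead.
  rewrite -[f](subrK ((lead_coef f)%:P * 'X^((size f).-1))) -/h coefD /J0 polyCD.
  apply: JD.
    apply: IH; first by apply: leq_trans szh _; rewrite -ltnS.
      by rewrite /h; apply: JD => //; apply: JN; rewrite mulrC; apply: Jm.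
    exact: ltn_trans szh ltf.
  by rewrite coefCM coefXn polyCM mulrC; apply: Jm.
(* [G] stands for the greatest common divisor of [c] and [Q] over the residue field of [J0]. It will
   turn out to be a constant, and the congruence between [G] and [V * c] is then a Bezout
   relation. *)
pose S n := exists G V, [/\ ~ J G, J (G - V * c) & size G = n].
have /least_nat [m [[G [V [nJG JGV szG]]] minG]] : exists n, S n.
  by exists (size c), c, 1; rewrite mul1r subrr; split=> //; case: idJ.
have {}minG f W : ~ J f -> J (f - W * c) -> (size G <= size f)%N.
  by move=> nJf Jf; rewrite szG; apply: minG; exists f, W.
have divE (f g : {poly P}) : g != 0 -> exists k H R,
    lead_coef g ^+ k *: f = H * g + R /\ (size R < size g)%N.
  move=> g0; exists (scalp f g), (f %/ g), (f %% g); split.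
    exact: Pdiv.Idomain.divp_eq.
  by rewrite Pdiv.Idomain.ltn_modp.
have nJlead (g f : {poly P}) k : ~ J0 (lead_coef g) -> ~ J f -> ~ J (lead_coef g ^+ k *: f).
  by move=> nl nJf; rewrite -mul_polyC => /JM[] // /J0X; apply.
have ltGQ : (size G < size Q)%N.
  case: (divE G Q Q0) => k [H [R [eR ltR]]]; apply: leq_ltn_trans ltR.
  apply: (minG _ ((lead_coef Q ^+ k)%:P * V)).
    move=> JR; apply: (nJlead Q G k) => //; rewrite eR; apply: JD => //; exact: Jm.
  have -> : R - (lead_coef Q ^+ k)%:P * V * c =
    (lead_coef Q ^+ k)%:P * (G - V * c) - H * Q.
    have -> : R = (lead_coef Q ^+ k)%:P * G - H * Q by rewrite mul_polyC eR addrC addKr.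
    by ring.
  by apply: JD; [apply: Jm|apply: JN; apply: Jm].
have nlG : ~ J0 (lead_coef G).
  move=> JlG; case: (trunc nJG) => g [JGg nlg szg].
  have : (size G <= size g)%N.
    apply: (minG _ V); first by move=> Jg; apply: nJG; rewrite -[G](subrK g); apply: JD.
    rewrite -[g](subrK G) -addrA; apply: JD => //.
    by rewrite -opprB; apply: JN.
  rewrite leq_eqVlt => /orP[/eqP eqs|]; last by rewrite ltnNge szg.
  have G0 : (0 < size G)%N.
    by rewrite size_poly_gt0; apply/eqP => G0; apply: nJG; rewrite G0; case: idJ.
  have : J0 (G - g)`_(size G).-1.
    apply: sm => //; apply: leq_ltn_trans (size_polyD _ _) _.
    by rewrite size_polyN -eqs maxnn.
  rewrite coefB -lead_coefE eqs -lead_coefE /J0 polyCB => Jd; apply: nlg.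
  rewrite /J0 -[(lead_coef g)%:P](subrK (lead_coef G)%:P); apply: JD => //.
  by rewrite -opprB; apply: JN.
have G0 : G != 0 by apply/eqP => G0; apply: nJG; rewrite G0; case: idJ.
(* Otherwise dividing [Q] by [G] leaves a remainder that minimality of [G] puts into [J]. Then
   [H * G] is in [J], hence [H] is, with leading coefficient outside [J0] and degree below that of
   [Q]. *)
have szG1 : (size G <= 1)%N.
  rewrite leqNgt; apply/negP => szG1.
  case: (divE Q G G0) => k [H [R [eR ltR]]].
  have JR : J R.
    apply: boolp.contrapT => nJR.
    have : (size G <= size R)%N; last by rewrite leqNgt ltR.
    apply: (minG _ (- H * V)) => //.
    have -> : R - - H * V * c = lead_coef G ^+ k *: Q - H * (G - V * c).
      by rewrite eR; ring.
    by apply: JD; [rewrite -mul_polyC; apply: Jm|apply: JN; apply: Jm].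
  have JHG : J (H * G).
    have -> : H * G = lead_coef G ^+ k *: Q - R by rewrite eR addrK.
    by apply: JD; [rewrite -mul_polyC; apply: Jm|apply: JN].
  have JH : J H by case: (JM JHG).
  have eHG : H * G = lead_coef G ^+ k *: Q - R by rewrite eR addrK.
  have lG0 : lead_coef G ^+ k != 0 by rewrite expf_neq0 // lead_coef_eq0.
  have ltRQ : (size (- R) < size (lead_coef G ^+ k *: Q))%N.
    by rewrite size_polyN size_scale //; apply: ltn_trans ltGQ.
  have lHG : lead_coef H * lead_coef G = lead_coef G ^+ k * lead_coef Q.
    by rewrite -lead_coefM eHG lead_coefDl // lead_coefZ.
  have nlH : ~ J0 (lead_coef H).
    move=> JlH; have : J (lead_coef H * lead_coef G)%:P.
      by rewrite mulrC polyCM; apply: Jm.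
    by rewrite lHG polyCM => /JM[/J0X|]; [apply|apply: nlQ].
  have H0 : H != 0 by apply/eqP => H0; apply: nlH; rewrite H0 lead_coef0; case: idJ.
  have := minQ _ JH nlH.
  have : size (H * G) = size Q by rewrite eHG size_polyDl // size_scale.
  by rewrite size_mul // => <-; move: szG1; clear; lia.
have eG := size1_polyC szG1; set d := G`_0 in eG.
exists (lead_coef Q * d).
  by rewrite polyCM -eG => /JM[].
move=> chi chi0; rewrite rmorphM mulf_eq0 negb_or => /andP[chiQ chid].
have szm : size (map_poly chi Q) = size Q by rewrite size_map_poly_id0.
have /closed_rootP [r /rootP Qr] : size (map_poly chi Q) != 1%N.
  by rewrite szm; case: (size Q) szQ1 => [|[]].
have van f : J f -> (map_poly chi f).[r] = 0.
  move=> Jf; case: (divE f Q Q0) => k [H [R [eR ltR]]].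
  have JR : J R.
    have -> : R = lead_coef Q ^+ k *: f - H * Q by rewrite eR addrC addKr.
    by apply: JD; [rewrite -mul_polyC; apply: Jm|apply: JN; apply: Jm].
  have R0 : map_poly chi R = 0.
    by apply/polyP => j; rewrite coef_map coef0; apply: chi0; apply: sm.
  have /eqP := congr1 (fun p => (map_poly chi p).[r]) eR.
  rewrite rmorphD rmorphM /= R0 addr0 hornerM Qr mulr0 map_polyZ hornerZ mulf_eq0.
  by rewrite rmorphXn expf_eq0 (negPf chiQ) andbF /= => /eqP.
exists r => //; apply: contraNneq chid => cr.
have := van _ JGV; rewrite eG rmorphB rmorphM /= map_polyC !hornerE cr mulr0 subr0.
by move=> ->.
Qed.
End Extension.

Section Nullstellensatz.
Variables (L : closedFieldType) (N : nat).

(** Adjoining one variable at a time is the form in which [extend_point] can be iterated. *)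
Fixpoint iter_poly n : idomainType :=
  if n is n'.+1 then {poly iter_poly n'} else L.

(** The value 0 for an index beyond [N] only makes the map total. *)
Definition var_at j : {mpoly L[N]} :=
  if insub j is Some i then 'X_i else 0.

Fixpoint to_mpoly n : {rmorphism iter_poly n -> {mpoly L[N]}} :=
  match n return {rmorphism iter_poly n -> {mpoly L[N]}} with
  | 0 => [the {rmorphism L -> {mpoly L[N]}} of @mpolyC N L]
  | n'.+1 => [the {rmorphism {poly iter_poly n'} -> {mpoly L[N]}} of
      @horner_morph _ _ (to_mpoly n') (var_at n') (fun x => mulrC (var_at n') (to_mpoly n' x))]
  end.

Lemma to_mpolyS n (f : {poly iter_poly n}) :
  to_mpoly n.+1 f = (map_poly (to_mpoly n) f).[var_at n].
Proof. by []. Qed.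

(** Only the first [n] variables occur, so the next coordinate of a point can be changed freely in
    the induction. *)
Lemma to_mpoly_local n (v w : 'I_N -> L) (f : iter_poly n) :
  (forall i : 'I_N, (i < n)%N -> v i = w i) ->
  (to_mpoly n f).@[v] = (to_mpoly n f).@[w].
Proof.
elim: n f => [|n IH] f vw; first by rewrite !mevalC.
rewrite to_mpolyS -!(horner_map (meval _)) -!map_poly_comp /=.
have -> : (var_at n).@[v] = (var_at n).@[w].
  rewrite /var_at; case: insubP => [i _ vi|_]; last by rewrite !meval0.
  by rewrite !mevalXU vw // vi.
congr (_.[_]); apply: eq_map_poly => x /=; apply: IH => i lti.
by apply: vw; apply: ltn_trans lti _.
Qed.

(** Carrying an element [c] outside the ideal is what makes the induction pass: [extend_point]
    trades it for an element in one variable less. *)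
Lemma prime_point n (J : iter_poly n -> Prop) c : (n <= N)%N ->
  is_prime J -> ~ J c ->
  exists2 v : 'I_N -> L, forall f, J f -> (to_mpoly n f).@[v] = 0 &
    (to_mpoly n c).@[v] != 0.
Proof.
elim: n J c => [|n IH] J c ltnN prJ nJc.
  case: (prJ) => [[J0 _ JM] nJ1 _]; exists (fun=> 0) => [f Jf|] /=; rewrite mevalC.
    apply/eqP; apply: boolp.contrapT => /negP f0; apply: nJ1.
    by rewrite -(mulVf f0); apply: JM.
  by apply/eqP => c0; apply: nJc; rewrite c0.
case: (extend_point L prJ nJc) => c' nJc' ext.
pose J' (a : iter_poly n) := J a%:P.
have prJ' : is_prime J'.
  case: (prJ) => [[J0 JD JM] nJ1 Jp]; split=> //.
    split=> // [x y Jx Jy|a x Jx].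
      by rewrite /J' polyCD; apply: JD.
    by rewrite /J' polyCM; apply: JM.
  by move=> x y; rewrite /J' polyCM => /Jp.
case: (IH J' c' (ltnW ltnN) prJ' nJc') => v v0 vc'.
pose chi : {rmorphism iter_poly n -> L} := [the {rmorphism _ -> _} of meval v \o to_mpoly n].
case: (ext chi) => // r r0 rc.
pose w (i : 'I_N) := if (i == n :> nat) then r else v i.
have wE (f : {poly iter_poly n}) : (to_mpoly n.+1 f).@[w] = (map_poly chi f).[r].
  rewrite to_mpolyS -(horner_map (meval _)) -map_poly_comp /=.
  have -> : (var_at n).@[w] = r.
    by rewrite /var_at insubT mevalXU /w eqxx.
  congr (_.[_]); apply: eq_map_poly => x /=; apply: to_mpoly_local => i lti.
  by rewrite /w ltn_eqF.
by exists w => [f Jf|]; rewrite wE //; apply: r0.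
Qed.

Lemma to_mpoly_surj (p : {mpoly L[N]}) : exists q, to_mpoly N q = p.
Proof.
have closedD p1 p2 : (exists q, to_mpoly N q = p1) -> (exists q, to_mpoly N q = p2) ->
  exists q, to_mpoly N q = p1 + p2.
  by case=> q1 <- [q2 <-]; exists (q1 + q2); rewrite rmorphD.
have closedM p1 p2 : (exists q, to_mpoly N q = p1) -> (exists q, to_mpoly N q = p2) ->
  exists q, to_mpoly N q = p1 * p2.
  by case=> q1 <- [q2 <-]; exists (q1 * q2); rewrite rmorphM.
have const n c : exists q, to_mpoly n q = c%:MP.
  elim: n => [|n [q IH]]; first by exists c.
  by exists q%:P; rewrite to_mpolyS map_polyC hornerC.
have vars n : (n <= N)%N -> forall i : 'I_N, (i < n)%N -> exists q, to_mpoly n q = 'X_i.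
  elim: n => // n IH ltnN i; rewrite ltnS leq_eqVlt => /orP[/eqP ei|lti].
    exists 'X; rewrite to_mpolyS map_polyX hornerX /var_at.
    by case: insubP => [j _ ej|]; [congr ('X_ _); apply: val_inj; rewrite /= ej|rewrite -ei ltn_ord].
  case: (IH (ltnW ltnN) i lti) => q eq; exists q%:P.
  by rewrite to_mpolyS map_polyC hornerC.
rewrite [p]mpolyE; elim/big_ind: _ => [|//|m _]; first by exists 0; rewrite rmorph0.
rewrite -mul_mpolyC; apply: (closedM _ _); first exact: const.
rewrite mpolyXE_id; elim/big_ind: _ => [|//|i _]; first by exists 1; rewrite rmorph1.
case: (vars N (leqnn N) i (ltn_ord i)) => q eq; exists (q ^+ m i).
by rewrite rmorphXn /= eq.
Qed.

Lemma mpoly_nonroot (p : {mpoly L[N]}) : p != 0 -> exists v : 'I_N -> L, p.@[v] != 0.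
Proof.
case: (to_mpoly_surj p) => q <- p0.
case: (@prime_point N (fun f => f = 0) q) => //; last by move=> v _; exists v.
  split; last by move=> x y /eqP; rewrite mulf_eq0 => /orP[]/eqP; [left|right].
    by split=> // [x y -> ->|a x ->]; rewrite ?addr0 ?mulr0.
  by move/eqP; rewrite oner_eq0.
by move=> q0; rewrite q0 rmorph0 eqxx in p0.
Qed.

Theorem nullstellensatz (I : {mpoly L[N]} -> Prop) : is_ideal I -> ~ I 1 ->
  exists v : 'I_N -> L, forall p, I p -> p.@[v] = 0.
Proof.
move=> idI nI1; case: (prime_over idI nI1) => J [[J0 JD JM] nJ1 Jp] IJ.
case: (@prime_point N (fun q => J (to_mpoly N q)) 1) => //.
- split; last by move=> x y; rewrite rmorphM => /Jp.
    split=> [|x y Jx Jy|a x Jx]; rewrite ?rmorph0 ?rmorphD ?rmorphM //=.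
      exact: JD.
    exact: JM.
  by rewrite rmorph1.
- by rewrite rmorph1.
move=> v vJ _; exists v => p /IJ; case: (to_mpoly_surj p) => q <-; exact: vJ.
Qed.
End Nullstellensatz.

(** * Functions given by forms *)

Section HomogeneousFunctions.
Variable L : closedFieldType.
Implicit Types (S : L -> Prop) (X Y Z : pspace L).

Definition scalars S := [/\ S 1, forall x y, S x -> S y -> S (x - y) &
  forall x y, S x -> S y -> S (x * y)].

Lemma anyL_scalars : scalars (@anyL L). Proof. by []. Qed.

Lemma in_base_scalars (k : finFieldType) (e : {rmorphism k -> L}) :
  scalars (in_base e).
Proof.
split=> [|_ _ [a ->] [b ->]|_ _ [a ->] [b ->]]; first by exists 1; rewrite rmorph1.
  by exists (a - b); rewrite rmorphB.
by exists (a * b); rewrite rmorphM.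
Qed.

(** Forms are treated as functions on points: equality modulo the equations of [X] becomes equality
    of functions, so these are the elements of the reduced homogeneous coordinate ring. *)
Definition hfun S X (d : nat) (f : X -> L) : Prop :=
  exists2 p : {mpoly L[amb X]}, form S d p & forall x, f x = ev (crd x) p.

Lemma hfun_any S X d (f : X -> L) : hfun S d f -> hfun anyL d f.
Proof. by case=> p [hp _] pf; exists p. Qed.

Lemma hfun_ext S X d (f g : X -> L) : f =1 g -> hfun S d f -> hfun S d g.
Proof. by move=> fg [p hp pf]; exists p => // x; rewrite -fg. Qed.

Lemma ev_scale N d (c : L) (v : 'rV[L]_N) (p : {mpoly L[N]}) :
  p \is d.-homog -> ev (c *: v) p = c ^+ d * ev v p.
Proof.
move=> /dhomogP hp; rewrite /ev !mevalE mulr_sumr big_seq [RHS]big_seq.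
apply: eq_bigr => m /hp md; rewrite mulrCA; congr (_ * _).
under eq_bigr do rewrite mxE exprMn.
by rewrite big_split /= prodrXr -mdegE [mdeg m]md.
Qed.

Section Closure.
Variables (S : L -> Prop) (X : pspace L).
Hypothesis hS : scalars S.
Implicit Types f g : X -> L.

Lemma scal1 : S 1. Proof. by case: hS. Qed.
Lemma scal0 : S 0. Proof. by case: hS => h1 hB _; rewrite -(subrr 1); apply: hB. Qed.
Lemma scalN x : S x -> S (- x).
Proof. by case: hS => h1 hB _ Sx; rewrite -sub0r; apply: hB => //; apply: scal0. Qed.
Lemma scalD x y : S x -> S y -> S (x + y).
Proof. by case: hS => h1 hB _ Sx Sy; rewrite -[y]opprK; apply: hB => //; apply: scalN. Qed.
Lemma scalM x y : S x -> S y -> S (x * y). Proof. by case: hS => _ _; apply. Qed.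

Lemma hfun0 d : hfun S d (fun _ : X => 0).
Proof.
exists 0; last by move=> x; rewrite /ev meval0.
by split; [exact: dhomog0|move=> m; rewrite mcoeff0; apply: scal0].
Qed.

Lemma hfunC c : S c -> hfun S 0 (fun _ : X => c).
Proof.
move=> Sc; exists c%:MP; last by move=> x; rewrite /ev mevalC.
split; first by rewrite -[c%:MP]mulr1 mul_mpolyC; apply: dhomogZ; apply: dhomog1.
by move=> m; rewrite mcoeffC; case: eqP => _; rewrite ?mulr1 ?mulr0 //; apply: scal0.
Qed.

Lemma hfun1 : hfun S 0 (fun _ : X => 1). Proof. exact/hfunC/scal1. Qed.

Lemma hfunD d f g : hfun S d f -> hfun S d g -> hfun S d (fun x => f x + g x).
Proof.
move=> [p [hp Sp] pf] [q [hq Sq] qg]; exists (p + q).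
  by split; [apply: dhomogD|move=> m; rewrite mcoeffD; apply: scalD].
by move=> x; rewrite /ev mevalD pf qg.
Qed.

Lemma hfunM d e f g : hfun S d f -> hfun S e g -> hfun S (d + e) (fun x => f x * g x).
Proof.
move=> [p [hp Sp] pf] [q [hq Sq] qg]; exists (p * q).
  split; first exact: dhomogM.
  move=> m; rewrite mcoeffM; elim/big_ind: _ => [|x y|i _]; first exact: scal0.
    exact: scalD.
  exact: scalM.
by move=> x; rewrite /ev mevalM pf qg.
Qed.

Lemma hfunM_eq d d1 d2 f g : (d1 + d2 = d)%N -> hfun S d1 f -> hfun S d2 g ->
  hfun S d (fun x => f x * g x).
Proof. by move=> <-; apply: hfunM. Qed.

Lemma hfunZ d c f : S c -> hfun S d f -> hfun S d (fun x => c * f x).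
Proof. by move=> Sc hf; apply: (@hfunM_eq d 0 d) => //; apply: hfunC. Qed.

Lemma hfunN d f : hfun S d f -> hfun S d (fun x => - f x).
Proof.
move=> hf; apply: hfun_ext (@hfunZ d (-1) f _ hf) => [x|]; first by rewrite mulN1r.
exact/scalN/scal1.
Qed.

Lemma hfunB d f g : hfun S d f -> hfun S d g -> hfun S d (fun x => f x - g x).
Proof. by move=> hf hg; apply: hfunD => //; apply: hfunN. Qed.

Lemma hfun_sum d (I : Type) (r : seq I) (P : pred I) (F : I -> X -> L) :
  (forall i, P i -> hfun S d (F i)) ->
  hfun S d (fun x => \sum_(i <- r | P i) F i x).
Proof.
move=> hF; elim: r => [|i r IH].
  by apply: hfun_ext (hfun0 d) => x; rewrite big_nil.
case: (boolP (P i)) => Pi.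
  by apply: hfun_ext (hfunD (hF i Pi) IH) => x; rewrite big_cons Pi.
by apply: hfun_ext IH => x; rewrite big_cons (negPf Pi).
Qed.

Lemma hfunX d n f : hfun S d f -> hfun S (d * n) (fun x => f x ^+ n).
Proof.
move=> hf; elim: n => [|n IH].
  by rewrite muln0; apply: hfun_ext hfun1 => x; rewrite expr0.
rewrite mulnS; apply: hfun_ext (hfunM hf IH) => x; by rewrite exprS.
Qed.

Lemma hfun_crd i : hfun S 1 (fun x : X => crd x 0 i).
Proof.
exists 'X_i; last by move=> x; rewrite /ev mevalXU.
split; first by rewrite dhomogX /= mdeg1.
by move=> m; rewrite mcoeffX; case: eqP => _; [apply: scal1|apply: scal0].
Qed.

Lemma hfun_prod (I : Type) (r : seq I) (P : pred I) (F : I -> X -> L) (d : I -> nat) :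
  (forall i, P i -> hfun S (d i) (F i)) ->
  hfun S (\sum_(i <- r | P i) d i) (fun x => \prod_(i <- r | P i) F i x).
Proof.
move=> hF; elim: r => [|i r IH].
  by rewrite big_nil; apply: hfun_ext hfun1 => x; rewrite big_nil.
rewrite big_cons; case: (boolP (P i)) => Pi.
  by apply: hfun_ext (hfunM (hF i Pi) IH) => x; rewrite big_cons Pi.
by apply: hfun_ext IH => x; rewrite big_cons (negPf Pi).
Qed.

Lemma hfun_comp N d e (p : {mpoly L[N]}) (G : 'I_N -> X -> L) :
  form S d p -> (forall i, hfun S e (G i)) ->
  hfun S (e * d) (fun x => p.@[fun i => G i x]).
Proof.
move=> [/dhomogP hp Sp] hG.
have : hfun S (e * d) (fun x => \sum_(m <- msupp p | m \in msupp p)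
    p@_m * \prod_i G i x ^+ m i).
  apply: hfun_sum => m mp; apply: hfunZ => //.
  have := @hfun_prod _ (index_enum 'I_N) xpredT _ _ (fun i _ => hfunX (m i) (hG i)).
  by rewrite -big_distrr /= -mdegE [mdeg m]hp.
by apply: hfun_ext => x; rewrite mevalE -big_seq.
Qed.

End Closure.

Lemma hfun_det S X (hS : scalars S) n (d : nat) (M : 'I_n -> 'I_n -> X -> L) :
  (forall i j, hfun S d (M i j)) ->
  hfun S (d * n) (fun x => \det (\matrix_(i, j) M i j x)).
Proof.
move=> hM.
have h : hfun S (d * n) (fun x => \sum_(s : 'S_n) (-1) ^+ s * \prod_i M i (s i) x).
  apply: hfun_sum => // s _; apply: hfunZ => //.
    elim: (s : nat) => [|m IH]; first by rewrite expr0; apply: scal1.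
    by rewrite exprS; apply: (scalM hS) => //; apply: (scalN hS); apply: scal1.
  have := @hfun_prod S X hS _ (index_enum 'I_n) xpredT _ _ (fun i _ => hM i (s i)).
  by rewrite sum_nat_const card_ord mulnC.
apply: hfun_ext h => x; rewrite /determinant; apply: eq_bigr => s _.
by congr (_ * _); apply: eq_bigr => i _; rewrite mxE.
Qed.

(** Only [c] times the coordinates of [phi x] are forms, so a form of degree [d] on [Y] becomes a
    form on [X] after multiplication by the [d]-th power of [c]. *)
Lemma hfun_pull S X Y (hS : scalars S) (phi : X -> Y) (c : X -> L) d e (q : Y -> L) :
  hfun S d q -> (forall i, hfun S e (fun x => c x * crd (phi x) 0 i)) ->
  hfun S (e * d) (fun x => c x ^+ d * q (phi x)).
Proof.
move=> [p fp pq] hc; apply: hfun_ext (hfun_comp hS fp hc) => x.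
rewrite pq; case: fp => hp _; rewrite -(ev_scale _ _ hp); apply: meval_eq => i.
by rewrite mxE.
Qed.

Lemma peq_sym N (u v : 'rV[L]_N) : peq u v -> peq v u.
Proof.
by case=> c c0 ->; exists c^-1; rewrite ?invr_eq0 // scalerA mulVf // scale1r.
Qed.

Lemma peq_trans N (u v w : 'rV[L]_N) : peq u v -> peq v w -> peq u w.
Proof. by case=> c c0 -> [d d0 ->]; exists (c * d); rewrite ?mulf_neq0 ?scalerA. Qed.

Lemma peq_refl N (u : 'rV[L]_N) : peq u u.
Proof. by exists 1; rewrite ?oner_eq0 ?scale1r. Qed.

Lemma row_neq0 N (v : 'rV[L]_N) : v != 0 -> exists i, v 0 i != 0.
Proof.
by move=> v0; apply: boolp.contrapT => h; case/eqP: v0; apply/rowP => i; rewrite mxE;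
   apply/eqP; apply: boolp.contrapT => hi; apply: h; exists i; apply/negP.
Qed.

Lemma crd_neq0 X : embedded X -> forall x : X, exists i, crd x 0 i != 0.
Proof. by case=> h _ x; apply: row_neq0. Qed.

(* A morphism is given near x by forms, and these are the homogeneous coordinates of the image up to a factor c. *)
Definition mrep S X Y (f : X -> Y) (d : nat) (c : X -> L) : Prop :=
  forall i, hfun S d (fun x => c x * crd (f x) 0 i).

Lemma morphP S X Y (f : X -> Y) : embedded Y ->
  morph S f <-> forall x, exists d c, c x != 0 /\ mrep S f d c.
Proof.
move=> [Y0 _]; split=> mf x; last first.
  case: (mf x) => d [c [cx hc]].
  have := boolp.choice (fun i => let: ex_intro2 p a b := hc i in
    ex_intro (fun p => form S d p /\ forall y, c y * crd (f y) 0 i = ev (crd y) p) p (conj a b)).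
  case=> F hF; exists d, F => /=.
  have eF y : \row_i ev (crd y) (F i) = c y *: crd (f y).
    by apply/rowP => i; rewrite !mxE; case: (hF i) => _ <-.
  split=> [i||y]; first by case: (hF i).
    by rewrite eF scaler_eq0 negb_or cx Y0.
  rewrite eF scaler_eq0 negb_or => /andP[cy _]; by exists (c y).
case: (mf x) => d [F [hF Fx eF]].
(* The factor is 0 where all the forms vanish, which gives one identity valid at every point. *)
have ex y : exists c : L, forall i, ev (crd y) (F i) = c * crd (f y) 0 i.
  case: (eqVneq (\row_i ev (crd y) (F i)) 0) => [F0|/eF [c c0 /rowP e]].
    by exists 0 => i; have /rowP/(_ i) := F0; rewrite !mxE mul0r.
  by exists c => i; have := e i; rewrite !mxE.
case: (boolp.choice ex) => c hc; exists d, c; split.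
  apply: contraNneq Fx => c0; apply/eqP/rowP => i; by rewrite !mxE hc c0 mul0r.
by move=> i; exists (F i) => // y; rewrite hc.
Qed.

Lemma morph_any S X Y (f : X -> Y) : morph S f -> morph anyL f.
Proof.
move=> mf x; case: (mf x) => d [F [hF Fx eF]]; exists d, F; split=> // i.
by case: (hF i).
Qed.

(* Regular functions of degree e, i.e. sections of O(e). *)
Definition rgd (e : nat) X (x : X) (f : X -> L) : Prop :=
  exists d q, [/\ q x != 0, hfun anyL d q & hfun anyL (d + e) (fun y => q y * f y)].

Notation rg := (rgd 0).

(** Nonvanishing sets of forms are a basis of the Zariski topology; naming the form allows
    denominators to be multiplied by it. *)
Definition near X (x : X) (P : X -> Prop) : Prop :=
  exists d u, [/\ hfun anyL d u, u x != 0 & forall y, u y != 0 -> P y].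

Lemma near_and X (x : X) P Q : near x P -> near x Q -> near x (fun y => P y /\ Q y).
Proof.
move=> [d [u [hu ux uP]]] [e [v [hv vx vQ]]].
exists (d + e)%N, (fun y => u y * v y); split; first exact: hfunM.
  exact: mulf_neq0.
by move=> y; rewrite mulf_eq0 negb_or => /andP[/uP ? /vQ].
Qed.

Lemma near_impl X (x : X) (P Q : X -> Prop) : (forall y, P y -> Q y) -> near x P -> near x Q.
Proof. by move=> PQ [d [u [hu ux uP]]]; exists d, u; split=> // y /uP /PQ. Qed.

Lemma near_all X (x : X) (P : X -> Prop) : (forall y, P y) -> near x P.
Proof.
by move=> h; exists 0%N, (fun=> 1); split=> //; [apply: hfun1|rewrite oner_eq0].
Qed.

Lemma near_self X (x : X) P : near x P -> P x.
Proof. by case=> d [u [_ ux h]]; apply: h. Qed.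

Lemma near_finite X (x : X) (I : finType) (P : I -> X -> Prop) :
  (forall i, near x (P i)) -> near x (fun y => forall i, P i y).
Proof.
move=> h.
suff : near x (fun y => forall i, i \in enum I -> P i y).
  by apply: near_impl => y hy i; apply: hy; rewrite mem_enum.
elim: (enum I) => [|i s IH]; first exact: near_all.
apply: near_impl (near_and (h i) IH) => y [Pi Ps] j.
by rewrite inE => /orP[/eqP->|/Ps].
Qed.

(** Multiplying the denominator by a form that vanishes wherever [f] and [g] may differ makes the
    global identity demanded by [rgd] true for [g]. *)
Lemma rgd_near e X (x : X) f g : near x (fun y => f y = g y) -> rgd e x f -> rgd e x g.
Proof.
move=> [d [u [hu ux ufg]]] [d' [q [qx hq hqf]]].
exists (d + d')%N, (fun y => u y * q y); split; first exact: mulf_neq0.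
  exact: hfunM.
rewrite -addnA; apply: hfun_ext (hfunM anyL_scalars hu hqf) => y.
by have [->|/ufg ->] := eqVneq (u y) 0; rewrite ?mul0r // mulrA.
Qed.

Lemma rgd_ext e X (x : X) f g : f =1 g -> rgd e x f -> rgd e x g.
Proof. by move=> fg; apply: rgd_near; apply: near_all. Qed.

Lemma hfun_rgd e X (x : X) f : hfun anyL e f -> rgd e x f.
Proof.
move=> hf; exists 0%N, (fun=> 1); rewrite oner_eq0; split=> //; first exact: hfun1.
by apply: hfun_ext hf => y; rewrite mul1r.
Qed.

Lemma rgdM e e' X (x : X) f g : rgd e x f -> rgd e' x g ->
  rgd (e + e') x (fun y => f y * g y).
Proof.
move=> [d [q [qx hq hqf]]] [d' [q' [qx' hq' hqf']]].
exists (d + d')%N, (fun y => q y * q' y); split; first exact: mulf_neq0.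
  exact: hfunM.
rewrite addnACA; apply: hfun_ext (hfunM anyL_scalars hqf hqf') => y; exact: mulrACA.
Qed.

Lemma rgdD e X (x : X) f g : rgd e x f -> rgd e x g -> rgd e x (fun y => f y + g y).
Proof.
move=> [d [q [qx hq hqf]]] [d' [q' [qx' hq' hqf']]].
exists (d + d')%N, (fun y => q y * q' y); split; first exact: mulf_neq0.
  exact: hfunM.
have h1 := hfunM anyL_scalars hqf hq'; have h2 := hfunM anyL_scalars hq hqf'.
rewrite addnAC in h1; rewrite addnA in h2.
by apply: hfun_ext (hfunD anyL_scalars h1 h2) => y; ring.
Qed.

Lemma rgC X (x : X) c : rg x (fun=> c).
Proof. by apply: hfun_rgd; apply: hfunC. Qed.

Lemma rgdZ e X (x : X) c f : rgd e x f -> rgd e x (fun y => c * f y).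
Proof. by move=> hf; have := rgdM (rgC x c) hf. Qed.

Lemma rgdN e X (x : X) f : rgd e x f -> rgd e x (fun y => - f y).
Proof. by move=> /(rgdZ (-1)); apply: rgd_ext => y; rewrite mulN1r. Qed.

Lemma rgdB e X (x : X) f g : rgd e x f -> rgd e x g -> rgd e x (fun y => f y - g y).
Proof. by move=> hf hg; apply: rgdD => //; apply: rgdN. Qed.

Lemma rgd_sum e X (x : X) (I : Type) (r : seq I) (P : pred I) (F : I -> X -> L) :
  (forall i, P i -> rgd e x (F i)) -> rgd e x (fun y => \sum_(i <- r | P i) F i y).
Proof.
move=> hF; elim: r => [|i r IH].
  by apply: rgd_ext (hfun_rgd x (hfun0 X anyL_scalars e)) => y; rewrite big_nil.
case: (boolP (P i)) => Pi.
  by apply: rgd_ext (rgdD (hF i Pi) IH) => y; rewrite big_cons Pi.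
by apply: rgd_ext IH => y; rewrite big_cons (negPf Pi).
Qed.

Lemma rgd_div e e' X (x : X) f g : rgd (e + e') x f -> rgd e x g -> g x != 0 ->
  rgd e' x (fun y => f y / g y).
Proof.
move=> [d [q [qx hq hqf]]] [d' [q' [qx' hq' hqg]]] gx.
pose w y := q' y * g y.

(* One factor [w] clears the denominator; the second makes both sides 0 where [g] vanishes, where
   division returns 0. *)
exists (d + (d' + e + (d' + e)))%N, (fun y => q y * (w y * w y)); split.
- by rewrite !mulf_neq0.
- by apply: hfunM => //; apply: hfunM.
have h : hfun anyL (d + (d' + e + (d' + e)) + e') (fun y => q y * f y * (q' y * w y)).
  apply: (@hfunM_eq _ _ _ _ (d + (e + e')) (d' + (d' + e))) => //; first by lia.
  exact: hfunM.
apply: hfun_ext h => y; rewrite /w.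
have [->|gy] := eqVneq (g y) 0; first by rewrite !(mulr0, mul0r).
by field.
Qed.

Lemma rgV X (x : X) f : rg x f -> f x != 0 -> rg x (fun y => (f y)^-1).
Proof.
move=> hf fx; apply: rgd_ext (@rgd_div 0 0 X x (fun=> 1) f (rgC x 1) hf fx) => y.
by rewrite mul1r.
Qed.

Lemma rg_near_neq0 e X (x : X) f : rgd e x f -> f x != 0 -> near x (fun y => f y != 0).
Proof.
move=> [d [q [qx hq hqf]]] fx; exists (d + e)%N, (fun y => q y * f y); split=> //.
  exact: mulf_neq0.
by move=> y; rewrite mulf_eq0 negb_or => /andP[].
Qed.

Lemma near_pull X Y (phi : X -> Y) x P : embedded Y -> morph anyL phi ->
  near (phi x) P -> near x (fun y => P (phi y)).
Proof.
move=> eY mphi [d [u [hu ux uP]]].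
case: ((morphP _ _ eY).1 mphi x) => e [c [cx hc]].
exists (e * d)%N, (fun y => c y ^+ d * u (phi y)); split.
- exact: hfun_pull.
- by rewrite mulf_neq0 // expf_neq0.
by move=> y; rewrite mulf_eq0 negb_or => /andP[_ /uP].
Qed.

Lemma rg_pull X Y (phi : X -> Y) x f : embedded Y -> morph anyL phi ->
  rg (phi x) f -> rg x (fun y => f (phi y)).
Proof.
move=> eY mphi [d [q [qx hq hqf]]].
case: ((morphP _ _ eY).1 mphi x) => e [c [cx hc]].
exists (e * d)%N, (fun y => c y ^+ d * q (phi y)); split.
- by rewrite mulf_neq0 // expf_neq0.
- exact: hfun_pull.
rewrite addn0 in hqf; rewrite addn0.
by apply: hfun_ext (hfun_pull anyL_scalars hqf hc) => y; rewrite mulrA.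
Qed.

Lemma morph_comp S X Y Z (f : X -> Y) (g : Y -> Z) : scalars S ->
  embedded Y -> embedded Z -> morph S f -> morph S g -> morph S (g \o f).
Proof.
move=> hS eY eZ /(morphP _ _ eY) mf /(morphP _ _ eZ) mg; apply/morphP => // x.
case: (mf x) => d [c [cx hc]]; case: (mg (f x)) => e [b [bx hb]].
exists (d * e)%N, (fun y => c y ^+ e * b (f y)); split.
  by rewrite mulf_neq0 // expf_neq0.
by move=> i; apply: hfun_ext (hfun_pull hS (hb i) hc) => y; rewrite mulrA.
Qed.

Lemma morph_id S X (hS : scalars S) : embedded X -> @morph L S X X id.
Proof.
move=> eX; apply/morphP => // x; exists 1%N, (fun=> 1).
rewrite oner_eq0; split=> // i; apply: hfun_ext (hfun_crd hS i) => y; by rewrite mul1r.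
Qed.

Lemma zclosedP S X (Z : X -> Prop) : zclosed S Z <->
  exists E : (X -> L) -> Prop, (forall f, E f -> exists d, hfun S d f) /\
    forall x, Z x <-> forall f, E f -> f x = 0.
Proof.
split=> [[E [fE hE]]|[E [fE hE]]].
  exists (fun f => exists2 p, E p & f = fun x => ev (crd x) p); split.
    by move=> f [p Ep ->]; case: (fE p Ep) => d fp; exists d, p.
  move=> x; rewrite hE; split=> h; first by move=> f [p Ep ->]; apply: h.
  by move=> p Ep; apply: (h (fun x => ev (crd x) p)); exists p.
exists (fun p => exists2 f, E f & (exists d, form S d p) /\ forall x, f x = ev (crd x) p).
split; first by move=> p [f _ []].
move=> x; rewrite hE; split=> h.
  by move=> p [f Ef [_ pf]]; rewrite -pf; apply: h.
move=> f Ef; case: (fE f Ef) => d [p fp pf]; rewrite pf; apply: h.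
by exists f => //; split=> //; exists d.
Qed.

Lemma zopen_near S X (U : X -> Prop) x : zopen S U -> U x -> near x U.
Proof.
move=> /zclosedP [E [fE hE]] Ux.
have [f [Ef fx]] : exists f, E f /\ f x != 0.
  apply: boolp.contrapT => h; apply: ((hE x).2 _ Ux) => f Ef.
  by apply/eqP; apply: boolp.contrapT => /negP fx; apply: h; exists f.
case: (fE f Ef) => d hf; exists d, f; split=> //; first exact: hfun_any hf.
move=> y fy; apply: boolp.contrapT => nUy; case/eqP: fy; exact: ((hE y).1 nUy).
Qed.

Lemma near_zopen X (U : X -> Prop) : (forall x, U x -> near x U) -> zopen anyL U.
Proof.
move=> h; apply/zclosedP.
exists (fun f => (exists d, hfun anyL d f) /\ forall y, f y != 0 -> U y); split.
  by move=> f [].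
move=> x; split=> [nUx f [_ fU]|h0 Ux].
  by apply/eqP; apply: boolp.contrapT => /negP /fU.
case: (h x Ux) => d [u [hu ux uU]]; case/eqP: ux; apply: h0; split=> //; by exists d.
Qed.

Lemma regular_rg S X (U : X -> Prop) f x : (U x -> near x U) -> regular S U f -> U x -> rg x f.
Proof.
move=> nU rf Ux; case: (rf x Ux) => d [p [q [fp fq qx pq]]].
case: (nU Ux) => e [u [hu ux uU]].
have hp : hfun anyL d (fun y => ev (crd y) p) by exists p => //; case: fp.
have hq : hfun anyL d (fun y => ev (crd y) q) by exists q => //; case: fq.
(* At the points outside [U], or where [q] vanishes, nothing is known of [f]: the factor [u] and the
   second factor [q] annihilate both sides there. *)
exists (e + (d + d))%N, (fun y => u y * (ev (crd y) q * ev (crd y) q)); split.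
- by rewrite !mulf_neq0.
- by apply: hfunM => //; apply: hfunM.
rewrite addn0; have := hfunM anyL_scalars hu (hfunM anyL_scalars hp hq).
apply: hfun_ext => y; have [->|/uU Uy] := eqVneq (u y) 0; first by rewrite !mul0r.
have [->|qy] := eqVneq (ev (crd y) q) 0; first by rewrite !(mulr0, mul0r).
by rewrite (pq y Uy qy); field.
Qed.

Lemma rg_regular X (U : X -> Prop) f : (forall x, U x -> rg x f) -> regular anyL U f.
Proof.
move=> h x Ux; case: (h x Ux) => d [q [qx [q' fq' eq] [p fp ep]]].
exists d, p, q'; rewrite addn0 in fp; split=> //; first by rewrite -eq.
move=> y Uy; rewrite -eq -ep => qy; by rewrite mulrC mulKf.
Qed.

Lemma irreducible_hfun X d e (f g : X -> L) : @irreducible L X (fun=> True) ->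
  hfun anyL d f -> hfun anyL e g -> (forall x, f x * g x = 0) ->
  (forall x, f x = 0) \/ (forall x, g x = 0).
Proof.
move=> [_ irr] hf hg fg.
have cl d' f' : hfun anyL d' f' -> zclosed anyL (fun x : X => f' x = 0).
  move=> h; apply/zclosedP; exists (fun f1 => f1 = f'); split.
    by move=> _ ->; exists d'.
  by move=> x; split=> [f0 _ ->|]; last by apply.
case: (irr _ _ (cl _ _ hf) (cl _ _ hg)).
- by move=> x _; move/eqP: (fg x); rewrite mulf_eq0 => /orP[]/eqP; [left|right].
- by move=> h; left=> x; apply: h.
- by move=> h; right=> x; apply: h.
Qed.

Lemma rgd_identity X e (f : X -> L) x0 : @irreducible L X (fun=> True) ->
  (forall x, rgd e x f) -> near x0 (fun y => f y = 0) -> forall x, f x = 0.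
Proof.
move=> irr rf [d [u [hu ux uf]]] x.
case: (rf x) => d' [q [qx hq hqf]].
case: (irreducible_hfun irr hu hqf) => [y|h|h].
- by have [->|/uf ->] := eqVneq (u y) 0; rewrite ?mul0r ?mulr0.
- by rewrite h eqxx in ux.
- by apply/eqP; have /eqP := h x; rewrite mulf_eq0 (negPf qx).
Qed.

End HomogeneousFunctions.
Notation rg := (rgd 0).
Arguments anyL_scalars {L}.

(** * Finiteness of fibres *)

Section ProjectiveNullstellensatz.
Variables (L : closedFieldType) (X : pspace L).
Hypothesis pX : projective anyL X.
Variable J : nat -> (X -> L) -> Prop.
Hypothesis J_zero : forall d, J d (fun=> 0).
Hypothesis J_add : forall d f g, J d f -> J d g -> J d (fun x => f x + g x).
Hypothesis J_mul : forall d e a f, hfun anyL e a -> J d f -> J (e + d) (fun x => a x * f x).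
Hypothesis J_hfun : forall d f, J d f -> hfun anyL d f.
Hypothesis J_ne : forall x, exists d f, J d f /\ f x != 0.
Let N := amb X.

(** The ideal generated by the homogeneous polynomials that restrict to elements of [J]. As [J]
    contains 0, the equations of [X] are among them, so nonzero common zeros represent points of
    [X]. *)
Inductive ideal_span : {mpoly L[N]} -> Prop :=
| IdealSpan0 : ideal_span 0
| IdealSpanS d c q : c \is d.-homog -> J d (fun x => ev (crd x) c) ->
    ideal_span q -> ideal_span (c + q).

Lemma ideal_span_ideal : is_ideal ideal_span.
Proof.
have D p q : ideal_span p -> ideal_span q -> ideal_span (p + q).
  elim=> [|d c r hc Jc _ IH] hq; first by rewrite add0r.
  by rewrite -addrA; apply: (IdealSpanS hc Jc); apply: IH.
split=> // [|a q hq]; first exact: IdealSpan0.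
rewrite [a]mpolyE mulr_suml; elim/big_ind: _ => // [|m _]; first exact: IdealSpan0.
elim: hq => [|d c r hc Jc _ IH]; first by rewrite mulr0; apply: IdealSpan0.
rewrite mulrDr; apply: (@IdealSpanS (mdeg m + d)) => //.
  by apply: dhomogM => //; apply: dhomogZ; rewrite dhomogX.
have ha : hfun anyL (mdeg m) (fun x : X => ev (crd x) (a@_m *: 'X_[m])).
  by exists (a@_m *: 'X_[m]) => //; split=> //; apply: dhomogZ; rewrite dhomogX.
have := J_mul ha Jc; congr (J _ _); apply: boolp.funext => x.
by rewrite /ev mevalM.
Qed.

Lemma ideal_span_dehomog i q : ideal_span q ->
  exists M, forall m, (M <= m)%N -> exists f, J m f /\ forall x : X, crd x 0 i != 0 ->
    f x = crd x 0 i ^+ m * ev ((crd x 0 i)^-1 *: crd x) q.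
Proof.
elim=> [|d c r hc Jc _ [M IH]].
  exists 0%N => m _; exists (fun=> 0); split=> // x _; by rewrite /ev meval0 mulr0.
exists (maxn M d) => m; rewrite geq_max => /andP[/IH [f [Jf ef]] ledm].
exists (fun x => crd x 0 i ^+ (m - d) * ev (crd x) c + f x); split.
  apply: J_add => //; rewrite -{1}(subnK ledm); apply: J_mul => //.
  by have := hfunX anyL_scalars (m - d) (hfun_crd anyL_scalars i); rewrite mul1n.
move=> x xi; rewrite ef // /ev mevalD mulrDr; congr (_ + _).
rewrite -/(ev _ _) -/(ev _ _) (ev_scale _ _ hc) -{2}(subnK ledm) exprD -mulrA.
by rewrite exprVn mulVKf ?expf_neq0.
Qed.

(** Dehomogenize by adding the equation that the i-th coordinate is 1. A common zero would be a
    point of [X] where all of [J] vanishes; so 1 lies in the ideal, and homogenizing that relation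
    gives a power of the coordinate. *)
Lemma coordinate_power i : exists M, J M (fun x => crd x 0 i ^+ M).
Proof.
pose I (p : {mpoly L[N]}) := exists q1 q2, ideal_span q1 /\ p = q1 + ('X_i - 1) * q2.
case: (ideal_span_ideal) => S0 SD SM.
have idI : is_ideal I.
  split.
  - by exists 0, 0; rewrite mulr0 addr0.
  - move=> x y [q1 [q2 [h1 ->]]] [r1 [r2 [h2 ->]]]; exists (q1 + r1), (q2 + r2).
    by rewrite mulrDr addrACA; split=> //; apply: SD.
  - move=> a x [q1 [q2 [h1 ->]]]; exists (a * q1), (a * q2).
    by rewrite mulrDr mulrCA; split=> //; apply: SM.
have SI q : ideal_span q -> I q by exists q, 0; rewrite mulr0 addr0.
case: (boolp.pselect (I 1)) => [[q1 [q2 [h1 e1]]]|/(nullstellensatz idI) [v v0]].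
  case: (ideal_span_dehomog i h1) => M /(_ M (leqnn M)) [f [Jf ef]].
  exists (1 + M)%N; have := J_mul (hfun_crd anyL_scalars i) Jf; congr (J _ _).
  apply: boolp.funext => x; rewrite exprD expr1.
  have [->|xi] := eqVneq (crd x 0 i) 0; first by rewrite !mul0r.
  rewrite ef //; congr (_ * _); rewrite -[RHS]mulr1; congr (_ * _).
  have := congr1 (ev ((crd x 0 i)^-1 *: crd x)) e1.
  rewrite /ev mevalD mevalM meval1 mevalB mevalXU meval1 mxE mulVf // subrr mul0r addr0.
  by move->.
have vi : v i = 1.
  have : I ('X_i - 1) by exists 0, 1; rewrite add0r mulr1; split.
  by move/v0; rewrite mevalB mevalXU meval1 => /eqP; rewrite subr_eq0 => /eqP.
pose w : 'rV[L]_N := \row_j v j.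
have wE p : ev w p = p.@[v] by apply: meval_eq => j; rewrite mxE.
have w0 : w != 0.
  by apply/eqP => /rowP/(_ i)/eqP; rewrite !mxE vi oner_eq0.
case: pX => eX [E [fE hE]].
have [x pwx] : exists x : X, peq w (crd x).
  apply/hE => // p Ep; rewrite wE; apply: v0; apply: SI.
  case: (fE p Ep) => d [hp _]; rewrite -[p]addr0; apply: (IdealSpanS hp) => //.
  have -> : (fun x : X => ev (crd x) p) = fun=> 0; last exact: J_zero.
  apply: boolp.funext => x; apply: ((hE (crd x) _).2 _ p Ep).
    by case: eX.
  by exists x; apply: peq_refl.
case: (J_ne x) => d [f [Jf /eqP[]]].
case: (J_hfun Jf) => p [hp _] fp; rewrite fp.
case: (peq_sym pwx) => c c0 ->; rewrite (ev_scale _ _ hp) wE v0 ?mulr0 //.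
apply: SI; rewrite -[p]addr0; apply: (IdealSpanS hp) => //.
by have := Jf; congr (J _ _); apply: boolp.funext => y; rewrite fp.
Qed.

(** A monomial of degree greater than [N * K] contains some coordinate with an exponent large enough
    for [coordinate_power]. In the applications [J] is any property of forms that is stable under
    linear combinations and multiples and holds, at each point, for some form not vanishing
    there. *)
Theorem proj_null : exists m0, forall m f, (m0 <= m)%N -> hfun anyL m f -> J m f.
Proof.
case: (boolp.choice coordinate_power) => M hM.
pose K := (\max_i M i)%N.
exists (N * K).+1 => m _ ltm [p [hp _] /boolp.funext ->].
have sumJ (r : seq 'X_{1..N}) : {in r, forall u, mdeg u = m} ->
    J m (fun x => \sum_(u <- r) p@_u * (\prod_j crd x 0 j ^+ u j)).
  elim: r => [|u r IH] hr.
    have -> : (fun x : X => \sum_(u <- [::]) p@_u * (\prod_j crd x 0 j ^+ u j)) = fun=> 0.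
      by apply: boolp.funext => x; rewrite big_nil.
    exact: J_zero.
  have -> : (fun x : X => \sum_(v <- u :: r) p@_v * (\prod_j crd x 0 j ^+ v j)) =
     fun x => p@_u * (\prod_j crd x 0 j ^+ u j) + \sum_(v <- r) p@_v * (\prod_j crd x 0 j ^+ v j).
    by apply: boolp.funext => x; rewrite big_cons.
  apply: J_add; last by apply: IH => v vr; apply: hr; rewrite inE vr orbT.
  have mu : mdeg u = m by apply: hr; rewrite inE eqxx.
  have [i iu] : exists i, (M i <= u i)%N.
    apply: boolp.contrapT => h; move: ltm; rewrite -mu ltnNge mdegE.
    have hle i : (u i <= K)%N.
      apply: leq_trans (leq_bigmax i); rewrite leqNgt; apply/negP => hi; apply: h.
      by exists i; apply: ltnW.
    apply/negP; rewrite negbK; apply: leq_trans (leq_sum _ (fun i _ => hle i)) _.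
    by rewrite sum_nat_const card_ord.
  have ha : hfun anyL (m - M i) (fun x : X => ev (crd x) (p@_u *: 'X_[u - U_(i) *+ M i])).
    exists (p@_u *: 'X_[u - U_(i) *+ M i]) => //; split=> //; apply: dhomogZ.
    rewrite dhomogX /= -mu -{2}(@submK _ (U_(i) *+ M i) u); last first.
      by apply/mnm_lepP => j; rewrite mulmnE mnm1E; case: eqP => [<-|_]; rewrite ?mul1n ?mul0n.
    by rewrite mdegD mdegMn mdeg1 mul1n addnK.
  have := J_mul ha (hM i); rewrite subnK; last first.
    by rewrite -mu; apply: leq_trans iu _; rewrite mdegE (bigD1 i) //= leq_addr.
  congr (J _ _); apply: boolp.funext => x.
  rewrite /ev mevalZ mevalX -mulrA; congr (_ * _).
  rewrite (bigD1 i) //= [RHS](bigD1 i) //= mulrAC; congr (_ * _).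
    by rewrite mnmBE mulmnE mnm1E eqxx mul1n -exprD subnK.
  apply: eq_bigr => j ji; rewrite mnmBE mulmnE mnm1E eq_sym (negPf ji) mul0n subn0 //.
have := sumJ (msupp p) (dhomogP _ _ _ hp); congr (J _ _).
Qed.
End ProjectiveNullstellensatz.

Section Span.
Variables (L : closedFieldType).
Implicit Types X Y : pspace L.

Lemma hfun_span X d : exists K (e : 'I_K -> X -> L),
  (forall j, hfun anyL d (e j)) /\
  forall f, hfun anyL d f -> exists c : 'I_K -> L, forall x, f x = \sum_j c j * e j x.
Proof.
pose T : finType := 'X_{1..(amb X) < d.+1}.
pose e0 (m : T) (x : X) := ev (crd x) (if mdeg m == d then 'X_[m] else 0).
exists #|T|, (fun j => e0 (enum_val j)); split=> [j|f [p [hp _] fp]].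
  rewrite /e0; exists (if mdeg (enum_val j : T) == d then 'X_[(enum_val j : T)] else 0) => //.
  by split=> //; case: (eqVneq (mdeg (enum_val j : T)) d) => h; [rewrite dhomogX; apply/eqP|apply: dhomog0].
exists (fun j => p@_(enum_val j : T)) => x; rewrite fp.
have szp : (msize p <= d.+1)%N.
  rewrite mmeasureE; apply/bigmax_leqP_seq => m mp _; rewrite ltnS.
  by move/dhomogP: hp => /(_ m mp) <-.
rewrite /ev [in LHS](mpolywE szp) raddf_sum /=.
rewrite (reindex_onto (@enum_val T predT) enum_rank) /=; last by move=> i _; rewrite enum_rankK.
apply: eq_big => [i|i _]; first by rewrite enum_valK eqxx.
rewrite mevalZ /e0 /ev; case: eqP => // ne; rewrite (dhomog_nemf_coeff hp) ?mul0r //.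
exact/eqP.
Qed.

(* Cayley-Hamilton trick: over the local ring at y0 the matrix y - M is invertible. *)
Lemma det_trick X Y (pi : X -> Y) y0 K D (e g : 'I_K -> X -> L) (y : Y -> L)
    (M : 'I_K -> 'I_K -> Y -> L) (P : X -> Prop) :
  hfun anyL D y -> y y0 != 0 -> (forall j k, hfun anyL D (M j k)) ->
  (forall j k, M j k y0 = 0) ->
  (forall x, P x -> forall j, y (pi x) * e j x = \sum_k M j k (pi x) * e k x + g j x) ->
  exists S (A : 'I_K -> 'I_K -> Y -> L), [/\ hfun anyL (D * K) S, S y0 != 0,
    forall j k, hfun anyL (D * K.-1) (A j k) &
    forall x, P x -> forall j, S (pi x) * e j x = \sum_k A j k (pi x) * g k x].
Proof.
move=> hy y0y hM M0 eqn.
pose B j k z := (j == k)%:R * y z - M j k z.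
have hB j k : hfun anyL D (B j k) by apply: hfunB => //; apply: hfunZ.
pose BM z : 'M[L]_K := \matrix_(j, k) B j k z.
exists (fun z => \det (BM z)), (fun j k z => (\adj (BM z)) j k); split.
- exact: hfun_det.
- have -> : BM y0 = (y y0)%:M.
    by apply/matrixP => j k; rewrite !mxE /B M0 subr0 mulr_natl.
  by rewrite det_scalar expf_neq0.
- move=> j k.
  have h : hfun anyL (D * K.-1) (fun z => (-1) ^+ (k + j) *
      \det (\matrix_(a, b) B (lift k a) (lift j b) z)).
    by apply: hfunZ => //; apply: hfun_det.
  apply: hfun_ext h => z; rewrite !mxE /cofactor; congr (_ * \det _).
  by apply/matrixP => a b; rewrite !mxE.
move=> x Px j.
pose ev_ : 'cV[L]_K := \col_k e k x; pose gv : 'cV[L]_K := \col_k g k x.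
have eBM : BM (pi x) *m ev_ = gv.
  apply/colP => i; rewrite !mxE.
  under eq_bigr do rewrite !mxE /B mulrBl.
  rewrite sumrB (bigD1 i) //= eqxx mul1r big1 => [|k ki]; last first.
    by rewrite eq_sym (negPf ki) !mul0r.
  by rewrite addr0 eqn // addrC addKr.
have := congr1 (fun v => (\adj (BM (pi x)) *m v) j 0) eBM.
rewrite /= mulmxA mul_adj_mx mul_scalar_mx !mxE => ->.
by apply: eq_bigr => k _; rewrite !mxE.
Qed.

End Span.

Section Fibre.
Variables (L : closedFieldType) (X Y : pspace L) (pi : X -> Y).
Hypotheses (pX : projective anyL X) (eY : embedded Y) (mpi : morph anyL pi).
Variables (y0 : Y) (i0 : 'I_(amb Y)).
Hypothesis hy0 : crd y0 0 i0 != 0.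

Let yc i x := crd (pi x) 0 i.
Let t i := crd y0 0 i / crd y0 0 i0.

(* The degree d part of the homogeneous ideal generated by the maximal ideal of y0. *)
Definition fibre_ideal d (f : X -> L) := hfun anyL d f /\
  exists2 s : 'I_(amb Y) -> X -> L, forall i, hfun anyL d (s i) &
    forall x, yc i0 x != 0 -> yc i0 x * f x = \sum_i (yc i x - t i * yc i0 x) * s i x.

Notation A := fibre_ideal.

Lemma fibre_ideal0 d : A d (fun=> 0).
Proof.
split; first exact: hfun0.
exists (fun _ _ => 0) => [i|x _]; first exact: hfun0.
by rewrite mulr0 big1 // => i _; rewrite mulr0.
Qed.

Lemma fibre_idealD d f g : A d f -> A d g -> A d (fun x => f x + g x).
Proof.
move=> [hf [s hs es]] [hg [s' hs' es']]; split; first exact: hfunD.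
exists (fun i x => s i x + s' i x) => [i|x xX]; first exact: hfunD.
by rewrite mulrDr es // es' // -big_split; apply: eq_bigr => i _; rewrite mulrDr.
Qed.

Lemma fibre_idealM d e a f : hfun anyL e a -> A d f -> A (e + d) (fun x => a x * f x).
Proof.
move=> ha [hf [s hs es]]; split; first exact: hfunM.
exists (fun i x => a x * s i x) => [i|x xX]; first exact: hfunM.
by rewrite mulrCA es // mulr_sumr; apply: eq_bigr => i _; rewrite mulrCA.
Qed.

Lemma fibre_ideal_zero x : (forall d f, A d f -> f x = 0) -> pi x = y0.
Proof.
move=> h; case: ((morphP _ _ eY).1 mpi x) => d [c [cx hc]].
have eqt i : yc i x = t i * yc i0 x.
  (* The equations of [y0] become forms on [X] only after multiplication by the local factor [c]. *)
  have hf : hfun anyL d (fun z => c z * yc i z - t i * (c z * yc i0 z)).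
    by apply: hfunB => //; [apply: hc|apply: hfunZ => //; apply: hc].
  have : c x * yc i x - t i * (c x * yc i0 x) = 0.
    apply: (h d (fun z => c z * yc i z - t i * (c z * yc i0 z))); split=> //.
    exists (fun j z => (j == i)%:R * (c z * yc i0 z)) => [j|z _].
      by apply: hfunZ => //; apply: hc.
    rewrite (bigD1 i) //= eqxx mul1r big1 ?addr0 => [|j ji]; last first.
      by rewrite (negPf ji) mul0r mulr0.
    by ring.
  rewrite mulrCA -mulrBr => /eqP; rewrite mulf_eq0 (negPf cx) /= subr_eq0.
  by move/eqP.
case: (eY) => Y0; apply.
have yx0 : yc i0 x != 0.
  apply: contraNneq (Y0 (pi x)) => y0x; apply/eqP/rowP => i.
  by rewrite mxE -/(yc i x) eqt y0x mulr0.
exists (yc i0 x / crd y0 0 i0); first by rewrite mulf_neq0 // invr_eq0.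
by apply/rowP => i; rewrite mxE -/(yc i x) eqt /t; field.
Qed.

Section Finite.
Variables (e : nat) (q : X -> L).
Hypotheses (hq : hfun anyL e q) (q0 : forall x, pi x = y0 -> q x != 0).

(** [q] and the ideal of the fibre have no common zero, so together they generate everything in
    large degree. *)
Lemma fibre_decompose : exists m0, forall m f, (m0 <= m)%N -> hfun anyL m f ->
  exists2 b, hfun anyL (m - e) b & A m (fun x => f x - q x * b x).
Proof.
(* When d is less than e the truncated difference of degrees is 0; requiring [b] to be 0 there keeps
   [J] stable under multiplication. *)
pose J d f := hfun anyL d f /\ exists b, [/\ hfun anyL (d - e) b, (d < e)%N -> b = (fun=> 0)
  & A d (fun x => f x - q x * b x)].
case: (@proj_null _ X pX J).
- move=> d; split; first exact: hfun0.
  exists (fun=> 0); split=> //; first exact: hfun0.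
  have := fibre_ideal0 d; congr (A _ _); apply: boolp.funext => x.
  by rewrite mulr0 subr0.
- move=> d f g [hf [b [hb b0 Ab]]] [hg [b' [hb' b0' Ab']]]; split; first exact: hfunD.
  exists (fun x => b x + b' x); split; first exact: hfunD.
    by move=> lt; rewrite b0 // b0' //; apply: boolp.funext => x; rewrite addr0.
  have := fibre_idealD Ab Ab'; congr (A _ _); apply: boolp.funext => x; ring.
- move=> d d' a f ha [hf [b [hb b0 Ab]]]; split; first exact: hfunM.
  case: (ltnP d e) => [lt|le].
    exists (fun=> 0); split=> //; first exact: hfun0.
    have := fibre_idealM ha Ab; congr (A _ _); apply: boolp.funext => x.
    by rewrite b0 // mulr0 !subr0.
  exists (fun x => a x * b x); split.
  + by rewrite -addnBA //; apply: hfunM.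
  + by rewrite ltnNge (leq_trans le (leq_addl _ _)).
  have := fibre_idealM ha Ab; congr (A _ _); apply: boolp.funext => x; ring.
- by move=> d f [].
- move=> x; apply: boolp.contrapT => h.
  have Jx d f : J d f -> f x = 0.
    by move=> Jf; apply/eqP; apply: boolp.contrapT => /negP fx; apply: h; exists d, f.
  have AJ d f : A d f -> J d f.
    move=> Af; split; first by case: Af.
    exists (fun=> 0); split=> //; first exact: hfun0.
    by have := Af; congr (A _ _); apply: boolp.funext => z; rewrite mulr0 subr0.
  have := q0 (fibre_ideal_zero (fun d f Af => Jx d f (AJ d f Af))).
  rewrite (Jx e) ?eqxx //; split=> //; exists (fun=> 1); split.
  + by rewrite subnn; apply: hfun1.
  + by rewrite ltnn.
  have := fibre_ideal0 e; congr (A _ _); apply: boolp.funext => z.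
  by rewrite mulr1 subrr.
move=> m0 hm0; exists m0 => m f /hm0 h /h [_ [b [hb _ Ab]]]; by exists b.
Qed.

(* R_m is contained in q R_(m - e) locally at y0. *)
Lemma fibre_finite : exists m0, forall m, (m0 <= m)%N -> exists K D S (b : 'I_K -> X -> L),
  [/\ hfun anyL D S, S y0 != 0, forall k, hfun anyL (m - e) (b k) &
   forall f, hfun anyL m f -> exists2 C : 'I_K -> Y -> L, forall k, hfun anyL D (C k) &
     forall x, S (pi x) * f x = q x * \sum_k C k (pi x) * b k x].
Proof.
case: fibre_decompose => m0 h; exists m0 => m lem.
case: (hfun_span X m) => K [g [hg spg]].
have /boolp.choice [bs hbs] j : exists bs : (X -> L) * ('I_K -> 'I_(amb Y) -> L),
    hfun anyL (m - e) bs.1 /\ forall x, yc i0 x != 0 ->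
     yc i0 x * g j x = \sum_k (\sum_i bs.2 k i * (yc i x - t i * yc i0 x)) * g k x +
        yc i0 x * (q x * bs.1 x).
  case: (h m (g j) lem (hg j)) => b hb [hgb [s hs es]].
  have /boolp.choice [c hc] i := spg _ (hs i).
  exists (b, fun k i => c i k); split=> //= x xX.
  have := es x xX; rewrite mulrBr => /eqP; rewrite subr_eq => /eqP ->; congr (_ + _).
  transitivity (\sum_i \sum_k (yc i x - t i * yc i0 x) * (c i k * g k x)).
    by apply: eq_bigr => i _; rewrite hc mulr_sumr.
  rewrite exchange_big; apply: eq_bigr => k _; rewrite mulr_suml.
  by apply: eq_bigr => i _; ring.
(* Modulo multiples of [q], the generators in degree [m] satisfy a linear system whose matrix
   vanishes at [y0]; the determinant is the denominator given by Nakayama's lemma. *)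
pose M j k (y : Y) := \sum_i (bs j).2 k i * (crd y 0 i - t i * crd y 0 i0).
case: (@det_trick L X Y pi y0 K 1 g (fun j x => yc i0 x * (q x * (bs j).1 x))
   (fun y => crd y 0 i0) M (fun x => yc i0 x != 0)).
- exact: hfun_crd.
- by [].
- move=> j k; apply: hfun_sum => // i _; apply: hfunZ => //; apply: hfunB => //.
    exact: hfun_crd.
  by apply: hfunZ => //; apply: hfun_crd.
- move=> j k; rewrite /M big1 // => i _; rewrite /t mulfVK ?subrr ?mulr0 //.
- by move=> x xX j; case: (hbs j) => _; apply.
move=> S [B [hS S0 hB eS]].
exists K, (1 + 1 * K)%N, (fun y => crd y 0 i0 * S y), (fun k => (bs k).1); split.
- by apply: hfunM => //; apply: hfun_crd.
- by rewrite mulf_neq0.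
- by move=> k; case: (hbs k).
move=> f /spg [c fc].
exists (fun k y => \sum_j c j * (crd y 0 i0 * (crd y 0 i0 * B j k y))) => [k|x].
  apply: hfun_sum => // j _; apply: hfunZ => //; apply: hfunM => //; first exact: hfun_crd.
  have K0 : K = K.-1.+1 by case: (K) j => [[]|].
  by apply: (@hfunM_eq _ _ _ _ _ 1 (1 * K.-1)) => //; [lia|apply: hfun_crd].
have [z|nz] := eqVneq (yc i0 x) 0.
  rewrite -/(yc i0 x) z !mul0r big1 ?mulr0 // => k _.
  by rewrite big1 ?mul0r // => j _; rewrite mul0r mulr0.
rewrite fc -mulrA mulr_sumr.
transitivity (yc i0 x * \sum_j \sum_k c j * (B j k (pi x) * (yc i0 x * (q x * (bs k).1 x)))).
  by congr (_ * _); apply: eq_bigr => j _; rewrite mulrCA eS // mulr_sumr.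
rewrite exchange_big /= !mulr_sumr; apply: eq_bigr => k _.
rewrite mulr_suml !mulr_sumr; apply: eq_bigr => j _; rewrite -/(yc i0 x); ring.
Qed.
End Finite.

(** Over an empty fibre [fibre_finite] applies to [q] = 0, and says that [S] annihilates all forms
    of some degree. *)
Lemma image_separate : (forall x, pi x <> y0) ->
  exists D S, [/\ hfun anyL D S, S y0 != 0 & forall x, S (pi x) = 0].
Proof.
move=> ny0.
case: (@fibre_finite 0 (fun=> 0)) => [||m0 /(_ m0 (leqnn _))].
- exact: hfun0.
- by move=> x /ny0.
move=> [K [D [S [b [hS S0 _ h]]]]]; exists D, S; split=> // x.
case: pX => eX _; case: (crd_neq0 eX x) => i xi.
case: (h (fun z => crd z 0 i ^+ m0)) => [|C _ /(_ x) /eqP].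
  by have := hfunX anyL_scalars m0 (hfun_crd anyL_scalars i); rewrite mul1n; apply.
by rewrite mul0r mulf_eq0 expf_eq0 (negPf xi) andbF orbF => /eqP.
Qed.

End Fibre.

Lemma closed_image (L : closedFieldType) (X Y : pspace L) (pi : X -> Y) :
  projective anyL X -> embedded Y -> morph anyL pi ->
  zclosed anyL (fun y => exists x, pi x = y).
Proof.
move=> pX eY mpi; apply/zclosedP.
exists (fun S => (exists D, hfun anyL D S) /\ forall x, S (pi x) = 0); split.
  by move=> S [].
move=> y0; split=> [[x <-] S [_ ->] //|h]; apply: boolp.contrapT => ny.
case: (crd_neq0 eY y0) => i0 hi0.
case: (image_separate pX eY mpi hi0) => [x xy|D [S [hS S0 Sv]]].
  by apply: ny; exists x.
by case/eqP: S0; apply: h; split=> //; exists D.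
Qed.

(** * Local rings and differentials of group laws *)

Section LocalRing.
Variables (L : closedFieldType) (X : pspace L) (x : X).
Hypothesis eX : embedded X.

Lemma rg_prod (I : Type) (r : seq I) (P : pred I) (F : I -> X -> L) :
  (forall i, P i -> rg x (F i)) -> rg x (fun y => \prod_(i <- r | P i) F i y).
Proof.
move=> hF; elim: r => [|i r IH].
  by apply: rgd_ext (rgC x 1) => y; rewrite big_nil.
case: (boolP (P i)) => Pi.
  by apply: rgd_ext (rgdM (hF i Pi) IH) => y; rewrite big_cons Pi.
by apply: rgd_ext IH => y; rewrite big_cons (negPf Pi).
Qed.

Lemma rg_exp f n : rg x f -> rg x (fun y => f y ^+ n).
Proof.
move=> hf; elim: n => [|n IH]; first by apply: rgd_ext (rgC x 1) => y; rewrite expr0.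
by apply: rgd_ext (rgdM hf IH) => y; rewrite exprS.
Qed.

Lemma rg_det n (M : 'I_n -> 'I_n -> X -> L) : (forall i j, rg x (M i j)) ->
  rg x (fun y => \det (\matrix_(i, j) M i j y)).
Proof.
move=> hM; apply: (@rgd_ext _ 0 X x (fun y => \sum_(s : 'S_n) (-1) ^+ s * \prod_i M i (s i) y)).
  by move=> y; apply: eq_bigr => s _; congr (_ * _); apply: eq_bigr => i _; rewrite mxE.
by apply: rgd_sum => s _; apply: rgdZ; apply: rg_prod.
Qed.

Definition local_ideal M (v : 'I_M -> X -> L) (f : X -> L) :=
  exists2 u : 'I_M -> X -> L, forall i, rg x (u i) &
    near x (fun z => f z = \sum_i v i z * u i z).

Lemma local_idealD M (v : 'I_M -> X -> L) f g : local_ideal v f -> local_ideal v g ->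
  local_ideal v (fun z => f z + g z).
Proof.
move=> [u hu eu] [u' hu' eu']; exists (fun i z => u i z + u' i z) => [i|]; first exact: rgdD.
apply: near_impl (near_and eu eu') => z [-> ->]; rewrite -big_split.
by apply: eq_bigr => i _; rewrite mulrDr.
Qed.

Lemma local_idealM M (v : 'I_M -> X -> L) a f : rg x a -> local_ideal v f ->
  local_ideal v (fun z => a z * f z).
Proof.
move=> ha [u hu eu]; exists (fun i z => a z * u i z) => [i|]; first exact: (rgdM ha (hu i)).
apply: near_impl eu => z ->; rewrite mulr_sumr; apply: eq_bigr => i _; ring.
Qed.

Lemma local_ideal_near M (v : 'I_M -> X -> L) f g : near x (fun z => f z = g z) ->
  local_ideal v f -> local_ideal v g.
Proof. by move=> fg [u hu eu]; exists u => //; apply: near_impl (near_and fg eu) => z [<-]. Qed.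

Lemma local_ideal0 M (v : 'I_M -> X -> L) : local_ideal v (fun=> 0).
Proof.
exists (fun _ _ => 0) => [i|]; first exact: rgC.
by apply: near_all => z; rewrite big1 // => i _; rewrite mulr0.
Qed.

Lemma local_ideal_gen M (v : 'I_M -> X -> L) i : local_ideal v (v i).
Proof.
exists (fun j _ => (j == i)%:R) => [j|]; first exact: rgC.
apply: near_all => z; rewrite (bigD1 i) //= eqxx mulr1 big1 ?addr0 // => j ji.
by rewrite (negPf ji) mulr0.
Qed.

Lemma local_ideal_sum M (v : 'I_M -> X -> L) (I : Type) (r : seq I) (F : I -> X -> L) :
  (forall i, local_ideal v (F i)) -> local_ideal v (fun z => \sum_(i <- r) F i z).
Proof.
move=> hF; elim: r => [|i r IH].
  by apply: local_ideal_near (local_ideal0 v); apply: near_all => z; rewrite big_nil.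
by apply: local_ideal_near (local_idealD (hF i) IH); apply: near_all => z; rewrite big_cons.
Qed.

Lemma local_ideal_trans M (v : 'I_M -> X -> L) M' (w : 'I_M' -> X -> L) f :
  local_ideal v f -> (forall i, local_ideal w (v i)) -> local_ideal w f.
Proof.
move=> [u hu eu] h; apply: local_ideal_near (local_ideal_sum (index_enum 'I_M) (fun i => local_idealM (hu i) (h i))).
by apply: near_impl eu => z ->; apply: eq_bigr => i _; rewrite mulrC.
Qed.

Definition affine_coord (j0 j : 'I_(amb X)) (z : X) :=
  crd z 0 j / crd z 0 j0 - crd x 0 j / crd x 0 j0.

Lemma rg_affine j0 j : crd x 0 j0 != 0 -> rg x (affine_coord j0 j).
Proof.
move=> h; apply: rgdB; last exact: rgC.
by apply: (@rgd_div _ 1 0) => //; apply: hfun_rgd; apply: hfun_crd.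
Qed.

(** The functions for which this holds contain the affine coordinates and are closed under sums,
    products and inverses of units, hence include every quotient of forms. *)
Lemma local_max_gen j0 f : crd x 0 j0 != 0 -> rg x f ->
  local_ideal (affine_coord j0) (fun z => f z - f x).
Proof.
move=> h0.
pose w := affine_coord j0.
pose W f := rg x f /\ local_ideal w (fun z => f z - f x).
have WC c : W (fun=> c).
  split; first exact: rgC.
  by apply: local_ideal_near (local_ideal0 w); apply: near_all => z; rewrite subrr.
have WD f1 f2 : W f1 -> W f2 -> W (fun z => f1 z + f2 z).
  move=> [h1 l1] [h2 l2]; split; first exact: rgdD.
  by apply: local_ideal_near (local_idealD l1 l2); apply: near_all => z; ring.
have WM f1 f2 : W f1 -> W f2 -> W (fun z => f1 z * f2 z).
  move=> [h1 l1] [h2 l2]; split; first exact: (rgdM h1 h2).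
  apply: local_ideal_near (local_idealD (local_idealM h2 l1) (local_idealM (rgC x (f1 x)) l2)).
  by apply: near_all => z; ring.
have WV f1 : W f1 -> f1 x != 0 -> W (fun z => (f1 z)^-1).
  move=> [h1 l1] n1; split; first exact: rgV.
  have ha : rg x (fun z => - (f1 x)^-1 * (f1 z)^-1) by apply: rgdZ; apply: rgV.
  apply: local_ideal_near (local_idealM ha l1).
  by apply: near_impl (rg_near_neq0 h1 n1) => z n2; field; rewrite n1.
have WX f1 n : W f1 -> W (fun z => f1 z ^+ n).
  move=> h1; elim: n => [|n IH].
    by have := WC 1; congr W; apply: boolp.funext => z; rewrite expr0.
  by have := WM _ _ h1 IH; congr W; apply: boolp.funext => z; rewrite exprS.
have Wc j : W (fun z => crd z 0 j / crd z 0 j0).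
  split; last exact: local_ideal_gen.
  by apply: (@rgd_div _ 1 0) => //; apply: hfun_rgd; apply: hfun_crd.
have Wp (p : {mpoly L[amb X]}) : W (fun z => ev ((crd z 0 j0)^-1 *: crd z) p).
  have -> : (fun z => ev ((crd z 0 j0)^-1 *: crd z) p) =
     fun z => \sum_(m <- msupp p) p@_m * \prod_i (crd z 0 i / crd z 0 j0) ^+ m i.
    apply: boolp.funext => z; rewrite /ev mevalE; apply: eq_bigr => m _; congr (_ * _).
    by apply: eq_bigr => i _; rewrite mxE mulrC.
  elim: (msupp p : seq _) => [|m r IH].
    by have := WC 0; congr W; apply: boolp.funext => z; rewrite big_nil.
  have -> : (fun z => \sum_(u <- m :: r) p@_u * \prod_i (crd z 0 i / crd z 0 j0) ^+ u i) =
   fun z => p@_m * \prod_i (crd z 0 i / crd z 0 j0) ^+ m i +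
      \sum_(u <- r) p@_u * \prod_i (crd z 0 i / crd z 0 j0) ^+ u i.
    by apply: boolp.funext => z; rewrite big_cons.
  apply: WD => //; apply: (WM _ _); first exact: WC.
  elim: (index_enum 'I_(amb X)) => [|i s IHs].
    by have := WC 1; congr W; apply: boolp.funext => z; rewrite big_nil.
  have -> : (fun z => \prod_(i <- i :: s) (crd z 0 i / crd z 0 j0) ^+ m i) =
   fun z => (crd z 0 i / crd z 0 j0) ^+ m i * \prod_(i <- s) (crd z 0 i / crd z 0 j0) ^+ m i.
    by apply: boolp.funext => z; rewrite big_cons.
  by apply: WM => //; apply: WX.
move=> [d [q [qx [q1 [hq1 _] eq] [p [hp _] ep]]]].
rewrite addn0 in hp.
have sc z (r : {mpoly L[amb X]}) : r \is d.-homog ->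
    ev ((crd z 0 j0)^-1 *: crd z) r = (crd z 0 j0)^-1 ^+ d * ev (crd z) r.
  by move=> hr; rewrite (ev_scale _ _ hr).
have nq : ev ((crd x 0 j0)^-1 *: crd x) q1 != 0.
  by rewrite sc // -eq mulf_neq0 // expf_neq0 // invr_eq0.
have [_ h] := WM _ _ (Wp p) (WV _ (Wp q1) nq).
have nj : near x (fun z => crd z 0 j0 != 0).
  by exists 1%N, (fun z => crd z 0 j0); split=> //; apply: hfun_crd.
have nnq : near x (fun z => q z != 0) by exists d, q; split=> //; exists q1.
have E z : crd z 0 j0 != 0 -> q z != 0 ->
  ev ((crd z 0 j0)^-1 *: crd z) p * (ev ((crd z 0 j0)^-1 *: crd z) q1)^-1 = f z.
  move=> n1 n2; rewrite !sc // -ep -eq; field.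
  by rewrite n2 expf_neq0 // invr_eq0.
apply: local_ideal_near h; apply: near_impl (near_and nj nnq) => z [n1 n2].
by rewrite (E z n1 n2) (E x h0 qx).
Qed.

(* The square of the maximal ideal. *)
Inductive msq : (X -> L) -> Prop :=
| msq_zero f : near x (fun z => f z = 0) -> msq f
| msq_cons f g h r : rg x g -> rg x h -> g x = 0 -> h x = 0 -> msq r ->
    near x (fun z => f z = g z * h z + r z) -> msq f.

Lemma msq_near f g : near x (fun z => f z = g z) -> msq f -> msq g.
Proof.
move=> fg mf; elim: mf g fg => [{}f f0 g fg|{}f g h r hg hh g0 h0 mr _ ef g' fg].
  by apply: msq_zero; apply: near_impl (near_and f0 fg) => z [<-].
by apply: (msq_cons hg hh) mr _ => //; apply: near_impl (near_and ef fg) => z [<-].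
Qed.

Lemma msqD f g : msq f -> msq g -> msq (fun z => f z + g z).
Proof.
move=> mf mg; elim: mf => [{}f f0|{}f a b r ha hb a0 b0 mr IH ef].
  by apply: msq_near mg; apply: near_impl f0 => z ->; rewrite add0r.
by apply: (msq_cons ha hb) IH _ => //; apply: near_impl ef => z ->; rewrite addrA.
Qed.

Lemma msqM a f : rg x a -> msq f -> msq (fun z => a z * f z).
Proof.
move=> ha; elim=> [{}f f0|{}f g h r hg hh g0 h0 mr IH ef].
  by apply: msq_zero; apply: near_impl f0 => z ->; rewrite mulr0.
apply: (msq_cons (rgdM ha hg) hh) IH _ => //; first by rewrite g0 mulr0.
by apply: near_impl ef => z ->; rewrite mulrDr mulrA.
Qed.

Lemma msq_mul g h : rg x g -> rg x h -> g x = 0 -> h x = 0 -> msq (fun z => g z * h z).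
Proof.
move=> hg hh g0 h0; apply: (msq_cons hg hh) (msq_zero (near_all x (fun=> erefl))) _ => //.
by apply: near_all => z; rewrite addr0.
Qed.

(** If the maximal ideal is its square plus the ideal of [v], its generators satisfy [w] = [Hm] [w]
    + g with [Hm] vanishing at [x] and g in the ideal of [v]. The determinant of 1 - [Hm] is 1 at
    [x], so the system can be solved near [x]. *)
Lemma local_nakayama M (v : 'I_M -> X -> L) :
  (forall i, rg x (v i)) ->
  (forall r, rg x r -> r x = 0 -> exists f g, [/\ msq f, local_ideal v g &
     near x (fun z => r z = f z + g z)]) ->
  forall r, rg x r -> r x = 0 -> local_ideal v r.
Proof.
move=> hv H; case: (crd_neq0 eX x) => j0 h0; pose w := affine_coord j0.
have gen f : rg x f -> f x = 0 -> local_ideal w f.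
  move=> hf f0; apply: local_ideal_near (local_max_gen h0 hf).
  by apply: near_all => z; rewrite f0 subr0.
have expand f : msq f -> exists h : 'I_(amb X) -> X -> L,
   (forall j, rg x (h j) /\ h j x = 0) /\ near x (fun z => f z = \sum_j h j z * w j z).
  elim=> [{}f f0|{}f g h r hg hh g0 h1 mr [b [hb eb]] ef].
    exists (fun _ _ => 0); split=> [j|]; first by split=> //; apply: rgC.
    by apply: near_impl f0 => z ->; rewrite big1 // => j _; rewrite mul0r.
  case: (gen g hg g0) => a ha ea.
  exists (fun j z => a j z * h z + b j z); split=> [j|].
    case: (hb j) => hbj bj; split; first by apply: rgdD => //; apply: (rgdM (ha j) hh).
    by rewrite h1 mulr0 bj addr0.
  apply: near_impl (near_and ea (near_and eb ef)) => z [ez [bz ->]].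
  rewrite ez bz mulr_suml -big_split; apply: eq_bigr => j _ /=; ring.
have w0 j : w j x = 0 by rewrite /w /affine_coord subrr.
have /boolp.choice [Hm hH] i : exists Hg : ('I_(amb X) -> X -> L) * (X -> L),
   [/\ forall j, rg x (Hg.1 j) /\ Hg.1 j x = 0, local_ideal v Hg.2 &
     near x (fun z => w i z = \sum_j Hg.1 j z * w j z + Hg.2 z)].
  case: (H (w i) (rg_affine _ h0) (w0 i)) => f [g [/expand [h [hh eh]] lg ew]].
  by exists (h, g); split=> //; apply: near_impl (near_and eh ew) => z [<-].
pose B i j z := (i == j)%:R - (Hm i).1 j z.
have hB i j : rg x (B i j).
  by apply: rgdB; [apply: rgC|case: (hH i) => /(_ j) []].
pose BM z : 'M[L]_(amb X) := \matrix_(i, j) B i j z.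
have hdet : rg x (fun z => \det (BM z)) by apply: rg_det.
have det1 : \det (BM x) = 1.
  have -> : BM x = 1%:M.
    apply/matrixP => i j; rewrite !mxE /B; case: (hH i) => /(_ j) [_ ->] _ _.
    by rewrite subr0.
  exact: det1.
have hadj i j : rg x (fun z => (\adj (BM z)) i j).
  apply: (@rgd_ext _ 0 X x (fun z => (-1) ^+ (j + i) *
      \det (\matrix_(a, b) B (lift j a) (lift i b) z))).
    move=> z; rewrite !mxE /cofactor; congr (_ * \det _).
    by apply/matrixP => a b; rewrite !mxE.
  by apply: rgdZ; apply: rg_det.
have lw i : local_ideal v (w i).
  have n1 : near x (fun z => forall i, w i z = \sum_j (Hm i).1 j z * w j z + (Hm i).2 z).
    by apply: near_finite => j; case: (hH j).
  have n2 : near x (fun z => \det (BM z) != 0).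
    by apply: rg_near_neq0 hdet _; rewrite det1 oner_eq0.
  have hdV : rg x (fun z => (\det (BM z))^-1) by apply: rgV => //; rewrite det1 oner_eq0.
  have lsum : local_ideal v (fun z => (\det (BM z))^-1 * \sum_j (\adj (BM z)) i j * (Hm j).2 z).
    apply: (local_idealM hdV).
    apply: (local_ideal_sum _ (F := fun j z => (\adj (BM z)) i j * (Hm j).2 z)) => j.
    by apply: local_idealM => //; case: (hH j).
  apply: local_ideal_near lsum; apply: near_impl (near_and n1 n2) => z [ez dz].
  have eBM : BM z *m (\col_j w j z) = \col_j (Hm j).2 z.
    apply/colP => k; rewrite !mxE; under eq_bigr do rewrite !mxE /B mulrBl.
    rewrite sumrB (bigD1 k) //= eqxx mul1r big1 => [|j jk]; last first.
      by rewrite eq_sym (negPf jk) mul0r.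
    by rewrite addr0 {1}ez addrC addKr.
  have := congr1 (fun u => (\adj (BM z) *m u) i 0) eBM.
  rewrite /= mulmxA mul_adj_mx mul_scalar_mx !mxE => E.
  rewrite -[RHS](mulKf dz) E; congr (_ * _); by apply: eq_bigr => j _; rewrite !mxE.
by move=> r hr r0; apply: local_ideal_trans (gen r hr r0) lw.
Qed.

End LocalRing.

(** * Products of projective varieties *)

Section Products.
Variables (L : closedFieldType) (S : L -> Prop).
Hypothesis hS : scalars S.
Implicit Types X Y Z : pspace L.

(** Vectors viewed as points, so that forms on the ambient space fall under the calculus of
    [hfun]. *)
Definition cone N : pspace L := PSpace (fun v : 'rV[L]_N => v).

Lemma projectiveP X : projective S X <-> embedded X /\
  exists E : ('rV[L]_(amb X) -> L) -> Prop,
    (forall f, E f -> exists d, @hfun L S (cone (amb X)) d f) /\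
    forall v, v != 0 -> (forall f, E f -> f v = 0) <-> exists x : X, peq v (crd x).
Proof.
split=> [[eX [E [fE hE]]]|[eX [E [fE hE]]]]; split=> //.
  exists (fun f => exists2 p, E p & f = fun v => ev v p); split.
    by move=> f [p Ep ->]; case: (fE p Ep) => d fp; exists d, p.
  move=> v v0; rewrite -hE //; split=> h; last by move=> f [p Ep ->]; apply: h.
  by move=> p Ep; apply: (h (fun v => ev v p)); exists p.
exists (fun p => exists2 f, E f & (exists d, form S d p) /\ forall v, f v = ev v p).
split; first by move=> p [f _ []].
move=> v v0; rewrite -hE //; split=> h.
  move=> f Ef; case: (fE f Ef) => d [p fp pf]; rewrite pf; apply: h.
  by exists f => //; split=> //; exists d.
by move=> p [f Ef [_ pf]]; rewrite -pf; apply: h.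
Qed.

Lemma pprod_crd X Y (u : pprod X Y) i j :
  crd u 0 (mxvec_index i j) = crd u.1 0 i * crd u.2 0 j.
Proof. by rewrite /= mxvecE !mxE big_ord1 mxE. Qed.

Lemma pprod_embedded X Y : embedded X -> embedded Y -> embedded (pprod X Y).
Proof.
move=> eX eY; split.
  move=> u; case: (crd_neq0 eX u.1) => i hi; case: (crd_neq0 eY u.2) => j hj.
  apply/eqP => /rowP/(_ (mxvec_index i j))/eqP; rewrite pprod_crd mxE mulf_eq0.
  by rewrite (negPf hi) (negPf hj).
move=> u v [c c0 /rowP uv].
have E i j : crd u.1 0 i * crd u.2 0 j = c * (crd v.1 0 i * crd v.2 0 j).
  by have := uv (mxvec_index i j); rewrite pprod_crd mxE pprod_crd.
case: (crd_neq0 eX u.1) => i hi; case: (crd_neq0 eY u.2) => j hj.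
have /negPf nz : crd v.1 0 i * crd v.2 0 j != 0.
  by apply: contraTneq (mulf_neq0 hi hj) => z; rewrite E z mulr0 eqxx.
move: (nz); rewrite mulf_eq0 => /norP[v1 v2].
rewrite [u]surjective_pairing [v]surjective_pairing; congr pair.
  case: eX => _; apply; exists (c * crd v.2 0 j / crd u.2 0 j).
    by rewrite !mulf_neq0 ?invr_eq0.
  by apply/rowP => k; rewrite mxE; apply: (mulIf hj); rewrite E; field.
case: eY => _; apply; exists (c * crd v.1 0 i / crd u.1 0 i).
  by rewrite !mulf_neq0 ?invr_eq0.
by apply/rowP => k; rewrite mxE; apply: (mulfI hi); rewrite E; field.
Qed.

Lemma pprod_projective X Y : projective S X -> projective S Y -> projective S (pprod X Y).
Proof.
move=> /projectiveP [eX [E [fE hE]]] /projectiveP [eY [F [fF hF]]].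
apply/projectiveP; split; first exact: pprod_embedded.
pose N := amb X; pose M := amb Y.
pose C := 'rV[L]_(amb (pprod X Y)).
pose col (j : 'I_M) (v : C) : 'rV[L]_N := \row_i v 0 (mxvec_index i j).
pose rw (i : 'I_N) (v : C) : 'rV[L]_M := \row_j v 0 (mxvec_index i j).
(* The equations of [X] on each column, those of [Y] on each row, and the minors that force rank
   one. *)
pose G (f : C -> L) := [\/ exists2 f', E f' & exists j, f = f' \o col j,
  exists2 f', F f' & exists i, f = f' \o rw i |
  exists i j i' j', f = fun v => v 0 (mxvec_index i j) * v 0 (mxvec_index i' j') -
     v 0 (mxvec_index i' j) * v 0 (mxvec_index i j')].
have hc k : @hfun L S (cone (amb (pprod X Y))) 1 (fun v => v 0 k).
  exact: (@hfun_crd L S (cone (amb (pprod X Y))) hS k).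
exists G; split=> [f []|v v0].
- move=> [f' /fE [d [p fp pf]] [j ->]]; exists (1 * d)%N.
  have := @hfun_comp L S (cone (amb (pprod X Y))) hS N d 1 p (fun i v => v 0 (mxvec_index i j)) fp.
  move/(_ (fun i => hc _)); apply: hfun_ext => v; rewrite /= pf; apply: meval_eq => i.
  by rewrite mxE.
- move=> [f' /fF [d [p fp pf]] [i ->]]; exists (1 * d)%N.
  have := @hfun_comp L S (cone (amb (pprod X Y))) hS M d 1 p (fun j v => v 0 (mxvec_index i j)) fp.
  move/(_ (fun i => hc _)); apply: hfun_ext => v; rewrite /= pf; apply: meval_eq => j.
  by rewrite mxE.
- move=> [i [j [i' [j' ->]]]]; exists (1 + 1)%N.
  by apply: hfunB => //; apply: hfunM.
split=> [h|[[x y] pv] f].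
  have [k vk] := row_neq0 v0; case/mxvec_indexP: k vk => i0 j0 vk.
  have minor i j : v 0 (mxvec_index i j) * v 0 (mxvec_index i0 j0) =
      col j0 v 0 i * rw i0 v 0 j.
    have := h _ (Or33 _ _ (ex_intro _ i (ex_intro _ j (ex_intro _ i0 (ex_intro _ j0 erefl))))).
    move/eqP; rewrite subr_eq0 => /eqP ->; rewrite !mxE mulrC //.
  have [x px] : exists x : X, peq (col j0 v) (crd x).
    apply/hE; last by move=> f' Ef'; apply: (h (f' \o col j0)); constructor 1; exists f' => //; exists j0.
    by apply/eqP => /rowP/(_ i0)/eqP; rewrite !mxE (negPf vk).
  have [y py] : exists y : Y, peq (rw i0 v) (crd y).
    apply/hF; last by move=> f' Ef'; apply: (h (f' \o rw i0)); constructor 2; exists f' => //; exists i0.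
    by apply/eqP => /rowP/(_ j0)/eqP; rewrite !mxE (negPf vk).
  exists (x, y); case: px => c c0 /rowP ec; case: py => d d0 /rowP ed.
  exists (c * d / v 0 (mxvec_index i0 j0)); first by rewrite !mulf_neq0 ?invr_eq0.
  apply/rowP => k; case/mxvec_indexP: k => i j; rewrite mxE (pprod_crd (x, y)) /=.
  apply: (mulIf vk); rewrite minor ec ed !mxE; field; exact: vk.
have {pv} [c c0 /rowP ev] := pv.
have E1 i j : v 0 (mxvec_index i j) = c * (crd x 0 i * crd y 0 j).
  by rewrite ev mxE (pprod_crd (x, y)).
case=> [[f' Ef' [j ->]]|[f' Ff' [i ->]]|[i [j [i' [j' ->]]]]]; last by rewrite !E1; ring.
- case: (fE f' Ef') => d [p [hp _] pf] /=.
  have -> : col j v = (c * crd y 0 j) *: crd x.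
    by apply/rowP => i; rewrite !mxE E1; ring.
  rewrite pf (ev_scale _ _ hp) -pf ((hE (crd x) _).2 _ f' Ef') ?mulr0 //; first by case: eX.
  by exists x; apply: peq_refl.
- case: (fF f' Ff') => d [p [hp _] pf] /=.
  have -> : rw i v = (c * crd x 0 i) *: crd y.
    by apply/rowP => j; rewrite !mxE E1; ring.
  rewrite pf (ev_scale _ _ hp) -pf ((hF (crd y) _).2 _ f' Ff') ?mulr0 //; first by case: eY.
  by exists y; apply: peq_refl.
Qed.

Lemma morph_pair Z X Y (f : Z -> X) (g : Z -> Y) : embedded X -> embedded Y ->
  morph S f -> morph S g -> @morph L S Z (pprod X Y) (fun z => (f z, g z)).
Proof.
move=> eX eY /(morphP _ _ eX) mf /(morphP _ _ eY) mg.
apply/morphP; first exact: pprod_embedded.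
move=> z; case: (mf z) => d [c [cz hc]]; case: (mg z) => e [b [bz hb]].
exists (d + e)%N, (fun z => c z * b z); split; first exact: mulf_neq0.
move=> k; case/mxvec_indexP: k => i j.
apply: hfun_ext (hfunM hS (hc i) (hb j)) => w; rewrite (pprod_crd (f w, g w)) /=; ring.
Qed.

Lemma mrep_fst X Y j : @mrep L S (pprod X Y) X fst 1 (fun u => crd u.2 0 j).
Proof.
move=> i; apply: hfun_ext (@hfun_crd L S (pprod X Y) hS (mxvec_index i j)) => u.
by rewrite pprod_crd mulrC.
Qed.

Lemma mrep_snd X Y i : @mrep L S (pprod X Y) Y snd 1 (fun u => crd u.1 0 i).
Proof.
by move=> j; apply: hfun_ext (@hfun_crd L S (pprod X Y) hS (mxvec_index i j)) => u; rewrite pprod_crd.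
Qed.

Lemma morph_fst X Y : embedded X -> embedded Y -> @morph L S (pprod X Y) X fst.
Proof.
move=> eX eY; apply/morphP => // u; case: (crd_neq0 eY u.2) => j hj.
by exists 1%N, (fun u => crd u.2 0 j); split=> //; apply: mrep_fst.
Qed.

Lemma morph_snd X Y : embedded X -> embedded Y -> @morph L S (pprod X Y) Y snd.
Proof.
move=> eX eY; apply/morphP => // u; case: (crd_neq0 eX u.1) => i hi.
by exists 1%N, (fun u => crd u.1 0 i); split=> //; apply: mrep_snd.
Qed.

Lemma morph_const X Y (v : 'rV[L]_(amb Y)) (y : Y) : embedded Y ->
  peq v (crd y) -> (forall i, S (v 0 i)) -> @morph L S X Y (fun=> y).
Proof.
move=> eY [c c0 ev] Sv; apply/morphP => // x; exists 0%N, (fun=> c); split=> // i.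
by apply: hfun_ext (hfunC X hS (Sv i)) => z; rewrite ev mxE.
Qed.
End Products.

Lemma morph_const_any (L : closedFieldType) (X Y : pspace L) (y : Y) : embedded Y ->
  @morph L anyL X Y (fun=> y).
Proof. by move=> eY; apply: morph_const (peq_refl (crd y)) _. Qed.

Section GroupVariety.
Variables (L : closedFieldType) (A : avar L).
Hypothesis eA : embedded (asp A).
Hypothesis mA : @morph L anyL (pprod (asp A) (asp A)) (asp A) (fun u => u.1 + u.2 : A).

Lemma morph_add (Z : pspace L) (f g : Z -> A) : @morph L anyL Z (asp A) f -> @morph L anyL Z (asp A) g ->
  @morph L anyL Z (asp A) (fun z => f z + g z).
Proof.
move=> mf mg; have mp := morph_pair anyL_scalars eA eA mf mg.
exact: (morph_comp anyL_scalars (pprod_embedded eA eA) eA mp mA).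
Qed.

Lemma morph_muln (Z : pspace L) (f : Z -> A) n : @morph L anyL Z (asp A) f ->
  @morph L anyL Z (asp A) (fun z => f z *+ n).
Proof.
move=> mf; elim: n => [|n IH]; first exact: (@morph_const_any L Z (asp A) 0 eA).
have -> : (fun z => f z *+ n.+1) = fun z => f z + f z *+ n.
  by apply: boolp.funext => z; rewrite mulrS.
exact: morph_add.
Qed.

Lemma morph_translate (c : A) : @morph L anyL (asp A) (asp A) (fun z => z + c : A).
Proof.
by apply: morph_add; [apply: morph_id|apply: (@morph_const_any L _ (asp A) c eA)].
Qed.

(* Along z |-> (a z, b z) the differential of F(u + v) is the sum of the two partial ones. *)
Lemma add_differential (Z : pspace L) (z0 : Z) (a b : Z -> A) (F : A -> L) :
  @morph L anyL Z (asp A) a -> @morph L anyL Z (asp A) b ->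
  @rgd L 0 (asp A) (a z0 + b z0) F ->
  exists2 f, msq z0 f & near z0 (fun z => F (a z + b z) + F (a z0 + b z0) =
     F (a z + b z0) + F (a z0 + b z) + f z).
Proof.
move=> ma mb rF; pose u0 := a z0; pose v0 := b z0.
(* Functions of two variables for which additivity holds modulo the square of the maximal ideal.
   They form a ring with inverses of units and contain the functions of a single variable, hence all
   quotients of forms on the product. *)
pose K (G : A -> A -> L) := [/\ rg z0 (fun z => G (a z) (b z)), rg z0 (fun z => G (a z) v0),
  rg z0 (fun z => G u0 (b z)) & exists2 f, msq z0 f & near z0 (fun z =>
    G (a z) (b z) + G u0 v0 = G (a z) v0 + G u0 (b z) + f z)].
have KC c : K (fun _ _ => c).
  split; try exact: rgC.
  exists (fun=> 0); first exact/msq_zero/near_all.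
  by apply: near_all => z; rewrite addr0.
have KD G H : K G -> K H -> K (fun u v => G u v + H u v).
  move=> [g1 g2 g3 [f mf ef]] [h1 h2 h3 [f' mf' ef']]; split; try exact: rgdD.
  exists (fun z => f z + f' z); first exact: msqD.
  by apply: near_impl (near_and ef ef') => z [e1 e2]; rewrite addrACA e1 e2; ring.
have KM G H : K G -> K H -> K (fun u v => G u v * H u v).
  move=> [g1 g2 g3 [f mf ef]] [h1 h2 h3 [f' mf' ef']]; split; [exact: (rgdM g1 h1)|exact: (rgdM g2 h2)|exact: (rgdM g3 h3)|].
  pose x1 z := G (a z) v0 - G u0 v0; pose x2 z := G u0 (b z) - G u0 v0.
  pose y1 z := H (a z) v0 - H u0 v0; pose y2 z := H u0 (b z) - H u0 v0.
  have rx1 : rg z0 x1 by apply: rgdB => //; apply: rgC.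
  have rx2 : rg z0 x2 by apply: rgdB => //; apply: rgC.
  have ry1 : rg z0 y1 by apply: rgdB => //; apply: rgC.
  have ry2 : rg z0 y2 by apply: rgdB => //; apply: rgC.
  have x10 : x1 z0 = 0 by rewrite /x1 subrr.
  have x20 : x2 z0 = 0 by rewrite /x2 subrr.
  have y10 : y1 z0 = 0 by rewrite /y1 subrr.
  have y20 : y2 z0 = 0 by rewrite /y2 subrr.
  exists (fun z => (x1 z * y2 z + x2 z * y1 z) + (H (a z) (b z) * f z +
     (G (a z) v0 + x2 z) * f' z)).
    apply: msqD; first by apply: msqD; apply: msq_mul.
    by apply: msqD; apply: msqM => //; apply: rgdD.
  apply: near_impl (near_and ef ef') => z [e1 e2].
  have E1 : G (a z) (b z) = G (a z) v0 + G u0 (b z) + f z - G u0 v0 by rewrite -e1 addrK.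
  have E2 : H (a z) (b z) = H (a z) v0 + H u0 (b z) + f' z - H u0 v0 by rewrite -e2 addrK.
  by rewrite E1 E2 /x1 /x2 /y1 /y2; ring.
have KV G : K G -> G u0 v0 != 0 -> K (fun u v => (G u v)^-1).
  move=> [g1 g2 g3 [f mf ef]] G0; split; try by apply: rgV.
  pose x1 z := G (a z) v0 - G u0 v0; pose x2 z := G u0 (b z) - G u0 v0.
  have rx1 : rg z0 x1 by apply: rgdB => //; apply: rgC.
  have rx2 : rg z0 x2 by apply: rgdB => //; apply: rgC.
  have x10 : x1 z0 = 0 by rewrite /x1 subrr.
  have x20 : x2 z0 = 0 by rewrite /x2 subrr.
  pose D z := (G (a z) (b z))^-1 * ((G u0 v0)^-1 * ((G (a z) v0)^-1 * (G u0 (b z))^-1)).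
  have rD : rg z0 D by apply: (rgdM (rgV g1 G0)); apply: (rgdM (rgC _ _)); apply: (rgdM (rgV g2 G0) (rgV g3 G0)).
  exists (fun z => D z * ((G (a z) v0 + G u0 (b z)) * (x1 z * x2 z) - G u0 v0 * G u0 v0 * f z
             + (x1 z * x2 z) * f z)).
    have mx : msq z0 (fun z => x1 z * x2 z) by apply: msq_mul.
    apply: msqM => //; apply: msqD; first apply: msqD.
    + by apply: msqM => //; apply: rgdD.
    + have : msq z0 (fun z => - (G u0 v0 * G u0 v0) * f z).
        by apply: (@msqM _ _ _ (fun=> _)) => //; apply: rgC.
      by congr (msq _ _); apply: boolp.funext => z; rewrite mulNr.
    + by apply: msqM => //; apply: (rgdM rx1 rx2).
  have n1 := rg_near_neq0 g1 G0; have n2 := rg_near_neq0 g2 G0; have n3 := rg_near_neq0 g3 G0.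
  apply: near_impl (near_and ef (near_and n1 (near_and n2 n3))) => z [e1 [m1 [m2 m3]]].
  have E1 : f z = G (a z) (b z) + G u0 v0 - G (a z) v0 - G u0 (b z) by rewrite e1; ring.
  rewrite /D /x1 /x2 E1; field; by rewrite m1 m2 m3 G0.
have KX G n : K G -> K (fun u v => G u v ^+ n).
  move=> KG; elim: n => [|n IH].
    by have := KC 1; congr K; apply: boolp.funext => u; apply: boolp.funext => v; rewrite expr0.
  have := KM _ _ KG IH; congr K; apply: boolp.funext => u; apply: boolp.funext => v.
  by rewrite exprS.
case: (crd_neq0 eA u0) => i0 hi; case: (crd_neq0 eA v0) => j0 hj.
pose ru i (u : A) := av_crd u 0 i / av_crd u 0 i0.
pose rv j (v : A) := av_crd v 0 j / av_crd v 0 j0.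
have rat (w0 : A) k0 k : av_crd w0 0 k0 != 0 ->
    @rgd L 0 (asp A) w0 (fun w => av_crd w 0 k / av_crd w 0 k0).
  by move=> h; apply: (@rgd_div L 1 0 (asp A)) => //; apply: hfun_rgd; apply: (@hfun_crd L _ (asp A)).
have Ku i : K (fun u _ => ru i u).
  have r1 : rg z0 (fun z => ru i (a z)) by apply: (rg_pull eA ma (rat _ _ i hi)).
  split=> //; try exact: rgC.
  exists (fun=> 0); first exact/msq_zero/near_all.
  by apply: near_all => z; rewrite addr0.
have Kv j : K (fun _ v => rv j v).
  have r1 : rg z0 (fun z => rv j (b z)) by apply: (rg_pull eA mb (rat _ _ j hj)).
  split=> //; try exact: rgC.
  exists (fun=> 0); first exact/msq_zero/near_all.
  by apply: near_all => z; rewrite addr0 addrC.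
pose AA := pprod (asp A) (asp A).
(* Scaling by [nrm] turns the Segre coordinates into products of one affine coordinate in each
   variable, to which [Ku] and [Kv] apply. *)
pose nrm (u v : A) := (av_crd u 0 i0 * av_crd v 0 j0)^-1.
have Kp (p : {mpoly L[amb AA]}) : K (fun u v => ev (nrm u v *: @crd L AA (u, v)) p).
  have -> : (fun u v => ev (nrm u v *: @crd L AA (u, v)) p) =
     fun u v => \sum_(m <- msupp p) p@_m * \prod_k (nrm u v * @crd L AA (u, v) 0 k) ^+ m k.
    apply: boolp.funext => u; apply: boolp.funext => v.
    by rewrite /ev mevalE; apply: eq_bigr => m _; under eq_bigr do rewrite mxE.
  elim: (msupp p : seq _) => [|m r IH].
    have := KC 0; congr K; apply: boolp.funext => u; apply: boolp.funext => v.
    by rewrite big_nil.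
  have -> : (fun u v => \sum_(n <- m :: r) p@_n * \prod_k (nrm u v * @crd L AA (u, v) 0 k) ^+ n k) =
   fun u v => p@_m * \prod_k (nrm u v * @crd L AA (u, v) 0 k) ^+ m k +
      \sum_(n <- r) p@_n * \prod_k (nrm u v * @crd L AA (u, v) 0 k) ^+ n k.
    by apply: boolp.funext => u; apply: boolp.funext => v; rewrite big_cons.
  apply: KD => //; apply: (KM _ _ (KC _)).
  elim: (index_enum _) => [|k s IHs].
    have := KC 1; congr K; apply: boolp.funext => u; apply: boolp.funext => v.
    by rewrite big_nil.
  have -> : (fun u v => \prod_(l <- k :: s) (nrm u v * @crd L AA (u, v) 0 l) ^+ m l) =
   fun u v => (nrm u v * @crd L AA (u, v) 0 k) ^+ m k *
     \prod_(l <- s) (nrm u v * @crd L AA (u, v) 0 l) ^+ m l.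
    by apply: boolp.funext => u; apply: boolp.funext => v; rewrite big_cons.
  apply: (KM _ _ _ IHs); apply: KX; case/mxvec_indexP: k => i j.
  have := KM _ _ (Ku i) (Kv j); congr K; apply: boolp.funext => u; apply: boolp.funext => v.
  rewrite (@pprod_crd L (asp A) (asp A) (u, v)) /nrm /ru /rv /= invfM.
  by rewrite [LHS]mulrACA [RHS]mulrC.
case: rF => d [q [qx hq hqF]]; rewrite addn0 in hqF.
case: ((morphP _ _ eA).1 mA (u0, v0)) => e [c [cx hc]].
have [Q [hQ _] eQ] := hfun_pull anyL_scalars hq hc.
have [P [hP _] eP] := hfun_pull anyL_scalars hqF hc.
have sc u v (r : {mpoly L[amb AA]}) : r \is (e * d).-homog ->
    ev (nrm u v *: @crd L AA (u, v)) r = nrm u v ^+ (e * d) * ev (@crd L AA (u, v)) r.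
  by move=> hr; rewrite (ev_scale _ _ hr).
have FE u v : av_crd u 0 i0 != 0 -> av_crd v 0 j0 != 0 -> c (u, v) != 0 -> q (u + v) != 0 ->
   ev (nrm u v *: @crd L AA (u, v)) P * (ev (nrm u v *: @crd L AA (u, v)) Q)^-1 = F (u + v).
  move=> n1 n2 n3 n4; rewrite !sc // -(eQ (u, v)) -(eP (u, v)) /=.
  have nn : nrm u v != 0 by rewrite invr_eq0 mulf_neq0.
  have m1 : nrm u v ^+ (e * d) != 0 by rewrite expf_neq0.
  have m2 : c (u, v) ^+ d != 0 by rewrite expf_neq0.
  by field; rewrite m1 m2 n4.
have nQ : ev (nrm u0 v0 *: @crd L AA (u0, v0)) Q != 0.
  rewrite sc // -(eQ (u0, v0)) /= !mulf_neq0 ?expf_neq0 //.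
  by rewrite invr_eq0 mulf_neq0.
have [_ _ _ [f mf ef]] := KM _ _ (Kp P) (KV _ (Kp Q) nQ).
exists f => //.
have nb (w : Z -> A * A) : @morph L anyL Z AA w -> w z0 = (u0, v0) ->
    near z0 (fun z => [/\ av_crd (w z).1 0 i0 != 0, av_crd (w z).2 0 j0 != 0,
       c (w z) != 0 & q ((w z).1 + (w z).2) != 0]).
  move=> mw w0.
  have n1 : near (w z0 : AA) (fun uv : AA => av_crd uv.1 0 i0 != 0).
    apply: (near_pull (P := fun u : asp A => av_crd u 0 i0 != 0) eA); first exact: morph_fst.
    by rewrite w0; exists 1%N, (fun u : asp A => av_crd u 0 i0); split=> //; apply: (@hfun_crd L _ (asp A)).
  have n2 : near (w z0 : AA) (fun uv : AA => av_crd uv.2 0 j0 != 0).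
    apply: (near_pull (P := fun u : asp A => av_crd u 0 j0 != 0) eA); first exact: morph_snd.
    by rewrite w0; exists 1%N, (fun u : asp A => av_crd u 0 j0); split=> //; apply: (@hfun_crd L _ (asp A)).
  have n3 : near (w z0 : AA) (fun uv : AA => c uv != 0).
    case: (crd_neq0 eA (u0 + v0)) => i hi0.
    exists e, (fun uv : AA => c uv * @crd L (asp A) (uv.1 + uv.2 : A) 0 i).
    split; [exact: hc|by rewrite w0 mulf_neq0|].
    by move=> uv; rewrite mulf_eq0 negb_or => /andP[].
  have n4 : near (w z0 : AA) (fun uv : AA => q (uv.1 + uv.2) != 0).
    apply: (near_pull (P := fun u : asp A => q u != 0) eA mA); rewrite w0.
    by exists d, q.
  have := near_and (near_and n1 n2) (near_and n3 n4).
  move/(near_pull (pprod_embedded eA eA) mw); apply: near_impl => z [[h1 h2] [h3 h4]].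
  by split.
have mu0 := @morph_const_any L Z (asp A) u0 eA.
have mv0 := @morph_const_any L Z (asp A) v0 eA.
have N1 := nb (fun z => (a z, b z)) (morph_pair anyL_scalars eA eA ma mb) erefl.
have N2 := nb (fun z => (a z, v0)) (morph_pair anyL_scalars eA eA ma mv0) erefl.
have N3 := nb (fun z => (u0, b z)) (morph_pair anyL_scalars eA eA mu0 mb) erefl.
have [h1 h2 h3 h4] := near_self N1.
apply: near_impl (near_and ef (near_and N1 (near_and N2 N3))) => z [].
move=> + [[a1 a2 a3 a4] [[b1 b2 b3 b4] [c1 c2 c3 c4]]].
by rewrite !FE.
Qed.

(** The differential of multiplication by n is n. The translation by [c] is there for the induction,
    which moves one summand at a time from z to x. *)
Lemma muln_differential (x c : A) n (F : A -> L) :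
  @rgd L 0 (asp A) (x *+ n.+1 + c) F ->
  exists2 f, @msq L (asp A) x f & @near L (asp A) x (fun z =>
    F (z *+ n.+1 + c) - F (x *+ n.+1 + c) =
    n.+1%:R * (F (z + x *+ n + c) - F (x *+ n.+1 + c)) + f z).
Proof.
elim: n c => [|n IH] c rF.
  exists (fun=> 0); first exact/msq_zero/near_all.
  by apply: near_all => z; rewrite addr0 mul1r !mulr1n mulr0n addr0.
have eq1 (z : A) : z *+ n.+2 + c = z *+ n.+1 + (z + c) by rewrite mulrSr addrA.
have ma : @morph L anyL (asp A) (asp A) (fun z => z *+ n.+1 : A).
  by apply: morph_muln; apply: morph_id.
have [|f mf ef] := @add_differential (asp A) x (fun z => z *+ n.+1) (fun z => z + c) F ma (morph_translate c).
  by rewrite -eq1.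
have [|f' mf' ef'] := IH (x + c); first by rewrite -eq1.
exists (fun z => f' z + f z); first exact: msqD.
apply: near_impl (near_and ef ef') => z []; rewrite -!eq1 => e1 e2.
have {}e1 : F (z *+ n.+2 + c) = F (z *+ n.+1 + (x + c)) +
   F (x *+ n.+1 + (z + c)) + f z - F (x *+ n.+2 + c) by rewrite -e1 addrK.
have s1 : x *+ n.+1 + (z + c) = z + x *+ n.+1 + c by rewrite addrCA addrA.
have s2 : z + x *+ n + (x + c) = z + x *+ n.+1 + c by rewrite addrA -[z + _ + x]addrA -mulrSr.
have {}e2 : F (z *+ n.+1 + (x + c)) = n.+1%:R * (F (z + x *+ n.+1 + c) - F (x *+ n.+2 + c)) +
   f' z + F (x *+ n.+2 + c) by rewrite -s2 -e2 subrK.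
by rewrite e1 e2 s1 -[n.+2%:R]natr1; ring.
Qed.

End GroupVariety.

(** * Closed subspaces and closed images *)

Section Subvariety.
Variables (L : closedFieldType) (S : L -> Prop) (X : pspace L).
Definition sub_space (Z : X -> Prop) : pspace L :=
  @PSpace L {x : X | Z x} _ (fun w => crd (sval w)).

Lemma sub_projective (Z : X -> Prop) : projective S X -> zclosed S Z ->
  projective S (sub_space Z).
Proof.
move=> [[X0 Xinj] [E [fE hE]]] [F [fF hF]]; split.
  split=> [w|[x Zx] [y Zy] /Xinj /= xy]; first exact: X0.
  by move: Zx Zy; rewrite xy => Zx Zy; rewrite (boolp.Prop_irrelevance Zx Zy).
exists (fun p => E p \/ F p); split; first by move=> p [/fE|/fF].
move=> v v0; split=> [h|[w vw] p].
  have [x vx] : exists x : X, peq v (crd x) by apply/hE => // p Ep; apply: h; left.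
  have Zx : Z x.
    apply/hF => p Fp; case: (fF p Fp) => d [hp _].
    case: (peq_sym vx) => c c0 ->; rewrite (ev_scale _ _ hp) h ?mulr0 //; by right.
  by exists (exist _ x Zx).
case=> [Ep|Fp]; first by apply: ((hE v v0).2 _ p Ep); exists (sval w).
case: (fF p Fp) => d [hp _]; case: vw => c c0 -> /=.
by rewrite (ev_scale _ _ hp) ((hF (sval w)).1 (svalP w) p Fp) mulr0.
Qed.

Lemma sub_morph (Z : X -> Prop) (Y : pspace L) (f : X -> Y) : embedded Y -> morph S f ->
  @morph L S (sub_space Z) Y (fun w => f (sval w)).
Proof.
move=> eY /(morphP _ _ eY) mf; apply/morphP => // w.
case: (mf (sval w)) => d [c [cx hc]]; exists d, (fun w => c (sval w)); split=> // i.
by case: (hc i) => p fp ep; exists p.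
Qed.
Lemma embed_projective (T : Type) (i : T -> X) : projective S X -> injective i ->
  zclosed S (fun w => exists t, i t = w) -> projective S (PSpace (fun t => crd (i t))).
Proof.
move=> pX inj cl; have eX : embedded X by case: pX.
have [_ [E [fE hE]]] := sub_projective pX cl; split.
  by split=> [x|x y /(proj2 eX) /inj //]; apply: (proj1 eX).
exists E; split=> // v v0; apply: (iff_trans (hE v v0)); split.
  by case=> -[w [x fx]] /= vw; exists x; rewrite /= fx.
by case=> x vx; exists (exist _ (i x) (ex_intro _ x erefl)).
Qed.
End Subvariety.

Lemma closed_image_of (L : closedFieldType) (X Y : pspace L) (pi : X -> Y) (Z : X -> Prop) :
  projective anyL X -> embedded Y -> morph anyL pi -> zclosed anyL Z ->
  zclosed anyL (fun y => exists2 x, Z x & pi x = y).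
Proof.
move=> pX eY mpi cZ.
have := @closed_image L (sub_space Z) Y (fun w => pi (sval w)) (sub_projective pX cZ) eY
  (sub_morph (Z:=Z) eY mpi).
congr zclosed; apply: boolp.funext => y; apply: boolp.propext; split.
  by case=> -[x Zx] /= <-; exists x.
by case=> x Zx <-; exists (exist _ x Zx).
Qed.

(** * Forms that vanish at none of finitely many points *)

Section Avoidance.
Variables (L : closedFieldType) (X : pspace L).
Hypothesis eX : embedded X.

Lemma separating_form (x y : X) : x <> y -> exists f, [/\ hfun anyL 1 f, f x != 0 & f y = 0].
Proof.
move=> nxy; case: (crd_neq0 eX y) => b hb.
have [a ha] : exists a, crd x 0 a * crd y 0 b - crd x 0 b * crd y 0 a != 0.
  apply: boolp.contrapT => h; apply: nxy; case: eX => X0; apply.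
  have E a : crd x 0 a * crd y 0 b = crd x 0 b * crd y 0 a.
    apply/eqP; rewrite -subr_eq0; apply/negPn/negP => n; apply: h; by exists a.
  have xb : crd x 0 b != 0.
    case: (crd_neq0 (conj X0 (proj2 eX)) x) => a ha; apply: contraNneq ha => xb.
    by apply/eqP; apply: (mulIf hb); rewrite E xb !mul0r.
  exists (crd x 0 b / crd y 0 b); first by rewrite mulf_neq0 // invr_eq0.
  by apply/rowP => a; rewrite mxE; apply: (mulIf hb); rewrite E; field.
exists (fun z => crd z 0 a * crd y 0 b - crd z 0 b * crd y 0 a); split=> //.
  apply: hfunB => //; apply: (@hfunM_eq _ _ _ _ _ 1 0) => //; try exact: hfun_crd; exact: hfunC.
by rewrite mulrC subrr.
Qed.

(* Homogeneous prime avoidance for finitely many points. *)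
Lemma avoid_points (D : nat -> (X -> L) -> Prop) n (pt : 'I_n -> X) :
  (forall d f g, D d f -> D d g -> D d (fun x => f x + g x)) ->
  (forall d e a f, hfun anyL e a -> D d f -> D (e + d)%N (fun x => a x * f x)) ->
  (forall d f, D d f -> hfun anyL d f) ->
  injective pt ->
  (forall j, exists d f, D d f /\ f (pt j) != 0) ->
  (0 < n)%N ->
  exists d f, [/\ (0 < d)%N, D d f & forall j, f (pt j) != 0].
Proof.
move=> DD DM Dh inj ex n0.
have DX d f k : D d f -> D (d * k.+1)%N (fun x => f x ^+ k.+1).
  move=> Df; have := DM _ _ _ _ (hfunX anyL_scalars k (Dh _ _ Df)) Df.
  rewrite mulnS addnC; congr (D _ _); apply: boolp.funext => x; by rewrite exprSr.
have pos j : exists d f, [/\ (0 < d)%N, D d f & f (pt j) != 0].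
  case: (ex j) => d [f [Df fj]]; case: (crd_neq0 eX (pt j)) => a ha.
  exists (1 + d)%N, (fun x => crd x 0 a * f x); split=> //; last exact: mulf_neq0.
  by apply: DM => //; apply: hfun_crd.
suff : forall m, (m < n)%N -> exists d f, [/\ (0 < d)%N, D d f &
    forall j : 'I_n, (j <= m)%N -> f (pt j) != 0].
  move/(_ n.-1); rewrite prednK // => /(_ (leqnn _)) [d [f [d0 Df h]]].
  by exists d, f; split=> // j; apply: h; rewrite -ltnS prednK.
elim=> [lt0|m IH ltm].
  case: (pos (Ordinal lt0)) => d [f [d0 Df fj]]; exists d, f; split=> // j.
  by rewrite leqn0 => /eqP j0; have -> : j = Ordinal lt0 by apply: val_inj.
case: (IH (ltnW ltm)) => d [f [d0 Df fn]].
pose jm := Ordinal ltm.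
have [fm|fm] := eqVneq (f (pt jm)) 0; last first.
  exists d, f; split=> // j; rewrite leq_eqVlt ltnS => /orP[/eqP ej|]; last exact: fn.
  by have -> : j = jm by apply: val_inj.
have sep (j : 'I_n) : exists z, hfun anyL 1 z /\ (j != jm -> z (pt jm) != 0 /\ z (pt j) = 0).
  have [->|nj] := eqVneq j jm; first by case: (crd_neq0 eX (pt jm)) => a _;
     exists (fun x => crd x 0 a); split=> //; apply: hfun_crd.
  have /separating_form [z [hz z1 z2]] : pt jm <> pt j.
    by move/inj => e; rewrite e eqxx in nj.
  by exists z.
case: (boolp.choice sep) => z hz.
case: (pos jm) => d' [f' [d'0 Df' fj']].
(* [Z] vanishes at all the points except the new one: adding a multiple of it repairs [f] there
   without changing its values at the earlier points. The exponents below equalize the degrees. *)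
pose Z x := \prod_(j < n | j != jm) z j x.
have hZ : hfun anyL (\sum_(j < n | j != jm) 1) Z.
  apply: (@hfun_prod L anyL X anyL_scalars _ (index_enum _) (fun j => j != jm) z (fun=> 1%N)).
  by move=> j _; case: (hz j).
have Zm : Z (pt jm) != 0 by apply/prodf_neq0 => j nj; case: (hz j) => _ /(_ nj) [].
have Zj j : j != jm -> Z (pt j) = 0.
  by move=> nj; apply/eqP/prodf_eq0; exists j => //; case: (hz j) => _ /(_ nj) [_ ->].
pose e := (\sum_(j < n | j != jm) 1 + d')%N.
have Dg : D e (fun x => Z x * f' x) by apply: DM.
have e0 : (0 < e)%N by rewrite /e addn_gt0 d'0 orbT.
exists (d * e)%N, (fun x => f x ^+ e + (Z x * f' x) ^+ d); split.
- by rewrite muln_gt0 d0.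
- apply: DD; first by rewrite -(prednK e0); apply: DX.
  by rewrite mulnC -(prednK d0); apply: DX.
move=> j; rewrite leq_eqVlt ltnS => /orP[/eqP ej|lej].
  have -> : j = jm by apply: val_inj.
  by rewrite fm expr0n (gtn_eqF e0) add0r expf_neq0 // mulf_neq0.
have nj : j != jm by rewrite -val_eqE /= neq_ltn ltnS lej.
by rewrite Zj // mul0r expr0n (gtn_eqF d0) addr0 expf_neq0 // fn.
Qed.
End Avoidance.

(** A common denominator of the finitely many ratios represents [h] by forms near [y]. *)
Lemma morph_ratio (L : closedFieldType) (Y T : pspace L) (h : Y -> T) : embedded T ->
  (forall y, exists2 k, crd (h y) 0 k != 0 &
     forall i, rg y (fun z => crd (h z) 0 i / crd (h z) 0 k)) -> morph anyL h.
Proof.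
move=> eT H; apply/morphP => // y; case: (H y) => k hk rk.
have /boolp.choice [dq hdq] i : exists dq : nat * (Y -> L), [/\ dq.2 y != 0, hfun anyL dq.1 dq.2 &
   hfun anyL dq.1 (fun z => dq.2 z * (crd (h z) 0 i / crd (h z) 0 k))].
  by case: (rk i) => d [q [q0 hq hqf]]; rewrite addn0 in hqf; exists (d, q).
pose Q z := \prod_i (dq i).2 z.
exists (\sum_i (dq i).1)%N, (fun z => Q z / crd (h z) 0 k); split.
  by rewrite mulf_neq0 ?invr_eq0 //; apply/prodf_neq0 => i _; case: (hdq i).
move=> i.
have h1 : hfun anyL (\sum_(j | j != i) (dq j).1) (fun z => \prod_(j | j != i) (dq j).2 z).
  by apply: hfun_prod => // j _; case: (hdq j).
have [_ _ h2] := hdq i.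
rewrite (bigD1 i) //=; apply: hfun_ext (hfunM anyL_scalars h2 h1) => z.
rewrite /Q [in RHS](bigD1 i) //=; ring.
Qed.

Lemma local_ideal_pull (L : closedFieldType) (X Y : pspace L) (phi : X -> Y) x M
    (v : 'I_M -> Y -> L) f : embedded Y -> morph anyL phi ->
  local_ideal (phi x) v f ->
  local_ideal x (fun i z => v i (phi z)) (fun z => f (phi z)).
Proof.
move=> eY mphi [u hu eu]; exists (fun i z => u i (phi z)) => [i|].
  exact: (rg_pull eY mphi (hu i)).
exact: (near_pull eY mphi eu).
Qed.

(** * Descent along unramified homomorphisms *)

Section EtaleDescent.
Variables (L : closedFieldType) (X Y : avar L) (pi : X -> Y) (g : Y -> X) (l : nat).
Hypothesis pX : projective anyL (asp X).
Hypothesis irrX : @irreducible L (asp X) (fun=> True).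
Hypothesis mX : @morph L anyL (pprod (asp X) (asp X)) (asp X) (fun u => u.1 + u.2 : X).
Hypothesis eY : embedded (asp Y).
Hypothesis mpi : @morph L anyL (asp X) (asp Y) pi.
Hypothesis mg : @morph L anyL (asp Y) (asp X) g.
Hypothesis addpi : {morph pi : x y / x + y}.
Hypothesis gpi : forall x, g (pi x) = x *+ l.
Hypothesis l_inv : l%:R != 0 :> L.
Variable ker : seq X.
Hypothesis kerP : forall x, pi x = 0 -> x \in ker.

Let eX : embedded (asp X). Proof. by case: pX. Qed.

(** Near x, r(lz - (l-1)x) agrees with l r(z) modulo the square of the maximal ideal, and it depends
    on z only through [pi z] because lz is [g (pi z)]. As l is invertible, the maximal ideal is its
    square plus functions pulled back from [Y], and Nakayama concludes. *)
Lemma unramified (x : X) i0 r : av_crd (pi x) 0 i0 != 0 -> @rgd L 0 (asp X) x r -> r x = 0 ->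
  @local_ideal L (asp X) x _ (fun i z => @affine_coord L (asp Y) (pi x) i0 i (pi z)) r.
Proof.
move=> hy; move: r; apply: (local_nakayama eX).
  move=> i; apply: (rg_pull (Y := asp Y) eY mpi).
  exact: (@rg_affine L (asp Y) (pi x) i0 i hy).
move=> r rr r0; case: l l_inv gpi => [|l'] li gp; first by rewrite eqxx in li.
pose F (w : X) := r (w - x *+ l').
have rF : @rgd L 0 (asp X) (x *+ l'.+1 + 0) F.
  apply: (rg_pull eX (morph_translate eX mX (- (x *+ l')))).
  by rewrite addr0 mulrS addrK.
case: (muln_differential eX mX rF) => f mf ef.
have rG : @rgd L 0 (asp Y) (pi x) (fun y => F (g y)).
  by apply: (rg_pull eX mg); rewrite gp -[x *+ _]addr0.
have := @local_max_gen L (asp Y) (pi x) i0 _ hy rG.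
move/(local_ideal_pull eY mpi) => lG.
exists (fun z => - l'.+1%:R^-1 * f z), (fun z => l'.+1%:R^-1 * (F (g (pi z)) - F (g (pi x)))).
split.
- by apply: msqM => //; apply: rgC.
- by apply: local_idealM lG; apply: rgC.
apply: near_impl ef => z; rewrite !addr0 !gp /F.
have -> : x *+ l'.+1 - x *+ l' = x by rewrite mulrS addrK.
rewrite addrK r0 !subr0 => ->; rewrite mulrDr mulrA mulVf // mul1r; ring.
Qed.

(** Clearing denominators in [unramified]: [w] is a product of the denominators with a coordinate
    that does not vanish at [x]. *)
Lemma vanish_in_fibre_ideal (x : X) i0 d r : av_crd (pi x) 0 i0 != 0 ->
  @hfun L anyL (asp X) d r -> r x = 0 ->
  exists e w, [/\ @hfun L anyL (asp X) e w, w x != 0 &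
    @fibre_ideal L (asp X) (asp Y) pi (pi x) i0 (e + d) (fun z => w z * r z)].
Proof.
move=> hy hr r0; case: (crd_neq0 eX x) => j0 hj.
pose la (z : asp X) := crd z 0 j0.
have hla : hfun anyL 1 la by apply: hfun_crd.
have hlad : hfun anyL d (fun z => la z ^+ d).
  by have := hfunX anyL_scalars d hla; rewrite mul1n.
have rho : @rgd L 0 (asp X) x (fun z => r z / la z ^+ d).
  apply: (@rgd_div L d 0 (asp X)); rewrite ?addn0; try exact: hfun_rgd.
  by rewrite expf_neq0.
case: (unramified hy rho) => [|u hu [dn [n0 [hn n0x en]]]]; first by rewrite r0 mul0r.
have /boolp.choice [dq hdq] i : exists dq : nat * (X -> L), [/\ dq.2 x != 0,
   @hfun L anyL (asp X) dq.1 dq.2 & @hfun L anyL (asp X) dq.1 (fun z => dq.2 z * u i z)].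
  by case: (hu i) => a [q [q0 hq hqf]]; rewrite addn0 in hqf; exists (a, q).
pose D := (\sum_i (dq i).1)%N; pose Q (z : X) := \prod_i (dq i).2 z.
have hQ : @hfun L anyL (asp X) D Q.
  by apply: (@hfun_prod L anyL (asp X)) => // i _; case: (hdq i).
have hQu i : @hfun L anyL (asp X) D (fun z => Q z * u i z).
  have h1 : @hfun L anyL (asp X) (\sum_(j | j != i) (dq j).1) (fun z => \prod_(j | j != i) (dq j).2 z).
    by apply: (@hfun_prod L anyL (asp X)) => // j _; case: (hdq j).
  have [_ _ h2] := hdq i.
  rewrite /D (bigD1 i) //=; apply: hfun_ext (hfunM anyL_scalars h2 h1) => z.
  rewrite /Q [in RHS](bigD1 i) //=; ring.
exists (dn + (D + 1))%N, (fun z => n0 z * (Q z * la z)).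
have hw : @hfun L anyL (asp X) (dn + (D + 1)) (fun z => n0 z * (Q z * la z)).
  by apply: hfunM => //; apply: hfunM.
split=> //.
  by rewrite !mulf_neq0 //; apply/prodf_neq0 => i _; case: (hdq i).
split; first exact: hfunM.
exists (fun i z => n0 z * ((Q z * u i z) * (la z * la z ^+ d))) => [i|z Xz].
  by rewrite -!addnA; apply: hfunM => //; apply: hfunM => //; apply: hfunM.
have [->|/en ez] := eqVneq (n0 z) 0.
  by rewrite !mul0r mulr0 big1 // => i _; rewrite mul0r mulr0.
have [la0|lan] := eqVneq (la z) 0.
  rewrite la0 !(mulr0, mul0r) big1 // => i _; by rewrite !(mulr0, mul0r).
have {ez} : r z = la z ^+ d * \sum_i @affine_coord L (asp Y) (pi x) i0 i (pi z) * u i z.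
  by rewrite -ez mulrC divfK // expf_neq0.
move=> ->; rewrite /affine_coord !mulr_sumr; apply: eq_bigr => i _.
by field; rewrite hy Xz.
Qed.

Section OneFibre.
Variables (x0 : X) (i0 : 'I_(amb (asp Y))).
Hypothesis hy : av_crd (pi x0) 0 i0 != 0.
Notation A := (@fibre_ideal L (asp X) (asp Y) pi (pi x0) i0).

(** The scheme-theoretic fibre is reduced: by [vanish_in_fibre_ideal] at its points, and trivially
    elsewhere, the multipliers taking [r] into the ideal of the fibre have no common zero. *)
Lemma vanish_on_fibre m r : @hfun L anyL (asp X) m r -> (forall x, pi x = pi x0 -> r x = 0) ->
  exists N0, forall N a, (N0 <= N)%N -> @hfun L anyL (asp X) N a ->
    A (N + m) (fun z => a z * r z).
Proof.
move=> hr r0.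
pose J d (a : X -> L) := @hfun L anyL (asp X) d a /\ A (d + m) (fun z => a z * r z).
case: (@proj_null L (asp X) pX J) => [d|d f f'|d e a f ha|d f []//|x|N0 h].
- split; first exact: hfun0.
  by have := @fibre_ideal0 L (asp X) (asp Y) pi (pi x0) i0 (d + m); congr (A _ _); apply: boolp.funext => z; rewrite mul0r.
- move=> [hf Jf] [hf' Jf']; split; first exact: hfunD.
  by have := fibre_idealD Jf Jf'; congr (A _ _); apply: boolp.funext => z; rewrite mulrDl.
- move=> [hf Jf]; split; first exact: hfunM.
  have := fibre_idealM ha Jf; rewrite addnA; congr (A _ _).
  by apply: boolp.funext => z; rewrite mulrA.
- case: (boolp.pselect (pi x = pi x0)) => [xx0|nx].
    have hyx : av_crd (pi x) 0 i0 != 0 by rewrite xx0.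
    case: (vanish_in_fibre_ideal hyx hr (r0 x xx0)) => e [w [hw wx Aw]].
    by exists e, w; split=> //; split=> //; rewrite -xx0.
  apply: boolp.contrapT => h; apply: nx.
  apply: (@fibre_ideal_zero L (asp X) (asp Y) pi eY mpi (pi x0) i0 hy) => d f Af.
  apply/eqP; apply: boolp.contrapT => /negP fx; apply: h; exists d, f; split=> //.
  case: (Af) => hf _; split=> //.
  have := fibre_idealM hr Af; rewrite addnC; congr (A _ _).
  by apply: boolp.funext => z; rewrite mulrC.
by exists N0 => N a leN ha; case: (h N a leN ha).
Qed.

Section Denominator.
Variables (e : nat) (q : X -> L).
Hypotheses (e0 : (0 < e)%N) (hq : @hfun L anyL (asp X) e q).
Hypothesis q0 : forall x, pi x = pi x0 -> q x != 0.

(** [fibre_finite] lowers the degree by [e] at the price of a factor [q]. Repeating it shows that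
    the fractions with denominator a power of [q] are a finite module over the local ring of [Y]. *)
Lemma finite_iter : exists m0, forall m K (b : 'I_K -> X -> L), (m0 <= m)%N ->
  (forall f, @hfun L anyL (asp X) m f -> exists c : 'I_K -> L, forall x, f x = \sum_j c j * b j x) ->
  forall k, exists D S, [/\ @hfun L anyL (asp Y) D S, S (pi x0) != 0 &
    forall f, @hfun L anyL (asp X) (m + k * e) f -> exists2 C : 'I_K -> Y -> L,
      forall j, @hfun L anyL (asp Y) D (C j) &
      forall x, S (pi x) * f x = q x ^+ k * \sum_j C j (pi x) * b j x].
Proof.
case: (@fibre_finite L (asp X) (asp Y) pi pX eY mpi (pi x0) i0 hy e q hq q0) => m0 hm0.
exists m0 => m K b lem spb; elim=> [|k [D [S [hS S0 IH]]]].
  exists 0%N, (fun=> 1); split; [exact: hfun1|exact: oner_neq0|].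
  move=> f; rewrite mul0n addn0 => /spb [c fc].
  exists (fun j _ => c j) => [j|x]; first exact: hfunC.
  by rewrite expr0 !mul1r fc.
have lemk : (m0 <= m + k.+1 * e)%N by apply: leq_trans lem (leq_addr _ _).
case: (hm0 _ lemk) => K' [D' [S' [b' [hS' S'0 hb' spb']]]].
have dk : (m + k.+1 * e - e = m + k * e)%N by rewrite mulSn addnCA addKn.
have /boolp.choice [C' hC'] j : exists C : 'I_K -> Y -> L,
   (forall i, @hfun L anyL (asp Y) D (C i)) /\
   forall x, S (pi x) * b' j x = q x ^+ k * \sum_i C i (pi x) * b i x.
  by have := hb' j; rewrite dk => /IH [C hC eC]; exists C.
exists (D' + D)%N, (fun y => S' y * S y); split; [exact: hfunM|exact: mulf_neq0|].
move=> f /spb' [C hC eC].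
exists (fun i y => \sum_j C j y * C' j i y) => [i|x].
  by apply: hfun_sum => // j _; apply: hfunM => //; case: (hC' j).
rewrite mulrAC eC -mulrA mulr_suml exprS -mulrA; congr (_ * _).
transitivity (\sum_j C j (pi x) * (q x ^+ k * \sum_i C' j i (pi x) * b i x)).
  by apply: eq_bigr => j _; case: (hC' j) => _ <-; ring.
transitivity (q x ^+ k * \sum_j \sum_i C j (pi x) * C' j i (pi x) * b i x).
  rewrite [RHS]mulr_sumr; apply: eq_bigr => j _; rewrite mulrCA; congr (_ * _).
  by rewrite mulr_sumr; apply: eq_bigr => i _; rewrite mulrA.
by rewrite exchange_big /=; congr (_ * _); apply: eq_bigr => i _; rewrite mulr_suml.
Qed.

(** [G] lists the kernel. The functions [be i / q ^+ h] separate the points of the fibre through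
    [x0], and their sum is 1. *)
Lemma interpolate : exists h n (G : 'I_n.+1 -> X) (be : 'I_n.+1 -> X -> L),
  [/\ injective G, forall x, pi x = 0 <-> exists j, x = G j,
    forall i, @hfun L anyL (asp X) (h * e) (be i),
    forall i j, be i (x0 + G j) = (i == j)%:R * q (x0 + G j) ^+ h &
    forall x, \sum_i be i x = q x ^+ h].
Proof.
pose s := [seq x <- undup ker | pi x == 0].
have sP x : (x \in s) = (pi x == 0).
  by rewrite mem_filter mem_undup; case: eqP => // /kerP.
have pi0 : pi 0 = 0 by apply: (addrI (pi 0)); rewrite -addpi !addr0.
have us : uniq s by rewrite filter_uniq ?undup_uniq.
have s0 : (0 < size s)%N.
  by have : 0 \in s; [rewrite sP pi0|case: (s)].
pose n := (size s).-1; have szs : size s = n.+1 by rewrite prednK.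
pose G (j : 'I_n.+1) := nth 0 s j.
have Gs j : G j \in s by rewrite mem_nth // szs.
have Ginj : injective G.
  by move=> i j /eqP; rewrite nth_uniq ?szs // => /eqP /val_inj.
have GP x : pi x = 0 <-> exists j, x = G j.
  split=> [/eqP|[j ->]]; last by apply/eqP; rewrite -sP.
  rewrite -sP => xs; have lt : (index x s < n.+1)%N by rewrite -szs index_mem.
  by exists (Ordinal lt); rewrite /G /= nth_index.
pose pt j := x0 + G j.
have ptinj : injective pt by move=> i j /addrI /Ginj.
have qpt j : q (pt j) != 0.
  by apply: q0; rewrite addpi ((GP (G j)).2 (ex_intro _ j erefl)) addr0.
have /boolp.choice [z hz] (ij : 'I_n.+1 * 'I_n.+1) : exists z, @hfun L anyL (asp X) 1 z /\
   (ij.2 != ij.1 -> z (pt ij.1) != 0 /\ z (pt ij.2) = 0).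
  have [->|nij] := eqVneq ij.2 ij.1.
    by case: (crd_neq0 eX x0) => a _; exists (fun x => av_crd x 0 a); split=> //; apply: (@hfun_crd L anyL (asp X)).
  have /(separating_form eX) [f [hf f1 f2]] : pt ij.1 <> pt ij.2.
    by move/ptinj => E; rewrite E eqxx in nij.
  by exists f.
pose P i x := \prod_(j < n.+1 | j != i) z (i, j) x ^+ e.
have hP i : @hfun L anyL (asp X) (n * e) (P i).
  have := @hfun_prod L anyL (asp X) anyL_scalars _ (index_enum 'I_n.+1) (fun j => j != i)
    (fun j x => z (i, j) x ^+ e) (fun=> e).
  rewrite sum_nat_const cardC1 card_ord /=; apply=> j _.
  by rewrite -[X in hfun _ X _]mul1n; apply: hfunX => //; case: (hz (i, j)).
have Pii i : P i (pt i) != 0.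
  by apply/prodf_neq0 => j nj; rewrite expf_neq0 //; case: (hz (i, j)) => _ /(_ nj) [].
have Pij i j : j != i -> P i (pt j) = 0.
  move=> nj; apply/eqP/prodf_eq0; exists j => //.
  by case: (hz (i, j)) => _ /(_ nj) [_ ->]; rewrite expr0n (gtn_eqF e0).
pose b i x := (q (pt i) ^+ n / P i (pt i)) * P i x.
have hb i : @hfun L anyL (asp X) (n * e) (b i) by apply: hfunZ.
have bE i j : b i (pt j) = (i == j)%:R * q (pt j) ^+ n.
  rewrite /b; have [->|nij] := eqVneq i j; first by rewrite mul1r divfK.
  by rewrite (Pij i j) ?mulr0 ?mul0r // eq_sym.
have hqn : @hfun L anyL (asp X) (n * e) (fun x => q x ^+ n).
  by rewrite mulnC; apply: hfunX.
(* The form of index 0 is defined as the complement of the others, so that the sum is [q ^+ n]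
   everywhere and not only on the fibre. *)
exists n, n, G, (fun i x => if i == ord0 then q x ^+ n - \sum_(j | j != ord0) b j x else b i x).
split=> //.
- move=> i; case: (i == ord0) => //; apply: hfunB => //; apply: hfun_sum => // j _; exact: hb.
- move=> i j; rewrite -/(pt j); case: eqP => [->|_]; last exact: bE.
  under eq_bigr do rewrite bE.
  have [<-|nj] := eqVneq ord0 j.
    rewrite big1 ?subr0 ?mul1r // => k nk; by rewrite (negPf nk) mul0r.
  rewrite (bigD1 j) 1?eq_sym //= eqxx mul1r big1 ?addr0 ?subrr ?mul0r // => k /andP[_ nk].
  by rewrite (negPf nk) mul0r.
move=> x; rewrite (bigD1 ord0) //= [X in _ + X](eq_bigr (fun j => b j x)) ?subrK // => j.
by move/negPf ->.
Qed.

(** The quotient p/q is a combination of the interpolating functions with coefficients from [Y]. If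
    it is invariant under the kernel, comparing the values at all translates forces these
    coefficients to be equal to it. *)
Lemma descend_local p : @hfun L anyL (asp X) e p ->
  exists D S C, [/\ @hfun L anyL (asp Y) D S, @hfun L anyL (asp Y) D C, S (pi x0) != 0 &
    @near L (asp X) x0 (fun x => (forall k, pi k = 0 -> p (x + k) * q x = p x * q (x + k)) ->
      S (pi x) * p x = C (pi x) * q x)].
Proof.
move=> hp; case: interpolate => h [n [G [be [Ginj GP hbe beE sbe]]]].
case: finite_iter => m0 hm0; pose a := (h + m0)%N; pose m := (a.+1 * e)%N.
have lem : (m0 <= m)%N.
  rewrite /m /a; by apply: leq_trans (leq_pmulr _ e0); lia.
case: (@hfun_span L (asp X) m) => K [b [hb spb]].
have {hm0} fin := hm0 m K b lem spb.
pose B i x := be i x * q x ^+ (a.+1 - h).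
have leh : (h <= a.+1)%N by rewrite /a -addnS leq_addr.
have hB i : @hfun L anyL (asp X) m (B i).
  apply: (@hfunM_eq _ _ _ _ _ (h * e) (e * (a.+1 - h))) => //; last exact: hfunX.
  by rewrite [(e * _)%N]mulnC -mulnDl subnKC.
pose pt j := x0 + G j.
have pipt j : pi (pt j) = pi x0 by rewrite addpi ((GP (G j)).2 (ex_intro _ j erefl)) addr0.
have qpt j : q (pt j) != 0 by exact: q0.
pose c k i := b k (pt i) / q (pt i) ^+ a.+1.
pose r k x := b k x - \sum_i c k i * B i x.
have hr k : @hfun L anyL (asp X) m (r k).
  by apply: hfunB => //; apply: hfun_sum => // i _; apply: hfunZ.
have Bpt i j : B i (pt j) = (i == j)%:R * q (pt j) ^+ a.+1.
  by rewrite /B beE -/(pt j) -mulrA -exprD subnKC.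
have r0 k x : pi x = pi x0 -> r k x = 0.
  move=> xx0; have [j xj] : exists j, x - x0 = G j.
    by apply/GP; apply: (addrI (pi x0)); rewrite -addpi addrC subrK addr0.
  have -> : x = pt j by rewrite /pt -xj addrC subrK.
  rewrite /r (bigD1 j) //= Bpt eqxx mul1r big1 => [|i ij]; last by rewrite Bpt (negPf ij) mul0r mulr0.
  by rewrite addr0 /c divfK ?subrr // expf_neq0.
have /boolp.choice [N0 hN0] k := vanish_on_fibre (hr k) (r0 k).
pose N := (\max_k N0 k)%N.
have hqN : @hfun L anyL (asp X) (N * e) (fun x => q x ^+ N) by rewrite mulnC; apply: hfunX.
have AN k : A (N * e + m) (fun z => q z ^+ N * r k z).
  apply: hN0 => //; apply: leq_trans (leq_bigmax k) _; exact: leq_pmulr.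
case: (fin N) => D [S [hS S0 spS]].
pose t i := av_crd (pi x0) 0 i / av_crd (pi x0) 0 i0.
have /boolp.choice [MM hMM] k : exists M : 'I_K -> Y -> L,
   [/\ forall j, @hfun L anyL (asp Y) (1 + D) (M j), forall j, M j (pi x0) = 0 &
    forall x, av_crd (pi x) 0 i0 != 0 -> q x != 0 ->
     av_crd (pi x) 0 i0 * S (pi x) * r k x = \sum_j M j (pi x) * b j x].
  case: (AN k) => _ [s hs es].
  have /boolp.choice [Cs hCs] i : exists C : 'I_K -> Y -> L,
     (forall j, @hfun L anyL (asp Y) D (C j)) /\
     forall x, S (pi x) * s i x = q x ^+ N * \sum_j C j (pi x) * b j x.
    by have := hs i; rewrite addnC => /spS [C hC eC]; exists C.
  exists (fun j y => \sum_i (av_crd y 0 i - t i * av_crd y 0 i0) * Cs i j y); split.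
  - move=> j; apply: hfun_sum => // i _; apply: hfunM => //; last by case: (hCs i).
    apply: hfunB => //; first exact: (@hfun_crd L anyL (asp Y)).
    by apply: hfunZ => //; exact: (@hfun_crd L anyL (asp Y)).
  - by move=> j; rewrite big1 // => i _; rewrite /t mulfVK ?subrr ?mul0r //; exact: hy.
  - move=> x Xx qx; apply: (mulfI (expf_neq0 N qx)).
    transitivity (S (pi x) * (av_crd (pi x) 0 i0 * (q x ^+ N * r k x))); first by ring.
    have -> := es x Xx.
    transitivity (\sum_i (av_crd (pi x) 0 i - t i * av_crd (pi x) 0 i0) *
        (q x ^+ N * \sum_j Cs i j (pi x) * b j x)).
      rewrite mulr_sumr; apply: eq_bigr => i _; case: (hCs i) => _ <-; rewrite /t /=; ring.
    rewrite mulr_sumr.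
    transitivity (\sum_i \sum_j q x ^+ N * ((av_crd (pi x) 0 i - t i * av_crd (pi x) 0 i0) *
        Cs i j (pi x) * b j x)).
      by apply: eq_bigr => i _; rewrite mulrCA mulr_sumr mulr_sumr; apply: eq_bigr => j _; ring.
    rewrite exchange_big; apply: eq_bigr => j _ /=.
    by rewrite mulr_suml mulr_sumr.
pose y1 (y : Y) := av_crd y 0 i0 * S y.
have hy1 : @hfun L anyL (asp Y) (1 + D) y1.
  by apply: hfunM => //; exact: (@hfun_crd L anyL (asp Y)).
have y10 : y1 (pi x0) != 0 by rewrite mulf_neq0.
case: (@det_trick L (asp X) (asp Y) pi (pi x0) K (1 + D) b
   (fun k x => y1 (pi x) * \sum_i c k i * B i x) y1 MM
   (fun x => av_crd (pi x) 0 i0 != 0 /\ q x != 0) hy1 y10).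
- by move=> j k; case: (hMM j).
- by move=> j k; case: (hMM j).
- move=> x [Xx qx] k; case: (hMM k) => _ _ /(_ x Xx qx) <-.
  by rewrite /r /y1; ring.
move=> S1 [AA [hS1 S10 hAA eS1]].
have hpm : @hfun L anyL (asp X) m (fun x => p x * q x ^+ a).
  by rewrite /m mulSn; apply: hfunM => //; rewrite mulnC; apply: hfunX.
case: (spb _ hpm) => cp ecp.
have K0 : (0 < K)%N.
  have : exists j : 'I_K, True.
    apply: boolp.contrapT => nK.
    have [|cq] := spb (fun x => q x ^+ a.+1).
    - by rewrite /m mulnC; apply: hfunX.
    - move/(_ x0); rewrite big1 => [/eqP|j]; last by case: nK; exists j.
      by rewrite expf_eq0 /= (negPf (q0 erefl)).
  by case=> j _; apply: leq_ltn_trans (ltn_ord j).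
pose C i y := \sum_k cp k * \sum_j AA k j y * (y1 y * c j i).
have hC i : @hfun L anyL (asp Y) ((1 + D) * K) (C i).
  apply: hfun_sum => // k _; apply: hfunZ => //; apply: hfun_sum => // j _.
  apply: (@hfunM_eq _ _ _ _ _ ((1 + D) * K.-1) (1 + D)) => //.
    by rewrite -mulnSr prednK.
  by apply: hfun_ext (hfunZ anyL_scalars (c := c j i) _ hy1) => // z; rewrite mulrC.
(* Modulo the ideal of the fibre, every form of degree [m] is a combination of the [B i]; by
   Nakayama this holds over the local ring of [Y]. *)
have E1 x : av_crd (pi x) 0 i0 != 0 -> q x != 0 ->
   S1 (pi x) * (p x / q x) = \sum_i C i (pi x) * (be i x / q x ^+ h).
  move=> Xx qx; apply: (mulIf (expf_neq0 a.+1 qx)).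
  transitivity (S1 (pi x) * (p x * q x ^+ a)); first by rewrite exprS; field.
  rewrite ecp mulr_sumr.
  transitivity (\sum_k cp k * \sum_j AA k j (pi x) * (y1 (pi x) * \sum_i c j i * B i x)).
    by apply: eq_bigr => k _; rewrite mulrCA eS1.
  transitivity (\sum_i C i (pi x) * B i x); last first.
    rewrite mulr_suml; apply: eq_bigr => i _; rewrite /B -[in RHS](subnKC leh) exprD.
    by rewrite -!mulrA; congr (_ * (_ * _)); rewrite mulKf // expf_neq0.
  rewrite /C; under [RHS]eq_bigr do rewrite mulr_suml.
  rewrite exchange_big; apply: eq_bigr => k _ /=.
  transitivity (cp k * \sum_i \sum_j AA k j (pi x) * (y1 (pi x) * c j i) * B i x); last first.
    by rewrite mulr_sumr; apply: eq_bigr => i _; rewrite -mulrA mulr_suml.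
  congr (_ * _); rewrite exchange_big; apply: eq_bigr => j _ /=.
  by rewrite !mulr_sumr; apply: eq_bigr => i _; ring.
exists ((1 + D) * K)%N, S1, (C ord0); split=> //.
(* The values of the interpolating functions at the translates of [x]: the identity matrix at [x0],
   hence invertible nearby. *)
pose W x : 'M[L]_n.+1 := \matrix_(i, j) (be i (x + G j) / q (x + G j) ^+ h).
have tr (j : 'I_n.+1) : @morph L anyL (asp X) (asp X) (fun x => x + G j) := morph_translate eX mX (G j).
have rW i j : @rgd L 0 (asp X) x0 (fun x => be i (x + G j) / q (x + G j) ^+ h).
  apply: (@rg_pull L (asp X) (asp X) (fun x : X => x + G j) x0 (fun x => be i x / q x ^+ h) eX (tr j)).
  apply: (@rgd_div L (h * e) 0 (asp X)); first by rewrite addn0; apply: hfun_rgd.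
    by apply: hfun_rgd; rewrite mulnC; apply: hfunX.
  by rewrite expf_neq0 // qpt.
have rdet : @rgd L 0 (asp X) x0 (fun x => \det (W x)).
  exact: (@rg_det L (asp X) x0 _ (fun i j x => be i (x + G j) / q (x + G j) ^+ h)).
have det1 : \det (W x0) = 1.
  have -> : W x0 = 1%:M; last exact: det1.
  by apply/matrixP => i j; rewrite !mxE beE mulfK // expf_neq0 // qpt.
have n1 : @near L (asp X) x0 (fun x => \det (W x) != 0).
  by apply: rg_near_neq0 rdet _; rewrite det1 oner_eq0.
have n2 : @near L (asp X) x0 (fun x => forall j : 'I_n.+1, q (x + G j) != 0).
  apply: (@near_finite L (asp X)) => j.
  apply: (@near_pull L (asp X) (asp X) (fun x : X => x + G j) x0 (fun x => q x != 0) eX (tr j)).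
  by exists e, q; split=> //; apply: qpt.
have n3 : @near L (asp X) x0 (fun x => av_crd (pi x) 0 i0 != 0).
  apply: (near_pull (P := fun y : asp Y => av_crd y 0 i0 != 0) eY mpi).
  exists 1%N, (fun y : asp Y => av_crd y 0 i0); split=> //; exact: (@hfun_crd L anyL (asp Y)).
apply: near_impl (near_and n1 (near_and n2 n3)) => x [dW [qG Xx]] inv.
have piG j : pi (x + G j) = pi x by rewrite addpi ((GP (G j)).2 (ex_intro _ j erefl)) addr0.
have qx : q x != 0.
  have pi0 : pi 0 = 0 by apply: (addrI (pi 0)); rewrite -addpi !addr0.
  have [j e0j] := (GP 0).1 pi0; by have := qG j; rewrite -e0j addr0.
pose v : 'rV[L]_n.+1 := \row_i (C i (pi x) - S1 (pi x) * (p x / q x)).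
have vW : v *m W x = 0.
  apply/rowP => j; rewrite !mxE.
  under eq_bigr do rewrite !mxE mulrBl.
  rewrite sumrB -mulr_sumr -mulr_suml sbe divff ?expf_neq0 // mulr1.
  have Xj : av_crd (pi (x + G j)) 0 i0 != 0 by rewrite piG.
  have := E1 (x + G j) Xj (qG j); rewrite piG => <-; apply/eqP; rewrite subr_eq0; apply/eqP.
  congr (_ * _).
  have k0 : pi (G j) = 0 by apply/GP; exists j.
  have := inv (G j) k0 => Einv.
  by apply: (mulIf qx); rewrite mulfVK // mulrAC Einv mulfK.
have v0 : v = 0.
  have Wu : W x \in unitmx by rewrite unitmxE unitfE.
  by rewrite -[v]mulmx1 -(mulmxV Wu) mulmxA vW mul0mx.
have := congr1 (fun u : 'rV[L]_n.+1 => u 0 ord0) v0; rewrite !mxE => /eqP.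
rewrite subr_eq0 => /eqP ->; by field.
Qed.

End Denominator.
End OneFibre.

Lemma descend_regular (x0 : X) (phi : Y -> L) :
  (forall y, exists x, pi x = y) ->
  (forall x, pi x = pi x0 -> @rgd L 0 (asp X) x (fun z => phi (pi z))) ->
  @rgd L 0 (asp Y) (pi x0) phi.
Proof.
move=> surj reg; case: (crd_neq0 eY (pi x0)) => i0 hy.
pose DD d q := @hfun L anyL (asp X) d q /\ @hfun L anyL (asp X) d (fun z => q z * phi (pi z)).
(* Regularity gives a denominator at each point of the fibre; avoidance makes one that serves for
   all of them. *)
have [e [q [e0 [hq hqf] q0]]] : exists e q, [/\ (0 < e)%N, DD e q &
    forall x, pi x = pi x0 -> q x != 0].
  have h1 : @hfun L anyL (asp X) 0 (fun=> 1) by apply: hfun1.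
  case: (crd_neq0 eX x0) => a ha.
  pose s := [seq x <- undup ker | pi x == 0].
  have sP x : (x \in s) = (pi x == 0).
    by rewrite mem_filter mem_undup; case: eqP => // /kerP.
  have pi0 : pi 0 = 0 by apply: (addrI (pi 0)); rewrite -addpi !addr0.
  have us : uniq s by rewrite filter_uniq ?undup_uniq.
  have s0 : (0 < size s)%N by have : 0 \in s; [rewrite sP pi0|case: (s)].
  pose pt (j : 'I_(size s)) := x0 + nth 0 s j.
  have ptP x : pi x = pi x0 <-> exists j, x = pt j.
    split=> [xx0|[j ->]]; last first.
      by have := mem_nth 0 (ltn_ord j); rewrite sP addpi => /eqP ->; rewrite addr0.
    have xs : x - x0 \in s.
      by rewrite sP; apply/eqP; apply: (addrI (pi x0)); rewrite -addpi addrC subrK addr0.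
    have lt : (index (x - x0)%R s < size s)%N by rewrite index_mem.
    by exists (Ordinal lt); rewrite /pt /= nth_index // addrC subrK.
  case: (@avoid_points L (asp X) eX DD (size s) pt) => //.
  - move=> d f f' [f1 f2] [g1 g2]; split; first exact: hfunD.
    by apply: hfun_ext (hfunD anyL_scalars f2 g2) => z; rewrite mulrDl.
  - move=> d d' b f hb [f1 f2]; split; first exact: hfunM.
    by apply: hfun_ext (hfunM anyL_scalars hb f2) => z; rewrite mulrA.
  - by move=> d f [].
  - by move=> i j /addrI /eqP; rewrite nth_uniq // => /eqP /val_inj.
  - move=> j; have := reg (pt j) ((ptP _).2 (ex_intro _ j erefl)).
    by case=> d [q [q0 hq hqf]]; rewrite addn0 in hqf; exists d, q.
  move=> d [f [d0 Df fn]]; exists d, f; split=> // x /ptP [j ->]; exact: fn.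
case: (descend_local hy e0 hq q0 hqf) => D [S [C [hS hC S0 [dn [u [hu ux eu]]]]]].
(* Invariance is automatic for a function coming from [Y], so the identity holds near [x0];
   irreducibility of [X] spreads it everywhere. *)
have E x : S (pi x) * (q x * phi (pi x)) = C (pi x) * q x.
  apply/eqP; rewrite -subr_eq0; apply/eqP.
  case: ((morphP _ _ eY).1 mpi x) => d [c [cx hc]].
  have h1 : @hfun L anyL (asp X) (d * D + e)
     (fun z => c z ^+ D * S (pi z) * (q z * phi (pi z)) - c z ^+ D * C (pi z) * q z).
    apply: hfunB => //; apply: hfunM => //.
      exact: (@hfun_pull L anyL (asp X) (asp Y) anyL_scalars pi c D d S hS hc).
    exact: (@hfun_pull L anyL (asp X) (asp Y) anyL_scalars pi c D d C hC hc).
  case: (irreducible_hfun irrX hu h1) => [z|u0|h0].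
  - have [->|uz] := eqVneq (u z) 0; first by rewrite mul0r.
    have inv k : pi k = 0 -> q (z + k) * phi (pi (z + k)) * q z = q z * phi (pi z) * q (z + k).
      by move=> k0; rewrite addpi k0 addr0; ring.
    by have := eu z uz inv => E; rewrite -!mulrA E subrr mulr0.
  - by have := ux; rewrite u0 eqxx.
  apply: (mulfI (expf_neq0 D cx)); rewrite mulr0 -[RHS](h0 x); ring.
(* To cancel [q] over a neighbourhood of [pi x0], its zeros must not lie above it: their image is
   closed and misses [pi x0]. *)
have cl : zclosed anyL (fun y : asp Y => exists2 x, q x = 0 & pi x = y).
  apply: (closed_image_of (X := asp X)) => //; apply/zclosedP.
  exists (fun f => f = q); split; first by move=> f ->; exists e.
  by move=> x; split=> [qx f ->|]; [exact: qx|apply].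
have op : @zopen L anyL (asp Y) (fun y => ~ exists2 x, q x = 0 & pi x = y).
  move: cl; congr zclosed; apply: boolp.funext => y; apply: boolp.propext.
  by split=> [h nh|h]; [apply: nh|apply: boolp.contrapT].
have ny0 : ~ exists2 x, q x = 0 & pi x = pi x0.
  by case=> x qx0 /q0; rewrite qx0 eqxx.
have nn := zopen_near op ny0.
have nS : @near L (asp Y) (pi x0) (fun y => S y != 0) by exists D, S.
have rr : @rgd L 0 (asp Y) (pi x0) (fun y => C y / S y).
  by apply: (@rgd_div L D 0 (asp Y)); rewrite ?addn0; try exact: hfun_rgd.
apply: rgd_near rr; apply: near_impl (near_and nn nS) => y [ny Sy].
case: (surj y) => x xy; have qx : q x != 0 by apply/eqP => qx; apply: ny; exists x.
have := E x; rewrite xy mulrCA [C y * _]mulrC => /(mulfI qx) <-.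
by rewrite mulrC mulKf.
Qed.

Theorem etale_quotient : (forall y, exists x, pi x = y) -> @quotient_by_kernel L X Y pi.
Proof.
move=> surj T h [eT _] mh inv.
have ex y : exists t, forall x, pi x = y -> h x = t.
  by case: (surj y) => x <-; exists (h x) => z /inv.
case: (boolp.choice ex) => h' hh'; exists h'; last by move=> a; apply: hh'.
apply: morph_ratio => // y; case: (surj y) => x0 xy0.
have h'E x : h' (pi x) = h x by rewrite -(hh' _ x erefl).
case: (crd_neq0 eT (h' y)) => k hk; exists k => // i; rewrite -xy0.
apply: (@descend_regular x0 (fun z => crd (h' z) 0 i / crd (h' z) 0 k)) => // x xx0.
apply: (@rgd_ext L 0 (asp X) x (fun z => crd (h z) 0 i / crd (h z) 0 k)).
  by move=> z; rewrite h'E.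
apply: (rg_pull (f := fun t => crd t 0 i / crd t 0 k) eT mh).
apply: (@rgd_div L 1 0 T); try exact/hfun_rgd/hfun_crd.
by rewrite -h'E xx0 xy0.
Qed.
End EtaleDescent.

(** * Growth of the coordinate ring and dimension *)

Section Sections.
Variables (L : closedFieldType) (X : pspace L).
Hypothesis pX : projective anyL X.
Let eX : embedded X. Proof. by case: pX. Qed.

(** The forms that turn [s] into a form are a graded ideal, and the local denominators of [s] show
    that it has no common zero. *)
Lemma section_multiplier D (s : X -> L) : (forall x, rgd D x s) ->
  exists m0, forall m r, (m0 <= m)%N -> hfun anyL m r -> hfun anyL (m + D) (fun x => r x * s x).
Proof.
move=> rs; pose J d (a : X -> L) := hfun anyL d a /\ hfun anyL (d + D) (fun x => a x * s x).
case: (@proj_null L X pX J) => [d|d f g|d e a f ha|d f []//|x|m0 h].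
- split; first exact: hfun0.
  by apply: hfun_ext (hfun0 X anyL_scalars _) => x; rewrite mul0r.
- move=> [hf Jf] [hg Jg]; split; first exact: hfunD.
  by apply: hfun_ext (hfunD anyL_scalars Jf Jg) => x; rewrite mulrDl.
- move=> [hf Jf]; split; first exact: hfunM.
  by rewrite -addnA; apply: hfun_ext (hfunM anyL_scalars ha Jf) => x; rewrite mulrA.
- by case: (rs x) => d [q [qx hq hqs]]; exists d, q.
by exists m0 => m r lem hr; case: (h m r lem hr).
Qed.

Lemma regular_zero_product D D' (f g : X -> L) : @irreducible L X (fun=> True) ->
  (forall x, rgd D x f) -> (forall x, rgd D' x g) -> (forall x, f x * g x = 0) ->
  (forall x, f x = 0) \/ (forall x, g x = 0).
Proof.
move=> irr rf rg' fg; case: (boolp.pselect (forall x, f x = 0)) => [|nf]; first by left.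
right; move: nf => /boolp.existsNP [x0 /eqP fx0].
apply: (@rgd_identity L X D' g x0) => //.
apply: near_impl (rg_near_neq0 (rf x0) fx0) => y fy.
by apply: (mulfI fy); rewrite fg mulr0.
Qed.

Definition dimle m K := exists e : 'I_K -> X -> L, forall f, hfun anyL m f ->
  exists c : 'I_K -> L, forall x, f x = \sum_j c j * e j x.

Lemma dimleI m (T : finType) (e : T -> X -> L) : (forall f, hfun anyL m f ->
  exists c : T -> L, forall x, f x = \sum_t c t * e t x) -> dimle m #|T|.
Proof.
move=> h; exists (fun j => e (enum_val j)) => f /h [c fc].
exists (fun j => c (enum_val j)) => x; rewrite fc.
rewrite (reindex_onto (@enum_val T predT) enum_rank) /=; last by move=> i _; rewrite enum_rankK.
by apply: eq_bigl => i; rewrite enum_valK eqxx.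
Qed.

Definition indep (T : finType) (f : T -> X -> L) :=
  forall c : T -> L, (forall x, \sum_t c t * f t x = 0) -> forall t, c t = 0.

Lemma indep_le m K (T : finType) (f : T -> X -> L) : dimle m K ->
  (forall t, hfun anyL m (f t)) -> indep f -> (#|T| <= K)%N.
Proof.
move=> [e he] hf ind.
have /boolp.choice [a ha] t := he _ (hf t).
pose M : 'M[L]_(#|T|, K) := \matrix_(i, j) a (enum_val i) j.
rewrite leqNgt; apply/negP => lt.
have : kermx M != 0.
  by rewrite kermx_eq0 /row_free neq_ltn (leq_ltn_trans (rank_leq_col M) lt).
case/rowV0Pn => v /sub_kermxP vM; case/eqP; apply/rowP => i; rewrite mxE.
rewrite -(enum_valK i); apply: (ind (fun t => v 0 (enum_rank t))) => x.
transitivity (\sum_j (v *m M) 0 j * e j x); last first.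
  by rewrite vM big1 // => j _; rewrite mxE mul0r.
transitivity (\sum_t \sum_j v 0 (enum_rank t) * a t j * e j x).
  by apply: eq_bigr => t _; rewrite ha mulr_sumr; apply: eq_bigr => j _; rewrite mulrA.
rewrite exchange_big; apply: eq_bigr => j _ /=; rewrite mxE mulr_suml.
rewrite [RHS](reindex_onto enum_rank (@enum_val T predT)) /=; last by move=> k _; rewrite enum_valK.
by apply: eq_big => [t|t _]; rewrite ?enum_rankK ?eqxx // mxE enum_rankK.
Qed.

Inductive lspan (E : (X -> L) -> Prop) : (X -> L) -> Prop :=
| lspan0 : lspan E (fun=> 0)
| lspanS c e g : E e -> lspan E g -> lspan E (fun x => c * e x + g x).

Lemma lspanD E f g : lspan E f -> lspan E g -> lspan E (fun x => f x + g x).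
Proof.
move=> sf sg; elim: sf => [|c e h Ee _ IH].
  by have := sg; congr lspan; apply: boolp.funext => x; rewrite add0r.
by have := lspanS c Ee IH; congr lspan; apply: boolp.funext => x; rewrite addrA.
Qed.

Lemma lspan_sum E (I : Type) (r : seq I) (F : I -> X -> L) :
  (forall i, lspan E (F i)) -> lspan E (fun x => \sum_(i <- r) F i x).
Proof.
move=> hF; elim: r => [|i r IH].
  by have := lspan0 E; congr lspan; apply: boolp.funext => x; rewrite big_nil.
by have := lspanD (hF i) IH; congr lspan; apply: boolp.funext => x; rewrite big_cons.
Qed.

Lemma lspan_mul E E' (a : X -> L) f : (forall e, E e -> E' (fun x => a x * e x)) ->
  lspan E f -> lspan E' (fun x => a x * f x).
Proof.
move=> h; elim=> [|c e g Ee _ IH].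
  by have := lspan0 E'; congr lspan; apply: boolp.funext => x; rewrite mulr0.
have := lspanS c (h e Ee) IH; congr lspan; apply: boolp.funext => x; ring.
Qed.

Lemma lspan_fin E (T : finType) (e : T -> X -> L) f :
  (forall g, E g -> exists t, g = e t) -> lspan E f ->
  exists c : T -> L, forall x, f x = \sum_t c t * e t x.
Proof.
move=> h; elim=> [|c g r /h [t ->] _ [d hd]].
  by exists (fun=> 0) => x; rewrite big1 // => t _; rewrite mul0r.
exists (fun u => (u == t)%:R * c + d u) => x; rewrite hd.
under [RHS]eq_bigr do rewrite mulrDl.
rewrite big_split /=; congr (_ + _); rewrite (bigD1 t) //= eqxx mul1r big1 ?addr0 // => u ut.
by rewrite (negPf ut) !mul0r.
Qed.

(** Such forms define a finite map to a projective space of dimension s - 1, so [s] plays the part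
    of an upper bound for the dimension plus one. *)
Definition cut_by s := exists D (y : 'I_s -> X -> L),
  [/\ (0 < D)%N, forall i, hfun anyL D (y i) & forall x, exists i, y i x != 0].

Lemma cut_by_coordinates : cut_by (amb X).
Proof.
exists 1%N, (fun i x => crd x 0 i); split=> //; first by move=> i; apply: hfun_crd.
by move=> x; apply: crd_neq0.
Qed.

Lemma cut_by_leq s t : (s <= t)%N -> cut_by s -> cut_by t.
Proof.
move=> st [D [y [D0 hy y0]]].
exists D, (fun i x => if insub (i : nat) is Some j then y j x else 0); split=> //.
  by move=> i; case: insubP => [j _ _|_] //; apply: hfun0.
move=> x; case: (y0 x) => i yi; exists (widen_ord st i).
by case: insubP => [j _ /= ji|]; [rewrite (_ : j = i) //; apply: val_inj|rewrite /= ltn_ord].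
Qed.

(** Every form of large degree is a combination of the [y i] with coefficients of degree lower by
    [D]. After [k] steps only monomials of degree [k] in the [y i], times a bounded number of
    functions, remain. *)
Lemma growth_upper s : cut_by s.+1 -> exists C, forall m, exists2 K, dimle m K & (K <= C * m.+1 ^ s)%N.
Proof.
move=> [D [y [D0 hy y0]]].
pose J d (f : X -> L) := hfun anyL d f /\ exists b : 'I_s.+1 -> X -> L,
  [/\ forall i, hfun anyL (d - D) (b i), (d < D)%N -> f = (fun=> 0) &
   (D <= d)%N -> forall x, f x = \sum_i y i x * b i x].
case: (@proj_null L X pX J) => [d|d f g|d e a f ha|d f []//|x|m0 hm0].
- split; first exact: hfun0.
  exists (fun _ _ => 0); split=> [i|//|_ x]; first exact: hfun0.
  by rewrite big1 // => i _; rewrite mulr0.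
- move=> [hf [b [hb b0 eb]]] [hg [b' [hb' b0' eb']]]; split; first exact: hfunD.
  exists (fun i x => b i x + b' i x); split=> [i|lt|le x]; first exact: hfunD.
    by apply: boolp.funext => x; rewrite b0 // b0' // addr0.
  by rewrite eb // eb' // -big_split; apply: eq_bigr => i _; rewrite mulrDr.
- move=> [hf [b [hb b0 eb]]]; split; first exact: hfunM.
  case: (ltnP d D) => [lt|le].
    exists (fun _ _ => 0); split=> [i|_|_ x]; first exact: hfun0.
      by apply: boolp.funext => x; rewrite b0 // mulr0.
    by rewrite b0 // mulr0 big1 // => i _; rewrite mulr0.
  exists (fun i x => a x * b i x); split=> [i|lt|_ x].
  + by rewrite -addnBA //; apply: hfunM.
  + by move: lt; rewrite ltnNge (leq_trans le (leq_addl _ _)).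
  + by rewrite eb // mulr_sumr; apply: eq_bigr => i _; rewrite mulrCA.
- case: (y0 x) => i yi; exists D, (y i); split=> //; split=> //.
  exists (fun j _ => (j == i)%:R); split=> [j|/[!ltnn]//|_ z].
    by rewrite subnn; apply: hfunC.
  rewrite (bigD1 i) //= eqxx mulr1 big1 ?addr0 // => j ji.
  by rewrite (negPf ji) mulr0.
pose M := (m0 + D)%N.
have dec m f : (M <= m)%N -> hfun anyL m f -> exists b : 'I_s.+1 -> X -> L,
    (forall i, hfun anyL (m - D) (b i)) /\ forall x, f x = \sum_i y i x * b i x.
  move=> leM /(hm0 m f) [|_ [b [hb _ eb]]]; first by apply: leq_trans leM; apply: leq_addr.
  by exists b; split=> //; apply: eb; apply: leq_trans leM; apply: leq_addl.
have /boolp.choice [Kd hKd] m : exists K, dimle m K.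
  by case: (hfun_span X m) => K [e [_ he]]; exists K, e.
pose K0 := (\max_(m < M + D) Kd m)%N.
have leK0 m : (m < M + D)%N -> (Kd m <= K0)%N by move=> lt; apply: (leq_bigmax (Ordinal lt)).
exists K0 => m; case: (ltnP m (M + D)) => [lt|le].
  exists (Kd m) => //; apply: leq_trans (leK0 m lt) _; by rewrite leq_pmulr // expn_gt0.
pose k := ((m - M) %/ D)%N; pose m' := (M + (m - M) %% D)%N.
have em : m = (m' + k * D)%N.
  by rewrite /m' /k -addnA [(_ %% _ + _)%N]addnC -divn_eq subnKC //; apply: leq_trans le; apply: leq_addr.
have lem' : (M <= m')%N by apply: leq_addr.
have ltm' : (m' < M + D)%N by rewrite ltn_add2l ltn_mod.
case: (hKd m') => e he.
(* The exponent of [y ord0] is determined by the others, so [s] exponents suffice to count the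
   monomials. *)
pose mon j (mu : 'I_s -> nat) x := y ord0 x ^+ (j - \sum_i mu i) * \prod_i y (lift ord0 i) x ^+ mu i.
pose E j (g : X -> L) := exists mu : 'I_s -> nat, exists i, (\sum_i mu i <= j)%N /\ g = fun x => mon j mu x * e i x.
have sp j : forall f, hfun anyL (m' + j * D) f -> lspan (E j) f.
  elim: j => [|j IH] f.
    rewrite mul0n addn0 => /he [c fc].
    have -> : f = fun x => \sum_i c i * e i x by apply: boolp.funext.
    apply: lspan_sum => i; have := @lspanS (E 0%N) (c i) (e i) _ _ (lspan0 _).
    set g := (fun x => c i * e i x + 0).
    have -> : g = fun x => c i * e i x by apply: boolp.funext => x; rewrite /g addr0.
    apply; exists (fun=> 0%N), i; rewrite sum_nat_const muln0; split=> //.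
    apply: boolp.funext => x; by rewrite /mon sub0n expr0 mul1r big1 ?mul1r.
  move=> hf; case: (dec _ f _ hf) => [|b [hb /boolp.funext ->]].
    by apply: leq_trans lem' _; apply: leq_addr.
  apply: lspan_sum => i.
  have hbi : hfun anyL (m' + j * D) (b i) by have := hb i; rewrite mulSn addnCA addKn.
  apply: lspan_mul (IH _ hbi) => g [mu [t [lemu ->]]].
  case: (unliftP ord0 i) => [i'|] ->.
    exists (fun a => mu a + (a == i'))%N, t.
    have smu : (\sum_a (mu a + (a == i')) = (\sum_a mu a).+1)%N.
      have s1 : (\sum_(a < s) (a == i') = 1)%N by rewrite (bigD1 i') //= eqxx big1 // => a /negPf ->.
      by rewrite big_split /= s1 addn1.
    rewrite smu ltnS; split=> //; apply: boolp.funext => x; rewrite /mon smu subSS.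
    have -> : \prod_(a < s) y (lift ord0 a) x ^+ (mu a + (a == i')) = (\prod_(a < s) y (lift ord0 a) x ^+ mu a) * y (lift ord0 i') x.
      rewrite (bigD1 i') //= eqxx addn1 exprSr [in RHS](bigD1 i') //=.
      rewrite (eq_bigr (fun a => y (lift ord0 a) x ^+ mu a)) => [|a /negPf ->]; [ring|by rewrite addn0].
    ring.
  exists mu, t; split; first by apply: leq_trans lemu _.
  by apply: boolp.funext => x; rewrite /mon subSn // exprS; ring.
exists #|{: {ffun 'I_s -> 'I_k.+1} * 'I_(Kd m')}|.
  apply: (@dimleI m {: {ffun 'I_s -> 'I_k.+1} * 'I_(Kd m')} (fun t x => mon k (fun i => val (t.1 i)) x * e t.2 x)) => f hf.
  apply: (@lspan_fin (E k)); last by apply: sp; rewrite -em.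
  move=> g [mu [i [lemu ->]]]; exists ([ffun a => inord (mu a)], i) => /=.
  apply: boolp.funext => x; congr (_ * _); congr (mon k _ x).
  apply: boolp.funext => a; rewrite ffunE inordK // ltnS.
  by apply: leq_trans lemu; rewrite (bigD1 a) //= leq_addr.
rewrite card_prod card_ffun !card_ord mulnC leq_mul //; first exact: leK0.
have lekm : (k <= m)%N by apply: leq_trans (leq_div _ _) (leq_subr _ _).
by case: (s) => // s0; rewrite leq_exp2r.
Qed.

(** Take the least number of forms without common zero. A polynomial relation between them would be
    nonzero at some [v] after setting the first form to 1; then the forms [y (lift ord0 i)] - v i
    [y ord0] would have no common zero, one fewer than the least number. So the monomials are
    independent. *)
Lemma growth_lower s : ~ cut_by s -> exists s' D, [/\ (s <= s')%N, (0 < D)%N &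
  forall k, exists2 f : {ffun 'I_s' -> 'I_k.+1} -> X -> L,
    forall mu, hfun anyL (D * (k * s')) (f mu) & indep f].
Proof.
move=> ns; case: (@least_nat cut_by) => [|t0 [ct0 mint0]].
  by exists (amb X); apply: cut_by_coordinates.
have lt : (s < t0)%N by rewrite ltnNge; apply/negP => le; apply: ns; apply: cut_by_leq le ct0.
case: t0 ct0 mint0 lt => // s' [D [y [D0 hy y0]]] mint0 lt.
exists s', D; split=> // k.
have lemu (mu : {ffun 'I_s' -> 'I_k.+1}) : (\sum_i mu i <= k * s')%N.
  have : (\sum_i mu i <= \sum_(i < s') k)%N by apply: leq_sum => i _; rewrite -ltnS.
  by rewrite sum_nat_const card_ord mulnC.
exists (fun (mu : {ffun 'I_s' -> 'I_k.+1}) x => y ord0 x ^+ (k * s' - \sum_i mu i) * \prod_i y (lift ord0 i) x ^+ mu i).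
  move=> mu; apply: (@hfunM_eq _ _ _ _ _ (D * (k * s' - \sum_i mu i)) (\sum_i D * mu i)).
  - by [].
  - by rewrite -big_distrr /= -mulnDr subnK.
  - exact: hfunX.
  - by apply: hfun_prod => // i _; apply: hfunX.
move=> c hc mu0; apply/eqP; apply: boolp.contrapT => /negP cmu0.
pose mn (mu : {ffun 'I_s' -> 'I_k.+1}) := [multinom (mu i : nat) | i < s'].
have mninj : injective mn.
  move=> mu nu /mnmP h; apply/ffunP => i; apply: val_inj.
  by have := h i; rewrite !mnmE.
pose p : {mpoly L[s']} := \sum_mu c mu *: 'X_[mn mu].
have p0 : p != 0.
  apply/eqP => /(congr1 (mcoeff (mn mu0))); rewrite mcoeff0 /p raddf_sum /=.
  rewrite (bigD1 mu0) //= mcoeffZ mcoeffX eqxx mulr1 big1 ?addr0; first by apply/eqP.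
  by move=> mu nmu; rewrite mcoeffZ mcoeffX (inj_eq mninj) (negPf nmu) mulr0.
case: (mpoly_nonroot p0) => v pv.
have : cut_by s'; last by move/mint0; rewrite ltnn.
exists D, (fun i x => y (lift ord0 i) x - v i * y ord0 x); split=> //.
  by move=> i; apply: hfunB => //; apply: hfunZ.
move=> x; apply: boolp.contrapT => h.
have yE i : y (lift ord0 i) x = v i * y ord0 x.
  apply/eqP; rewrite -subr_eq0; apply/negPn/negP => n; apply: h; by exists i.
have y00 : y ord0 x = 0.
  have := hc x.
  have -> : \sum_mu c mu * (y ord0 x ^+ (k * s' - \sum_i mu i) * \prod_i y (lift ord0 i) x ^+ mu i)
     = y ord0 x ^+ (k * s') * p.@[v].
    rewrite /p raddf_sum /= mulr_sumr; apply: eq_bigr => mu _.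
    have -> : \prod_i y (lift ord0 i) x ^+ mu i = (\prod_i v i ^+ mu i) * y ord0 x ^+ (\sum_i mu i).
      rewrite -prodrXr -big_split; apply: eq_bigr => i _; by rewrite yE exprMn.
    rewrite mevalZ mevalX -[in RHS](subnK (lemu mu)) exprD.
    have -> : \prod_i v i ^+ mn mu i = \prod_i v i ^+ mu i by apply: eq_bigr => i _; rewrite mnmE.
    ring.
  by move/eqP; rewrite mulf_eq0 (negPf pv) orbF expf_eq0 => /andP[_ /eqP].
case: (y0 x) => i; case: (unliftP ord0 i) => [j|] ->; last by rewrite y00 eqxx.
by rewrite yE y00 mulr0 eqxx.
Qed.

End Sections.

(** Multiplied by a suitable [r], all powers of [u] lie in one finite-dimensional space of forms.
    Hence [u] satisfies a polynomial equation, and irreducibility selects one of its roots. *)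
Lemma regular_constant (L : closedFieldType) (X : pspace L) (u : X -> L) :
  projective anyL X -> @irreducible L X (fun=> True) -> (forall x, rg x u) ->
  exists c, forall x, u x = c.
Proof.
move=> pX irr ru; case: (section_multiplier pX ru) => m0 hm0.
case: (irr) => -[x0 _] _; case: (crd_neq0 (proj1 pX) x0) => i xi.
pose r (x : X) := crd x 0 i ^+ m0.
have hr j : hfun anyL m0 (fun x => u x ^+ j * r x).
  elim: j => [|j IH].
    have := hfunX anyL_scalars m0 (hfun_crd anyL_scalars (X := X) i); rewrite mul1n.
    by apply: hfun_ext => x; rewrite expr0 mul1r.
  have := hm0 m0 _ (leqnn _) IH; rewrite addn0.
  by apply: hfun_ext => x; rewrite exprS; ring.
case: (hfun_span X m0) => K [e [_ he]].
have [c hc [t ct]] : exists2 c : 'I_K.+1 -> L,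
    (forall x, \sum_j c j * (u x ^+ j * r x) = 0) & exists t, c t != 0.
  apply: boolp.contrapT => h.
  have := @indep_le L X m0 K 'I_K.+1 (fun j x => u x ^+ j * r x) _ (fun j => hr j).
  rewrite card_ord ltnn => /(_ (ex_intro _ e he)) H; suff // : False by []; apply/notF/H.
  move=> c hc t; apply/eqP; apply: boolp.contrapT => /negP ct; apply: h.
  by exists c => //; exists t.
pose P : {poly L} := \poly_(j < K.+1) (if insub j is Some j' then c j' else 0).
have P0 : P != 0.
  apply/eqP => /(congr1 (fun p : {poly L} => p`_t)); rewrite coef_poly ltn_ord coef0.
  by rewrite (valK t); apply/eqP.
have PE x : P.[u x] * r x = 0.
  rewrite -[RHS](hc x) horner_poly mulr_suml; apply: eq_bigr => j _.
  by rewrite (valK j) mulrA.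
have Pn : near x0 (fun x => P.[u x] = 0).
  exists m0, r; split.
  - have := hfunX anyL_scalars m0 (hfun_crd anyL_scalars (X := X) i); by rewrite mul1n.
  - by rewrite expf_neq0.
  by move=> x rx; apply: (mulIf rx); rewrite PE mul0r.
have [s Ps] := closed_field_poly_normal P.
have rP (q : {poly L}) x : rg x (fun z => q.[u z]).
  have -> : (fun z => q.[u z]) = fun z => \sum_(j < size q) q`_j * u z ^+ j.
    by apply: boolp.funext => z; rewrite horner_coef.
  by apply: rgd_sum => j _; apply: rgdZ; apply: rg_exp.
have Pz x : P.[u x] = 0 by apply: (rgd_identity irr (rP P) Pn).
have : forall x, (\prod_(z <- s) ('X - z%:P)).[u x] = 0.
  move=> x; have := Pz x; rewrite Ps hornerZ => /eqP; rewrite mulf_eq0 lead_coef_eq0.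
  by rewrite (negPf P0) => /eqP.
clear -pX irr ru rP; elim: s => [|z s IH] h.
  by case: (irr) => -[x _] _; have := h x; rewrite big_nil hornerC => /eqP; rewrite oner_eq0.
case: (regular_zero_product irr (rP ('X - z%:P)) (rP (\prod_(w <- s) ('X - w%:P)))) => [x|h1|].
- by have := h x; rewrite big_cons hornerM.
- by exists z => x; have /eqP := h1 x; rewrite !hornerE subr_eq0 => /eqP.
- exact: IH.
Qed.

(** * Comparison with chains of irreducible closed sets *)

Section Dimension.
Variables (L : closedFieldType) (X : pspace L).
Hypothesis pX : projective anyL X.

Definition cut_on (Z : X -> Prop) s := exists D (y : 'I_s -> X -> L),
  [/\ (0 < D)%N, forall i, hfun anyL D (y i) & forall x, Z x -> exists i, y i x != 0].

Lemma cut_onP Z s : cut_on Z s <-> cut_by (sub_space Z) s.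
Proof.
split=> -[D [y [D0 hy y0]]].
  exists D, (fun i w => y i (sval w)); split=> [//|i|[x Zx]]; last exact: y0.
  by case: (hy i) => p fp ep; exists p.
have /boolp.choice [y' hy'] i : exists y', hfun anyL D y' /\ forall w : sub_space Z, y i w = y' (sval w).
  by case: (hy i) => p fp ep; exists (fun x : X => ev (crd x) (p : {mpoly L[amb X]})); split=> //; exists p.
exists D, y'; split=> [//|i|x Zx]; first by case: (hy' i).
case: (y0 (exist _ x Zx)) => i yi; exists i.
by case: (hy' i) => _ /(_ (exist _ x Zx)) /= <-.
Qed.

Lemma dimle_union (Z1 Z2 : X -> Prop) m K1 K2 :
  @dimle L (sub_space Z1) m K1 -> @dimle L (sub_space Z2) m K2 ->
  @dimle L (sub_space (fun x => Z1 x \/ Z2 x)) m (K1 + K2).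
Proof.
move=> [e1 h1] [e2 h2]; pose W := sub_space (fun x => Z1 x \/ Z2 x).
pose e (t : 'I_K1 + 'I_K2) (w : W) := match t with
  | inl j => if boolp.pselect (Z1 (sval w)) is left z then e1 j (exist _ _ z) else 0
  | inr j => if boolp.pselect (Z1 (sval w)) is left z then 0 else
     if boolp.pselect (Z2 (sval w)) is left z then e2 j (exist _ _ z) else 0 end.
have -> : (K1 + K2 = #|{: 'I_K1 + 'I_K2}|)%N by rewrite card_sum !card_ord.
apply: (@dimleI L W m {: 'I_K1 + 'I_K2} e) => f [p fp ep].
case: (h1 (fun w => ev (crd w) p)) => [|c1 hc1]; first by exists p.
case: (h2 (fun w => ev (crd w) p)) => [|c2 hc2]; first by exists p.
exists (fun t => match t with inl j => c1 j | inr j => c2 j end) => w.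
rewrite big_sumType /= ep; case: (boolp.pselect (Z1 (sval w))) => [z|nz].
  rewrite [X in _ = _ + X]big1 ?addr0; last by move=> i _; rewrite mulr0.
  exact: (hc1 (exist _ _ z)).
rewrite [X in _ = X + _]big1 ?add0r; last by move=> i _; rewrite mulr0.
case: (boolp.pselect (Z2 (sval w))) => [z|nz2]; first exact: (hc2 (exist _ _ z)).
by case: w {ep} nz nz2 => x /= [].
Qed.

Lemma zclosed_union (Z1 Z2 : X -> Prop) : zclosed anyL Z1 -> zclosed anyL Z2 ->
  zclosed anyL (fun x => Z1 x \/ Z2 x).
Proof.
move=> /zclosedP [E1 [h1 e1]] /zclosedP [E2 [h2 e2]]; apply/zclosedP.
exists (fun h => exists f g, [/\ E1 f, E2 g & h = fun x => f x * g x]); split.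
  move=> h [f [g [/h1 [d hf] /h2 [d' hg] ->]]]; exists (d + d')%N; exact: (hfunM anyL_scalars).
move=> x; split=> [h f [a [b [Ea Eb ->]]]|h].
  by case: h => [/e1 h|/e2 h]; [rewrite (h _ Ea) mul0r|rewrite (h _ Eb) mulr0].
apply: boolp.contrapT => n; apply: n.
case: (boolp.pselect (Z1 x)) => [|n1]; [by left|right].
apply/e2 => g Eg; apply: boolp.contrapT => gx; apply: n1; apply/e1 => f Ef.
have /eqP := h _ (ex_intro _ f (ex_intro _ g (And3 Ef Eg erefl))).
by rewrite mulf_eq0 => /orP[/eqP //|/eqP].
Qed.

Lemma zclosed_inter (I : Type) (P : I -> Prop) (Z : I -> X -> Prop) :
  (forall i, P i -> zclosed anyL (Z i)) -> zclosed anyL (fun x => forall i, P i -> Z i x).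
Proof.
move=> cZ; apply/zclosedP.
exists (fun f => (exists d, hfun anyL d f) /\ exists i, P i /\ forall x, Z i x -> f x = 0); split; first by move=> f [].
move=> x; split=> [h f [_ [i [Pi]]]|h i Pi]; first by apply; apply: h.
have /zclosedP [E [hE eE]] := cZ i Pi.
apply/eE => f Ef; apply: h; split; first exact: hE.
by exists i; split=> // y /eE; apply.
Qed.

(** On the union the spaces of forms grow at most like the sum of the two growths, which is too slow
    for [growth_lower]. *)
Lemma cut_union Z1 Z2 s : zclosed anyL Z1 -> zclosed anyL Z2 -> cut_on Z1 s -> cut_on Z2 s ->
  cut_on (fun x => Z1 x \/ Z2 x) s.
Proof.
move=> cZ1 cZ2 h1 h2; apply: boolp.contrapT => nW.
case: s => [|s] in h1 h2 nW.
  apply: nW; case: h1 => D [y [D0 hy y0]]; exists D, y; split=> // x.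
  case: h2 => ? [z [_ _ z0]]; by move=> [/y0|/z0] [[]].
have nW' : ~ cut_by (sub_space (fun x => Z1 x \/ Z2 x)) s.+1 by move/cut_onP.
have [C1 g1] := growth_upper (sub_projective pX cZ1) (proj1 (cut_onP _ _) h1).
have [C2 g2] := growth_upper (sub_projective pX cZ2) (proj1 (cut_onP _ _) h2).
have [s' [D [les D0 g]]] := growth_lower (sub_projective pX (zclosed_union cZ1 cZ2)) nW'.
(* With this [E] the degree of the independent monomials is less than E (k + 1), and with this [k]
   the power (k+1)^(s+1) exceeds (C1 + C2) (E (k+1))^s. *)
pose E := (D * s').+1; pose k := ((C1 + C2) * E ^ s)%N.
have [f hf ind] := g k.
case: (g1 (D * (k * s'))%N) => K1 d1 l1; case: (g2 (D * (k * s'))%N) => K2 d2 l2.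
have := indep_le (dimle_union d1 d2) hf ind.
rewrite card_ffun !card_ord => le.
have : (k.+1 ^ s.+1 <= (C1 + C2) * (E * k.+1) ^ s)%N.
  apply: leq_trans (leq_trans (leq_pexp2l _ les) le) _ => //.
  apply: leq_trans (leq_add l1 l2) _; rewrite -mulnDl leq_mul2l; apply/orP; right.
  case: (s) => // s0; rewrite leq_exp2r // /E; nia.
rewrite expnMn mulnA -/k expnS leq_mul2r.
by rewrite expn_eq0 /= ltnn.
Qed.

Lemma cut_hyperplane (Z : X -> Prop) s D (y : X -> L) : (0 < D)%N -> hfun anyL D y ->
  cut_on (fun x => Z x /\ y x = 0) s -> cut_on Z s.+1.
Proof.
move=> D0 hy [D' [z [D'0 hz z0]]].
exists (D' * D)%N, (fun i x => if unlift ord0 i is Some j then z j x ^+ D else y x ^+ D').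
split=> [|i|x Zx]; first by rewrite muln_gt0 D'0.
  case: (unliftP ord0 i) => [j|] _; first exact: (hfunX anyL_scalars).
  by rewrite mulnC; apply: (hfunX anyL_scalars).
have [yx|yx] := eqVneq (y x) 0; last by exists ord0; rewrite unlift_none expf_neq0.
case: (z0 x) => // j zj; exists (lift ord0 j); by rewrite liftK expf_neq0.
Qed.

Lemma zclosed_zero d (y : X -> L) : hfun anyL d y -> zclosed anyL (fun x => y x = 0).
Proof.
move=> hy; apply/zclosedP; exists (fun f => f = y); split=> [f ->|x]; first by exists d.
by split=> [h f ->|]; [|apply].
Qed.

(** A compactness argument: the forms [y] and the equations of the members have no common zero, so a
    power of each coordinate vanishes on the zeros of [y] in some member. The smallest of these
    finitely many members works. *)
Lemma cut_chain (F : (X -> Prop) -> Prop) s : (exists Z, F Z) ->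
  (forall Z, F Z -> zclosed anyL Z) ->
  (forall Z Z', F Z -> F Z' -> (forall x, Z x -> Z' x) \/ (forall x, Z' x -> Z x)) ->
  cut_on (fun x => forall Z, F Z -> Z x) s -> exists2 Z, F Z & cut_on Z s.
Proof.
move=> [Z0 FZ0] cF tot [D [y [D0 hy y0]]].
pose J d (f : X -> L) := hfun anyL d f /\ exists2 Z, F Z & forall x, Z x -> (forall i, y i x = 0) -> f x = 0.
case: (@proj_null L X pX J) => [d|d f g|d e a f ha|d f []//|x|m0 h].
- by split; [exact: hfun0|exists Z0].
- move=> [hf [Z1 F1 z1]] [hg [Z2 F2 z2]]; split; first exact: hfunD.
  by case: (tot _ _ F1 F2) => sub; [exists Z1|exists Z2] => // x zx yx;
    rewrite ?z1 ?z2 ?addr0 //; apply: sub.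
- move=> [hf [Z1 F1 z1]]; split; first exact: hfunM.
  by exists Z1 => // x zx yx; rewrite z1 ?mulr0.
- case: (boolp.pselect (forall Z, F Z -> Z x)) => [/y0 [i yi]|/boolp.existsNP [Z /boolp.not_implyP [FZ nZ]]].
    by exists D, (y i); split=> //; split=> //; exists Z0.
  have /zclosedP [E [hE eE]] := cF _ FZ.
  have [f Ef fx] : exists2 f, E f & f x != 0.
    apply: boolp.contrapT => n; apply: nZ; apply/eE => f Ef; apply/eqP/negPn/negP => fx.
    by apply: n; exists f.
  case: (hE f Ef) => d hd; exists d, f; split=> //; split=> //; exists Z => // z Zz _.
  exact: (proj1 (eE z) Zz).
have hc i : J m0 (fun x => crd x 0 i ^+ m0).
  by apply: h => //; have := hfunX anyL_scalars m0 (hfun_crd anyL_scalars (X := X) i); rewrite mul1n.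
have [Z FZ ZE] : exists2 Z, F Z & forall i : 'I_(amb X), forall x, Z x -> (forall i, y i x = 0) -> crd x 0 i = 0.
  suff : forall r : seq 'I_(amb X), exists2 Z, F Z & forall i, i \in r -> forall x, Z x -> (forall i, y i x = 0) -> crd x 0 i = 0.
    by case/(_ (enum 'I_(amb X))) => Z FZ hZ; exists Z => // i; apply: hZ; rewrite mem_enum.
  elim=> [|i r [Z1 F1 z1]]; first by exists Z0.
  case: (hc i) => _ [Z2 F2 z2].
  have z2' x : Z2 x -> (forall i, y i x = 0) -> crd x 0 i = 0.
    by move=> zx yx; have /eqP := z2 x zx yx; rewrite expf_eq0 => /andP[_ /eqP].
  by case: (tot _ _ F1 F2) => sub; [exists Z1|exists Z2] => // j; rewrite inE => /orP[/eqP ->|jr] x zx;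
    [apply: z2'; rewrite ?sub|apply: z1| apply: z2'|apply: z1; rewrite ?sub] => //; apply: sub.
exists Z => //; exists D, y; split=> // x Zx; apply: boolp.contrapT => n.
case: (crd_neq0 (proj1 pX) x) => i /eqP; apply; apply: ZE Zx _ => j.
by apply/eqP/negPn/negP => yj; apply: n; exists j.
Qed.

(** A hyperplane section of [Z] is not cut by [s] forms. A closed subset of it minimal with this
    property is irreducible, because by [cut_union] it is not covered by two closed sets whose
    traces on it are smaller. Zorn's lemma is applied to complements. *)
Lemma hyperplane_component (Z : X -> Prop) s : zclosed anyL Z -> @irreducible L X Z -> ~ cut_on Z s.+1 ->
  exists Z', [/\ zclosed anyL Z', @irreducible L X Z', ~ cut_on Z' s, forall x, Z' x -> Z x & exists2 x, Z x & ~ Z' x].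
Proof.
move=> cZ [[x0 Zx0] _] nZ; case: (crd_neq0 (proj1 pX) x0) => i0 hx0.
have hi := hfun_crd anyL_scalars (X := X) i0.
pose H x := Z x /\ crd x 0 i0 = 0.
have cH : zclosed anyL H.
  have -> : H = fun x => forall b : bool, True -> if b then Z x else crd x 0 i0 = 0.
    apply: boolp.funext => x; apply: boolp.propext; split; first by move=> [? ?] [].
    by move=> h; split; [exact: (h true)|exact: (h false)].
  by apply: zclosed_inter => -[] _; [|exact: (zclosed_zero hi)].
have nH : ~ cut_on H s by move=> cH'; apply: nZ; apply: cut_hyperplane hi cH'.
pose P (U : X -> Prop) := [/\ zclosed anyL (fun x => ~ U x), ~ cut_on (fun x => ~ U x) s & forall x, ~ H x -> U x].
have nnE (W : X -> Prop) : (fun x => ~ ~ W x) = W.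
  by apply: boolp.funext => x; apply: boolp.propext; split=> [/boolp.contrapT//|w n]; apply: n.
case: (@zorn_subset X P (fun x => ~ H x)) => [|F [U0 FU0] FP tot|U [PU _ maxU]].
- by rewrite /P nnE.
- have E : (fun x => ~ (exists2 U, F U & U x)) = fun x => forall W, F (fun x => ~ W x) -> W x.
    apply: boolp.funext => x; apply: boolp.propext; split=> [n W FW|h [U FU Ux]].
      by apply: boolp.contrapT => nW; apply: n; exists (fun x => ~ W x).
    by have := h (fun x => ~ U x); rewrite nnE => /(_ FU); apply.
  split.
  + rewrite E; apply: (@zclosed_inter (X -> Prop) (fun W => F (fun x => ~ W x)) id) => W /FP [].
    by rewrite nnE.
  + rewrite E => ct.
    case: (@cut_chain (fun W => F (fun x => ~ W x)) s _ _ _ ct) => [|W /FP []|W W' FW FW'|W /FP []].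
    * by exists (fun x => ~ U0 x); rewrite nnE.
    * by rewrite nnE.
    * by case: (tot _ _ FW FW') => h; [right|left] => x w; apply: boolp.contrapT => n; case: (h _ n).
    * by rewrite nnE.
  + by move=> x nHx; case: (FP _ FU0) => _ _ /(_ x nHx) Ux; exists U0.
case: PU => cU nU HU; exists (fun x => ~ U x); split=> //.
- split.
    apply: boolp.contrapT => n; apply: nU; exists 1%N, (fun _ _ => 0); split=> //.
      by move=> i; apply: (hfun0 X anyL_scalars).
    by move=> x Ux; case: n; exists x.
  move=> Z1 Z2 c1 c2 sub.
  have step W : zclosed anyL W -> ~ cut_on (fun x => ~ U x /\ W x) s -> forall x, ~ U x -> W x.
    move=> cW nW x Ux; apply: boolp.contrapT => nWx.
    case: (Ux); apply: (maxU (fun x => ~ (~ U x /\ W x))); last by case.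
    - split; rewrite ?nnE //.
        have -> : (fun x => ~ U x /\ W x) = fun x => forall b : bool, True -> if b then ~ U x else W x.
          apply: boolp.funext => z; apply: boolp.propext; split; first by move=> [? ?] [].
          by move=> h; split; [exact: (h true)|exact: (h false)].
        by apply: zclosed_inter => -[].
      by move=> z /HU Uz [].
    - by move=> z Uz [].
  case: (boolp.pselect (cut_on (fun x => ~ U x /\ Z1 x) s)) => [ct1|]; last by left; apply: step.
  case: (boolp.pselect (cut_on (fun x => ~ U x /\ Z2 x) s)) => [ct2|]; last by right; apply: step.
  have cI W : zclosed anyL W -> zclosed anyL (fun x => ~ U x /\ W x).
    move=> cW; have -> : (fun x => ~ U x /\ W x) = fun x => forall b : bool, True -> if b then ~ U x else W x.
      apply: boolp.funext => z; apply: boolp.propext; split; first by move=> [? ?] [].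
      by move=> h; split; [exact: (h true)|exact: (h false)].
    by apply: zclosed_inter => -[].
  case: nU; case: (cut_union (cI _ c1) (cI _ c2) ct1 ct2) => D [y [D0 hy y0]].
  by exists D, y; split=> // x Ux; apply: y0; case: (sub x Ux); [left|right].
- by move=> x Ux; apply: boolp.contrapT => n; apply: Ux; apply: HU => -[].
- by exists x0 => // Ux; apply: Ux; apply: HU => -[_ /eqP]; rewrite (negPf hx0).
Qed.

(** Repeated hyperplane components give a strictly decreasing chain of irreducible closed sets of
    length [s]. *)
Lemma cut_dim s : @irreducible L X (fun=> True) -> ~ dim_ge X s -> cut_by X s.
Proof.
move=> irr nd; apply: boolp.contrapT => nc; apply: nd.
have nc' : ~ cut_on (fun=> True) s.
  by move=> [D [y [D0 hy y0]]]; apply: nc; exists D, y; split=> // x; apply: y0.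
have cT : zclosed anyL (fun _ : X => True).
  by apply/zclosedP; exists (fun=> False); split=> // x; split.
move: (fun _ : X => True) cT irr nc' => Z cZ iZ nZ {nc}.
suff : exists W : nat -> X -> Prop, (forall i, (i <= s)%N -> zclosed anyL (W i) /\ irreducible (W i)) /\
    (W s = Z /\ forall i, (i < s)%N -> (forall x, W i x -> W i.+1 x) /\ exists2 x, W i.+1 x & ~ W i x).
  by case=> W [h [_ h']]; exists W.
elim: s Z cZ iZ nZ => [|s IH] Z cZ iZ nZ.
  by exists (fun=> Z).
case: (hyperplane_component cZ iZ nZ) => Z' [cZ' iZ' nZ' sub strict].
case: (IH Z' cZ' iZ' nZ') => W [h [eW h']].
exists (fun i => if i == s.+1 then Z else W i); split; last split.
- by move=> i; rewrite leq_eqVlt; case: eqP => [//|_] /=; apply: h.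
- by rewrite eqxx.
- move=> i; rewrite ltnS eqSS leq_eqVlt => /orP[/eqP ->|lt].
    by rewrite eqxx (ltn_eqF (ltnSn s)) eW.
  by rewrite (ltn_eqF lt) (ltn_eqF (ltnW (_ : i.+1 < s.+1)%N)) //; apply: h'.
Qed.
End Dimension.

(** * Images, preimages and finite coverings of closed sets *)

Section Transfer.
Variables (L : closedFieldType).

Lemma zclosed_preimage (X Y : pspace L) (f : X -> Y) (Z : Y -> Prop) : embedded Y ->
  morph anyL f -> zclosed anyL Z -> zclosed anyL (fun x => Z (f x)).
Proof.
move=> eY mf cZ.
have op : zopen anyL (fun y => ~ Z y).
  rewrite /zopen; have -> // : (fun y => ~ ~ Z y) = Z.
  by apply: boolp.funext => y; apply: boolp.propext; split=> [/boolp.contrapT//|w n]; apply: n.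
have : zopen anyL (fun x => ~ Z (f x)).
  by apply: near_zopen => x nZ; apply: (@near_pull _ _ _ f x (fun y => ~ Z y) eY mf); apply: zopen_near op nZ.
rewrite /zopen; congr zclosed; apply: boolp.funext => x; apply: boolp.propext.
by split=> [/boolp.contrapT//|w n]; apply: n.
Qed.

Lemma irreducible_image (X Y : pspace L) (f : X -> Y) (Z : X -> Prop) : embedded Y ->
  morph anyL f -> irreducible Z -> irreducible (fun y => exists2 x, Z x & f x = y).
Proof.
move=> eY mf [[x Zx] irr]; split; first by exists (f x), x.
move=> Z1 Z2 c1 c2 sub.
case: (irr _ _ (zclosed_preimage eY mf c1) (zclosed_preimage eY mf c2)) => [z Zz|h|h].
- by apply: sub; exists z.
- by left=> y [z /h Zz <-].
- by right=> y [z /h Zz <-].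
Qed.

(** Quasi-compactness: the forms that are nonzero at only finitely many points of [Z] are a graded
    ideal, and isolation of points says that it has no common zero. *)
Lemma isolated_finite (X : pspace L) (Z : X -> Prop) : projective anyL X ->
  (forall x : X, near x (fun y => Z y -> y = x)) -> exists n (s : 'I_n -> X), forall x, Z x -> exists i, x = s i.
Proof.
move=> pX iso.
pose fin (P : X -> Prop) := exists n (s : 'I_n -> X), forall x, P x -> exists i, x = s i.
have finU P Q : fin P -> fin Q -> fin (fun x => P x \/ Q x).
  move=> [n [s hs]] [m [t ht]]; exists (n + m)%N, (fun i => match split i with inl a => s a | inr b => t b end).
  move=> x [/hs [i ->]|/ht [i ->]].
    by exists (lshift m i); rewrite (unsplitK (inl i)).
  by exists (rshift n i); rewrite (unsplitK (inr i)).
have finS (P Q : X -> Prop) : (forall x, P x -> Q x) -> fin Q -> fin P.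
  by move=> sub [n [s hs]]; exists n, s => x /sub/hs.
have fin0 : fin (fun=> False) by exists 0%N, (fun i : 'I_0 => False_rect X (notF (ltn_ord i))) => x [].
pose J d (f : X -> L) := hfun anyL d f /\ fin (fun x => Z x /\ f x != 0).
case: (@proj_null L X pX J) => [d|d f g|d e a f ha|d f []//|x|m0 h].
- split; first exact: (hfun0 X anyL_scalars).
  by apply: finS fin0 => x []; rewrite eqxx.
- move=> [hf ff] [hg fg]; split; first exact: (hfunD anyL_scalars).
  apply: finS (finU _ _ ff fg) => x [Zx]; have [->|fx] := eqVneq (f x) 0; last by left.
  by rewrite add0r; right.
- move=> [hf ff]; split; first exact: (hfunM anyL_scalars).
  by apply: finS ff => x [Zx]; rewrite mulf_eq0 negb_or => /andP[].
- case: (iso x) => d [u [hu ux hux]]; exists d, u; split=> //; split=> //.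
  exists 1%N, (fun=> x) => y [Zy uy]; exists ord0; exact: hux.
have hc i : fin (fun x => Z x /\ crd x 0 i != 0).
  have [] := h m0 (fun x => crd x 0 i ^+ m0) (leqnn _).
    by have := hfunX anyL_scalars m0 (hfun_crd anyL_scalars (X := X) i); rewrite mul1n.
  by move=> _; apply: finS => x [Zx xi]; rewrite expf_neq0.
suff : forall r : seq 'I_(amb X), fin (fun x => Z x /\ exists2 i, i \in r & crd x 0 i != 0).
  move/(_ (enum 'I_(amb X))); apply: finS => x Zx; split=> //.
  by case: (crd_neq0 (proj1 pX) x) => i hi; exists i; rewrite ?mem_enum.
elim=> [|i r IH]; first by apply: finS fin0 => x [_ []].
apply: finS (finU _ _ (hc i) IH) => x [Zx [j]].
rewrite inE => /orP[/eqP -> hj|jr hj]; [by left|by right; split=> //; exists j].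
Qed.

Lemma irreducible_cover (X : pspace L) (Z : X -> Prop) (I : eqType) (s : seq I) (W : I -> X -> Prop) :
  irreducible Z -> (forall i, zclosed anyL (W i)) ->
  (forall x, Z x -> exists2 i, i \in s & W i x) -> exists i, forall x, Z x -> W i x.
Proof.
move=> irr cW; elim: s => [|i s IH] h.
  by case: irr => -[x Zx] _; case: (h x Zx).
pose U x := exists2 i, i \in s & W i x.
have cU : zclosed anyL U.
  rewrite /U; elim: s {IH h U} => [|j s IH].
    apply/zclosedP; exists (fun f => f = fun=> 1); split.
      by move=> f ->; exists 0%N; apply: (hfun1 X anyL_scalars).
    move=> x; split=> [[]//|/(_ _ erefl)/eqP]; by rewrite oner_eq0.
  have := zclosed_union (cW j) IH; congr zclosed; apply: boolp.funext => x; apply: boolp.propext.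
  split=> [[wj|[i' hi w]]|[i']].
  - by exists j; rewrite ?mem_head.
  - by exists i'; rewrite // inE hi orbT.
  - by rewrite inE => /orP[/eqP -> w|hi w]; [left|right; exists i'].
case: (proj2 irr _ _ (cW i) cU) => [x Zx|h1|h2]; [|by exists i|exact: IH].
by case: (h x Zx) => j; rewrite inE => /orP[/eqP -> w|hj w]; [left|right; exists j].
Qed.

End Transfer.

(** * Multiplication by n *)

Section Multiplication.
Variables (L : closedFieldType) (A : avar L).
Hypothesis pA : projective anyL (asp A).
Hypothesis irrA : @irreducible L (asp A) (fun=> True).
Hypothesis mA : @morph L anyL (pprod (asp A) (asp A)) (asp A) (fun u => u.1 + u.2 : A).
Let eA : embedded (asp A). Proof. by case: pA. Qed.

(** By [unramified] the affine coordinates at [x] are combinations of functions that vanish on the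
    fibre of [pi], so a nearby point of the fibre has the coordinates of [x]. *)
Lemma fibre_isolated (Y : avar L) (pi : A -> Y) (g : Y -> A) n (x : A) : embedded (asp Y) ->
  @morph L anyL (asp A) (asp Y) pi -> @morph L anyL (asp Y) (asp A) g ->
  (forall x, g (pi x) = x *+ n) -> n%:R != 0 :> L ->
  @near L (asp A) x (fun z => pi z = pi x -> z = x).
Proof.
move=> eY mpi mg gpi n0.
case: (crd_neq0 eY (pi x : asp Y)) => i0 hi0; case: (crd_neq0 eA (x : asp A)) => j0 hj0.
have hr j : @near L (asp A) x (fun z => pi z = pi x -> @affine_coord L (asp A) x j0 j z = 0).
  have := @unramified L A Y pi g n pA mA eY mpi mg gpi n0 x i0 _ hi0 (rg_affine j hj0).
  have -> : @affine_coord L (asp A) x j0 j x = 0 by rewrite /affine_coord subrr.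
  case=> // u ru; apply: near_impl => z -> pz; rewrite big1 // => i _.
  by rewrite /affine_coord pz subrr mul0r.
have n1 : @near L (asp A) x (fun z => av_crd z 0 j0 != 0).
  exists 1%N, (fun z : asp A => crd z 0 j0); split=> //; exact: (hfun_crd anyL_scalars).
have n2 := @near_finite L (asp A) x _ _ hr.
apply: near_impl (near_and n1 n2) => z [zj hz] pz; apply: (proj2 eA).
exists (av_crd z 0 j0 / av_crd x 0 j0); first by rewrite mulf_neq0 ?invr_eq0.
apply/rowP => j; rewrite mxE; have /eqP := hz j pz; rewrite subr_eq0 /= => /eqP e.
by apply: (mulfI (_ : (av_crd z 0 j0)^-1 != 0)); rewrite ?invr_eq0 // mulrC e; field; apply/andP.
Qed.

Lemma kernel_finite (Y : avar L) (pi : A -> Y) (g : Y -> A) n : embedded (asp Y) ->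
  @morph L anyL (asp A) (asp Y) pi -> @morph L anyL (asp Y) (asp A) g ->
  (forall x, g (pi x) = x *+ n) -> n%:R != 0 :> L -> {morph pi : x y / x + y} ->
  exists s : seq A, forall x, pi x = 0 -> x \in s.
Proof.
move=> eY mpi mg gpi n0 addpi.
case: (@isolated_finite L (asp A) (fun x => pi x = 0) pA) => [x|m [s hs]].
  case: (boolp.pselect (pi x = 0)) => px.
    by have := fibre_isolated x eY mpi mg gpi n0; apply: near_impl => z h pz; apply: h; rewrite px.
  have cl : zclosed anyL (fun y : asp Y => y = (0 : Y)).
    have := closed_image_of pA eY (@morph_const_any L (asp A) (asp Y) (0 : Y) eY)
      (_ : zclosed anyL (fun _ : asp A => True)).
    have -> : (fun y : asp Y => exists2 x : asp A, True & (0 : Y) = y) = (fun y => y = 0).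
      by apply: boolp.funext => y; apply: boolp.propext; split=> [[_ _ ->]//|->]; exists (0 : A).
    by apply; apply/zclosedP; exists (fun=> False).
  have : zopen anyL (fun z : asp A => pi z <> 0).
    rewrite /zopen; have := zclosed_preimage eY mpi cl; congr zclosed.
    by apply: boolp.funext => z; apply: boolp.propext; split=> [w|/boolp.contrapT //]; apply.
  by move/zopen_near => /(_ x px); apply: near_impl => z.
exists [seq s i | i : 'I_m] => x /hs [i ->].
by apply/mapP; exists i; rewrite ?mem_enum.
Qed.

Lemma torsion_finite n : n%:R != 0 :> L -> exists s : seq A, forall x, x *+ n = 0 -> x \in s.
Proof.
move=> n0; apply: (@kernel_finite A (fun x => x *+ n) id n) => //; try exact: morph_id.
- by apply: morph_muln => //; apply: morph_id.
- by move=> x y; rewrite mulrnDl.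
Qed.

Lemma torsion_finite_exp n k : (exists s : seq A, forall x, x *+ n = 0 -> x \in s) ->
  exists s : seq A, forall x, x *+ n ^ k = 0 -> x \in s.
Proof.
move=> [s hs]; elim: k => [|k [t ht]].
  by exists [:: 0] => x; rewrite expn0 mulr1n => ->; rewrite mem_head.
have /boolp.choice [r hr] (y : A) : exists x, (exists x', x' *+ n = y) -> x *+ n = y.
  case: (boolp.pselect (exists x', x' *+ n = y)) => [[x xy]|ne]; first by exists x.
  by exists 0 => /ne.
exists [seq r y + u | y <- t, u <- s] => x; rewrite expnS mulrnA => /ht xt.
apply/allpairsP; exists (x *+ n, x - r (x *+ n)); split=> //=; last by rewrite addrC subrK.
by apply: hs; rewrite mulrnBl hr ?subrr //; exists x.
Qed.

(** The images of the powers of n are irreducible and closed, so the decreasing chain stabilizes by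
    dimension. Then [A] is a finite union of translates of the stable image by torsion points, hence
    equal to one of them. Only finiteness of the torsion enters, so that a power of the
    characteristic is allowed for n. *)
Lemma muln_surjective_finite d n : ~ dim_ge (asp A) d -> (exists s : seq A, forall x, x *+ n = 0 -> x \in s) ->
  forall y : A, exists x, x *+ n = y.
Proof.
move=> nd n0.
have mn k : @morph L anyL (asp A) (asp A) (fun x => x *+ k).
  by apply: morph_muln => //; apply: morph_id.
pose W k (y : A) := exists x : A, x *+ (n ^ k) = y.
have cW k : @zclosed L anyL (asp A) (W k) by apply: (@closed_image L (asp A) (asp A)).
have iW k : @irreducible L (asp A) (W k).
  have := irreducible_image eA (mn (n ^ k)%N) irrA; congr irreducible.
  by apply: boolp.funext => y; apply: boolp.propext; split=> [[x _ e]|[x e]]; exists x.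
have Wsub k y : W k.+1 y -> W k y.
  by case=> x <-; exists (x *+ n); rewrite -mulrnA -expnS.
have [k hk] : exists k, forall y, W k y -> W k.+1 y.
  apply: boolp.contrapT => h; apply: nd; exists (fun i => W (d - i)%N); split; first by move=> i _.
  move=> i lt; have -> : (d - i = (d - i.+1).+1)%N by rewrite subnSK.
  split; first exact: Wsub.
  apply: boolp.contrapT => n'; apply: h; exists (d - i.+1)%N => y Wy.
  by apply: boolp.contrapT => nW; apply: n'; exists y.
have hkj j y : W k y -> W (k + j)%N y.
  elim: j => [|j IH] Wy; first by rewrite addn0.
  case: (IH Wy) => x xy.
  case: (hk (x *+ n ^ k)) => [|z zx]; first by exists x.
  exists z; have -> : (n ^ (k + j.+1) = n ^ k.+1 * n ^ j)%N by rewrite -expnD addSn addnS.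
  by rewrite mulrnA zx -xy expnD mulrnA.
case: (torsion_finite_exp k n0) => s hs.
case: (@irreducible_cover L (asp A) (fun=> True) A s (fun t x => W k (x - t : A)) irrA) => [t|x _|t ht y].
- apply: (@zclosed_preimage L (asp A) (asp A) (fun x => x - t : A) (W k)) => //.
  exact: morph_translate.
- case: (hkj k (x *+ n ^ k)) => [|b]; first by exists x.
  rewrite expnD => hb; exists (x - b *+ n ^ k).
    by apply: hs; rewrite mulrnBl -mulrnA hb subrr.
  by exists b; rewrite opprB addrC subrK.
have Wk z : W k z by have := ht (z + t) I; rewrite addrK.
by case: (hk y (Wk y)) => z <-; exists (z *+ n ^ k); rewrite -mulrnA -expnSr.
Qed.

Lemma muln_surjective d n : ~ dim_ge (asp A) d -> n%:R != 0 :> L -> forall y : A, exists x, x *+ n = y.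
Proof. by move=> nd /torsion_finite; apply: muln_surjective_finite nd. Qed.

End Multiplication.

(** * Line bundles as cocycles on points *)

Section Cocycles.
Variables (L : closedFieldType).
Implicit Types X Y : pspace L.

Definition unitat X (x : X) (u : X -> L) := rg x u /\ u x != 0.

Lemma unitatM X (x : X) u v : unitat x u -> unitat x v -> unitat x (fun y => u y * v y).
Proof. by move=> [ru u0] [rv v0]; split; [apply: (rgdM ru rv)|rewrite mulf_neq0]. Qed.

Lemma unitatV X (x : X) u : unitat x u -> unitat x (fun y => (u y)^-1).
Proof. by move=> [ru u0]; split; [apply: rgV|rewrite invr_eq0]. Qed.

Lemma unitat_near X (x : X) u v : near x (fun y => u y = v y) -> unitat x u -> unitat x v.
Proof. by move=> n [ru u0]; split; [apply: rgd_near n ru|rewrite -(near_self n)]. Qed.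

Lemma unitat_const X (x : X) c : c != 0 -> unitat x (fun=> c).
Proof. by split=> //; apply: rgC. Qed.

Lemma unitat_pull X Y (f : X -> Y) x u : embedded Y -> morph anyL f ->
  unitat (f x) u -> unitat x (fun z => u (f z)).
Proof. by move=> eY mf [ru u0]; split=> //; apply: rg_pull. Qed.

Lemma unitat_neq0 X (x : X) u : unitat x u -> near x (fun y => u y != 0).
Proof. by case=> ru u0; apply: rg_near_neq0 ru u0. Qed.

(* [t x] is the transition function from a set-theoretic trivialization to a  *)
(* local frame at [x]; [trivial_cocycle] says that the line bundle is trivial. *)
Definition trivial_cocycle X (t : X -> X -> L) :=
  exists ka : X -> L, forall x, unitat x (fun y => t x y * ka y).
Notation Tr := trivial_cocycle.

Lemma TrM X (t s : X -> X -> L) : Tr t -> Tr s -> Tr (fun x y => t x y * s x y).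
Proof.
move=> [a ha] [b hb]; exists (fun y => a y * b y) => x.
by apply: unitat_near (unitatM (ha x) (hb x)); apply: near_all => y; rewrite mulrACA.
Qed.

Lemma TrV X (t : X -> X -> L) : Tr t -> Tr (fun x y => (t x y)^-1).
Proof.
move=> [a ha]; exists (fun y => (a y)^-1) => x.
by apply: unitat_near (unitatV (ha x)); apply: near_all => y; rewrite invfM.
Qed.

Lemma Tr_near X (t s : X -> X -> L) : (forall x, near x (fun y => t x y = s x y)) -> Tr t -> Tr s.
Proof.
move=> n [a ha]; exists a => x; apply: unitat_near (ha x).
by apply: near_impl (n x) => y ->.
Qed.

Lemma Tr_unit X (t : X -> X -> L) : (forall x, unitat x (t x)) -> Tr t.
Proof.
move=> h; exists (fun=> 1) => x; apply: unitat_near (h x).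
by apply: near_all => y; rewrite mulr1.
Qed.

Lemma Tr_pull X Y (f : X -> Y) t : embedded Y -> morph anyL f -> Tr t ->
  Tr (fun x y => t (f x) (f y)).
Proof.
move=> eY mf [a ha]; exists (fun y => a (f y)) => x.
exact: (unitat_pull (u := fun z => t (f x) z * a z) eY mf (ha (f x))).
Qed.

Lemma TrX X (t : X -> X -> L) n : Tr t -> Tr (fun x y => t x y ^+ n).
Proof.
move=> ht; elim: n => [|n IH].
  by apply: Tr_unit => x; apply: unitat_near (unitat_const x (oner_neq0 _)); apply: near_all.
by apply: Tr_near (TrM ht IH) => x; apply: near_all => y; rewrite exprS.
Qed.

Definition lb_local X (D : lbdata X) := [/\ forall i x, @lU _ X D i x -> near x (@lU _ X D i),
  forall x, exists i, @lU _ X D i x,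
  forall i j x, @lU _ X D i x -> lU j x -> unitat x (@lg _ X D i j) &
  forall i j l x, @lU _ X D i x -> lU j x -> lU l x -> lg i j x * lg j l x = lg i l x].

Lemma line_bundleP S X (D : lbdata X) : line_bundle S D -> lb_local D.
Proof.
case=> [op cov ru coc]; split=> // [i x|i j x ix jx]; first exact: zopen_near.
case: (ru i j) => rij nz; split; last exact: nz.
apply: (regular_rg _ rij (conj ix jx)) => _.
by apply: near_and; [apply: zopen_near (op i) _|apply: zopen_near (op j) _].
Qed.

Lemma regular_unitP X (U : X -> Prop) f : (forall x, U x -> unitat x f) -> regular_unit anyL U f.
Proof.
move=> h; split; first by apply: rg_regular => x /h [].
by move=> x /h [].
Qed.

Lemma lb_local_line_bundle X (D : lbdata X) : lb_local D -> line_bundle anyL D.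
Proof.
case=> [op cov ru coc]; split=> // [i|i j]; first by apply: near_zopen; apply: op.
by apply: regular_unitP => x [ix jx]; apply: ru.
Qed.

(** Each point is given the trivialization of the first chart containing it; [frame D x y] passes at
    y from that of y to that of x. The deterministic choice makes pull-backs hold by computation and
    commutes with Frobenius. The value 1 is a default for points in no chart. *)
Definition frame X (D : lbdata X) (x y : X) : L :=
  match [pick i | boolp.asbool (@lU _ X D i x)], [pick i | boolp.asbool (@lU _ X D i y)] with
  | Some i, Some j => lg i j y | _, _ => 1 end.
Notation fr := frame.

Lemma frame_index X (D : lbdata X) : lb_local D -> exists i : X -> ix D,
  (forall x, lU (i x) x) /\ forall x y, fr D x y = lg (i x) (i y) y.
Proof.
case=> _ cov _ _.
have /boolp.choice [i hi] x : exists i, [pick i | boolp.asbool (@lU _ X D i x)] = Some i /\ lU i x.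
  case: pickP => [i /boolp.asboolP ix|n]; first by exists i.
  by case: (cov x) => i ix; have := n i; rewrite (introT (boolp.asboolP _) ix).
exists i; split=> [x|x y]; first by case: (hi x).
by rewrite /frame (proj1 (hi x)) (proj1 (hi y)).
Qed.

Lemma frame_near X (D : lbdata X) x : lb_local D -> near x (fun y => fr D x y != 0).
Proof.
move=> hD; case: (frame_index hD) => i [iU di].
case: (hD) => op cov ru coc; apply: near_impl (op _ _ (iU x)) => y xy; rewrite di.
by case: (ru (i x) (i y) y xy (iU y)).
Qed.

Lemma lb_isoP X (D E : lbdata X) : lb_local D -> lb_local E ->
  lb_iso D E <-> Tr (fun x y => fr D x y / fr E x y).
Proof.
move=> hD hE; case: (frame_index hD) => i [iU di]; case: (frame_index hE) => j [jU ej].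
have -> : (fun x y => fr D x y / fr E x y) = fun x y => lg (i x) (i y) y / lg (j x) (j y) y.
  by apply: boolp.funext => x; apply: boolp.funext => y; rewrite di ej.
case: (hD) => opD _ ruD cD; case: (hE) => opE _ ruE cE; split.
  (* Evaluating the isomorphism at y in the charts chosen for y gives the trivialization of the
     quotient cocycle. *)
  move=> [h [hh hc]]; exists (fun y => h (i y) (j y) y) => x.
  have nx : near x (fun y => lU (i x) y /\ lU (j x) y).
    by apply: near_and; [apply: opD|apply: opE].
  have : unitat x (h (i x) (j x)).
    case: (hh (i x) (j x)) => rh nz; split; last exact: nz.
    by apply: (regular_rg _ rh).
  apply: unitat_near; apply: near_impl nx => y [xy yy].
  have := hc (i x) (i y) (j x) (j y) y xy (iU y) yy (jU y) => e.
  case: (ruE (j x) (j y) y yy (jU y)) => _ nz; apply: (mulIf nz).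
  by rewrite -e; field.
move=> [ka hk]; exists (fun a b y => lg a (i y) y * ka y / lg b (j y) y); split.
  move=> a b; apply: regular_unitP => x [ax bx].
  have := unitatM (unitatM (ruD a (i x) x ax (iU x)) (hk x)) (unitatV (ruE b (j x) x bx (jU x))).
  have n1 := near_and (near_and (opD _ _ ax) (opE _ _ bx)) (near_and (opD _ _ (iU x)) (opE _ _ (jU x))).
  apply: unitat_near; apply: near_impl n1 => y [[ay by_] [iy jy]].
  rewrite -(cD a (i x) (i y) y) // -(cE b (j x) (j y) y) // invfM; ring.
move=> a a' b b' x ax a'x bx b'x.
rewrite -(cD a a' (i x) x) // -(cE b b' (j x) x) // invfM.
case: (ruE b b' x bx b'x) => _ nz; case: (ruE b' (j x) x b'x (jU x)) => _ nz'.
by field; rewrite nz nz'.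
Qed.

Lemma frame_pull X Y (f : X -> Y) (D : lbdata Y) x y : fr (lb_pull f D) x y = fr D (f x) (f y).
Proof. by []. Qed.

Lemma frame_inv X (D : lbdata X) x y : fr (lb_inv D) x y = (fr D x y)^-1.
Proof. by rewrite /frame /=; case: pickP => [i _|_]; rewrite ?invr1 ?expr1n //; case: pickP => [j _|_]; rewrite ?invr1. Qed.

Lemma frame_exp X (D : lbdata X) n x y : fr (lb_exp D n) x y = fr D x y ^+ n.
Proof. by rewrite /frame /=; case: pickP => [i _|_]; rewrite ?invr1 ?expr1n //; case: pickP => [j _|_]; rewrite ?expr1n. Qed.

Lemma frame_one X (x y : X) : fr (lb_one X) x y = 1.
Proof. by rewrite /frame /=; case: pickP => [i _|_] //; case: pickP => [j _|_]. Qed.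

Lemma lb_pull_local X Y (f : X -> Y) (D : lbdata Y) : embedded Y -> morph anyL f ->
  lb_local D -> lb_local (lb_pull f D).
Proof.
move=> eY mf [op cov ru coc]; split=> /= [i x ix|x|i j x ix jx|i j l x]; last exact: coc.
- exact: (near_pull eY mf (op _ _ ix)).
- exact: cov.
- exact: (unitat_pull eY mf (ru i j _ ix jx)).
Qed.

Lemma lb_mul_local X (D E : lbdata X) : lb_local D -> lb_local E -> lb_local (lb_mul D E).
Proof.
move=> [op cov ru coc] [op' cov' ru' coc']; split=> /=.
- by move=> [i j] x [ix jx]; apply: near_and; [apply: op|apply: op'].
- by move=> x; case: (cov x) => i ix; case: (cov' x) => j jx; exists (i, j).
- by move=> [i j] [i' j'] x [ix jx] [ix' jx']; apply: unitatM; [apply: ru|apply: ru'].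
- move=> [i j] [i' j'] [i2 j2] x [ix jx] [ix' jx'] [? ?] /=.
  by rewrite -(coc i i' i2) // -(coc' j j' j2) // mulrACA.
Qed.

Lemma lb_inv_local X (D : lbdata X) : lb_local D -> lb_local (lb_inv D).
Proof.
move=> [op cov ru coc]; split=> //= [i j x ix jx|i j l x ix jx lx].
- by apply: unitatV; apply: ru.
- by rewrite -(coc i j l) // invfM.
Qed.

Lemma lb_exp_local X (D : lbdata X) n : lb_local D -> lb_local (lb_exp D n).
Proof.
move=> [op cov ru coc]; split=> //= [i j x ix jx|i j l x ix jx lx].
- by case: (ru i j x ix jx) => r nz; split; [apply: rg_exp|rewrite expf_neq0].
- by rewrite -(coc i j l) // exprMn.
Qed.

Lemma lb_one_local X : lb_local (lb_one X).
Proof.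
split=> /=.
- by move=> _ x _; apply: near_all.
- by move=> x; exists tt.
- by move=> _ _ x _ _; apply: unitat_const; apply: oner_neq0.
- by move=> *; rewrite mulr1.
Qed.

Lemma lb_O1_local X : embedded X -> lb_local (lb_O1 X).
Proof.
move=> eX; split=> /= [i x ix|x|i j x ix jx|i j l x ix jx lx].
- by exists 1%N, (fun y => crd y 0 i); split=> //; apply: (hfun_crd anyL_scalars).
- exact: crd_neq0.
- split; last by rewrite mulf_neq0 ?invr_eq0.
  by apply: (@rgd_div _ 1 0) => //; apply: hfun_rgd; apply: (hfun_crd anyL_scalars).
- by field; apply/andP.
Qed.

(** The chart chosen for the product need not be the pair of charts chosen for the factors, so that,
    unlike for inverses and powers, the frames agree only up to a trivial cocycle. *)
Lemma frame_mul X (D E : lbdata X) : lb_local D -> lb_local E ->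
  Tr (fun x y => fr (lb_mul D E) x y / (fr D x y * fr E x y)).
Proof.
move=> hD hE; case: (frame_index hD) => i [iU di]; case: (frame_index hE) => j [jU ej].
case: (frame_index (lb_mul_local hD hE)) => k [kU dk].
case: (hD) => opD _ ruD cD; case: (hE) => opE _ ruE cE.
exists (fun y => lg (k y).1 (i y) y * lg (k y).2 (j y) y) => x.
case: (kU x) => kx1 kx2.
have := unitatM (ruD (k x).1 (i x) x kx1 (iU x)) (ruE (k x).2 (j x) x kx2 (jU x)).
have n1 := near_and (near_and (opD _ _ kx1) (opE _ _ kx2)) (near_and (opD _ _ (iU x)) (opE _ _ (jU x))).
apply: unitat_near; apply: near_impl n1 => y [[k1y k2y] [iy jy]].
rewrite dk di ej /=; case: (kU y) => ky1 ky2.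
case: (ruD _ _ y iy (iU y)) => _ nz; case: (ruE _ _ y jy (jU y)) => _ nz'.
have e1 : lg (k x).1 (k y).1 y * lg (k y).1 (i y) y = lg (k x).1 (i x) y * lg (i x) (i y) y by rewrite !cD.
have e2 : lg (k x).2 (k y).2 y * lg (k y).2 (j y) y = lg (k x).2 (j x) y * lg (j x) (j y) y by rewrite !cE.
rewrite mulrAC -[X in X / _]mulrACA e1 e2.
by field; rewrite nz nz'.
Qed.

(** A trivialization of the quotient of the two cocycles is exactly a scaling that turns the
    coordinates of f into sections of O(D). *)
Lemma Tr_regular_multiplier X Y (f : X -> Y) D : embedded X -> embedded Y -> morph anyL f ->
  lb_iso (lb_pull f (lb_O1 Y)) (lb_exp (lb_O1 X) D) ->
  exists th : X -> L, (forall x, th x != 0) /\ forall j x, rgd D x (fun y => th y * crd (f y) 0 j).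
Proof.
move=> eX eY mf.
move/(lb_isoP (lb_pull_local eY mf (lb_O1_local eY)) (lb_exp_local D (lb_O1_local eX))).
case: (frame_index (lb_O1_local eX)) => i [/= iU di].
case: (frame_index (lb_O1_local eY)) => j [/= jU ej].
have -> : (fun x y => fr (lb_pull f (lb_O1 Y)) x y / fr (lb_exp (lb_O1 X) D) x y) =
   fun x y => (crd (f y) 0 (j (f y)) / crd (f y) 0 (j (f x))) / (crd y 0 (i y) / crd y 0 (i x)) ^+ D.
  by apply: boolp.funext => x; apply: boolp.funext => y; rewrite frame_pull frame_exp di ej.
move=> [ka hk].
exists (fun y => (crd (f y) 0 (j (f y)) * ka y / crd y 0 (i y) ^+ D)^-1); split.
  move=> x; case: (hk x) => _; rewrite !divff ?expr1n ?invr1 ?mul1r //.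
  by move=> k0; rewrite invr_eq0 !mulf_neq0 ?invr_eq0 ?expf_neq0.
move=> a x.
pose u y := (crd (f y) 0 (j (f y)) / crd (f y) 0 (j (f x)) / (crd y 0 (i y) / crd y 0 (i x)) ^+ D * ka y)^-1.
have [ru _] : unitat x u by apply: unitatV; apply: hk.
have r1 : rg x (fun y => crd (f y) 0 a / crd (f y) 0 (j (f x))).
  apply: (rg_pull (f := fun z => crd z 0 a / crd z 0 (j (f x))) eY mf).
  by apply: (@rgd_div _ 1 0) => //; apply: hfun_rgd; apply: (hfun_crd anyL_scalars).
have r2 : rgd D x (fun y => crd y 0 (i x) ^+ D).
  by apply: hfun_rgd; have := hfunX anyL_scalars D (hfun_crd anyL_scalars (X := X) (i x)); rewrite mul1n.
have := rgdM (rgdM r1 ru) r2; rewrite addn0 add0n.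
have nx : near x (fun y => crd y 0 (i x) != 0 /\ crd (f y) 0 (j (f x)) != 0).
  have [op _ _ _] := lb_O1_local eX; have [op' _ _ _] := lb_O1_local eY.
  by apply: near_and; [apply: (op _ _ (iU x))|apply: (near_pull eY mf (op' _ _ (jU (f x))))].
apply: rgd_near; apply: near_impl nx => y [y1 y2]; rewrite /u.
have [ky|ky] := eqVneq (ka y) 0; first by rewrite ky !(mulr0, mul0r, invr0).
have := jU (f y); have := iU y => n1 n2.
rewrite expr_div_n; set c := crd y 0 (i y) ^+ D; set d := crd y 0 (i x) ^+ D.
have c0 : c != 0 by rewrite expf_neq0.
have d0 : d != 0 by rewrite expf_neq0.
by field; rewrite ky n2 c0 y2 d0.
Qed.
End Cocycles.
Notation Tr := trivial_cocycle.
Notation fr := frame.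

Ltac fld := rewrite /=; field; repeat (apply/andP; split); assumption.

(** * The dual variety and the theorem of the square *)

Section Dual.
Variables (L : closedFieldType) (S : L -> Prop) (A B : avar L) (P : lbdata (pprod (asp A) (asp B))).
Hypothesis eA : embedded (asp A).
Hypothesis mtr : forall a : A, @morph L anyL (asp A) (asp A) (fun x => x + a : A).
Hypothesis hD : dual_variety S P.
Let eB : embedded (asp B). Proof. by case: hD => -[[[]]]. Qed.
Let p (u v : A * B) : L := @frame L (pprod (asp A) (asp B)) P u v.

Lemma poincare_local : lb_local P.
Proof. by case: hD => -[_ /line_bundleP]. Qed.

Lemma morph_at (T : pspace L) (t : T) : embedded T ->
  @morph L anyL (asp A) (pprod (asp A) T) (fun x => (x, t)).
Proof.
move=> eT; apply: morph_pair => //; [exact: (morph_id anyL_scalars)|exact: morph_const_any].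
Qed.

Lemma morph_origin (T : pspace L) : embedded T ->
  @morph L anyL T (pprod (asp A) T) (fun t => (0 : A, t)).
Proof.
move=> eT; apply: morph_pair => //; [exact: morph_const_any|exact: (morph_id anyL_scalars)].
Qed.

Lemma fibre_local (T : pspace L) (Q : lbdata (pprod (asp A) T)) t : embedded T -> lb_local Q ->
  lb_local (fibre t Q).
Proof. by move=> eT; apply: lb_pull_local; [apply: pprod_embedded|apply: morph_at]. Qed.

Lemma at_origin_local (T : pspace L) (Q : lbdata (pprod (asp A) T)) : embedded T -> lb_local Q ->
  lb_local (at_origin Q).
Proof. by move=> eT; apply: lb_pull_local; [apply: pprod_embedded|apply: morph_origin]. Qed.

Lemma Tr_const (X : pspace L) (t : X -> X -> L) c : (forall x, near x (fun y => t x y = c)) -> c != 0 -> Tr t.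
Proof.
move=> n c0; apply: Tr_near (_ : Tr (fun _ _ => c)) => [x|].
  by apply: near_impl (n x) => y ->.
by apply: Tr_unit => x; apply: unitat_const.
Qed.

Lemma frame_diag (X : pspace L) (D : lbdata X) x : lb_local D -> fr D x x != 0.
Proof. by move=> hd; apply: (near_self (frame_near x hd)). Qed.

Lemma at_originP (T : pspace L) (Q : lbdata (pprod (asp A) T)) : embedded T -> lb_local Q ->
  lb_iso (at_origin Q) (lb_one T) <-> @Tr L T (fun t t' => @frame L (pprod (asp A) T) Q (0, t) (0, t')).
Proof.
move=> eT hQ.
have E : (fun t t' : T => @frame L T (at_origin Q) t t' / @frame L T (lb_one T) t t') =
    fun t t' => @frame L (pprod (asp A) T) Q (0, t) (0, t').
  by apply: boolp.funext => t; apply: boolp.funext => t'; rewrite frame_one divr1.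
have := lb_isoP (at_origin_local eT hQ) (lb_one_local T); by rewrite E.
Qed.

(** The universal property over a one-point parameter space: the two constant maps classify the same
    family. *)
Lemma dual_inj (b b' : B) : @Tr L (asp A) (fun x y => p (x, b) (y, b) / p (x, b') (y, b')) -> b = b'.
Proof.
move=> h; pose T := @PSpace L unit 1 (fun=> 1).
have pT : projective anyL T.
  split.
    split=> [t|[] []//]; apply/eqP => /rowP /(_ 0); rewrite !mxE; apply/eqP; exact: oner_neq0.
  exists (fun=> False); split=> // v v0; split=> // _; exists tt.
  case: (row_neq0 v0) => i; rewrite ord1 => vi; exists (v 0 0) => //.
  by apply/rowP => j; rewrite !ord1 !mxE mulr1.
have eT : embedded T by case: pT.
case: hD => _ hpic _ _ hun.
have eAB := pprod_embedded eA eB.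
have eAT := pprod_embedded eA eT.
have mb c : @morph L anyL (pprod (asp A) T) (pprod (asp A) (asp B)) (fun u => (u.1, c)).
  by apply: morph_pair => //; [exact: (morph_fst anyL_scalars)|exact: morph_const_any].
pose Q := @lb_pull L (pprod (asp A) T) (pprod (asp A) (asp B)) (fun u => (u.1, b)) P.
have lQ : lb_local Q by apply: lb_pull_local => //; exact: poincare_local.
have qT : quasi_projective anyL T.
  case: pT => _ [E [fE hE]]; split=> //; exists E, (fun f => f = 1); split=> //.
    by move=> f ->; exists 0%N; split; [exact: dhomog1|].
  move=> v v0; rewrite -hE //; split=> [[]//|h0]; split=> //.
  by exists 1 => //; rewrite /ev meval1 oner_neq0.
case: (hun T Q qT).
- exact: lb_local_line_bundle.
- by move=> t; have := hpic b; congr pic0.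
- apply/at_originP => //; apply: (@Tr_const T _ (p (0, b) (0, b)) _ (frame_diag _ poincare_local)) => t.
  by apply: near_all => t'; rewrite frame_pull.
have sat c : @Tr L (asp A) (fun x y => p (x, c) (y, c) / p (x, b) (y, b)) ->
    lb_iso (@lb_pull L (pprod (asp A) T) (pprod (asp A) (asp B)) (fun u => (u.1, c)) P) Q.
  move=> tc; apply/lb_isoP => //; first by apply: lb_pull_local => //; exact: poincare_local.
  exact: (@Tr_pull L (pprod (asp A) T) (asp A) fst (fun x y => p (x, c) (y, c) / p (x, b) (y, b)) eA (morph_fst anyL_scalars eA eT) tc).
move=> phi [_ u].
have e1 : phi = fun=> b.
  apply: u; split; first exact: morph_const_any.
  apply: sat; apply: Tr_const (oner_neq0 L) => x.
  have := frame_near x (fibre_local (b : asp B) eB poincare_local).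
  by apply: near_impl => y; rewrite frame_pull => ny; rewrite /p divff.
have e2 : phi = fun=> b'.
  apply: u; split; first exact: morph_const_any.
  apply: sat; apply: Tr_near (TrV h) => x; apply: near_all => y.
  by rewrite invfM invrK mulrC.
by have := congr1 (fun f => f tt) e1; rewrite e2.
Qed.

Lemma projective_quasi (T : pspace L) : projective anyL T -> quasi_projective anyL T.
Proof.
case=> eT [E [fE hE]]; split=> //; exists E, (fun f => f = 1); split=> //.
  by move=> f ->; exists 0%N; split; [exact: dhomog1|].
move=> v v0; rewrite -hE //; split=> [[]//|h0]; split=> //.
by exists 1 => //; rewrite /ev meval1 oner_neq0.
Qed.

(** A form of the seesaw principle. Nothing is assumed of [phi] beyond agreement on fibres: the
    universal property provides a morphism, and [dual_inj] identifies it with [phi] point by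
    point. *)
Lemma dual_univ (T : pspace L) (Q : lbdata (pprod (asp A) T)) (phi : T -> B) :
  projective anyL T -> lb_local Q -> lb_iso (at_origin Q) (lb_one T) ->
  (forall t, lb_iso (fibre t Q) (@fibre L A (asp B) (phi t) P)) ->
  @morph L anyL T (asp B) phi /\
  @Tr L (pprod (asp A) T) (fun u v => fr Q u v / p (u.1, phi u.2) (v.1, phi v.2)).
Proof.
move=> pT lQ orQ fQ; have eT : embedded T by case: pT.
have eAB := pprod_embedded eA eB; have eAT := pprod_embedded eA eT.
case: (hD) => _ hpic _ _ hun.
pose q (u v : A * T) : L := @frame L (pprod (asp A) T) Q u v.
have fQ' t : @Tr L (asp A) (fun x y => q (x, t) (y, t) / p (x, phi t) (y, phi t)).
  by have /lb_isoP := fQ t; apply; apply: fibre_local => //; exact: poincare_local.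
case: (hun T Q (projective_quasi pT)) => [|t||psi [[mpsi ipsi] _]] //.
- exact: lb_local_line_bundle.
- split; first by apply: lb_local_line_bundle; apply: fibre_local.
  move=> a; have lt : lb_local (fibre t Q) by apply: fibre_local.
  have lp : lb_local (@fibre L A (asp B) (phi t) P) by apply: fibre_local => //; exact: poincare_local.
  apply/lb_isoP => //; first exact: lb_pull_local.
  have [_ /(_ a) /lb_isoP hp] := hpic (phi t).
  have {}hp := hp (lb_pull_local eA (mtr a) lp) lp.
  have h1 := @Tr_pull L (asp A) (asp A) (fun x => x + a : A) (fun x y => q (x, t) (y, t) / p (x, phi t) (y, phi t)) eA (mtr a) (fQ' t).
  apply: Tr_near (TrM (TrM h1 hp) (TrV (fQ' t))) => x.
  have n1 := frame_near x lp; have n2 := frame_near x (lb_pull_local eA (mtr a) lp).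
  have n3 := frame_near x lt.
  apply: near_impl (near_and (near_and n1 n2) n3) => y [[]]; rewrite /p /q !frame_pull => c1 c2 c3.
  fld.
move: ipsi => /lb_isoP ipsi.
have lpsi : lb_local (@lb_pull L (pprod (asp A) T) (pprod (asp A) (asp B)) (fun u => (u.1, psi u.2)) P).
  apply: lb_pull_local => //; last exact: poincare_local.
  apply: morph_pair => //; first exact: (morph_fst anyL_scalars).
  exact: (@morph_comp L anyL (pprod (asp A) T) T (asp B) snd psi anyL_scalars eT eB (morph_snd anyL_scalars eA eT) mpsi).
have {}ipsi := ipsi lpsi lQ.
have E : psi = phi.
  apply: boolp.funext => t; apply: dual_inj.
  have h1 := Tr_pull eAT (morph_at t eT) ipsi.
  apply: Tr_near (TrM h1 (fQ' t)) => x.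
  apply: near_impl (frame_near x (fibre_local t eT lQ)) => y; rewrite !frame_pull /= => n.
  by rewrite -!/(p _ _) -!/(q _ _) mulrA divfK.
rewrite -E; split=> //; apply: Tr_near (TrV ipsi) => u; apply: near_all => v.
by rewrite invfM invrK mulrC.
Qed.

(** Over [B x B], the product of the two pulled-back Poincare bundles is a family with the fibres
    prescribed by addition; [dual_univ] makes the fibrewise isomorphisms global. *)
Lemma dual_bilinear : @Tr L (pprod (asp A) (pprod (asp B) (asp B)))
  (fun u v => p (u.1, u.2.1 + u.2.2) (v.1, v.2.1 + v.2.2) /
     (p (u.1, u.2.1) (v.1, v.2.1) * p (u.1, u.2.2) (v.1, v.2.2))).
Proof.
case: (hD) => -[[/= pB _ _ _ _] _] _ orP addP _.
have pB' : projective anyL (asp B).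
  case: pB => e [E [fE hE]]; split=> //; exists E; split=> // f /fE [d [hd _]].
  by exists d; split.
have eBB := pprod_embedded eB eB; have eABB := pprod_embedded eA eBB.
have eAB := pprod_embedded eA eB.
have m1 : @morph L anyL (pprod (asp A) (pprod (asp B) (asp B))) (pprod (asp A) (asp B)) (fun u => (u.1, u.2.1)).
  apply: morph_pair => //; first exact: (morph_fst anyL_scalars).
  exact: (@morph_comp L anyL (pprod (asp A) (pprod (asp B) (asp B))) (pprod (asp B) (asp B)) (asp B) snd fst anyL_scalars eBB eB (morph_snd anyL_scalars eA eBB) (morph_fst anyL_scalars eB eB)).
have m2 : @morph L anyL (pprod (asp A) (pprod (asp B) (asp B))) (pprod (asp A) (asp B)) (fun u => (u.1, u.2.2)).
  apply: morph_pair => //; first exact: (morph_fst anyL_scalars).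
  exact: (@morph_comp L anyL (pprod (asp A) (pprod (asp B) (asp B))) (pprod (asp B) (asp B)) (asp B) snd snd anyL_scalars eBB eB (morph_snd anyL_scalars eA eBB) (morph_snd anyL_scalars eB eB)).
have lP := poincare_local.
have l1 := lb_pull_local eAB m1 lP; have l2 := lb_pull_local eAB m2 lP.
have fm := frame_mul l1 l2.
move/(at_originP eB lP) : orP => orP.
case: (@dual_univ (pprod (asp B) (asp B)) _ (fun t => t.1 + t.2 : B) (pprod_projective anyL_scalars pB' pB') (lb_mul_local l1 l2)).
- apply/at_originP => //; first exact: lb_mul_local.
  have h1 := Tr_pull eABB (morph_origin eBB) fm.
  have h2 := Tr_pull eB (morph_fst anyL_scalars eB eB) orP.
  have h3 := Tr_pull eB (morph_snd anyL_scalars eB eB) orP.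
  apply: Tr_near (TrM h1 (TrM h2 h3)) => t.
  have n1 := frame_near t (at_origin_local eBB l1); have n2 := frame_near t (at_origin_local eBB l2).
  apply: near_impl (near_and n1 n2) => t' []; rewrite !frame_pull /= => c1 c2.
  by rewrite divfK ?mulf_neq0.
- move=> t; apply/lb_isoP; [exact: fibre_local (lb_mul_local l1 l2)|exact: fibre_local|].
  have h1 := Tr_pull eABB (morph_at t eBB) fm.
  have /lb_isoP h2 := addP t.1 t.2.
  have f1 := fibre_local t.1 eB lP; have f2 := fibre_local t.2 eB lP.
  have {}h2 := h2 (fibre_local _ eB lP) (lb_mul_local f1 f2).
  have h3 := frame_mul f1 f2.
  apply: Tr_near (TrM h1 (TrV (TrM h2 h3))) => x.
  have n1 := frame_near x f1; have n2 := frame_near x f2.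
  have n3 := frame_near x (lb_mul_local f1 f2).
  have n4 := frame_near x (@fibre_local (asp B) P (t.1 + t.2 : B) eB lP).
  have n5 := frame_near x (fibre_local t eBB (lb_mul_local l1 l2)).
  apply: near_impl (near_and (near_and (near_and n1 n2) n3) (near_and n4 n5)) => y.
  case=> -[[]]; rewrite /fibre !frame_pull => c1 c2 c3 []; rewrite /p => c4 c5; fld.
move=> _ h; apply: Tr_near (TrM (TrV h) fm) => u.
have n1 := frame_near u l1; have n2 := frame_near u l2; have n3 := frame_near u (lb_mul_local l1 l2).
apply: near_impl (near_and (near_and n1 n2) n3) => v [[]]; rewrite /p !frame_pull => c1 c2 c3.
have [->|c4] := eqVneq (@frame L (pprod (asp A) (asp B)) P (u.1, u.2.1 + u.2.2) (v.1, v.2.1 + v.2.2)) 0.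
  by rewrite !(mul0r, invr0, mulr0).
fld.
Qed.
End Dual.

Lemma projective_any (L : closedFieldType) (S : L -> Prop) (X : pspace L) :
  projective S X -> projective anyL X.
Proof.
case=> e [E [fE hE]]; split=> //; exists E; split=> // f /fE [d [hd _]].
by exists d; split.
Qed.

Lemma abelian_varietyP (L : closedFieldType) (S : L -> Prop) (A : avar L) : abelian_variety S A ->
  [/\ projective anyL (asp A), @irreducible L (asp A) (fun=> True),
      @morph L anyL (pprod (asp A) (asp A)) (asp A) (fun u => u.1 + u.2 : A) &
      @morph L anyL (asp A) (asp A) (fun x => - x : A)].
Proof.
case=> pA irrA _ mA nA; split=> //; first exact: projective_any pA.
- exact: morph_any mA.
- exact: morph_any nA.
Qed.

Section Lambda.
Variables (L : closedFieldType) (S : L -> Prop) (A B : avar L) (P : lbdata (pprod (asp A) (asp B))).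
Hypothesis aA : abelian_variety S A.
Hypothesis hD : dual_variety S P.
Variable (pol : A -> B).
Hypothesis mpol : @morph L anyL (asp A) (asp B) pol.
Hypothesis addpol : {morph pol : x y / x + y}.
Variable M : lbdata (asp A).
Hypothesis lM : lb_local M.
Let m : A -> A -> L := @frame L (asp A) M.
Let p (u v : A * B) : L := @frame L (pprod (asp A) (asp B)) P u v.
Hypothesis hM : forall a : A, @Tr L (asp A)
  (fun x y => p (x, pol a) (y, pol a) / (m (x + a) (y + a) / m x y)).

Let pA : projective anyL (asp A). Proof. by case: (abelian_varietyP aA). Qed.
Let mA : @morph L anyL (pprod (asp A) (asp A)) (asp A) (fun u => u.1 + u.2 : A).
Proof. by case: (abelian_varietyP aA). Qed.
Let nA : @morph L anyL (asp A) (asp A) (fun x => - x : A).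
Proof. by case: (abelian_varietyP aA). Qed.
Let eA : embedded (asp A). Proof. by case: pA. Qed.
Let eB : embedded (asp B). Proof. by case: hD => -[[[]]]. Qed.
Let mtr (a : A) : @morph L anyL (asp A) (asp A) (fun x => x + a : A).
Proof. exact: morph_translate. Qed.

(** The Mumford bundle of [M] on [A x A]: the pull-back of [M] by addition, divided by its
    pull-backs by the two projections. *)
Definition lambda_frame (M : lbdata (asp A)) (u v : A * A) : L :=
  @frame L (asp A) M (u.1 + u.2 : A) (v.1 + v.2 : A) / (@frame L (asp A) M u.1 v.1 * @frame L (asp A) M u.2 v.2).
Notation lam := (lambda_frame M).

Lemma near_frame (Z : pspace L) (f : Z -> A) z : @morph L anyL Z (asp A) f ->
  near z (fun w => m (f z) (f w) != 0).
Proof. by move=> mf; have := frame_near z (lb_pull_local eA mf lM). Qed.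

(** The Mumford bundle is trivial along the origin and has the fibres of the polarization, so
    [dual_univ] identifies it with the pulled-back Poincare bundle. *)
Lemma lambda_poincare : @Tr L (pprod (asp A) (asp A))
  (fun u v => lam u v / p (u.1, pol u.2) (v.1, pol v.2)).
Proof.
have eAA := pprod_embedded eA eA.
have m1 := morph_fst anyL_scalars eA eA; have m2 := morph_snd anyL_scalars eA eA.
have l0 := lb_pull_local eA mA lM; have l1 := lb_pull_local eA m1 lM; have l2 := lb_pull_local eA m2 lM.
have l12 := lb_mul_local l1 l2.
have lQ := lb_mul_local l0 (lb_inv_local l12).
have hQ : @Tr L (pprod (asp A) (asp A)) (fun u v => frame (lb_mul (@lb_pull L (pprod (asp A) (asp A)) (asp A) (fun u => u.1 + u.2 : A) M) (lb_inv (lb_mul (@lb_pull L (pprod (asp A) (asp A)) (asp A) fst M) (@lb_pull L (pprod (asp A) (asp A)) (asp A) snd M)))) u v / lam u v).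
  apply: Tr_near (TrM (frame_mul l0 (lb_inv_local l12)) (TrV (frame_mul l1 l2))) => u.
  have n0 := frame_near u l0; have n1 := frame_near u l1; have n2 := frame_near u l2.
  have n3 := frame_near u l12.
  apply: near_impl (near_and (near_and n0 n1) (near_and n2 n3)) => v [].
  rewrite /lambda_frame frame_inv !frame_pull => -[c0 c1] [c2 c3]; fld.
set Q := (lb_mul _ _) in lQ hQ.
case: (@dual_univ L S A B P eA mtr hD (asp A) Q pol pA lQ).
- apply/(at_originP eA eA lQ).
  have h1 := Tr_pull eAA (morph_origin eA eA) hQ.
  have h2 : @Tr L (asp A) (fun t t' => lam (0, t) (0, t')).
    have c0 : (m 0 0)^-1 != 0 by rewrite invr_eq0 (frame_diag _ lM).
    apply: Tr_const c0 => t.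
    apply: near_impl (near_frame t (morph_id anyL_scalars eA)) => t'.
    rewrite /lambda_frame /= !add0r -!/(m _ _) => c1.
    have c2 : m 0 0 != 0 := frame_diag (0 : asp A) lM.
    by fld.
  apply: Tr_near (TrM h1 h2) => t.
  have n1 := near_frame t (morph_id anyL_scalars eA).
  apply: near_impl n1 => t' c1; rewrite divfK //.
  rewrite /lambda_frame /= !add0r -!/(m _ _).
  have c2 : m 0 0 != 0 := frame_diag (0 : asp A) lM.
  by rewrite mulf_neq0 ?invr_eq0 // mulf_neq0.
- move=> a; have lP := @fibre_local L A eA (asp B) P (pol a) eB (poincare_local hD).
  apply/lb_isoP => //; first exact: fibre_local.
  have h1 := Tr_pull eAA (@morph_at L A eA (asp A) a eA) hQ.
  apply: Tr_near (TrM h1 (TrV (TrM (@Tr_const L (asp A) (fun _ _ => m a a) _ (fun x => near_all x (fun _ => erefl)) (frame_diag (a : asp A) lM)) (hM a)))) => x.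
  have n1 := near_frame x (morph_id anyL_scalars eA).
  have n2 := near_frame x (mtr a).
  have n3 := frame_near x lP.
  apply: near_impl (near_and (near_and n1 n2) n3) => y [[]].
  rewrite /fibre !frame_pull /lambda_frame /p /= => c1 c2 c3.
  have c4 : m a a != 0 := frame_diag (a : asp A) lM.
  rewrite -!/(m _ _); fld.
- move=> _ h.
  apply: Tr_near (TrM (TrV hQ) h) => u; have n := frame_near u lQ.
  apply: near_impl n => v c1; rewrite mulrA; congr (_ / _).
  by rewrite invf_div divfK.
Qed.

(** The theorem of the cube for [M], read off from the bilinearity of the Poincare bundle and the
    additivity of [pol]. *)
Lemma lambda_addr (Z : pspace L) (a b c : Z -> A) :
  @morph L anyL Z (asp A) a -> @morph L anyL Z (asp A) b -> @morph L anyL Z (asp A) c ->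
  @Tr L Z (fun z w => lam (a z, b z + c z) (a w, b w + c w) / (lam (a z, b z) (a w, b w) * lam (a z, c z) (a w, c w))).
Proof.
move=> ma mb mc.
have eAA := pprod_embedded eA eA; have eBB := pprod_embedded eB eB.
have mbc : @morph L anyL Z (asp A) (fun z => b z + c z) := morph_add eA mA mb mc.
have mp f : @morph L anyL Z (asp A) f -> @morph L anyL Z (asp B) (fun z => pol (f z)).
  by move=> mf; apply: (@morph_comp L anyL Z (asp A) (asp B) f pol).
have h1 f : @morph L anyL Z (asp A) f -> @Tr L Z (fun z w => lam (a z, f z) (a w, f w) / p (a z, pol (f z)) (a w, pol (f w))).
  move=> mf; exact: (Tr_pull eAA (morph_pair anyL_scalars eA eA ma mf) lambda_poincare).
have h2 := Tr_pull (pprod_embedded eA eBB) (morph_pair anyL_scalars eA eBB ma (morph_pair anyL_scalars eB eB (mp b mb) (mp c mc))) (dual_bilinear eA mtr hD).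
apply: Tr_near (TrM (TrM (h1 _ mbc) (TrV (TrM (h1 _ mb) (h1 _ mc)))) h2) => z.
have nn (f : Z -> A) : @morph L anyL Z (asp A) f -> near z (fun w => lam (a z, f z) (a w, f w) != 0 /\ p (a z, pol (f z)) (a w, pol (f w)) != 0).
  move=> mf; have n1 := near_frame z ma; have n2 := near_frame z mf.
  have n3 := near_frame z (morph_add eA mA ma mf).
  have eAB := pprod_embedded eA eB.
  have n4 := frame_near z (lb_pull_local eAB (morph_pair anyL_scalars eA eB ma (mp f mf)) (poincare_local hD)).
  apply: near_impl (near_and (near_and n1 n2) (near_and n3 n4)) => w [[c1 c2] [c3 c4]].
  split=> //; rewrite /lambda_frame /= -!/(m _ _) mulf_neq0 // invr_eq0 mulf_neq0 //.
apply: near_impl (near_and (near_and (nn _ mb) (nn _ mc)) (nn _ mbc)) => w.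
rewrite /= -!addpol -!/(p _ _) => -[[[c1 c2] [c3 c4]] [c5 c6]]; fld.
Qed.

Lemma lambda_sym (u v : A * A) : lam (u.2, u.1) (v.2, v.1) = lam u v.
Proof. by rewrite /lambda_frame /= [u.2 + _]addrC [v.2 + _]addrC [X in _ / X]mulrC. Qed.

Let lam1 (x y : A) := lam (x, x) (y, y).

Lemma lambda_near (Z : pspace L) (a b : Z -> A) z : @morph L anyL Z (asp A) a -> @morph L anyL Z (asp A) b ->
  near z (fun w => lam (a z, b z) (a w, b w) != 0).
Proof.
move=> ma mb; have n1 := near_frame z ma; have n2 := near_frame z mb.
have n3 := near_frame z (morph_add eA mA ma mb).
apply: near_impl (near_and (near_and n1 n2) n3) => w [[c1 c2] c3].
by rewrite /lambda_frame /= -!/(m _ _) mulf_neq0 // invr_eq0 mulf_neq0.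
Qed.

Lemma lambda_muln n : @Tr L (asp A) (fun x y => lam (x *+ n, x) (y *+ n, y) / lam1 x y ^+ n).
Proof.
have mi := morph_id anyL_scalars eA.
have mn k : @morph L anyL (asp A) (asp A) (fun x => x *+ k) by apply: morph_muln.
elim: n => [|n IH].
  have c0 : (m 0 0)^-1 != 0 by rewrite invr_eq0 (frame_diag _ lM).
  apply: Tr_const c0 => x; apply: near_impl (near_frame x mi) => y c1.
  rewrite expr0 divr1 /lambda_frame /= !mulr0n !add0r -!/(m _ _).
  have c2 : m 0 0 != 0 := frame_diag (0 : asp A) lM.
  by fld.
apply: Tr_near (TrM IH (lambda_addr mi mi (mn n))) => x.
have n1 := lambda_near x (mn n) mi; have n2 := lambda_near x mi mi.
have n3 := lambda_near x mi (mn n.+1).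
apply: near_impl (near_and (near_and n1 n2) n3) => y [[c1 c2] c3].
rewrite /= -!mulrS.
have es k : lam (x *+ k, x) (y *+ k, y) = lam (x, x *+ k) (y, y *+ k) := esym (lambda_sym (x *+ k, x) (y *+ k, y)).
rewrite !es in c1 *.
have c5 : lam1 x y != 0 by [].
by rewrite exprS -/(lam1 x y); field; rewrite c1 c5 expf_neq0.
Qed.

(** Adding x to nx contributes n times the diagonal of the Mumford bundle; these contributions sum
    to the binomial coefficient. *)
Lemma muln_frame n : @Tr L (asp A) (fun x y => m (x *+ n) (y *+ n) / (m x y ^+ n * lam1 x y ^+ 'C(n, 2))).
Proof.
have mi := morph_id anyL_scalars eA.
have mn k : @morph L anyL (asp A) (asp A) (fun x => x *+ k) by apply: morph_muln.
elim: n => [|n IH].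
  have c0 : m 0 0 != 0 := frame_diag (0 : asp A) lM.
  by apply: Tr_const c0 => x; apply: near_all => y; rewrite !expr0 mulr1 divr1 !mulr0n.
apply: Tr_near (TrM IH (lambda_muln n)) => x.
have n1 := near_frame x (mn n); have n2 := near_frame x (mn n.+1).
have n3 := near_frame x mi; have n4 := lambda_near x mi mi.
apply: near_impl (near_and (near_and n1 n2) (near_and n3 n4)) => y [[c1 c2] [c3 c4]].
rewrite /lambda_frame /= -!/(m _ _) -!mulrSr.

have -> : 'C(n.+1, 2) = (n + 'C(n, 2))%N by rewrite binS bin1 addnC.
by rewrite exprS exprD; field; rewrite c1 c3 !expf_neq0.
Qed.

(** Apply biadditivity to x + (-x) = 0 in the second variable. *)
Lemma lambda_neg : @Tr L (asp A) (fun x y => lam1 x y / (m x y * m (- x) (- y))).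
Proof.
have mi := morph_id anyL_scalars eA.
have h := lambda_addr mi mi nA.
have c0 : m 0 0 != 0 := frame_diag (0 : asp A) lM.
have c00 : (m 0 0 ^+ 2)^-1 != 0 by rewrite invr_eq0 expf_neq0.
apply: Tr_near (TrM (TrV h) (@Tr_const L (asp A) (fun _ _ => (m 0 0 ^+ 2)^-1) _ (fun x => near_all x (fun _ => erefl)) c00)) => x.
have n1 := near_frame x mi; have n2 := near_frame x nA.
have n3 := lambda_near x mi mi.
apply: near_impl (near_and (near_and n1 n2) n3) => y [[c1 c2] c3].
rewrite /= !subrr /lam1.
have -> : lam (x, 0) (y, 0) = (m 0 0)^-1 by rewrite /lambda_frame /= !addr0 -!/(m _ _); fld.
have -> : lam (x, - x) (y, - y) = m 0 0 / (m x y * m (- x) (- y)) by rewrite /lambda_frame /= !subrr.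
fld.
Qed.

(** By [lambda_neg] the diagonal of the Mumford bundle is the symmetric bundle itself, so the
    exponents add up to n + 2 binom(n, 2), which is the square of n. *)
Lemma muln_symmetric n : @Tr L (asp A) (fun x y => m (x *+ n) (y *+ n) * m (- (x *+ n)) (- (y *+ n)) /
  (m x y * m (- x) (- y)) ^+ (n ^ 2)).
Proof.
have mi := morph_id anyL_scalars eA.

have h1 := muln_frame n; have h2 := Tr_pull eA nA h1.
have h3 := TrX 'C(n, 2) lambda_neg; have h4 := Tr_pull eA nA h3.
apply: Tr_near (TrM (TrM h1 h2) (TrM h3 h4)) => x.
have n1 := near_frame x mi; have n2 := near_frame x nA; have n3 := lambda_near x mi mi.
have n4 := lambda_near x nA nA.
apply: near_impl (near_and (near_and n1 n2) (near_and n3 n4)) => y [[c1 c2] [c3 c4]].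
rewrite /= !opprK !mulNrn.
have c5 : lam1 x y != 0 by []. have c6 : lam1 (- x) (- y) != 0 by [].
have -> : (n ^ 2 = n + 'C(n, 2) + 'C(n, 2))%N.
  by elim: (n) => // k IH; move: IH; rewrite binS bin1 -!mulnn; nia.
move: c1 c2 c5 c6.
move: (m x y) (m (- x) (- y)) (lam1 x y) (lam1 (- x) (- y)) => u u' s s' hu hu' hs hs'.
rewrite !exprD !expr_div_n !exprMn.
by field; rewrite !expf_neq0.
Qed.

End Lambda.

(** * The number of torsion points *)

Section TorsionCount.
Variables (L : closedFieldType) (A : avar L) (n d : nat).
Hypothesis pA : projective anyL (asp A).
Hypothesis irrA : @irreducible L (asp A) (fun=> True).
Hypothesis mA : @morph L anyL (pprod (asp A) (asp A)) (asp A) (fun u => u.1 + u.2 : A).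
Hypothesis n_gt1 : (1 < n)%N.
Hypothesis n_surj : forall y : A, exists x, x *+ n = y.
Variable C : nat.
Hypothesis growth : forall m, exists2 K, @dimle L (asp A) m K & (K <= C * m.+1 ^ d)%N.
Variable th : A -> L.
Hypothesis th0 : forall x, th x != 0.
Hypothesis rth : forall j x, @rgd L (n ^ 2) (asp A) x (fun y => th y * av_crd (y *+ n) 0 j).
Let eA : embedded (asp A). Proof. by case: pA. Qed.
Variables (q : nat) (g : 'I_q -> A).
Hypothesis ginj : injective g.
Hypothesis gtor : forall i, g i *+ n = 0.
Hypothesis q_gt0 : (0 < q)%N.
Notation hf := (@hfun L anyL (asp A)).

Lemma interpolation : exists b : 'I_q -> A -> L, (forall j, hf q.-1 (b j)) /\
  forall i j, (b j (g i) != 0) = (i == j).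
Proof.
have /boolp.choice [z hz] (ji : 'I_q * 'I_q) : exists z, ji.1 != ji.2 ->
    [/\ hf 1 z, z (g ji.1) != 0 & z (g ji.2) = 0].
  have [e|ne] := eqVneq ji.1 ji.2; first by exists (fun=> 0).
  have /(@separating_form L (asp A) eA) [z hz] : g ji.1 <> g ji.2 by move/ginj/eqP; apply/negP.
  by exists z.
exists (fun j x => \prod_(i < q | j != i) z (j, i) x); split=> [j|i j].
  have := @hfun_prod L anyL (asp A) anyL_scalars _ (index_enum 'I_q) (fun i => j != i) (fun i => z (j, i)) (fun=> 1%N).
  rewrite sum_nat_const muln1 (_ : #|_| = q.-1); last first.
    have := cardC1 j; rewrite card_ord => <-; apply: eq_card => i.
    by rewrite !inE eq_sym.
  by apply=> i ji; case: (hz (j, i) ji).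
have [->|ne] := eqVneq i j.
  by apply/prodf_neq0 => i' ji'; case: (hz (j, i') ji').
apply/negbTE; rewrite negbK; apply/prodf_eq0; exists i; first by rewrite eq_sym.
by case: (hz (j, i)); rewrite /= ?[j == i]eq_sym // => _ _ ->.
Qed.

(** At 0 the matrix of the values of the interpolating forms at the points g i is diagonal and
    invertible; it stays invertible nearby. *)
Lemma translates_independent : exists b : 'I_q -> A -> L, (forall j, hf q.-1 (b j)) /\
  @near L (asp A) (0 : A) (fun x => forall E : 'I_q -> L,
    (forall i, \sum_j b j (x + g i) * E j = 0) -> forall j, E j = 0).
Proof.
case: interpolation => b [hb bg]; exists b; split=> //.
have mt (a : A) := morph_translate eA mA a.
pose M i j (x : A) := b j (x + g i) / b i (x + g i).
have g0 i : 0 + g i = g i by rewrite add0r.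
have rM i j : @rgd L 0 (asp A) (0 : A) (M i j).
  apply: (@rg_pull L (asp A) (asp A) (fun x => x + g i : A) (0 : A) (fun x => b j x / b i x) eA (mt _)).
  rewrite g0; apply: (@rgd_div L q.-1 0 (asp A)); rewrite ?addn0; try exact: hfun_rgd.
  by rewrite bg.
have nb i : @near L (asp A) (0 : A) (fun x => b i (x + g i) != 0).
  apply: (@near_pull L (asp A) (asp A) (fun x => x + g i : A) (0 : A) (fun x => b i x != 0) eA (mt _)).
  rewrite g0; exists q.-1, (b i); split=> //; by rewrite bg.
have nd : @near L (asp A) (0 : A) (fun x => \det (\matrix_(i, j) M i j x) != 0).
  apply: (rg_near_neq0 (rg_det rM)); have -> : \matrix_(i, j) M i j 0 = 1%:M.
    apply/matrixP => i j; rewrite !mxE /M !g0.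
    have [<-|ne] := eqVneq i j; first by rewrite divff ?bg.
    by have := bg i j; rewrite (negPf ne) => /negbFE/eqP ->; rewrite mul0r.
  by rewrite det1 oner_neq0.
apply: near_impl (near_and (near_finite nb) nd) => x [bx dx] E h j.
have : (\matrix_(i, j) M i j x) *m (\col_j E j) = 0.
  apply/colP => i; rewrite !mxE; transitivity ((b i (x + g i))^-1 * (\sum_j b j (x + g i) * E j)).
    by rewrite mulr_sumr; apply: eq_bigr => k _; rewrite !mxE /M; ring.
  by rewrite h mulr0.
move/(congr1 (mulmx (invmx (\matrix_(i, j) M i j x)))); rewrite mulKmx ?mulmx0; last first.
  by rewrite unitmxE unitfE.
by move/colP/(_ j); rewrite !mxE.
Qed.

(** The threshold [m0] does not depend on the degree [t], so that each round of [growth_step] costs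
    the same constant. *)
Lemma scaled_mult : exists m0, forall m r t (e : A -> L), (m0 <= m)%N -> hf m r -> hf t e ->
  hf (m + n ^ 2 * t) (fun x => r x * (th x ^+ t * e (x *+ n))).
Proof.
pose Sg i (y : A) := th y * av_crd (y *+ n) 0 i.
have /boolp.choice [m1 hm1] i := section_multiplier pA (rth i).
pose m0 := (\max_i m1 i)%N.
have mul1 m r i : (m0 <= m)%N -> hf m r -> hf (m + n ^ 2) (fun x => r x * Sg i x).
  by move=> lem; apply: hm1; apply: leq_trans lem; apply: leq_bigmax.
have mulX m r i k : (m0 <= m)%N -> hf m r -> hf (m + n ^ 2 * k) (fun x => r x * Sg i x ^+ k).
  move=> lem hr; elim: k => [|k IH].
    by rewrite muln0 addn0; apply: hfun_ext hr => x; rewrite expr0 mulr1.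
  rewrite mulnS addnCA addnC; apply: hfun_ext (mul1 _ _ i _ IH) => [x|].
    by rewrite exprSr mulrA.
  by apply: leq_trans lem _; apply: leq_addr.
have mulP m r (s : seq 'I_(av_amb A)) (k : 'I_(av_amb A) -> nat) : (m0 <= m)%N -> hf m r ->
    hf (m + \sum_(i <- s) n ^ 2 * k i) (fun x => r x * \prod_(i <- s) Sg i x ^+ k i).
  elim: s m r => [|i s IH] m r lem hr.
    by rewrite big_nil addn0; apply: hfun_ext hr => x; rewrite big_nil mulr1.
  rewrite big_cons addnA; apply: hfun_ext (IH _ _ _ (mulX _ _ i (k i) lem hr)) => [x|].
    by rewrite big_cons mulrA.
  by apply: leq_trans lem _; apply: leq_addr.
exists m0 => m r t e lem hr [p [hph hp2] ep].
have /dhomogP hp := hph.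
have : hf (m + n ^ 2 * t) (fun x => \sum_(k <- msupp p | k \in msupp p) p@_k * (r x * \prod_i Sg i x ^+ k i)).
  apply: (hfun_sum (X := asp A) anyL_scalars) => k kp; apply: (hfunZ (X := asp A) anyL_scalars) => //.
  have := mulP m r (index_enum _) k lem hr.
  by rewrite -big_distrr /= -mdegE [mdeg k]hp.
apply: hfun_ext => x; rewrite ep -[RHS](_ : r x * ev (th x *: av_crd (x *+ n)) p = _); last first.
  by rewrite (ev_scale _ _ hph) /=.
rewrite /ev mevalE mulr_sumr -big_seq; apply: eq_bigr => k _; rewrite mulrCA; congr (_ * (_ * _)).
by apply: eq_bigr => i _; rewrite mxE.
Qed.

(** Functions composed with multiplication by n do not change under translation by torsion. A
    relation between their products with the [b j], tested at the translates of x, therefore splits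
    into one relation for each j. *)
Lemma growth_step : exists c0, forall m (T : finType) (e : T -> A -> L), @indep L (asp A) T e -> (forall t, hf m (e t)) ->
  exists e' : 'I_q * T -> A -> L, @indep L (asp A) _ e' /\ forall t, hf (n ^ 2 * m + c0) (e' t).
Proof.
case: translates_independent => b [hb nb]; case: scaled_mult => m0 hm0.
case: (crd_neq0 eA ((0 : A) : asp A)) => i0 hi0.
pose r (x : A) := av_crd x 0 i0 ^+ m0.
have hr : hf m0 r by have := hfunX anyL_scalars m0 (hfun_crd anyL_scalars (X := asp A) i0); rewrite mul1n.
exists (m0 + q.-1)%N => m T e ind he.
have hE t : hf (m0 + n ^ 2 * m) (fun x => r x * (th x ^+ m * e t (x *+ n))) by apply: hm0.
exists (fun t x => b t.1 x * (r x * (th x ^+ m * e t.2 (x *+ n)))); split; last first.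
  move=> t; apply: (@hfunM_eq L anyL (asp A) anyL_scalars _ q.-1 (m0 + n ^ 2 * m)) => //; lia.
move=> c hc.
pose E j x := \sum_t c (j, t) * (th x ^+ m * e t (x *+ n)).
pose U j (x : A) := \sum_t c (j, t) * e t x.
have EU j x : E j x = th x ^+ m * U j (x *+ n).
  by rewrite /U mulr_sumr; apply: eq_bigr => t _; rewrite mulrCA.
have rE j x : @rgd L (n ^ 2 * m) (asp A) x (E j).
  apply: rgd_sum => t _; apply: rgdZ.
  have [i ri] := crd_neq0 eA (x : asp A).
  have hx : hf m0 (fun x => av_crd x 0 i ^+ m0).
    by have := hfunX anyL_scalars m0 (hfun_crd anyL_scalars (X := asp A) i); rewrite mul1n.
  exists m0, (fun x : A => av_crd x 0 i ^+ m0); split=> //; first by rewrite expf_neq0.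
  exact: hm0.
have h1 x : \sum_j b j x * E j x = 0.
  have r1 y : @rgd L m0 (asp A) y r by apply: hfun_rgd.
  have r2 y : @rgd L (q.-1 + n ^ 2 * m) (asp A) y (fun x => \sum_j b j x * E j x).
    by apply: rgd_sum => j _; apply: (rgdM (hfun_rgd _ (hb j)) (rE j y)).
  have h0 y : r y * (\sum_j b j y * E j y) = 0.
    have hc' : \sum_j \sum_t c (j, t) * (b j y * (r y * (th y ^+ m * e t (y *+ n)))) = 0.
      by rewrite pair_bigA -[RHS](hc y); apply: eq_bigr => -[].
    rewrite -[RHS]hc' mulr_sumr; apply: eq_bigr => j _; rewrite !mulr_sumr; apply: eq_bigr => t _ /=; ring.
  case: (regular_zero_product irrA r1 r2 h0) => [/(_ (0 : A)) /eqP|]; last exact.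
  by rewrite expf_eq0 (negPf hi0) andbF.
have n0 j : @near L (asp A) (0 : A) (fun x => E j x = 0).
  apply: near_impl nb => x hx; rewrite EU; have -> : U j (x *+ n) = 0; last by rewrite mulr0.
  apply: (hx (fun j => U j (x *+ n))) => i.
  have := h1 (x + g i); under eq_bigr do rewrite EU mulrnDl gtor addr0 mulrCA.
  by rewrite -mulr_sumr => /eqP; rewrite mulf_eq0 expf_eq0 (negPf (th0 _)) andbF => /eqP.
case=> j t; have := ind (fun t => c (j, t)); apply=> y.
case: (n_surj y) => x <-.
have := @rgd_identity L (asp A) _ (E j) (0 : A) irrA (rE j) (n0 j) x.
by rewrite EU => /eqP; rewrite mulf_eq0 expf_eq0 (negPf (th0 _)) andbF => /eqP.
Qed.

(** Iteration gives q^k independent forms in degree at most a constant times n^(2k), where the space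
    of forms has dimension at most a constant times n^(2kd). For large k this forces the bound. *)
Lemma torsion_count : (q <= (n ^ 2) ^ d)%N.
Proof.
case: growth_step => c0 step.
have it k : exists m (T : finType) (e : T -> A -> L), [/\ @indep L (asp A) T e, forall t, hf m (e t),
    #|T| = (q ^ k)%N & (m + c0.+1 <= c0.+1 * (n ^ 2) ^ k)%N].
  elim: k => [|k [m [T [e [ind he cT lem]]]]].
    exists 0%N, unit, (fun _ _ => 1); split=> [c hc []|t||]; rewrite ?card_unit ?expn0 ?muln1 //.
      by have := hc (0 : A); rewrite (bigD1 tt) //= big1 ?addr0 ?mulr1 // => -[].
    exact: (hfun1 (asp A) anyL_scalars).
  case: (step m T e ind he) => e' [ind' he'].
  exists (n ^ 2 * m + c0)%N, ('I_q * T)%type, e'; split=> //.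
    by rewrite card_prod card_ord cT expnS.
  have : (2 <= n ^ 2)%N by rewrite -mulnn; nia.
  rewrite [(_ ^ k.+1)%N]expnS; move: ((n ^ 2) ^ k)%N lem => N; move: (n ^ 2)%N => n2 lem h2.
  have := leq_mul (leqnn n2) lem; have := leq_mul h2 (leqnn c0.+1).
  rewrite mulnDr [(c0.+1 * (n2 * N))%N]mulnCA; lia.
rewrite leqNgt; apply/negP; set N := ((n ^ 2) ^ d)%N => lt.
have N0 : (0 < N)%N by rewrite !expn_gt0 ltnW.
pose C' := (C * c0.+1 ^ d)%N.
have up k : (N.+1 ^ k <= C' * N ^ k)%N.
  case: (it k) => m [T [e [ind he cT lem]]]; case: (growth m) => K dK leK.
  have lek : (N.+1 ^ k <= q ^ k)%N by case: (k) => // k'; rewrite leq_exp2r.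
  apply: leq_trans lek _.
  have := indep_le dK he ind; rewrite cT => /leq_trans; apply.
  apply: (leq_trans leK); rewrite /C' -mulnA leq_mul2l; apply/orP; right.
  rewrite /N -[((_ ^ d) ^ k)%N]expnM [(d * k)%N]mulnC expnM -expnMn; case: (d) => // d'; rewrite leq_exp2r //.
  by apply: leq_trans lem; lia.
(* Bernoulli's inequality for (1 + 1/N)^k, cleared of denominators; at k = N C' + 1 it contradicts
   [up]. *)
have bern k : (N ^ k * (N + k) <= N * N.+1 ^ k)%N.
  elim: k => [|k IH]; first by rewrite !expn0 addn0 mul1n muln1.
  rewrite !expnS; move: (N ^ k)%N (N.+1 ^ k)%N IH => a b; nia.
have := bern (N * C').+1; have := up (N * C').+1.
have : (0 < N ^ (N * C').+1)%N by rewrite expn_gt0 N0.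
move: (N ^ _)%N (N.+1 ^ _)%N => a b; nia.
Qed.
End TorsionCount.

Section Reembedding.
Variable L : closedFieldType.

Lemma image_projective (X W : pspace L) (f : X -> W) : projective anyL X -> projective anyL W ->
  morph anyL f -> injective f -> projective anyL (PSpace (fun x => crd (f x))).
Proof.
move=> pX pW mf finj; have eW : embedded W by case: pW.
exact: (embed_projective pW finj (closed_image pX eW mf)).
Qed.

Variables (T : Type) (N N' : nat) (c : T -> 'rV[L]_N) (c' : T -> 'rV[L]_N').
Hypotheses (e : embedded (PSpace c)) (e' : embedded (PSpace c')).
Hypotheses (m : @morph L anyL (PSpace c) (PSpace c') id) (m' : @morph L anyL (PSpace c') (PSpace c) id).

Lemma irreducible_reembed (Z : T -> Prop) : @irreducible L (PSpace c) Z -> @irreducible L (PSpace c') Z.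
Proof.
case=> ne irr; split=> // Z1 Z2 c1 c2; apply: irr.
- exact: (@zclosed_preimage L (PSpace c) (PSpace c') id Z1 e' m c1).
- exact: (@zclosed_preimage L (PSpace c) (PSpace c') id Z2 e' m c2).
Qed.

Lemma dim_ge_reembed d : dim_ge (PSpace c) d -> dim_ge (PSpace c') d.
Proof.
case=> Z [h h']; exists Z; split=> // i /h [cZ iZ]; split.
  exact: (@zclosed_preimage L (PSpace c') (PSpace c) id (Z i) e m' cZ).
exact: irreducible_reembed.
Qed.
End Reembedding.

Lemma quotient_power (F : fieldType) (a1 a2 a3 a4 b1 b2 b3 b4 : F) n s :
  a1 != 0 -> a2 != 0 -> a3 != 0 -> a4 != 0 -> b1 != 0 -> b2 != 0 -> b3 != 0 -> b4 != 0 ->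
  (a3 * a4 / (a1 * a2) ^+ s) ^+ n * ((a1 ^+ n / b1 * (a2 ^+ n / b2)) ^+ s *
    (a3 ^+ n / b3 * (a4 ^+ n / b4))^-1) = b3 * b4 / (b1 * b2) ^+ s.
Proof.
move=> *; rewrite !(expr_div_n, exprMn) -!exprM [(n * s)%N]mulnC.
by field; rewrite !expf_neq0 //; repeat (apply/andP; split).
Qed.

Section SymmetricEmbedding.
Variables (L : closedFieldType) (S : L -> Prop) (A : avar L).
Hypothesis aA : abelian_variety S A.
Let pA : projective anyL (asp A). Proof. by case: (abelian_varietyP aA). Qed.
Let irrA : @irreducible L (asp A) (fun=> True). Proof. by case: (abelian_varietyP aA). Qed.
Let mA : @morph L anyL (pprod (asp A) (asp A)) (asp A) (fun u => u.1 + u.2 : A).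
Proof. by case: (abelian_varietyP aA). Qed.
Let nA : @morph L anyL (asp A) (asp A) (fun x => - x : A).
Proof. by case: (abelian_varietyP aA). Qed.
Let eA : embedded (asp A). Proof. by case: pA. Qed.
Variables (N : nat) (c : A -> 'rV[L]_N).
Let Y := PSpace c.
Hypothesis pY : projective anyL Y.
Hypothesis mAY : @morph L anyL (asp A) Y id.
Hypothesis mYA : @morph L anyL Y (asp A) id.
Let eY : embedded Y. Proof. by case: pY. Qed.

(** The coordinates of x and of -x are multiplied together, so that O(1) becomes symmetric and
    [muln_symmetric] applies to it. *)
Definition symmetrized : avar L := AVar (fun x : A => crd ((x, - x) : pprod Y Y)).
Notation A' := symmetrized.

Let mpair : @morph L anyL (asp A) (pprod Y Y) (fun x : A => (x, - x)).
Proof.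
apply: morph_pair => //.
exact: (@morph_comp L anyL (asp A) (asp A) Y (fun x => - x : A) id anyL_scalars eA eY nA mAY).
Qed.

Lemma symmetrized_projective : projective anyL (asp A').
Proof.
by apply: (image_projective pA (pprod_projective anyL_scalars pY pY) mpair) => x y [].
Qed.
Let eA' : embedded (asp A'). Proof. by case: symmetrized_projective. Qed.

Lemma to_symmetrized : @morph L anyL (asp A) (asp A') id.
Proof. exact: mpair. Qed.

Lemma of_symmetrized : @morph L anyL (asp A') (asp A) id.
Proof.
have m1 : @morph L anyL (asp A') (pprod Y Y) (fun x : A => (x, - x)) := morph_id anyL_scalars eA'.
have m2 := @morph_comp L anyL (asp A') (pprod Y Y) Y _ fst anyL_scalars (pprod_embedded eY eY) eY m1 (morph_fst anyL_scalars eY eY).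
exact: (@morph_comp L anyL (asp A') Y (asp A) id id anyL_scalars eY eA m2 mYA).
Qed.

Lemma symmetrized_add : @morph L anyL (pprod (asp A') (asp A')) (asp A') (fun u => u.1 + u.2 : A).
Proof.
have m1 := @morph_comp L anyL _ (asp A') (asp A) _ id anyL_scalars eA' eA (morph_fst anyL_scalars eA' eA') of_symmetrized.
have m2 := @morph_comp L anyL _ (asp A') (asp A) _ id anyL_scalars eA' eA (morph_snd anyL_scalars eA' eA') of_symmetrized.
have m3 := morph_add eA mA m1 m2.
exact: (@morph_comp L anyL _ (asp A) (asp A') _ id anyL_scalars eA eA' m3 to_symmetrized).
Qed.

Let o : A -> A -> L := @frame L Y (lb_O1 Y).

Lemma frame_symmetrized : @Tr L (asp A') (fun x y => @frame L (asp A') (lb_O1 (asp A')) x y / (o x y * o (- x) (- y))).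
Proof.
have eYY := pprod_embedded eY eY.
case: (frame_index (lb_O1_local eY)) => i [/= iU di].
case: (frame_index (lb_O1_local eA')) => k [/= kU dk].
have ko x : exists a b, k x = mxvec_index a b.
  by case/mxvec_indexP: (k x) => a b; exists a, b.
have /boolp.choice [ab hab] x : exists ab : 'I_N * 'I_N, k x = mxvec_index ab.1 ab.2.
  by case: (ko x) => a [b e]; exists (a, b).
have kE x y : crd ((y, - y) : pprod Y Y) 0 (k x) = c y 0 (ab x).1 * c (- y) 0 (ab x).2.
  by rewrite hab pprod_crd.
have c1 x : c x 0 (ab x).1 != 0 by have := kU x; rewrite kE mulf_eq0 negb_or => /andP[].
have c2 x : c (- x) 0 (ab x).2 != 0 by have := kU x; rewrite kE mulf_eq0 negb_or => /andP[].
exists (fun y => c y 0 (i y) * c (- y) 0 (i (- y)) / crd ((y, - y) : pprod Y Y) 0 (k y)) => x.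
have hY j z : @rgd L 1 Y z (fun y => c y 0 j) by apply: hfun_rgd; apply: (hfun_crd anyL_scalars).
have u1 : @unitat L Y x (fun y => c y 0 (i x) / c y 0 (ab x).1).
  by split; [apply: (@rgd_div L 1 0)|rewrite mulf_neq0 ?invr_eq0 //; apply: iU].
have u2 : @unitat L Y (- x) (fun y => c y 0 (i (- x)) / c y 0 (ab x).2).
  by split; [apply: (@rgd_div L 1 0)|rewrite mulf_neq0 ?invr_eq0 //; apply: iU].
have mA'Y := @morph_comp L anyL (asp A') (asp A) Y id id anyL_scalars eA eY of_symmetrized mAY.
have nA'Y : @morph L anyL (asp A') Y (fun x : A => - x).
  have h := @morph_comp L anyL (asp A') (asp A) (asp A) id (fun x => - x : A) anyL_scalars eA eA of_symmetrized nA.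
  exact: (@morph_comp L anyL (asp A') (asp A) Y (fun x => - x : A) id anyL_scalars eA eY h mAY).
have := unitatM (@unitat_pull L (asp A') Y id x _ eY mA'Y u1) (@unitat_pull L (asp A') Y (fun x => - x : A) x _ eY nA'Y u2).
have n1 : @near L (asp A') x (fun y => crd ((y, - y) : pprod Y Y) 0 (k x) != 0).
  exists 1%N, (fun y => crd (y : asp A') 0 (k x)); split; [exact: (hfun_crd anyL_scalars (X := asp A'))|exact: kU|by []].
apply: unitat_near; apply: near_impl n1 => y; rewrite dk /o !di /= -!/(crd ((y, - y) : pprod Y Y)) !kE.
rewrite mulf_eq0 negb_or => /andP[e1 e2].
have e3 : c y 0 (i y) != 0 by apply: iU.
have e4 : c (- y) 0 (i (- y)) != 0 by apply: iU.
have := c1 y; have := c2 y => e5 e6.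
have [->|e7] := eqVneq (c y 0 (i x)) 0; first by rewrite !(mul0r, mulr0, invr0).
have [->|e8] := eqVneq (c (- y) 0 (i (- x))) 0; first by rewrite !(mul0r, mulr0, invr0).
fld.
Qed.

Variables (M : lbdata (asp A)) (n0 n : nat).
Hypothesis lM : lb_local M.
Hypothesis iM : lb_iso (lb_exp M n0) (@lb_pull L (asp A) Y id (lb_O1 Y)).
Let m : A -> A -> L := @frame L (asp A) M.
Hypothesis hMn : @Tr L (asp A) (fun x y => m (x *+ n) (y *+ n) * m (- (x *+ n)) (- (y *+ n)) /
  (m x y * m (- x) (- y)) ^+ (n ^ 2)).

(** The ample bundle is only known through its power [n0], so the isomorphism of [hMn] is raised to
    that power and compared with O(1) in four places: at x, -x, nx and -nx. *)
Lemma symmetrized_multiplier : exists th : A -> L, (forall x, th x != 0) /\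
  forall j x, @rgd L (n ^ 2) (asp A') x (fun y => th y * av_crd (y *+ n : A') 0 j).
Proof.
have mn : @morph L anyL (asp A') (asp A') (fun x => x *+ n : A').
  by apply: (@morph_muln L A' eA' symmetrized_add); apply: morph_id.
apply: (Tr_regular_multiplier (f := (fun x => x *+ n : A') : asp A' -> asp A')) => //.
have lO := lb_O1_local eA'; have lY := lb_O1_local eY.
apply/lb_isoP; [exact: lb_pull_local|exact: lb_exp_local|].
have mnA : @morph L anyL (asp A) (asp A) (fun x => x *+ n) by apply: morph_muln => //; apply: morph_id.
have mnnA : @morph L anyL (asp A) (asp A) (fun x => - (x *+ n)).
  exact: (@morph_comp L anyL (asp A) (asp A) (asp A) _ (fun x => - x : A) anyL_scalars eA eA mnA nA).
have t1 : @Tr L (asp A) (fun x y => m x y ^+ n0 / o x y).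
  have lYA := lb_pull_local eY mAY lY.
  have /lb_isoP := iM; move/(_ (lb_exp_local n0 lM) lYA); apply: Tr_near => x; apply: near_all => y.
  by rewrite frame_exp frame_pull.
have t2 := Tr_pull eA nA t1; have t3 := Tr_pull eA mnA t1; have t4 := Tr_pull eA mnnA t1.
have t5 : @Tr L (asp A) (fun x y => o (x *+ n) (y *+ n) * o (- (x *+ n)) (- (y *+ n)) / (o x y * o (- x) (- y)) ^+ (n ^ 2)).
  apply: Tr_near (TrM (TrX n0 hMn) (TrM (TrX (n ^ 2) (TrM t1 t2)) (TrV (TrM t3 t4)))) => x.
  have nm (f : A -> A) : @morph L anyL (asp A) (asp A) f ->
      @near L (asp A) x (fun y => m (f x) (f y) != 0 /\ o (f x) (f y) != 0).
    move=> mf; have h1 := frame_near x (lb_pull_local eA mf lM).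
    have h2 := frame_near x (lb_pull_local eA mf (lb_pull_local eY mAY lY)).
    by apply: near_and; [exact: h1|exact: h2].
  have q1 := nm _ (morph_id anyL_scalars eA); have q2 := nm _ nA; have q3 := nm _ mnA; have q4 := nm _ mnnA.
  apply: near_impl (near_and (near_and q1 q2) (near_and q3 q4)) => y [[[a1 b1] [a2 b2]] [[a3 b3] [a4 b4]]].
  rewrite /= in a1 b1.
  exact: quotient_power.
have t6 := Tr_pull eA of_symmetrized t5.
have t7 := Tr_pull eA' mn frame_symmetrized.
apply: Tr_near (TrM t7 (TrM t6 (TrV (TrX (n ^ 2) frame_symmetrized)))) => x.
have nO (f : A -> A) : @morph L anyL (asp A') (asp A) f ->
    @near L (asp A') x (fun y => o (f x) (f y) != 0).
  by move=> mf; have := frame_near x (lb_pull_local eA mf (lb_pull_local eY mAY lY)).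
have comp (f : A -> A) : @morph L anyL (asp A) (asp A) f -> @morph L anyL (asp A') (asp A) f.
  exact: (@morph_comp L anyL (asp A') (asp A) (asp A) id f anyL_scalars eA eA of_symmetrized).
have q1 := nO _ of_symmetrized; have q2 := nO _ (comp _ nA); have q3 := nO _ (comp _ mnA); have q4 := nO _ (comp _ mnnA).
have q5 := frame_near x (lb_pull_local eA' mn lO).
have q6 := frame_near x lO.
apply: near_impl (near_and (near_and (near_and q1 q2) (near_and q3 q4)) (near_and q5 q6)) => y.
rewrite frame_exp !frame_pull => -[[[b1 b2] [b3 b4]] [b5 b6]]; rewrite /= in b1.
rewrite expr_div_n; have := expf_neq0 (n ^ 2) (mulf_neq0 b1 b2) => b7; have := expf_neq0 (n ^ 2) b6 => b8.
by rewrite invf_div; field; rewrite b3 b4 b7 b8.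
Qed.

End SymmetricEmbedding.

Section TorsionBound.
Variables (L : closedFieldType) (S : L -> Prop) (A : pavar L).
Hypothesis aA : abelian_variety S A.
Hypothesis hA : principally_polarized S A.

Lemma polarization_bundle : exists M : lbdata (asp A), [/\ lb_local M, ample M & forall a : A,
  @Tr L (asp A) (fun x y => @frame L (pprod (asp A) (asp (pdual A))) (poincare A) (x, polar a) (y, polar a) /
    (@frame L (asp A) M (x + a : A) (y + a : A) / @frame L (asp A) M x y))].
Proof.
case: (abelian_varietyP aA) => pA irrA mA nA; have eA : embedded (asp A) by case: pA.
case: hA => hD [mpol addpol] _ [M [lM aM hM]]; exists M; split=> //; first exact: line_bundleP lM.
move=> a; have {}lM := line_bundleP lM; have lP := poincare_local hD.
have eB : embedded (asp (pdual A)) by case: hD => -[[[]]].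
have lt := lb_pull_local eA (morph_translate eA mA a) lM.
have := hM a => /lb_isoP h.
have {h} h1 := h (fibre_local eA (polar a : asp (pdual A)) eB lP) (lb_mul_local lt (lb_inv_local lM)).
apply: Tr_near (TrM h1 (frame_mul lt (lb_inv_local lM))) => x.
have n1 := frame_near x (lb_mul_local lt (lb_inv_local lM)).
apply: near_impl n1 => y; rewrite frame_inv !frame_pull => c; by rewrite mulrA divfK.
Qed.

(** Dimension at most 2 gives three forms without common zero, hence quadratic growth;
    multiplication by n scales degrees by n^2, and the exponents multiply to 4. *)
Lemma torsion_bound n : ~ dim_ge (asp A) 3 -> (1 < n)%N -> n%:R != 0 :> L ->
  exists s : seq A, [/\ uniq s, forall x, (x \in s) = (x *+ n == 0) & (size s <= n ^ 4)%N].
Proof.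
move=> nd n1 n0; case: (abelian_varietyP aA) => pA irrA mA nA; have eA : embedded (asp A) by case: pA.
case: polarization_bundle => M [lM [n' n'0 [N [c]]]] /= [pY mAY mYA iM] hM.
case: (hA) => hD [mpol addpol] _ _.
have hMn := muln_symmetric aA hD (morph_any mpol) addpol lM hM n.
case: (symmetrized_multiplier aA pY mAY mYA lM iM hMn) => th [th0 rth].
have pA' := symmetrized_projective aA pY mAY.
have eA' : embedded (asp (symmetrized c)) by case: pA'.
have mAA' := to_symmetrized aA pY mAY; have mA'A := of_symmetrized aA pY mAY mYA.
have irrA' : @irreducible L (asp (symmetrized c)) (fun=> True) := irreducible_reembed eA' mAA' irrA.
have nd' : ~ dim_ge (asp (symmetrized c)) 3.
  by move=> dg; apply: nd; apply: (dim_ge_reembed eA' eA mA'A mAA' dg).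
case: (growth_upper pA' (cut_dim pA' irrA' nd')) => C gr.
have [s hs] := torsion_finite pA mA n0.
pose s' := undup [seq x <- s | x *+ n == 0].
have s'E x : (x \in s') = (x *+ n == 0).
  rewrite mem_undup mem_filter; case: eqP => //= xn; exact: hs.
exists s'; split=> //; first exact: undup_uniq.
have sur := muln_surjective pA irrA mA nd n0.
have := @torsion_count L (symmetrized c) n 2 pA' irrA' (symmetrized_add aA pY mAY mYA) n1 sur C gr th th0 rth
  (size s') (fun i => nth 0 s' i).
rewrite -expnM; apply.
- by move=> i j /eqP; rewrite nth_uniq ?undup_uniq // => /eqP/val_inj.
- by move=> i; apply/eqP; rewrite -s'E mem_nth.
- have : 0 \in s' by rewrite s'E mul0rn.
  by case: (s').
Qed.
End TorsionBound.

(** * Adjoint homomorphisms *)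

Section Adjunction.
Variables (L : closedFieldType) (S : L -> Prop).

(** The bundle [M] is kept as a parameter, because adjoints are compared through its Mumford bundle;
    [pol_frame] is the relation between polarization and bundle in terms of cocycles. *)
Record polarized (A : pavar L) (M : lbdata (asp A)) : Prop := Polarized {
  pol_av : abelian_variety S A;
  pol_pp : principally_polarized S A;
  pol_local : lb_local M;
  pol_frame : forall a : A,
    @Tr L (asp A) (fun x y => @frame L (pprod (asp A) (asp (pdual A))) (poincare A) (x, polar a) (y, polar a) /
      (@frame L (asp A) M (x + a : A) (y + a : A) / @frame L (asp A) M x y)) }.

Lemma polarized_ex (A : pavar L) : abelian_variety S A -> principally_polarized S A ->
  exists M : lbdata (asp A), polarized M.
Proof.
by move=> aA hA; case: (polarization_bundle aA hA) => M [lM _ hM]; exists M.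
Qed.

Notation pf A := (@frame L (pprod (asp A) (asp (pdual A))) (poincare A)).

Section One.
Variables (A : pavar L) (M : lbdata (asp A)).
Hypothesis hA : polarized M.

Lemma pol_projective : projective anyL (asp A).
Proof. by case: (abelian_varietyP (pol_av hA)). Qed.
Lemma pol_irreducible : @irreducible L (asp A) (fun=> True).
Proof. by case: (abelian_varietyP (pol_av hA)). Qed.
Lemma pol_add : @morph L anyL (pprod (asp A) (asp A)) (asp A) (fun u => u.1 + u.2 : A).
Proof. by case: (abelian_varietyP (pol_av hA)). Qed.
Lemma pol_embedded : embedded (asp A). Proof. by case: pol_projective. Qed.
Lemma pol_translate (a : A) : @morph L anyL (asp A) (asp A) (fun x => x + a : A).
Proof. exact: morph_translate pol_embedded pol_add a. Qed.
Lemma pol_dual : dual_variety S (poincare A).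
Proof. by case: (pol_pp hA). Qed.
Lemma pol_morph : @morph L anyL (asp A) (asp (pdual A)) (@polar L A).
Proof. by case: (pol_pp hA) => _ [/morph_any]. Qed.
Lemma pol_additive : {morph @polar L A : x y / x + y}.
Proof. by case: (pol_pp hA) => _ []. Qed.
Lemma pol_inverse : exists2 mu : pdual A -> A, hom S mu & cancel (@polar L A) mu /\ cancel mu (@polar L A).
Proof. by case: (pol_pp hA). Qed.
Lemma pol_inj : injective (@polar L A).
Proof. by case: pol_inverse => mu _ [/can_inj]. Qed.
Lemma pol_dual_embedded : embedded (asp (pdual A)).
Proof. by case: pol_dual => -[[[]]]. Qed.

Lemma pol_lambda_poincare : @Tr L (pprod (asp A) (asp A))
  (fun u v => lambda_frame M u v / pf A (u.1, polar u.2) (v.1, polar v.2)).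
Proof. exact: (lambda_poincare (pol_av hA) pol_dual (pol_local hA) (pol_frame hA)). Qed.

Lemma pol_lambda_addr (Z : pspace L) (a b c : Z -> A) :
  @morph L anyL Z (asp A) a -> @morph L anyL Z (asp A) b -> @morph L anyL Z (asp A) c ->
  @Tr L Z (fun z w => lambda_frame M (a z, b z + c z) (a w, b w + c w) /
    (lambda_frame M (a z, b z) (a w, b w) * lambda_frame M (a z, c z) (a w, c w))).
Proof. exact: (lambda_addr (pol_av hA) pol_dual pol_morph pol_additive (pol_local hA) (pol_frame hA)). Qed.

Lemma pol_lambda_near (Z : pspace L) (a b : Z -> A) z : @morph L anyL Z (asp A) a -> @morph L anyL Z (asp A) b ->
  near z (fun w => lambda_frame M (a z, b z) (a w, b w) != 0).
Proof. exact: (lambda_near (pol_av hA) (pol_local hA)). Qed.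

Lemma pol_poincare_near (Z : pspace L) (a : Z -> A) (b : Z -> pdual A) z :
  @morph L anyL Z (asp A) a -> @morph L anyL Z (asp (pdual A)) b ->
  near z (fun w => pf A (a z, b z) (a w, b w) != 0).
Proof.
move=> ma mb; have eAB := pprod_embedded pol_embedded pol_dual_embedded.
exact: (frame_near z (lb_pull_local eAB (morph_pair anyL_scalars pol_embedded pol_dual_embedded ma mb) (poincare_local pol_dual))).
Qed.

Lemma pol_compare (Z : pspace L) (a b : Z -> A) : @morph L anyL Z (asp A) a -> @morph L anyL Z (asp A) b ->
  @Tr L Z (fun z w => lambda_frame M (a z, b z) (a w, b w) / pf A (a z, polar (b z)) (a w, polar (b w))).
Proof.
move=> ma mb; have eA := pol_embedded.
exact: (Tr_pull (pprod_embedded eA eA) (morph_pair anyL_scalars eA eA ma mb) pol_lambda_poincare).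
Qed.
End One.

Section Two.
Variables (A B : pavar L) (MA : lbdata (asp A)) (MB : lbdata (asp B)).
Hypotheses (hA : polarized MA) (hB : polarized MB).
Let eA := pol_embedded hA. Let eB := pol_embedded hB.

(** An isomorphism over the whole product. This form is symmetric in f and g and additive, because
    Mumford bundles are. *)
Definition adjoint (f : A -> B) (g : B -> A) := @Tr L (pprod (asp A) (asp B))
  (fun u v => lambda_frame MB (f u.1, u.2) (f v.1, v.2) / lambda_frame MA (u.1, g u.2) (v.1, g v.2)).

(** The same condition for each b separately: g is the dual of f transported by the two
    polarizations. This form gives uniqueness and composition. *)
Definition fibre_adjoint (f : A -> B) (g : B -> A) := forall b : B, @Tr L (asp A)
  (fun x y => pf B (f x, polar b) (f y, polar b) / pf A (x, polar (g b)) (y, polar (g b))).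

Lemma morph_fst_of (Z : pspace L) (f : A -> Z) : embedded Z -> @morph L anyL (asp A) Z f ->
  @morph L anyL (pprod (asp A) (asp B)) Z (fun u => f u.1).
Proof.
move=> eZ mf.
exact: (@morph_comp L anyL (pprod (asp A) (asp B)) (asp A) Z fst f anyL_scalars eA eZ (morph_fst anyL_scalars eA eB) mf).
Qed.

Lemma morph_snd_of (Z : pspace L) (f : B -> Z) : embedded Z -> @morph L anyL (asp B) Z f ->
  @morph L anyL (pprod (asp A) (asp B)) Z (fun u => f u.2).
Proof.
move=> eZ mf.
exact: (@morph_comp L anyL (pprod (asp A) (asp B)) (asp B) Z snd f anyL_scalars eB eZ (morph_snd anyL_scalars eA eB) mf).
Qed.

(** The passage from fibres to the product is [dual_univ], which also shows that g is a morphism. *)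
Lemma fibre_adjoint_adjoint f g : @morph L anyL (asp A) (asp B) f -> f 0 = 0 ->
  fibre_adjoint f g -> @morph L anyL (asp B) (asp A) g /\ adjoint f g.
Proof.
move=> mf f0 h.
have eA' := pol_dual_embedded hA; have eB' := pol_dual_embedded hB.
have eBB := pprod_embedded eB eB'.
have m1 : @morph L anyL (pprod (asp A) (asp B)) (pprod (asp B) (asp (pdual B))) (fun u => (f u.1, polar u.2)).
  apply: morph_pair => //; [exact: morph_fst_of|apply: morph_snd_of => //; exact: pol_morph hB].
have lP := poincare_local (pol_dual hB).
have lQ := lb_pull_local eBB m1 lP.
case: (@dual_univ L S A (pdual A) (poincare A) eA (pol_translate hA) (pol_dual hA) (asp B) _ (fun b => polar (g b)) (pol_projective hB) lQ).
- apply/(at_originP eA eB lQ).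
  have [_ _ o _ _] := pol_dual hB.
  have /at_originP := o; move/(_ eB eB' lP) => h0.
  have := Tr_pull eB' (pol_morph hB) h0; apply: Tr_near => x; apply: near_all => y.
  by rewrite frame_pull /= f0.
- move=> b; apply/lb_isoP; [exact: fibre_local|exact: (fibre_local eA _ eA' (poincare_local (pol_dual hA)))|].
  exact: h.
move=> mg tg.
case: (pol_inverse hA) => mu [mmu _] [muK _].
have {mg} mg : @morph L anyL (asp B) (asp A) g.
  have := @morph_comp L anyL (asp B) (asp (pdual A)) (asp A) _ mu anyL_scalars eA' eA mg (morph_any mmu).
  by congr morph; apply: boolp.funext => b /=; rewrite muK.
split=> //.
have c1 := pol_compare hB (morph_fst_of eB mf) (morph_snd_of eB (morph_id anyL_scalars eB)).
have c2 := pol_compare hA (morph_fst_of eA (morph_id anyL_scalars eA)) (morph_snd_of eA mg).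
apply: Tr_near (TrM (TrM c1 (TrV c2)) tg) => u.
have n1 := pol_poincare_near hB u (morph_fst_of eB mf) (morph_snd_of eB' (pol_morph hB)).
have n2 := pol_poincare_near hA u (morph_fst_of eA (morph_id anyL_scalars eA))
   (morph_snd_of eA' (@morph_comp L anyL (asp B) (asp A) (asp (pdual A)) _ _ anyL_scalars eA eA' mg (pol_morph hA))).
have n3 := pol_lambda_near hA u (morph_fst_of eA (morph_id anyL_scalars eA)) (morph_snd_of eA mg).
apply: near_impl (near_and (near_and n1 n2) n3) => v [[]]; rewrite frame_pull /= => a1 a2 a3; fld.
Qed.

Lemma adjoint_fibre f g : @morph L anyL (asp A) (asp B) f -> @morph L anyL (asp B) (asp A) g ->
  adjoint f g -> fibre_adjoint f g.
Proof.
move=> mf mg h b; have eAB := pprod_embedded eA eB.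
have eA' := pol_dual_embedded hA; have eB' := pol_dual_embedded hB.
have t1 := Tr_pull eAB (@morph_at L A eA (asp B) b eB) h.
have mb : @morph L anyL (asp A) (asp B) (fun=> b) := @morph_const_any L (asp A) (asp B) b eB.
have mi := morph_id anyL_scalars eA.
have mgb : @morph L anyL (asp A) (asp A) (fun=> g b) := @morph_const_any L (asp A) (asp A) (g b) eA.
have c1 := pol_compare hB mf mb; have c2 := pol_compare hA mi mgb.
apply: Tr_near (TrM (TrM (TrV c1) c2) t1) => x.
have n1 := pol_lambda_near hB x mf mb; have n2 := pol_lambda_near hA x mi mgb.
have mp : @morph L anyL (asp A) (asp (pdual A)) (fun=> polar (g b)) := @morph_const_any L (asp A) (asp (pdual A)) (polar (g b)) eA'.
have mp' : @morph L anyL (asp A) (asp (pdual B)) (fun=> polar b) := @morph_const_any L (asp A) (asp (pdual B)) (polar b) eB'.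
have n3 := pol_poincare_near hA x mi mp. have n4 := pol_poincare_near hB x mf mp'.
by apply: near_impl (near_and (near_and n1 n2) (near_and n3 n4)) => y [[a1 a2] [a3 a4]]; fld.
Qed.

Lemma fibre_adjoint_unique f g g' : @morph L anyL (asp A) (asp B) f ->
  fibre_adjoint f g -> fibre_adjoint f g' -> g =1 g'.
Proof.
move=> mf h h' b; apply: (pol_inj hA); apply: (dual_inj eA (pol_dual hA)).
have eB' := pol_dual_embedded hB.
apply: Tr_near (TrM (TrV (h b)) (h' b)) => x.
have n := pol_poincare_near hB x mf (@morph_const_any L (asp A) (asp (pdual B)) (polar b) eB').
by apply: near_impl n => y a1; rewrite invf_div mulrA divfK.
Qed.

Lemma fibre_adjoint_additive f g : @morph L anyL (asp A) (asp B) f ->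
  fibre_adjoint f g -> {morph g : x y / x + y}.
Proof.
move=> mf h b b'; apply: (pol_inj hA); rewrite (pol_additive hA); apply: (dual_inj eA (pol_dual hA)).
have eA' := pol_dual_embedded hA; have eB' := pol_dual_embedded hB.
have bil (C : pavar L) (MC : lbdata (asp C)) (a : A -> C) (c c' : pdual C) : polarized MC -> @morph L anyL (asp A) (asp C) a ->
    @Tr L (asp A) (fun x y => pf C (a x, c + c') (a y, c + c') / (pf C (a x, c) (a y, c) * pf C (a x, c') (a y, c'))).
  move=> hC ma; have eC := pol_embedded hC; have eC' := pol_dual_embedded hC.
  have eCC := pprod_embedded eC' eC'.
  have mc d : @morph L anyL (asp A) (asp (pdual C)) (fun=> d) := @morph_const_any L (asp A) (asp (pdual C)) d eC'.
  exact: (Tr_pull (pprod_embedded eC eCC) (morph_pair anyL_scalars eC eCC ma (morph_pair anyL_scalars eC' eC' (mc c) (mc c')))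
    (dual_bilinear eC (pol_translate hC) (pol_dual hC))).
have mi := morph_id anyL_scalars eA.
have t1 := bil B MB f (polar b) (polar b') hB mf.
have t2 := bil A MA id (polar (g b)) (polar (g b')) hA mi.
apply: Tr_near (TrM (TrM (TrV (h (b + b'))) t1) (TrM (TrM (h b) (h b')) (TrV t2))) => x.
have nA c := pol_poincare_near hA x mi (@morph_const_any L (asp A) (asp (pdual A)) c eA').
have nB c := pol_poincare_near hB x mf (@morph_const_any L (asp A) (asp (pdual B)) c eB').
apply: near_impl (near_and (near_and (near_and (nA (polar (g b))) (nA (polar (g b')))) (near_and (nA (polar (g (b + b')))) (nA (polar (g b) + polar (g b')))))
  (near_and (near_and (nB (polar b)) (nB (polar b'))) (nB (polar b + polar b')))) => y.
rewrite (pol_additive hB) => -[[[a1 a2] [a3 a4]] [[b1 b2] b3]]; fld.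
Qed.

(** Pulling the Poincare bundle of [B] back by f and the polarization gives a family over [B] of
    elements of Pic^0 of [A]; its classifying map followed by the inverse polarization of [A] is the
    adjoint. *)
Lemma adjoint_ex f : @morph L anyL (asp A) (asp B) f -> {morph f : x y / x + y} ->
  exists g, [/\ @morph L anyL (asp B) (asp A) g, {morph g : x y / x + y} & fibre_adjoint f g].
Proof.
move=> mf addf; have eA' := pol_dual_embedded hA; have eB' := pol_dual_embedded hB.
have f0 : f 0 = 0 by apply: (@addrI _ (f 0)); rewrite -addf !addr0.
have eBB := pprod_embedded eB eB'.
have m1 : @morph L anyL (pprod (asp A) (asp B)) (pprod (asp B) (asp (pdual B))) (fun u => (f u.1, polar u.2)).
  apply: morph_pair => //; [exact: morph_fst_of|apply: morph_snd_of => //; exact: pol_morph hB].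
have lP := poincare_local (pol_dual hB).
have lQ := lb_pull_local eBB m1 lP.
have [_ hpic o _ _] := pol_dual hB.
have [_ _ _ _ hun] := pol_dual hA.
case: (hun (asp B) _ (projective_quasi (pol_projective hB)) (lb_local_line_bundle lQ)).
- move=> b; split; first by apply: lb_local_line_bundle; apply: fibre_local.
  move=> a; have lf := fibre_local eA (b : asp B) eB lQ.
  apply/(lb_isoP (lb_pull_local eA (pol_translate hA a) lf) lf).
  have [_ /(_ (f a))] := hpic (polar b).
  have lb := fibre_local eB (polar b : asp (pdual B)) eB' lP.
  move/(lb_isoP (lb_pull_local eB (pol_translate hB (f a)) lb) lb) => h.
  have := Tr_pull eB mf h; apply: Tr_near => x; apply: near_all => y.
  by rewrite /fibre !frame_pull addf addf.
- apply/(at_originP eA eB lQ).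
  have /at_originP := o; move/(_ eB eB' lP) => h0.
  have := Tr_pull eB' (pol_morph hB) h0; apply: Tr_near => x; apply: near_all => y.
  by rewrite frame_pull /= f0.
move=> psi [[mpsi ipsi] _].
case: (pol_inverse hA) => mu [mmu _] [muK Kmu].
have eAA := pprod_embedded eA eA'.
have fa : fibre_adjoint f (fun b => mu (psi b)).
  move=> b; rewrite Kmu.
  have mpair : @morph L anyL (pprod (asp A) (asp B)) (pprod (asp A) (asp (pdual A))) (fun u => (u.1, psi u.2)).
    by apply: morph_pair => //; [exact: (morph_fst anyL_scalars)|apply: morph_snd_of].
  move/(lb_isoP (lb_pull_local eAA mpair (poincare_local (pol_dual hA))) lQ) : ipsi => h.
  have := Tr_pull (pprod_embedded eA eB) (@morph_at L A eA (asp B) b eB) (TrV h).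
  apply: Tr_near => x; apply: near_all => y; by rewrite invf_div.
exists (fun b => mu (psi b)); split=> //; last exact: fibre_adjoint_additive fa.
exact: (@morph_comp L anyL (asp B) (asp (pdual A)) (asp A) _ mu anyL_scalars eA' eA mpsi (morph_any mmu)).
Qed.

Lemma adjoint_add f f' g g' : @morph L anyL (asp A) (asp B) f -> @morph L anyL (asp A) (asp B) f' ->
  @morph L anyL (asp B) (asp A) g -> @morph L anyL (asp B) (asp A) g' ->
  adjoint f g -> adjoint f' g' -> adjoint (fun x => f x + f' x) (fun y => g y + g' y).
Proof.
move=> mf mf' mg mg' h h'.
have m1 := morph_fst_of eB mf; have m2 := morph_fst_of eB mf'.
have m3 := morph_snd_of eA mg; have m4 := morph_snd_of eA mg'.
have i1 := morph_fst_of eA (morph_id anyL_scalars eA); have i2 := morph_snd_of eB (morph_id anyL_scalars eB).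
have t1 := pol_lambda_addr hA i1 m3 m4.
have t2 := pol_lambda_addr hB i2 m1 m2.
have s := @lambda_sym L B MB.
apply: Tr_near (TrM (TrM h h') (TrM t2 (TrV t1))) => u.
have n1 := pol_lambda_near hA u i1 m3; have n2 := pol_lambda_near hA u i1 m4.
have n3 := pol_lambda_near hA u i1 (morph_add eA (pol_add hA) m3 m4).
have n4 := pol_lambda_near hB u i2 m1; have n5 := pol_lambda_near hB u i2 m2.
apply: near_impl (near_and (near_and (near_and n1 n2) n3) (near_and n4 n5)) => v.
rewrite /= -!(s (f u.1, u.2)) -!(s (f' u.1, u.2)) -!(s (f u.1 + f' u.1, u.2)) /=.
case=> -[[a1 a2] a3] [a4 a5]; fld.
Qed.
End Two.

Lemma adjoint_sym (A B : pavar L) (MA : lbdata (asp A)) (MB : lbdata (asp B)) f g :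
  polarized MA -> polarized MB -> adjoint MA MB f g -> adjoint MB MA g f.
Proof.
move=> hA hB h; have eA := pol_embedded hA; have eB := pol_embedded hB.
have sw : @morph L anyL (pprod (asp B) (asp A)) (pprod (asp A) (asp B)) (fun u => (u.2, u.1)).
  by apply: morph_pair => //; [exact: (morph_snd anyL_scalars)|exact: (morph_fst anyL_scalars)].
have := Tr_pull (pprod_embedded eA eB) sw h.
move/TrV; apply: Tr_near => u; apply: near_all => v; rewrite /= invf_div.
by rewrite -(lambda_sym MB (f u.2, u.1) (f v.2, v.1)) -(lambda_sym MA (u.2, g u.1) (v.2, g v.1)).
Qed.

Lemma fibre_adjoint_comp (A B C : pavar L) (MA : lbdata (asp A)) (MB : lbdata (asp B))
  (f : A -> B) (g : B -> A) (f' : B -> C) (g' : C -> B) :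
  polarized MA -> polarized MB -> @morph L anyL (asp A) (asp B) f ->
  fibre_adjoint f g -> fibre_adjoint f' g' -> fibre_adjoint (fun x => f' (f x)) (fun y => g (g' y)).
Proof.
move=> hA hB mf h h' c; have eB := pol_embedded hB; have eB' := pol_dual_embedded hB.
have t := Tr_pull eB mf (h' c).
apply: Tr_near (TrM t (h (g' c))) => x.
have n := pol_poincare_near hB x mf (@morph_const_any L (asp A) (asp (pdual B)) (polar (g' c)) eB').
by apply: near_impl n => y a1; rewrite mulrA divfK.
Qed.

Lemma fibre_adjoint_id (A : pavar L) (MA : lbdata (asp A)) : polarized MA -> fibre_adjoint (id : A -> A) (id : A -> A).
Proof.
move=> hA a; have eA := pol_embedded hA; have eA' := pol_dual_embedded hA.
apply: Tr_const (oner_neq0 L) => x.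
have n := pol_poincare_near hA x (morph_id anyL_scalars eA) (@morph_const_any L (asp A) (asp (pdual A)) (polar a) eA').
by apply: near_impl n => y; rewrite /= => a1; rewrite divff.
Qed.
End Adjunction.

(** * Frobenius descent *)

Section Conjugation.
Variables (L : closedFieldType) (S : L -> Prop) (tau : {rmorphism L -> L}).
Hypothesis Stau : forall x, S x -> tau x = x.

(** For [tau] the power map of the base field, this is the Frobenius map on points. *)
Definition conjugates (X : pspace L) (F : X -> X) := forall x, peq (crd (F x)) (map_mx tau (crd x)).

Lemma ev_conj N (v : 'rV[L]_N) (p : {mpoly L[N]}) : ev (map_mx tau v) (map_mpoly tau p) = tau (ev v p).
Proof.
rewrite /ev !mevalE rmorph_sum (perm_big _ (msupp_map_mpoly p (fmorph_inj tau))) /=.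
apply: eq_bigr => m _; rewrite mcoeff_map_mpoly rmorphM rmorph_prod; congr (_ * _).
by apply: eq_bigr => i _; rewrite mxE rmorphXn.
Qed.

Lemma form_conj N d (p : {mpoly L[N]}) : form anyL d p -> form anyL d (map_mpoly tau p).
Proof.
case=> /dhomogP hp _; split=> //; apply/dhomogP => m.
by rewrite (perm_mem (msupp_map_mpoly p (fmorph_inj tau))); apply: hp.
Qed.

Lemma form_fixed N d (p : {mpoly L[N]}) : form S d p -> map_mpoly tau p = p.
Proof. by case=> _ hp; apply/mpolyP => m; rewrite mcoeff_map_mpoly /= Stau. Qed.

Section OneSpace.
Variables (X : pspace L) (F : X -> X).
Hypothesis hF : conjugates F.

Lemma conj_scale : exists2 s : X -> L, forall x, s x != 0 & forall x, crd (F x) = s x *: map_mx tau (crd x).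
Proof.
have /boolp.choice [s hs] x : exists s, s != 0 /\ crd (F x) = s *: map_mx tau (crd x).
  by case: (hF x) => s s0 e; exists s.
by exists s => x; case: (hs x).
Qed.

Lemma hfun_conj d h : hfun anyL d h -> exists h', hfun anyL d h' /\
  forall s x, crd (F x) = s *: map_mx tau (crd x) -> h' (F x) = s ^+ d * tau (h x).
Proof.
case=> p fp ep; exists (fun x => ev (crd x) (map_mpoly tau p)); split.
  by exists (map_mpoly tau p) => //; apply: form_conj.
move=> s x e; have [hp _] := form_conj fp.
by rewrite e (ev_scale _ _ hp) ev_conj ep.
Qed.

Lemma hfun_conj_fixed d h : hfun S d h -> forall s x, crd (F x) = s *: map_mx tau (crd x) ->
  h (F x) = s ^+ d * tau (h x).
Proof.
case=> p fp ep s x e; have [hp _] := fp.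
by rewrite ep e (ev_scale _ _ hp) -{1}(form_fixed fp) ev_conj ep.
Qed.

Lemma zclosed_conj (Z : X -> Prop) : zclosed S Z -> forall x, Z (F x) <-> Z x.
Proof.
move=> /zclosedP [E [hE eE]] x; case: conj_scale => s s0 es.
split=> h; apply/eE => f Ef; case: (hE f Ef) => d hf; have := hfun_conj_fixed hf (es x).
  move/eE: h => -> // /esym/eqP; rewrite mulf_eq0 expf_eq0 (negPf (s0 x)) andbF fmorph_eq0.
  by move/eqP.
by rewrite (proj1 (eE x) h f Ef) rmorph0 mulr0.
Qed.

Lemma regular_conj (U : X -> Prop) f y : regular S U f -> U y -> U (F y) -> f (F y) = tau (f y).
Proof.
move=> rf Uy UFy; case: conj_scale => s s0 es.
case: (rf (F y) UFy) => d [p [q [fp fq qx e]]].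
have E r : form S d r -> ev (crd (F y)) r = s y ^+ d * tau (ev (crd y) r).
  by move=> fr; apply: (@hfun_conj_fixed d (fun z => ev (crd z) r)) => //; exists r.
have qy : ev (crd y) q != 0.
  by move: qx; rewrite E // mulf_eq0 expf_eq0 (negPf (s0 _)) andbF fmorph_eq0.
rewrite e // (e y) // !E // fmorph_div; field.
by rewrite fmorph_eq0 qy expf_neq0.
Qed.

Lemma near_conj x P (G : X -> X) : cancel F G -> near x P -> near (F x) (fun y => P (G y) \/ forall z, y <> F z).
Proof.
move=> FG [d [u [hu ux hP]]]; case: (hfun_conj hu) => u' [hu' eu'].
case: conj_scale => s s0 es; exists d, u'; split=> // [|y uy].
  by rewrite (eu' _ _ (es x)) mulf_neq0 ?expf_neq0 ?fmorph_eq0.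
case: (boolp.pselect (exists z, y = F z)) => [[z yz]|n]; last by right=> z yz; apply: n; exists z.
left; rewrite yz FG; apply: hP; move: uy; rewrite yz (eu' _ _ (es z)) mulf_eq0 negb_or fmorph_eq0.
by case/andP.
Qed.

Variable G : X -> X.
Hypotheses (FG : cancel F G) (GF : cancel G F).

Lemma rgd_conj e x u : rgd e x u -> e = 0%N -> rg (F x) (fun y => tau (u (G y))).
Proof.
move=> ru e0; move: ru; rewrite e0 => -[d [q [qx hq hqu]]].
case: (hfun_conj hq) => q' [hq' eq']; case: (hfun_conj hqu) => r' [hr' er'].
case: conj_scale => s s0 es; exists d, q'; split=> //.
  by rewrite (eq' _ _ (es x)) mulf_neq0 ?expf_neq0 ?fmorph_eq0.
apply: hfun_ext hr' => y; rewrite -{1 2}(GF y) (er' _ _ (es (G y))) (eq' _ _ (es (G y))) addn0 rmorphM.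
by rewrite mulrA.
Qed.

Lemma Tr_conj (t t' : X -> X -> L) : (forall x, near x (fun y => t' (F x) (F y) = tau (t x y))) ->
  Tr t -> Tr t'.
Proof.
move=> n [ka hk]; exists (fun y => tau (ka (G y))) => x.
have [ru u0] := hk (G x); have := rgd_conj ru erefl; rewrite GF => ru'.
have : unitat x (fun y => tau (t (G x) (G y) * ka (G y))) by split=> //; rewrite fmorph_eq0.
have := near_conj FG (n (G x)); rewrite GF => n1.
apply: unitat_near; apply: near_impl n1 => y [|/(_ (G y))]; last by rewrite GF.
by rewrite GF rmorphM => ->.
Qed.

(** Charts defined over [S] are stable under [F], so the first chart containing F x is the one
    chosen for x. *)
Lemma frame_conj (D : lbdata X) x : line_bundle S D ->
  near x (fun y => fr D (F x) (F y) = tau (fr D x y)).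
Proof.
move=> lD; have lD' := line_bundleP lD; case: (lD) => op cov ru _.
have Ui i z : @lU _ X D i (F z) <-> lU i z.
  have := zclosed_conj (op i) z; move=> h; split=> u; apply: boolp.contrapT => n; have := n; by move/h.
have pk z : [pick i | boolp.asbool (@lU _ X D i (F z))] = [pick i | boolp.asbool (@lU _ X D i z)].
  by apply: eq_pick => i; apply/boolp.asboolP/boolp.asboolP => /Ui.
case: lD' => op' _ _ _; case ex: [pick i | boolp.asbool (@lU _ X D i x)] => [i|]; last first.
  case: pickP ex => // n _; case: (cov x) => i ix.
  by have := n i; rewrite (introT (boolp.asboolP _) ix).
have ix : lU i x by case: pickP ex => // j /boolp.asboolP jx [<-].
apply: near_impl (op' _ _ ix) => y iy; rewrite /frame !pk ex.
case ey: [pick j | boolp.asbool (@lU _ X D j y)] => [j|]; last by rewrite rmorph1.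
have jy : lU j y by case: pickP ey => // j' /boolp.asboolP jx [<-].
case: (ru i j) => rij _; apply: (regular_conj rij) => //.
by split; apply/Ui.
Qed.
End OneSpace.

Lemma morph_conj (X Y : pspace L) (F : X -> X) (F' : Y -> Y) (f : X -> Y) : embedded Y ->
  conjugates F -> conjugates F' -> morph S f -> forall x, f (F x) = F' (f x).
Proof.
move=> eY hF hF' /(morphP _ _ eY) mf x; case: (conj_scale hF) => s s0 es.
case: (mf (F x)) => d [c [cx hc]].
have E i := hfun_conj_fixed (hc i) (es x).
apply: (proj2 eY); apply: peq_trans (peq_sym (hF' (f x))).
have cne : c x != 0.
  have [i fi] := crd_neq0 eY (f (F x)).
  have := mulf_neq0 cx fi; rewrite (E i) rmorphM mulf_eq0 negb_or => /andP[_].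
  by rewrite mulf_eq0 negb_or fmorph_eq0 => /andP[].
exists (s x ^+ d * tau (c x) / c (F x)).
  by rewrite !mulf_neq0 ?invr_eq0 ?expf_neq0 ?fmorph_eq0.
apply/rowP => i; rewrite !mxE; apply: (mulfI cx); rewrite E rmorphM; field.
by [].
Qed.

Lemma conjugates_prod (X Y : pspace L) (F : X -> X) (F' : Y -> Y) : conjugates F -> conjugates F' ->
  @conjugates (pprod X Y) (fun u => (F u.1, F' u.2)).
Proof.
move=> h h' [x y]; case: (h x) => s s0 es; case: (h' y) => s' s'0 es' /=.
exists (s * s'); first exact: mulf_neq0.
apply/rowP => k; case/mxvec_indexP: k => i j; rewrite [RHS]mxE [in RHS]mxE !mxvecE es es' !mxE !big_ord1 !mxE rmorphM.
ring.
Qed.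

Lemma conjugates_ex (X : pspace L) : projective S X -> exists F : X -> X, conjugates F.
Proof.
case=> eX [E [fE hE]].
suff /boolp.choice [F hF] : forall x : X, exists y : X, peq (crd y) (map_mx tau (crd x)) by exists F.
move=> x; have v0 : map_mx tau (crd x) != 0 by rewrite map_mx_eq0; case: eX => h _; apply: h.
have [|y vy] := (hE _ v0).1 _; last by exists y; apply: peq_sym.
  move=> p Ep; case: (fE p Ep) => d fp; rewrite -(form_fixed fp) ev_conj.
  rewrite ((hE (crd x) _).2 _ p Ep) ?rmorph0 //; first by case: eX.
  by exists x; apply: peq_refl.
Qed.

Lemma conjugates_bij (X : pspace L) (F : X -> X) : projective S X -> conjugates F ->
  (forall x, exists y, tau y = x) -> exists2 G, cancel F G & cancel G F.
Proof.
move=> [eX [E [fE hE]]] hF sur.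
have inj : injective F.
  move=> x y e; apply: (proj2 eX); have := peq_trans (peq_sym (hF x)) (_ : peq (crd (F x)) _).
  rewrite {1}e => /(_ _ (hF y)) [c c0 e1]; have [c' ec] := sur c; exists c'.
    by rewrite -(fmorph_eq0 tau) ec.
  apply/rowP => i; rewrite mxE; apply: (fmorph_inj tau); rewrite rmorphM ec.
    by move/rowP: e1 => /(_ i); rewrite !mxE.
have surF y : exists x, F x = y.
  have /boolp.choice [g hg] := sur.
  have y0 : crd y != 0 by case: eX => h _; apply: h.
  pose v := \row_i g (crd y 0 i).
  have ev_ : map_mx tau v = crd y by apply/rowP => i; rewrite !mxE hg.
  have v0 : v != 0 by rewrite -(map_mx_eq0 tau) ev_.
  have [|x vx] := (hE v v0).1.
    move=> p Ep; case: (fE p Ep) => d fp; apply: (fmorph_inj tau).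
    rewrite -ev_conj (form_fixed fp) ev_ rmorph0.
    by apply: ((hE _ y0).2 _ p Ep); exists y; apply: peq_refl.
  exists x; apply: (proj2 eX); apply: peq_trans (hF x) _; rewrite -ev_.
  case: (peq_sym vx) => c c0 ->; exists (tau c); first by rewrite fmorph_eq0.
  by rewrite map_mxZ.
have /boolp.choice [G hG] := surF.
by exists G => // x; apply: inj; rewrite hG.
Qed.
End Conjugation.

Section PowerEndomorphism.
Variables (L : closedFieldType) (n : nat).
Hypothesis n_pchar : [pchar L].-nat n.

(** The hypothesis on n is an argument so that the ring morphism structures can be attached to the
    function. *)
Definition pow_endo of [pchar L].-nat n := fun x : L => x ^+ n.
Notation tau := (pow_endo n_pchar).

Lemma pow_endo_zmod : zmod_morphism tau.
Proof. by move=> x y; rewrite /pow_endo exprDn_pchar // exprNn_pchar. Qed.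

Lemma pow_endo_monoid : monoid_morphism tau.
Proof. by split=> [|x y]; rewrite /pow_endo ?expr1n ?exprMn. Qed.

HB.instance Definition _ := GRing.isZmodMorphism.Build L L tau pow_endo_zmod.
HB.instance Definition _ := GRing.isMonoidMorphism.Build L L tau pow_endo_monoid.

Lemma pow_endo_surj x : exists y, tau y = x.
Proof.
have n0 : (0 < n)%N by case/andP: n_pchar.
have /closed_rootP [y] : size ('X^n - x%:P : {poly L}) != 1%N.
  by rewrite size_XnsubC // eqSS -lt0n.
by rewrite rootE !hornerE subr_eq0 => /eqP; exists y.
Qed.
End PowerEndomorphism.

Section FrobeniusDescent.
Variables (k : finFieldType) (L : closedFieldType) (e : {rmorphism k -> L}).
Hypothesis hL : forall x : L, algebraicOver e x.
Notation q := #|k|.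
Notation S := (in_base e).

Lemma card_pnat i : [pchar L].-nat (q ^ i)%N.
Proof.
case: (finPcharP k) => p p_pr pk; rewrite (card_pprimeChar pk) -expnM.
rewrite pnatX; apply/orP; left; rewrite pnatE //.
by have := rmorph_pchar e pk.
Qed.
Notation tau i := (pow_endo (card_pnat i)).

Lemma base_fixed i x : S x -> tau i x = x.
Proof.
case=> a ->; rewrite /pow_endo -rmorphXn; congr (e _).
by elim: i => [|i IH]; rewrite ?expr1 // expnSr exprM IH expf_card.
Qed.

Lemma fixed_base (x : L) : x ^+ q = x -> S x.
Proof.
move=> xq; have : root (map_poly e ('X^q - 'X)) x.
  by rewrite rmorphB /= map_polyXn map_polyX rootE !hornerE xq subrr.
rewrite finField_genPoly rmorph_prod /= rootE horner_prod prodf_seq_eq0.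
case/hasP => a _ /=; rewrite rmorphB /= map_polyX map_polyC !hornerE subr_eq0 => /eqP ->.
by exists a.
Qed.

Lemma q_gt1 : (1 < q)%N. Proof. exact: finNzRing_gt1. Qed.

(** All the iterates of x under Frobenius are roots of a polynomial over [k] that kills x. So two of
    them coincide, and Frobenius is injective. *)
Lemma fixed_power (x : L) : exists2 r, (0 < r)%N & x ^+ (q ^ r) = x.
Proof.
case: (hL x) => p p0 px.
pose s := mkseq (fun i => x ^+ (q ^ i)) (size p).
have p0' : map_poly e p != 0 by rewrite map_poly_eq0.
have : ~~ uniq s.
  apply/negP => us; have := max_poly_roots p0' _ us; rewrite size_mkseq size_map_poly ltnn.
  move=> h; suff : false by []; apply: h; apply/allP => y /mapP[i _ ->].
  have -> : map_poly e p = map_poly (tau i) (map_poly e p).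
    by apply/polyP => j; rewrite !coef_map /=; apply/esym/base_fixed; exists p`_j.
  by have := rmorph_root (tau i) px.
case/(uniqPn 0) => i [j [ij]]; rewrite size_mkseq => jp.
rewrite !nth_mkseq ?(ltn_trans ij) // => E.
exists (j - i)%N; first by rewrite subn_gt0.
apply: (fmorph_inj (tau i)); rewrite -[LHS]/((x ^+ (q ^ (j - i))) ^+ (q ^ i)) -[RHS]/(x ^+ (q ^ i)).
by rewrite -exprM -expnD subnK ?E //; exact: ltnW.
Qed.

Lemma fixed_power_mul (x : L) r m : x ^+ (q ^ r) = x -> x ^+ (q ^ (r * m)) = x.
Proof.
move=> xr; elim: m => [|m IH]; first by rewrite muln0 expr1.
by rewrite mulnS expnD exprM xr IH.
Qed.

Lemma fixed_power_seq (s : seq L) : exists2 r, (0 < r)%N & forall x, x \in s -> x ^+ (q ^ r) = x.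
Proof.
elim: s => [|y s [r r0 h]]; first by exists 1%N.
case: (fixed_power y) => r' r'0 hy; exists (r' * r)%N; first by rewrite muln_gt0 r0 r'0.
move=> x; rewrite inE => /orP[/eqP ->|xs]; first exact: fixed_power_mul.
by rewrite mulnC; apply: fixed_power_mul; apply: h.
Qed.

(** A polynomial of degree at most q^(r-1) whose linear coefficient is not zero cannot vanish at all
    q^r elements fixed by the r-th power of Frobenius. *)
Lemma trace_nonzero r (la : nat -> L) : (0 < r)%N -> la 0%N != 0 ->
  exists a, a ^+ (q ^ r) = a /\ \sum_(i < r) a ^+ (q ^ i) * la i != 0.
Proof.
move=> r0 la0; pose P : {poly L} := \sum_(i < r) la i *: 'X^(q ^ i).
have Pa a : P.[a] = \sum_(i < r) a ^+ (q ^ i) * la i.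
  by rewrite horner_sum; apply: eq_bigr => i _; rewrite !hornerE mulrC.
have P0 : P != 0.
  apply/eqP => /(congr1 (fun p : {poly L} => p`_1)); rewrite coef0 coef_sum.
  rewrite (bigD1 (Ordinal r0)) //= coefZ coefXn expn0 eqxx mulr1 big1 ?addr0; first by apply/eqP.
  move=> i; rewrite -val_eqE /= => i0; rewrite coefZ coefXn.
  by rewrite -[X in X == _](expn0 q) (inj_eq (expnI q_gt1)) eq_sym (negPf i0) mulr0.
have sP : (size P <= (q ^ r.-1).+1)%N.
  apply: leq_trans (size_sum _ _ _) _; apply/bigmax_leqP => i _.
  apply: leq_trans (size_scale_leq _ _) _; rewrite size_polyXn ltnS leq_exp2l ?q_gt1 //.
  by rewrite -ltnS prednK.
pose Q : {poly L} := 'X^(q ^ r) - 'X.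
have qr : (1 < q ^ r)%N by rewrite -(exp1n r) ltn_exp2r // q_gt1.
have sQ : size Q = (q ^ r).+1.
  by rewrite /Q size_polyDl ?size_polyXn // size_polyN size_polyX.
case: (closed_field_poly_normal Q) => s Qs.
have lQ : lead_coef Q = 1.
  by rewrite /Q lead_coefDl ?lead_coefXn // size_polyN size_polyX size_polyXn.
rewrite lQ scale1r in Qs.
have us : uniq s.
  rewrite -separable_prod_XsubC -Qs separable_poly.unlock.
  have -> : Q^`() = (-1)%:P.
    rewrite /Q derivB derivXn derivX; have -> : ('X^((q ^ r).-1) *+ (q ^ r)%N : {poly L}) = 0; last by rewrite sub0r polyCN.
    rewrite -mulr_natr; have -> : (q ^ r)%N%:R = 0 :> {poly L}; last by rewrite mulr0.
    case: (finPcharP k) => p p_pr pk; have pL := rmorph_pchar e pk.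
    rewrite -polyC_natr; have -> : (q ^ r)%N%:R = 0 :> L; last by rewrite polyC0.
    have cq : q = (p ^ logn p q)%N := card_pprimeChar pk.
    have n0 : (0 < logn p q)%N by rewrite lt0n; apply/eqP => h; have := q_gt1; rewrite cq h.
    by rewrite natrX cq natrX (pcharf0 pL) expr0n (gtn_eqF n0) expr0n (gtn_eqF r0).
  by rewrite -alg_polyC coprimepZr ?oppr_eq0 ?oner_eq0 // coprimep1.
have ss : size s = (q ^ r)%N by have := sQ; rewrite Qs size_prod_XsubC => -[].
apply: boolp.contrapT => h.
have : (size s < size P)%N.
  apply: max_poly_roots => //; apply/allP => a as_.
  have aq : a ^+ (q ^ r) = a.
    have : root Q a by rewrite Qs root_prod_XsubC.
    by rewrite rootE !hornerE subr_eq0 => /eqP.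
  rewrite rootE Pa; apply: boolp.contrapT => /negP n; apply: h; by exists a.
rewrite ss => /leq_trans/(_ sP); rewrite ltnS leq_exp2l ?q_gt1 //.
by rewrite -{1}(prednK r0) ltnn.
Qed.

(** The forms representing f have coefficients in the field with q^r elements. Their trace, after
    multiplication by a suitable scalar a, has coefficients in the base field and still represents
    f. *)
Lemma descent (X Y : pspace L) (F : X -> X) (F' : Y -> Y) (f : X -> Y) :
  projective S X -> embedded Y -> conjugates (tau 1) F -> conjugates (tau 1) F' ->
  morph anyL f -> (forall x, f (F x) = F' (f x)) -> morph S f.
Proof.
move=> pX eY hF hF' /(morphP _ _ eY) mf comm.

apply/(morphP _ _ eY) => x0; case: (mf x0) => d [c [cx hc]].
have /boolp.choice [p hp] j : exists p : {mpoly L[amb X]}, form anyL d p /\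
    forall x, c x * crd (f x) 0 j = ev (crd x) p.
  by case: (hc j) => p fp ep; exists p.
pose coefs := flatten [seq [seq (p j)@_m | m <- msupp (p j)] | j <- enum 'I_(amb Y)].
case: (fixed_power_seq coefs) => r r0 hr.
have pr j m : (p j)@_m ^+ (q ^ r) = (p j)@_m.
  case: (boolP (m \in msupp (p j))) => [ms|].
    apply: hr; apply/flatten_mapP; exists j; rewrite ?mem_enum //.
    by apply/mapP; exists m.
  by rewrite mcoeff_msupp negbK => /eqP ->; rewrite expr0n expn_eq0 -leqn0 leqNgt (ltnW q_gt1).
have conj_iter (Z : pspace L) (H : Z -> Z) i : conjugates (tau 1) H -> conjugates (tau i) (iter i H).
  move=> hH; elim: i => [|i IH] z.
    have -> : map_mx (tau 0) (crd z) = crd z by apply/rowP => j; rewrite mxE /= /pow_endo expr1.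
    exact: peq_refl.
  apply: peq_trans (hH _) _; case: (IH z) => s s0 ->; exists (tau 1 s); first by rewrite fmorph_eq0.
  by apply/rowP => j; rewrite !mxE rmorphM; congr (_ * _); rewrite -[LHS]/((crd z 0 j ^+ (q ^ i)) ^+ (q ^ 1)) -exprM -expnD addn1.
have fiter i x : f (iter i F x) = iter i F' (f x).
  by elim: i => //= i <-.
have sur i : exists2 G, cancel (iter i F) G & cancel G (iter i F).
  apply: (conjugates_bij (S := S) (tau := tau i) _ pX); first exact: base_fixed.
    exact: conj_iter.
  exact: pow_endo_surj.
(* Since f commutes with Frobenius, the conjugate forms also represent f, with other factors. *)
have /boolp.choice [la hla] (iz : nat * X) : exists la, forall j, ev (crd iz.2) (map_mpoly (tau iz.1) (p j)) = la * crd (f iz.2) 0 j.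
  case: iz => i z /=; case: (sur i) => G FG GF.
  case: (conj_iter _ _ i hF (G z)); rewrite GF => s s0 es.
  case: (peq_sym (conj_iter _ _ i hF' (f (G z)))); rewrite -fiter GF => s' s'0 es'.
  exists (s ^+ d * tau i (c (G z)) * s') => j; have [fp ep] := hp j.
  have [hgp _] := form_conj (tau i) fp.
  rewrite es (ev_scale _ _ hgp) ev_conj -ep rmorphM.
  have E2 : tau i (crd (f (G z)) 0 j) = s' * crd (f z) 0 j.
    by have := congr1 (fun v : 'rV[L]__ => v 0 j) es'; rewrite mxE [RHS]mxE.
  rewrite -!mulrA; congr (_ * (_ * _)); exact: E2.
have la0 : la (0%N, x0) != 0.
  case: (crd_neq0 eY (f x0)) => j fj; have [fp ep] := hp j.
  have := hla (0%N, x0) j; rewrite /= (_ : map_mpoly _ _ = p j); last first.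
    by apply/mpolyP => m; rewrite mcoeff_map_mpoly /= /pow_endo expr1.
  by rewrite -ep => /eqP; apply: contraTneq => ->; rewrite mul0r mulf_neq0.
case: (trace_nonzero (la := fun i => la (i, x0)) r0 la0) => a [ar ane].
pose p' j := \sum_(i < r) (tau i a) *: map_mpoly (tau i) (p j).
exists d, (fun z => \sum_(i < r) a ^+ (q ^ i) * la (nat_of_ord i, z)); split=> // j.
exists (p' j).
  split.
    rewrite rpred_sum // => i _; apply: rpredZ; have [fp _] := hp j.
    by have [] := form_conj (tau i) fp.
  (* Frobenius permutes the r summands of the trace cyclically. *)
  move=> m; apply: fixed_base.
  have E : (p' j)@_m = \sum_(i < r) (a * (p j)@_m) ^+ (q ^ i).
    rewrite raddf_sum; apply: eq_bigr => i _.
    by rewrite /= mcoeffZ mcoeff_map_mpoly /= /pow_endo exprMn.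
  have hb : (a * (p j)@_m) ^+ (q ^ r) = a * (p j)@_m by rewrite exprMn ar pr.
  rewrite E; move: (a * _) hb => b hb.
  have -> : (\sum_(i < r) b ^+ (q ^ i)) ^+ q = tau 1 (\sum_(i < r) b ^+ (q ^ i)) by [].
  rewrite rmorph_sum /=; transitivity (\sum_(i < r) b ^+ (q ^ i.+1)).
    by apply: eq_bigr => i _; rewrite /pow_endo -exprM -expnD addn1.
  case: r r0 hb {E hr pr ar ane p'} => // r _ hb.
  by rewrite big_ord_recr [RHS]big_ord_recl /= hb expn0 expr1 addrC.
move=> z; rewrite /p' /ev raddf_sum mulr_suml; apply: eq_bigr => i _.
by rewrite /= mevalZ -/(ev _ _) (hla (nat_of_ord i, z)) /pow_endo /= mulrA.
Qed.

(** f, the polarizations and the Poincare bundles are defined over the base field, so conjugating g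
    by Frobenius gives again an adjoint of f. By uniqueness g commutes with Frobenius. *)
Lemma rosati_descent (A B : pavar L) (MA : lbdata (asp A)) (MB : lbdata (asp B)) (f : A -> B) (g : B -> A) :
  polarized S MA -> polarized S MB -> @morph L S (asp A) (asp B) f -> @morph L anyL (asp B) (asp A) g ->
  fibre_adjoint f g -> @morph L S (asp B) (asp A) g.
Proof.
move=> hA hB mf mg h.
have prj (C : pavar L) (MC : lbdata (asp C)) : polarized S MC -> projective S (asp C) /\ projective S (asp (pdual C)).
  by move=> hC; split; [case: (pol_av hC)|case: (pol_dual hC) => -[[]]].
have [pA pA'] := prj _ _ hA; have [pB pB'] := prj _ _ hB.
have eA := pol_embedded hA; have eB := pol_embedded hB.
have fx := base_fixed 1.
have [FA cA] := conjugates_ex fx pA; have [FA' cA'] := conjugates_ex fx pA'.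
have [FB cB] := conjugates_ex fx pB; have [FB' cB'] := conjugates_ex fx pB'.
apply: (descent pB eA cB cA mg).
have polC (C : pavar L) (MC : lbdata (asp C)) (F : C -> C) (F' : pdual C -> pdual C) : polarized S MC ->
    @conjugates L (tau 1) (asp C) F -> @conjugates L (tau 1) (asp (pdual C)) F' -> forall x, polar (F x) = F' (polar x).
  move=> hC hF hF'; have [_ [mp _] _ _] := pol_pp hC.
  by apply: (morph_conj fx (pol_dual_embedded hC) hF hF' mp).
case: (conjugates_bij fx pA cA (@pow_endo_surj _ _ _)) => GA FGA GFA.
case: (conjugates_bij fx pB cB (@pow_endo_surj _ _ _)) => GB FGB GFB.
have fF x : f (FA x) = FB (f x) := morph_conj fx eB cA cB mf x.
suff u : fibre_adjoint f (fun b => FA (g (GB b))).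
  move=> b; have := fibre_adjoint_unique hA hB (morph_any mf) h u (FB b).
  by rewrite FGB.
move=> b; have := h (GB b).
apply: (Tr_conj (tau := tau 1) (F := FA) (X := asp A) cA FGA GFA) => x.
have pf (C : pavar L) (MC : lbdata (asp C)) (F : C -> C) (F' : pdual C -> pdual C) (u : A -> C) (c : pdual C) : polarized S MC ->
    @conjugates L (tau 1) (asp C) F -> @conjugates L (tau 1) (asp (pdual C)) F' -> @morph L anyL (asp A) (asp C) u ->
    @near L (asp A) x (fun y => @frame L (pprod (asp C) (asp (pdual C))) (poincare C) (F (u x), F' c) (F (u y), F' c) =
      tau 1 (@frame L (pprod (asp C) (asp (pdual C))) (poincare C) (u x, c) (u y, c))).
  move=> hC hF hF' mu; have eC := pol_embedded hC; have eC' := pol_dual_embedded hC.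
  have lP : line_bundle S (poincare C) by case: (pol_dual hC) => -[_ lp].
  have := frame_conj fx (conjugates_prod hF hF') (u x, c) lP.
  have mpair : @morph L anyL (asp A) (pprod (asp C) (asp (pdual C))) (fun y => (u y, c)).
    by apply: morph_pair => //; exact: morph_const_any.
  by move/(near_pull (pprod_embedded eC eC') mpair (x := x)).
have n1 := pf B MB FB FB' f (polar (GB b)) hB cB cB' (morph_any mf).
have n2 := pf A MA FA FA' id (polar (g (GB b))) hA cA cA' (morph_id anyL_scalars eA).
apply: near_impl (near_and n1 n2) => y [e1 e2].
have := congr2 (fun a b => a / b) e1 e2.
by rewrite -fmorph_div -(polC B MB FB FB' hB cB cB') GFB -(polC A MA FA FA' hA cA cA') -!fF.
Qed.

End FrobeniusDescent.

(** * The pairing between ker f and ker g *)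

Section CharacterIndependence.
Variables (F : fieldType) (G : zmodType) (s : seq G) (I : finType) (chi : I -> G -> F).
Hypothesis s0 : 0 \in s.
Hypothesis sD : forall x y, x \in s -> y \in s -> x + y \in s.
Hypothesis chiD : forall i x y, x \in s -> y \in s -> chi i (x + y) = chi i x * chi i y.
Hypothesis chi_neq0 : forall i x, x \in s -> chi i x != 0.
Hypothesis chi_inj : forall i j, (forall x, x \in s -> chi i x = chi j x) -> i = j.

(** Artin's argument: subtracting a multiple of a relation from its translate by a group element
    shortens it. *)
Lemma characters_independent (c : I -> F) : (forall x, x \in s -> \sum_i c i * chi i x = 0) ->
  forall i, c i = 0.
Proof.
have [n] := ubnP #|[pred i | c i != 0]|; elim: n c => // n IH c; rewrite ltnS => leS hc i.
apply/eqP; apply: boolp.contrapT => /negP ci.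
have ck k : k != i -> c k = 0.
  move=> ki; have [g gs ne] : exists2 g, g \in s & chi k g != chi i g.
    apply: boolp.contrapT => h; move/eqP: ki; apply; apply: chi_inj => x xs.
    by apply/eqP; apply: boolp.contrapT => /negP ne; apply: h; exists x.
  have := IH (fun j => c j * (chi j g - chi i g)) _ _ k.
  have lt : (#|[pred j | (c j * (chi j g - chi i g))%R != 0%R]| < n)%N.
    apply: leq_trans leS; apply: proper_card; apply/properP; split.
      by apply/subsetP => j; rewrite !inE mulf_eq0 negb_or => /andP[].
    by exists i; rewrite !inE // subrr mulr0 eqxx.
  move=> /(_ lt) h; have /eqP : c k * (chi k g - chi i g) = 0.
    apply: h => x xs; have := hc _ (sD gs xs); have := hc _ xs => h1 h2.
    transitivity (\sum_j c j * chi j (g + x) - chi i g * \sum_j c j * chi j x).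
      rewrite mulr_sumr -sumrB; apply: eq_bigr => j _; rewrite chiD //; ring.
    by rewrite h1 h2 mulr0 subr0.
  by rewrite mulf_eq0 subr_eq0 (negPf ne) orbF => /eqP.
have := hc 0 s0; rewrite (bigD1 i) //= big1 ?addr0 => [|j ji]; last by rewrite ck // mul0r.
by apply/eqP; rewrite mulf_neq0 // chi_neq0.
Qed.

Lemma characters_le : (#|I| <= size s)%N.
Proof.
pose M : 'M[F]_(#|I|, size s) := \matrix_(i, j) chi (enum_val i) (nth 0 s j).
rewrite leqNgt; apply/negP => lt.
have : kermx M != 0.
  by rewrite kermx_eq0 /row_free neq_ltn (leq_ltn_trans (rank_leq_col M) lt).
case/rowV0Pn => v /sub_kermxP vM; case/eqP; apply/rowP => i; rewrite mxE.
rewrite -(enum_valK i); apply: (characters_independent (c := fun t => v 0 (enum_rank t))) => x xs.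
have hx : (index x s < size s)%N by rewrite index_mem.
have /rowP /(_ (Ordinal hx)) := vM; rewrite !mxE => vM0; rewrite -[RHS]vM0.
transitivity (\sum_(j < #|I|) v 0 (enum_rank (@enum_val I predT j)) * chi (enum_val j) x); last first.
  by apply: eq_bigr => t _; rewrite enum_valK mxE /= nth_index.
rewrite (reindex_onto (@enum_val I predT) enum_rank) /=; last by move=> k _; rewrite enum_rankK.
by apply: eq_bigl => t; rewrite enum_valK eqxx.
Qed.
End CharacterIndependence.

Section WeilPairing.
Variables (L : closedFieldType) (S : L -> Prop) (A B : pavar L) (MA : lbdata (asp A)) (MB : lbdata (asp B)).
Hypotheses (hA : polarized S MA) (hB : polarized S MB).
Variables (f : A -> B) (fd : B -> A) (l : nat).
Hypotheses (mf : @morph L anyL (asp A) (asp B) f) (mfd : @morph L anyL (asp B) (asp A) fd).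
Hypotheses (addf : {morph f : x y / x + y}) (adj : fibre_adjoint f fd).
Hypotheses (fdf : forall x, fd (f x) = x *+ l) (l_inv : l%:R != 0 :> L).
Hypothesis fsurj : forall b, exists a, f a = b.
Let eA := pol_embedded hA. Let eB := pol_embedded hB.
Notation pB := (@frame L (pprod (asp B) (asp (pdual B))) (poincare B)).
Notation pA := (@frame L (pprod (asp A) (asp (pdual A))) (poincare A)).

(** Additivity of the Poincare bundle at 0 + 0 = 0 says that the fibre at 0 is isomorphic to its own
    square. *)
Lemma poincare_zero (C : pavar L) (MC : lbdata (asp C)) : polarized S MC ->
  @Tr L (asp C) (fun x y => @frame L (pprod (asp C) (asp (pdual C))) (poincare C) (x, 0) (y, 0)).
Proof.
move=> hC; have eC := pol_embedded hC; have eC' := pol_dual_embedded hC.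
have [_ _ _ /(_ 0 0) addP _] := pol_dual hC; rewrite addr0 in addP.
have l0 := fibre_local eC (0 : asp (pdual C)) eC' (poincare_local (pol_dual hC)).
have lm := lb_mul_local l0 l0.
move/(lb_isoP l0 lm) : addP => h.
apply: Tr_near (TrV (TrM h (frame_mul l0 l0))) => x.
have n1 := frame_near x l0; have n2 := frame_near x lm.
apply: near_impl (near_and n1 n2) => y [a1 a2]; rewrite frame_pull in a1 *; move: a1 a2.
rewrite /fibre; move: (frame _ _ _) (frame _ _ _) => u v a1 a2.
have -> : v / u * (u / (v * v)) = v^-1 by fld.
by rewrite invrK.
Qed.

(** A trivialization [ka] on [A] of the pull-back by f of the bundle of b. It exists when b is
    killed by [fd], and the quotient [ka g / ka 0], for g in the kernel of f, is the pairing of g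
    with b. *)
Definition descent_cocycle (b : B) (ka : A -> L) := forall x,
  @unitat L (asp A) x (fun y => pB (f x, polar b) (f y, polar b) * ka y).

Lemma descent_cocycle_ex b : fd b = 0 -> exists ka, descent_cocycle b ka.
Proof.
move=> fb; have t := adj b; have t0 := poincare_zero hA.
have p0 : polar (fd b) = 0 :> pdual A.
  rewrite fb; apply: (@addrI _ (polar (0 : A))); by rewrite -(pol_additive hA) !addr0.
have eA' := pol_dual_embedded hA.
rewrite p0 in t.
suff [ka hk] : @Tr L (asp A) (fun x y => pB (f x, polar b) (f y, polar b)) by exists ka.
apply: Tr_near (TrM t t0) => x.
have n := pol_poincare_near hA x (morph_id anyL_scalars eA) (@morph_const_any L (asp A) (asp (pdual A)) 0 eA').
by apply: near_impl n => y a; rewrite divfK.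
Qed.

Lemma descent_cocycle_neq0 b ka x : descent_cocycle b ka -> ka x != 0.
Proof. by case/(_ x) => _; rewrite mulf_eq0 negb_or => /andP[]. Qed.

Lemma unit_quotient_constant (u v : A -> L) (w : A -> A -> L) :
  (forall x, @unitat L (asp A) x (fun y => w x y * u y)) ->
  (forall x, @unitat L (asp A) x (fun y => w x y * v y)) -> exists c, forall x, u x = c * v x.
Proof.
move=> hu hv; have [|c hc] := @regular_constant L (asp A) (fun y => u y / v y) (pol_projective hA) (pol_irreducible hA).
  move=> x; suff [] : @unitat L (asp A) x (fun y => u y / v y) by [].
  have n1 := unitat_neq0 (hv x); have := unitatM (hu x) (unitatV (hv x)).
  apply: unitat_near; apply: near_impl n1 => y; rewrite mulf_eq0 negb_or => /andP[w0 v0].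
  fld.
exists c => x; rewrite -(hc x) divfK //.
by case: (hv x) => _; rewrite mulf_eq0 negb_or => /andP[].
Qed.

(** Translation by a kernel element gives another trivialization of the same bundle, and two
    trivializations differ by a constant. *)
Lemma descent_character b ka g : descent_cocycle b ka -> f g = 0 ->
  exists c, forall x, ka (x + g) = c * ka x.
Proof.
move=> hk fg; apply: (unit_quotient_constant (w := fun x y => pB (f x, polar b) (f y, polar b))) => [x|]; last exact: hk.
have := @unitat_pull L (asp A) (asp A) (fun y => y + g : A) x _ eA (pol_translate hA g) (hk (x + g)).
by apply: unitat_near; apply: near_all => y; rewrite !addf fg !addr0.
Qed.

Lemma pairingE b ka g x : descent_cocycle b ka -> f g = 0 -> ka (x + g) = ka g / ka 0 * ka x.
Proof.
move=> hk fg; case: (descent_character hk fg) => c hc.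
have e0 := hc 0; rewrite add0r in e0.
by rewrite hc e0 mulfK // (descent_cocycle_neq0 _ hk).
Qed.

(** A trivialization that is invariant under the kernel descends to [B] by [descend_regular]; a
    point of the dual with trivial bundle is 0. *)
Lemma pairing_nondegenerate b ka : descent_cocycle b ka ->
  (forall g, f g = 0 -> ka g = ka 0) -> b = 0.
Proof.
move=> hk triv.
have inv x g : f g = 0 -> ka (x + g) = ka x.
  move=> fg; rewrite (pairingE _ hk fg) triv // divff ?mul1r //.
  exact: (descent_cocycle_neq0 _ hk).
have /boolp.choice [k hk'] : forall y, exists v, forall x, f x = y -> ka x = v.
  move=> y; case: (fsurj y) => x0 fx0; exists (ka x0) => x fx.
  rewrite -(subrK x0 x) addrC; apply: inv.
  by apply: (@addIr _ (f x0)); rewrite -addf subrK add0r fx.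
have [s hs] := kernel_finite (pol_projective hA) (pol_add hA) eB mf mfd fdf l_inv addf.

have t : @Tr L (asp B) (fun x y => pB (x, polar b) (y, polar b)).
  exists k => y0; case: (fsurj y0) => x0 fx0; rewrite -fx0; split; last first.
    by case: (hk x0) => _; rewrite -(hk' _ x0 erefl).
  apply: (descend_regular (pol_projective hA) (pol_irreducible hA) (pol_add hA) eB mf mfd addf fdf l_inv hs fsurj (x0 := x0)
    (phi := fun y => pB (f x0, polar b) (y, polar b) * k y)).
  move=> x fx; case: (hk x) => r _; rewrite fx in r.
  by apply: rgd_ext r => z; rewrite -(hk' _ z erefl).
have t0 := poincare_zero hB.
apply: (pol_inj hB); apply: (dual_inj eB (pol_dual hB)).
have -> : polar (0 : B) = 0 :> pdual B.
  by apply: (@addrI _ (polar (0 : B))); rewrite -(pol_additive hB) !addr0.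
exact: TrM t (TrV t0).
Qed.

Lemma descent_cocycle_add b b' ka ka' : descent_cocycle b ka -> descent_cocycle b' ka' ->
  exists h : B -> L, descent_cocycle (b + b') (fun x => ka x * ka' x * h (f x)).
Proof.
move=> hk hk'; have eB' := pol_dual_embedded hB.
have eBB := pprod_embedded eB' eB'.
have mc d : @morph L anyL (asp B) (asp (pdual B)) (fun=> d) := @morph_const_any L (asp B) (asp (pdual B)) d eB'.
have [h hh] := Tr_pull (pprod_embedded eB eBB) (morph_pair anyL_scalars eB eBB (morph_id anyL_scalars eB) (morph_pair anyL_scalars eB' eB' (mc (polar b)) (mc (polar b'))))
  (dual_bilinear eB (pol_translate hB) (pol_dual hB)).
exists h => x.
have := unitatM (unitatM (hk x) (hk' x)) (@unitat_pull L (asp A) (asp B) f x _ eB mf (hh (f x))).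
have n c := @near_pull L (asp A) (asp B) f x _ eB mf (pol_poincare_near hB (f x : asp B) (morph_id anyL_scalars eB) (mc c)).
apply: unitat_near; apply: near_impl (near_and (n (polar b)) (n (polar b'))) => y [a1 a2] /=.
rewrite (pol_additive hB); rewrite /= in a1 a2; fld.
Qed.

(** Since [h (f x)] is constant on the kernel of f, this is the rule that self-adjoint endomorphisms
    move across the pairing. *)
Lemma descent_cocycle_adjoint (ga : B -> B) (ga' : A -> A) b ka :
  @morph L anyL (asp A) (asp A) ga' -> @morph L anyL (asp B) (asp B) ga ->
  (forall x, f (ga' x) = ga (f x)) -> fibre_adjoint ga ga -> descent_cocycle b ka ->
  exists2 h : B -> L, forall y, h y != 0 & descent_cocycle (ga b) (fun x => ka (ga' x) / h (f x)).
Proof.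
move=> mg' mg comm ag hk; have [h hh] := ag b; have eB' := pol_dual_embedded hB.
exists h => [y|x]; first by case: (hh y) => _; rewrite mulf_eq0 negb_or => /andP[].
have := unitatM (@unitat_pull L (asp A) (asp A) ga' x _ eA mg' (hk (ga' x))) (unitatV (@unitat_pull L (asp A) (asp B) f x _ eB mf (hh (f x)))).
have mc d : @morph L anyL (asp B) (asp (pdual B)) (fun=> d) := @morph_const_any L (asp B) (asp (pdual B)) d eB'.
have n1 := @near_pull L (asp A) (asp B) f x _ eB mf (pol_poincare_near hB (f x : asp B) mg (mc (polar b))).
have n2 := @near_pull L (asp A) (asp B) f x _ eB mf (pol_poincare_near hB (f x : asp B) (morph_id anyL_scalars eB) (mc (polar (ga b)))).
apply: unitat_near; apply: near_impl (near_and n1 n2) => y [a1 a2] /=.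
have h0 : h (f y) != 0 by case: (hh (f y)) => _; rewrite mulf_eq0 negb_or => /andP[].
rewrite !comm; rewrite /= in a1 a2; fld.
Qed.

Variables (al be : A -> A) (beB : B -> B).
Hypotheses (mbe : @morph L anyL (asp A) (asp A) be) (mbeB : @morph L anyL (asp B) (asp B) beB).
Hypotheses (comm : forall x, f (be x) = beB (f x)) (self : fibre_adjoint beB beB).
Hypothesis split_ker : forall g, f g = 0 -> exists g1 g2, [/\ g = g1 + g2, f g1 = 0, f g2 = 0, al g1 = 0 & be g2 = 0].
Variables (sG : seq A) (sH : seq B).
Hypothesis hG : forall g, (g \in sG) <-> f g = 0 /\ al g = 0.
Hypothesis addal : {morph al : x y / x + y}.
Hypothesis addbe : {morph be : x y / x + y}.
Hypothesis uH : uniq sH.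
Hypothesis hH : forall b, b \in sH -> fd b = 0 /\ exists2 b', fd b' = 0 & beB b' = b.
Hypothesis hHB : forall b b', b \in sH -> b' \in sH -> b - b' \in sH.

(** b has the form [beB b'], so by self-adjointness it pairs trivially with the part of the kernel
    killed by [be]. Triviality on [sG] then gives triviality on the whole kernel. *)
Lemma pairing_component b ka : b \in sH -> descent_cocycle b ka ->
  (forall g, g \in sG -> ka g = ka 0) -> b = 0.
Proof.
move=> bH hk triv; apply: (pairing_nondegenerate hk) => g fg.
case: (split_ker fg) => g1 [g2 [-> f1 f2 a1 b2]].
have g1G : g1 \in sG by apply/hG.
rewrite (pairingE _ hk f2) [ka g1]triv // divfK ?(descent_cocycle_neq0 _ hk) //.
have [_ [b' fb' eb]] := hH bH; case: (descent_cocycle_ex fb') => ka' hk'.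
case: (descent_cocycle_adjoint mbe mbeB comm self hk') => h h0 hk2; rewrite eb in hk2.
case: (unit_quotient_constant hk hk2) => c hc.
have z0 (C D : zmodType) (u : C -> D) : {morph u : x y / x + y} -> u 0 = 0.
  by move=> au; apply: (@addrI _ (u 0)); rewrite -au !addr0.
by rewrite !hc b2 f2 (z0 _ _ _ addbe) (z0 _ _ _ addf).
Qed.

(** Distinct elements of [sH] give distinct characters of the group [sG]: if two characters agreed,
    that of the difference would be trivial. *)
Lemma pairing_bound : (size sH <= size sG)%N.
Proof.
have z0 (C D : zmodType) (u : C -> D) : {morph u : x y / x + y} -> u 0 = 0.
  by move=> au; apply: (@addrI _ (u 0)); rewrite -au !addr0.
have f0 := z0 _ _ f addf.
have /boolp.choice [ka hka] (i : 'I_(size sH)) : exists ka, descent_cocycle (nth 0 sH i) ka.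
  by apply: descent_cocycle_ex; have [] := hH (mem_nth 0 (ltn_ord i)).
have ne i x : ka i x != 0 := descent_cocycle_neq0 x (hka i).
have := @characters_le L A sG 'I_(size sH) (fun i g => ka i g / ka i 0); rewrite card_ord; apply.
- by apply/hG; rewrite f0 z0.
- by move=> x y /hG [fx ax] /hG [fy ay]; apply/hG; rewrite addf addal fx fy ax ay !addr0.
- move=> i x y /hG [fx _] /hG [fy _]; rewrite (pairingE _ (hka i) fy).
  by have := ne i 0 => n0; field.
- by move=> i x _; rewrite mulf_neq0 ?invr_eq0.
move=> i j e; apply: val_inj; apply/eqP; rewrite -(nth_uniq 0 (ltn_ord i) (ltn_ord j) uH); apply/eqP.
apply/eqP; rewrite -subr_eq0; apply/eqP.
have iH := mem_nth 0 (ltn_ord i : (i < size sH)%N); have jH := mem_nth 0 (ltn_ord j : (j < size sH)%N).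
have dH := hHB iH jH.
have [fd0 _] := hH dH; case: (descent_cocycle_ex fd0) => kd hkd.
apply: (pairing_component dH hkd) => g gG; have [fg _] := proj1 (hG g) gG.
case: (descent_cocycle_add (hka j) hkd) => h; rewrite addrC subrK => hk2.
case: (unit_quotient_constant (hka i) hk2) => c hc.
have := e g gG; rewrite !hc fg f0.
have := descent_cocycle_neq0 0 (hka i); rewrite hc f0 !mulf_eq0 !negb_or => /andP[c0 /andP[/andP[k0 d0] h0]] E.
have k1 := ne j g; apply: (mulfI k1); apply: (mulIf (_ : (ka j 0 * kd 0)^-1 != 0)).
  by rewrite invr_eq0 mulf_neq0.
transitivity (c * (ka j g * kd g * h 0) / (c * (ka j 0 * kd 0 * h 0))); first by fld.
by rewrite E; fld.
Qed.
End WeilPairing.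

Lemma rmorphism_of (R T : nzRingType) (g : R -> T) : (forall x y, g (x - y) = g x - g y) -> g 1 = 1 ->
  (forall x y, g (x * y) = g x * g y) -> exists h : {rmorphism R -> T}, h =1 g.
Proof.
move=> gB g1 gM.
pose gA := GRing.isZmodMorphism.Build R T g gB.
have gm : monoid_morphism g by split.
pose gMM := GRing.isMonoidMorphism.Build R T g gm.
pose h : {rmorphism R -> T} := HB.pack g gA gMM.
by exists h.
Qed.

(** * Arithmetic of K and K0 *)

Section NumberFields.
Variable K : fieldExtType rat.

(** A primitive element is sent to a complex root of its minimal polynomial. *)
Lemma embedding_ex : exists g : {rmorphism K -> algC}, True.
Proof.
have sep : separable 1%AS ({:K}%AS : {subfield K}).
  by apply/separableP => y _; apply: pcharf0_separable => p; rewrite pchar_lalg pchar_num.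
have gen := eq_adjoin_separable_generator sep (sub1v _).
set x0 := separable_generator _ _ in gen.
have /polyOver1P [q0 hq0] := minPolyOver 1%AS x0.
have dz : size (map_poly ratr q0 : {poly algC}) != 1%N.
  rewrite size_map_poly -(size_map_poly (GRing.in_alg K)) -hq0 size_minPoly eqSS.
  by rewrite -lt0n.
case/closed_rootP: dz => z hz.
have wd p : (map_poly (GRing.in_alg K) p).[x0] = 0 -> (map_poly ratr p : {poly algC}).[z] = 0.
  move=> p0; have : minPoly 1%AS x0 %| map_poly (GRing.in_alg K) p.
    by apply: minPoly_dvdp; [apply/polyOver1P; exists p|apply/rootP].
  rewrite hq0 dvdp_map => /dvdpP [r ->]; rewrite rmorphM hornerM.
  by move/rootP: hz => ->; rewrite mulr0.
have /boolp.choice [P hP] y : exists p, y = (map_poly (GRing.in_alg K) p).[x0].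
  have : y \in <<1%AS; x0>>%VS by rewrite -gen memvf.
  by case/Fadjoin_polyP => p /polyOver1P [r ->] ->; exists r.
pose g y := (map_poly ratr (P y) : {poly algC}).[z].
have ext p y : y = (map_poly (GRing.in_alg K) p).[x0] -> g y = (map_poly ratr p : {poly algC}).[z].
  move=> ey; apply/eqP; rewrite -subr_eq0 /g -hornerN -hornerD -rmorphN -rmorphD; apply/eqP; apply: wd.
  by rewrite rmorphD rmorphN hornerD hornerN -hP -ey subrr.
case: (@rmorphism_of K algC g) => [x y||x y|h _]; last by exists h.
- rewrite (ext (P x - P y)); last by rewrite rmorphB /= hornerD hornerN -!hP.
  by rewrite rmorphB hornerD hornerN.
- by rewrite (ext 1) ?rmorph1 ?hornerC.
- rewrite (ext (P x * P y)); last by rewrite rmorphM /= hornerM -!hP.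
  by rewrite rmorphM hornerM.
Qed.

Lemma quadratic_span (F : {subfield K}) (x : K) : \dim F = 2%N -> x \in F -> x \notin 1%VS ->
  forall y, y \in F -> exists a b : rat, y = a%:A + b *: x.
Proof.
move=> dF xF x1 y yF; pose U := (1 + <[x]>)%VS.
have UF : (U <= F)%VS by rewrite subv_add sub1v -memvE.
have E : U = F.
  apply/eqP; rewrite eqEdim UF dF /=; rewrite ltnNge; apply/negP => d1.
  have : (1%VS == U) by rewrite eqEdim addvSl dimv1.
  by move/eqP => e1; case/negP: x1; rewrite e1 -[x]add0r memv_add ?mem0v ?memv_line.
move: yF; rewrite -E => /memv_addP [u /vlineP [a ->] [v /vlineP [b ->] ->]].
by exists a, b.
Qed.

Lemma adjoin_real (g : {rmorphism K -> algC}) (F : {subfield K}) (z : K) :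
  (forall y, y \in F -> g y \is Num.real) -> g z \is Num.real ->
  forall y, y \in <<F; z>>%VS -> g y \is Num.real.
Proof.
move=> hF hz y /Fadjoin_polyP [p pF ->]; rewrite -horner_map; apply: rpred_horner => //.
by apply/polyOverP => i; rewrite coef_map; apply: hF; apply: (polyOverP pF).
Qed.

Lemma adjoin_fixed (s : {rmorphism K -> K}) (z : K) : s z = z ->
  forall y, y \in <<1%AS; z>>%VS -> s y = y.
Proof.
move=> sz y /Fadjoin_polyP [p /polyOver1P [q ->] ->].
rewrite -horner_map sz; congr horner; apply/polyP => i; rewrite !coef_map /=.
by rewrite !alg_num_field fmorph_rat.
Qed.

Lemma real_sqrt_rat (F : fieldExtType rat) (g : {rmorphism F -> algC}) (z : F) (s : rat) :
  z ^+ 2 = s%:A -> 0 <= s -> g z \is Num.real.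
Proof.
move=> zs s0; have e : g z ^+ 2 = ratr s by rewrite -rmorphXn zs alg_num_field fmorph_rat.
have r0 : 0 <= g z ^+ 2 by rewrite e ler0q.
have := sqrtC_ge0 (g z ^+ 2); rewrite r0 => h.
have : g z ^+ 2 == sqrtC (g z ^+ 2) ^+ 2 by rewrite sqrtCK.
rewrite eqf_sqr => /orP[]/eqP ->; rewrite ?rpredN; exact: ger0_real.
Qed.

Lemma rat_sqr_ge0 (F : fieldExtType rat) (g : {rmorphism F -> algC}) (z : F) (s : rat) :
  z ^+ 2 = s%:A -> g z \is Num.real -> 0 <= s.
Proof.
move=> zs gr; have e : g z ^+ 2 = ratr s by rewrite -rmorphXn zs alg_num_field fmorph_rat.
by rewrite -(ler0q algC) -e real_exprn_even_ge0.
Qed.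

(** Otherwise the fixed field of [s] contains a quadratic field [F], real by primitivity, and [K] is
    the compositum of the real fields [F] and [K0], against total imaginarity. *)
Lemma involution_real (K0 : {subfield K}) (s : {rmorphism K -> K}) :
  quartic_CM K0 -> primitive_CM K -> involutive s -> forall x, x \in K0 -> s x = x.
Proof.
move=> [dK dK0 tr ti] prim inv x xK0; apply/eqP; apply: boolp.contrapT => /negP sx.
have sQ a : s a%:A = a%:A by rewrite alg_num_field fmorph_rat.

have x1 : x \notin 1%VS by apply: contra sx => /vlineP [a ->]; rewrite sQ.
have [g _] := embedding_ex.
have quad (F : {subfield K}) y : \dim F = 2%N -> y \in F -> y \notin 1%VS ->
    exists2 r : rat, (y - r%:A) \in F & exists c : rat, (y - r%:A) ^+ 2 = c%:A.
  move=> dF yF y1; have [|a [b e]] := quadratic_span dF yF y1 (y := y ^+ 2); first exact: rpredX.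
  exists (b / 2%:R); first by rewrite rpredB // rpredZ // rpred1.
  exists (a + (b / 2%:R) ^+ 2).
  have bE : b = b / 2%:R + b / 2%:R by field.
  rewrite bE in e; move: (b / 2%:R) e => h; rewrite scalerDl -[h *: y]mulr_algl => e.
  have -> : (a + h ^+ 2)%:A = a%:A + h%:A ^+ 2 :> K by rewrite scalerDl exprZn expr1n.
  rewrite sqrrB e; ring.
have two : 2%:R != 0 :> K by rewrite -[2%:R](rmorph_nat (GRing.in_alg K)) fmorph_eq0.
have [r xr [d dd]] := quad _ _ dK0 xK0 x1; set de := x - r%:A in xr dd.
have sde : s de = - de.
  have : s de ^+ 2 == de ^+ 2 by rewrite -rmorphXn dd sQ.
  rewrite eqf_sqr => /orP[/eqP e|/eqP //]; case/negP: sx; apply/eqP.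
  by have := e; rewrite /de rmorphB sQ => /addIr.
have de0 : de != 0.
  apply: contra sx => /eqP e; have : x = r%:A by apply/eqP; rewrite -subr_eq0 -/de e.
  by move=> ->; rewrite sQ.
(* [s] negates [de], so every element is a sum of a fixed element and a fixed multiple of [de]. A
   fixed field equal to Q would leave dimension at most 2. *)
have [ph sph ph1] : exists2 ph, s ph = ph & ph \notin 1%VS.
  apply: boolp.contrapT => n.
  have fx y : s y = y -> y \in 1%VS by move=> sy; apply: boolp.contrapT => /negP h; apply: n; exists y.
  have : (fullv <= 1 + <[de]>)%VS.
    apply/subvP => y _; have -> : y = (y + s y) / 2%:R + (y - s y) / (2%:R * de) * de by field; rewrite two de0.
    apply: memv_add; first by apply: fx; rewrite fmorph_div rmorphD inv rmorph_nat addrC.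
    have /vlineP [c ->] : (y - s y) / (2%:R * de) \in 1%VS.
      apply: fx; rewrite fmorph_div rmorphB inv rmorphM rmorph_nat sde.
      by rewrite mulrN -opprB invrN mulrNN.
    by rewrite mulr_algl memvZ // memv_line.
  move/dimvS; rewrite dK => le; have := leq_trans le (leq_of_leqif (dimv_add_leqif _ _)).
  by rewrite dimv1 dim_vline; case: (de != 0).
pose F : {subfield K} := <<1%AS; ph>>%AS.
have phF : ph \in F by apply: memv_adjoin.
have deF : de \notin F.
  apply/negP => /(adjoin_fixed sph) /eqP; rewrite sde eq_sym -subr_eq0 opprK -mulr2n -mulr_natl mulf_eq0.
  by rewrite (negPf two) (negPf de0).
have dF : \dim F = 2%N.
  have := field_dimS (subvf F); rewrite dK => dv.
  have : (\dim F \in divisors 4)%N by rewrite -dvdn_divisors.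
  rewrite !inE => /or3P[/eqP d1|/eqP //|/eqP d4].
    case/negP: ph1; have E : 1%VS = F :> {vspace K} by apply/eqP; rewrite eqEdim sub1v dimv1 d1.
    by rewrite E.
  case/negP: deF; have E : F = fullv :> {vspace K} by apply/eqP; rewrite eqEdim subvf d4 dK.
  by rewrite E memvf.
(* Primitivity forbids that the quadratic field [F] is totally imaginary, and all the values of a
   quadratic field under a real embedding determine the sign of its radicand. *)
have [f' hf'] : exists f' : {rmorphism subvs_of F -> algC}, forall y, f' y \is Num.real.
  have /boolp.existsNP [f' h] := prim F dF; exists f' => y.
  by apply: boolp.contrapT => /negP n; apply: h; exists y.
have [r' pr' [c cc]] := quad _ _ dF phF ph1; set p0 := ph - r'%:A in pr' cc.
have gQ a : g a%:A \is Num.real by rewrite alg_num_field fmorph_rat; apply: Rreal_rat || apply: rpred_rat.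
have c0 : 0 <= c.
  apply: (@rat_sqr_ge0 (subvs_of F) f' (Subvs pr') c) => //.
  by apply: (fmorph_inj (vsval : {rmorphism subvs_of F -> K})); rewrite rmorphXn alg_num_field fmorph_rat -alg_num_field.
have gph : g ph \is Num.real.
  have -> : ph = p0 + r'%:A by rewrite subrK.
  by rewrite rmorphD rpredD // (real_sqrt_rat g cc c0).
have gF : forall y, y \in F -> g y \is Num.real.
  by apply: adjoin_real => // y /vlineP [a ->].
have gde : g de \is Num.real.
  exact: (tr (g \o (vsval : {rmorphism subvs_of K0 -> K}) : {rmorphism subvs_of K0 -> algC}) (Subvs xr)).
have [y] := ti g; apply/negP; rewrite negbK.
apply: (adjoin_real gF gde).
have E : <<F; de>>%VS = fullv; last by rewrite E memvf.
apply/eqP; rewrite eqEdim subvf dK.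
have := field_dimS (subvf <<F; de>>%AS); have := field_dimS (subv_adjoin F de : (F <= <<F; de>>%AS)%VS).
rewrite dF dK => dv2 dv4.
have : (\dim <<F; de>> \in divisors 4)%N by rewrite -dvdn_divisors.
rewrite !inE => /or3P[/eqP d1|/eqP d2|/eqP -> //]; first by rewrite d1 in dv2.
case/negP: deF; have E : F = <<F; de>>%VS :> {vspace K} by apply/eqP; rewrite eqEdim subv_adjoin dF d2.
by rewrite E memv_adjoin.
Qed.
End NumberFields.

Section Integers.
Variable F : fieldExtType rat.

Lemma integer_add (x y : F) : integer_of x -> integer_of y -> integer_of (x + y).
Proof. exact: integral_add. Qed.
Lemma integer_mul (x y : F) : integer_of x -> integer_of y -> integer_of (x * y).
Proof. exact: integral_mul. Qed.
Lemma integer_opp (x : F) : integer_of x -> integer_of (- x).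
Proof. exact: integral_opp. Qed.
Lemma integer1 : integer_of (1 : F). Proof. exact: integral1. Qed.
Lemma integer0 : integer_of (0 : F). Proof. exact: integral0. Qed.
Lemma integer_nat n : integer_of (n%:R : F). Proof. exact: integral_nat. Qed.

Lemma natF_neq0 n : (0 < n)%N -> n%:R != 0 :> F.
Proof. by move=> n0; rewrite -(rmorph_nat (GRing.in_alg F)) fmorph_eq0 pnatr_eq0 -lt0n. Qed.

Lemma mulrn_injF n (x y : F) : (0 < n)%N -> x *+ n = y *+ n -> x = y.
Proof.
by move=> n0; rewrite -[x *+ n]mulr_natr -[y *+ n]mulr_natr => /(mulIf (natF_neq0 n0)).
Qed.

Lemma ideal_coprime (I : F -> Prop) (l m : nat) : prime_ideal_of I -> I l%:R -> coprime l m -> ~ I m%:R.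
Proof.
move=> [[[_ I0 ID IM] _] n1 _] Il co Im; apply: n1.
case: l Il co => [|l] Il co.
  by move: co; rewrite /coprime gcd0n => /eqP m1; rewrite m1 in Im.
case: (@egcdnP l.+1 m) => // u v e _; move: e; rewrite (eqP co) => e.
have -> : (1 : F) = u%:R * l.+1%:R + (- v%:R) * m%:R.
  by rewrite mulNr -!natrM e natrD addrC addKr.
by apply: ID; apply: IM => //; [|apply: integer_opp]; apply: integer_nat.
Qed.

Variables (l : nat) (l1 l2 : F -> Prop).
Hypotheses (l_gt0 : (0 < l)%N) (hl1 : prime_ideal_of l1) (hl2 : prime_ideal_of l2).
Hypothesis hl12 : ~ (forall x, l1 x <-> l2 x).
Hypothesis hl : forall x, principal (l%:R : F) x <-> ideal_mul l1 l2 x.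
Hypothesis hN1 : ideal_norm l1 l.

(** Since l and a [b0] divide each other, correcting [b0] by a unit makes a b equal to l. The Bezout
    relation comes from finiteness of the residue ring of [l1]. *)
Lemma split_generators (a b0 : F) : integer_of a -> integer_of b0 ->
  (forall x, l1 x <-> principal a x) -> (forall x, l2 x <-> principal b0 x) ->
  exists b x y, [/\ integer_of b, integer_of x, integer_of y, forall z, l2 z <-> principal b z &
    a * b = l%:R /\ a * x + b * y = 1].
Proof.
move=> ia ib ha hb0; have l0 := natF_neq0 l_gt0.
have la : l1 a by apply/ha; exists 1; [exact: integer1|rewrite mulr1].
have lb : l2 b0 by apply/hb0; exists 1; [exact: integer1|rewrite mulr1].
have [c ic lc] : exists2 c, integer_of c & l%:R = a * b0 * c.
  have : principal (l%:R : F) l%:R by exists 1; [exact: integer1|rewrite mulr1].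
  case/hl => n [u [v [hu hv ->]]].
  suff : exists2 c, integer_of c & \sum_(i < n) u i * v i = a * b0 * c by [].
  elim/big_rec: _ => [|i s _ [c ic ->]]; first by exists 0; [exact: integer0|rewrite mulr0].
  have [u' iu ->] := proj1 (ha _) (hu i); have [v' iv ->] := proj1 (hb0 _) (hv i).
  exists (u' * v' + c); last by ring.
  by apply: integer_add => //; apply: integer_mul.
have [c' ic' lc'] : principal (l%:R : F) (a * b0).
  by apply/hl; exists 1%N, (fun=> a), (fun=> b0); rewrite big_ord1.
have cc : c * c' = 1.
  by apply: (mulfI l0); rewrite mulr1 {2}lc lc' ; ring.
pose b := b0 * c; have ib' : integer_of b by apply: integer_mul.
have hb z : l2 z <-> principal b z.
  split=> [/hb0 [w iw ->]|[w iw ->]].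
    exists (c' * w); first exact: integer_mul.
    by rewrite /b -!mulrA [c * _]mulrA cc mul1r.
  by apply/hb0; exists (c * w); [exact: integer_mul|rewrite /b mulrA].
have l2b : l2 b by apply/hb; exists 1; [exact: integer1|rewrite mulr1].
case: (hl1) => [[[i1 l10 l1D l1M] _] l11 pr1]; case: (hl2) => [[[i2 l20 l2D l2M] _] l21 pr2].
have nb : ~ l1 b.
  move=> /ha [z iz bz]; have : l2 (a * z) by rewrite -bz.
  move/(pr2 _ _ ia iz) => [l2a|/hb [w iw zw]].
    apply: hl12 => x; split=> [/ha [w iw ->]|/hb [w iw ->]]; first by rewrite mulrC; apply: l2M.
    by rewrite bz -mulrA; apply/ha; exists (z * w); first exact: integer_mul.
  have b0' : b != 0.
    by apply: contraTneq l0 => be; rewrite lc -mulrA -/b be mulr0 eqxx.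
  have e : a * w = 1 by apply: (mulfI b0'); rewrite mulr1 {2}bz zw; ring.
  by apply: l11; rewrite -e mulrC; apply: l1M.
case: hN1 => r [ir hr].
have l1B x y : l1 x -> l1 y -> l1 (x - y).
  by move=> hx hy; apply: l1D => //; rewrite -mulN1r; apply: l1M => //; apply/integer_opp/integer1.
(* As b is not in the prime ideal [l1], multiplication by b permutes the [l] residue classes, so
   some class is its inverse. *)
have /boolp.choice [ph hph] i : exists j, l1 (b * r i - r j).
  by case: (hr (b * r i)) => [|j [hj _]]; [exact: integer_mul|exists j].
have inj : injective ph.
  move=> i i' e; have : l1 (b * (r i - r i')).
    have -> : b * (r i - r i') = (b * r i - r (ph i)) - (b * r i' - r (ph i')) by rewrite e; ring.
    exact: l1B.
  case/pr1 => //; first by apply: integer_add => //; apply: integer_opp.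
  move=> h; case: (hr (r i)) => // j [_ u].
  by rewrite -(u i) ?subrr // -(u i').
case: (hr 1) => [|j [hj _]]; first exact: integer1.
have /codomP [i ji] : j \in codom ph by rewrite inj_card_onto.
have : l1 (1 - b * r i).
  have -> : 1 - b * r i = (1 - r j) - (b * r i - r j) by ring.
  by apply: l1B; rewrite // ji.
case/ha => x ix e; exists b, x, (r i); split=> //; split; first by rewrite /b mulrA -lc.
by rewrite -e subrK.
Qed.
End Integers.

Lemma integer_vsval (K : fieldExtType rat) (K0 : {subfield K}) (x : subvs_of K0) :
  integer_of (vsval x) -> integer_of x.
Proof.
case=> p pm px; exists p => //.
have : root (map_poly (vsval : {rmorphism subvs_of K0 -> K}) (map_poly (intr : int -> subvs_of K0) p)) (vsval x).
  rewrite -map_poly_comp (eq_map_poly (g := intr)) // => z /=; exact: rmorph_int.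
by rewrite fmorph_root.
Qed.

Lemma order_integral (K : fieldExtType rat) (O : K -> Prop) x : order_of O -> O x -> integer_of x.
Proof.
move=> [O1 OM [b bb hO]] Ox; set n := \dim {:K} in b bb hO.
have Ob (i : 'I_n) : O b`_i.
  apply/hO; exists (fun j => (j == i)%:Z); rewrite (bigD1 i) //= eqxx mulr1z big1 ?addr0 // => j /negPf ->.
  by rewrite mulr0z.
have /boolp.choice [c hc] (i : 'I_n) : exists c : 'I_n -> int, x * b`_i = \sum_(j < n) b`_j *~ c j.
  by apply/hO; apply: OM.
pose M : 'M[int]_n := \matrix_(i, j) c j i.
have : eigenvalue (map_mx intr M) x.
  apply/eigenvalueP; exists (\row_j b`_j).
    apply/rowP => i; rewrite !mxE hc; apply: eq_bigr => j _; by rewrite !mxE mulrzr.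
  have n0 : (0 < n)%N by rewrite /n adim_gt0.
  apply/eqP => /rowP /(_ (Ordinal n0)); rewrite !mxE; apply/eqP.
  have fb := basis_free bb; apply: (free_not0 fb); rewrite mem_nth // size_tuple.
  exact: n0.
rewrite eigenvalue_root_char -map_char_poly => rt.
by exists (char_poly M) => //; apply: char_poly_monic.
Qed.

(** * Endomorphisms and the Rosati involution *)

Section Homs.
Variables (L : closedFieldType) (S : L -> Prop).
Hypothesis hS : scalars S.

Lemma additive0 (A B : zmodType) (f : A -> B) : {morph f : x y / x + y} -> f 0 = 0.
Proof. by move=> af; apply: (@addrI _ (f 0)); rewrite -af !addr0. Qed.

Lemma additive_muln (A B : zmodType) (f : A -> B) : {morph f : x y / x + y} ->
  forall n x, f (x *+ n) = f x *+ n.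
Proof. by move=> af n x; elim: n => [|n IH]; rewrite ?additive0 // !mulrS af IH. Qed.

Lemma additive_opp (A B : zmodType) (f : A -> B) : {morph f : x y / x + y} -> forall x, f (- x) = - f x.
Proof. by move=> af x; apply: (@addrI _ (f x)); rewrite -af !subrr additive0. Qed.

Lemma additiveB (A B : zmodType) (f : A -> B) : {morph f : x y / x + y} -> forall x y, f (x - y) = f x - f y.
Proof. by move=> af x y; rewrite af additive_opp. Qed.

Section Closure.
Variables (Z : pspace L) (A : avar L).
Hypothesis aA : abelian_variety S A.
Let eA : embedded (asp A). Proof. by case: aA => -[]. Qed.

Lemma morphS_add (f g : Z -> A) : @morph L S Z (asp A) f -> @morph L S Z (asp A) g ->
  @morph L S Z (asp A) (fun z => f z + g z).
Proof.
move=> mf mg; case: aA => _ _ _ mA _.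
exact: (@morph_comp L S Z (pprod (asp A) (asp A)) (asp A) _ _ hS (pprod_embedded eA eA) eA (morph_pair hS eA eA mf mg) mA).
Qed.

Lemma morphS_opp (f : Z -> A) : @morph L S Z (asp A) f -> @morph L S Z (asp A) (fun z => - f z).
Proof.
move=> mf; case: aA => _ _ _ _ nA.
exact: (@morph_comp L S Z (asp A) (asp A) f _ hS eA eA mf nA).
Qed.

Lemma morphS_zero : @morph L S Z (asp A) (fun=> 0).
Proof. by case: aA => _ _ [v v0 Sv] _ _; first [exact: (@morph_const L S Z (asp A) v 0 eA v0 Sv)|exact: (@morph_const L S hS Z (asp A) v 0 eA v0 Sv)]. Qed.

Lemma morphS_muln (f : Z -> A) n : @morph L S Z (asp A) f -> @morph L S Z (asp A) (fun z => f z *+ n).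
Proof.
move=> mf; elim: n => [|n IH].
  by have := morphS_zero; congr morph; apply: boolp.funext => z; rewrite mulr0n.
by have := morphS_add mf IH; congr morph; apply: boolp.funext => z; rewrite mulrS.
Qed.
End Closure.

Lemma av_embedded (A : avar L) : abelian_variety S A -> embedded (asp A).
Proof. by case=> -[]. Qed.

Lemma hom_comp (A B C : avar L) (f : A -> B) (g : B -> C) : abelian_variety S B -> abelian_variety S C ->
  hom S f -> hom S g -> hom S (fun x => g (f x)).
Proof.
move=> aB aC [mf af] [mg ag]; split; last by move=> x y; rewrite af ag.
exact: (@morph_comp L S (asp A) (asp B) (asp C) f g hS (av_embedded aB) (av_embedded aC) mf mg).
Qed.

Lemma hom_add (A B : avar L) (f g : A -> B) : abelian_variety S B -> hom S f -> hom S g ->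
  hom S (fun x => f x + g x).
Proof.
move=> aB [mf af] [mg ag]; split; first exact: morphS_add.
by move=> x y; rewrite af ag addrACA.
Qed.

Lemma hom_muln (A B : avar L) (f : A -> B) n : abelian_variety S B -> hom S f -> hom S (fun x => f x *+ n).
Proof.
move=> aB [mf af]; split; first exact: morphS_muln.
by move=> x y; rewrite af mulrnDl.
Qed.

Lemma hom_opp (A B : avar L) (f : A -> B) : abelian_variety S B -> hom S f -> hom S (fun x => - f x).
Proof.
move=> aB [mf af]; split; first exact: morphS_opp.
by move=> x y; rewrite af opprD.
Qed.

Lemma hom_id (A : avar L) : abelian_variety S A -> hom S (id : A -> A).
Proof. by move=> aA; split=> //; apply: morph_id => //; apply: av_embedded. Qed.
End Homs.

Section Divisible.
Variables (L : closedFieldType) (S : L -> Prop) (A : avar L).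
Hypothesis aA : abelian_variety S A.
Hypothesis dA : ~ dim_ge (asp A) 3.

(** For primes other than p torsion is finite because multiplication is unramified; for p it is
    finite by ordinarity. Either way finiteness yields surjectivity. *)
Lemma ordinary_divisible p : p \in [pchar L] -> ordinary_surface p A ->
  forall n, (0 < n)%N -> forall y : A, exists x, x *+ n = y.
Proof.
move=> pL [s [_ _ hs]]; case: (abelian_varietyP aA) => pA irrA mA _.
have prim q : prime q -> forall y : A, exists x, x *+ q = y.
  move=> qp; apply: (muln_surjective_finite pA irrA mA dA).
  have [->|qp'] := eqVneq q p; first by exists s => x /hs.
  apply: (torsion_finite pA mA); rewrite -(dvdn_pcharf pL) dvdn_prime2 //; last exact: (pcharf_prime pL).
  by rewrite eq_sym.
move=> n; have [m] := ubnP n; elim: m n => // m IH n; rewrite ltnS => le n0 y.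
case: (ltnP 1 n) => [n1|]; last first.
  by move=> n1; have -> : n = 1%N by [apply/eqP; rewrite eqn_leq n1]; exists y.
have qd := pdiv_dvd n; have qp := pdiv_prime n1.
case: (prim _ qp y) => z <-.
case: (IH (n %/ pdiv n)%N _ _ z) => [||x <-].
- by apply: leq_trans le; apply: ltn_Pdiv => //; apply: prime_gt1.
- by rewrite divn_gt0 ?prime_gt0 // dvdn_leq.
by exists x; rewrite -mulrnA divnK.
Qed.
End Divisible.

Section Endomorphisms.
Variables (L : closedFieldType) (S : L -> Prop) (K : fieldExtType rat) (A : avar L).
Variables (O : K -> Prop) (iota : K -> qhom A A).
Hypothesis hS : scalars S.
Hypothesis aA : abelian_variety S A.
Hypothesis hCM : has_CM S O iota.
Hypothesis divA : forall n, (0 < n)%N -> forall y : A, exists x, x *+ n = y.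

(** On a divisible group the auxiliary integer of [qeq] cancels, so that x acts as f exactly when
    the numerator of [iota x] is f times the denominator. *)
Definition endo (x : K) (f : A -> A) := hom S f /\ forall a, (iota x).1 a = f a *+ (iota x).2.

Lemma iota_wf x : hom S (iota x).1 /\ (0 < (iota x).2)%N.
Proof. by case: hCM => -[/(_ x)]. Qed.

Lemma iota_add x : {morph (iota x).1 : a b / a + b}.
Proof. by case: (iota_wf x) => -[]. Qed.

Lemma qeq_muln (B C : avar L) (u v : qhom B C) : (forall n, (0 < n)%N -> forall y : B, exists x, x *+ n = y) ->
  {morph u.1 : a b / a + b} -> {morph v.1 : a b / a + b} ->
  qeq u v <-> forall a, u.1 a *+ v.2 = v.1 a *+ u.2.
Proof.
move=> divB au av; split=> [[t t0 h] a|h]; last by exists 1%N => // a; rewrite !mul1n.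
by case: (divB t t0 a) => b <-; rewrite !additive_muln // -!mulrnA h.
Qed.

Lemma endo_qeq x f : endo x f <-> hom S f /\ qeq (iota x) (qint f).
Proof.
split=> -[hf h]; split=> //.
  by apply/(@qeq_muln A A (iota x) (qint f) divA (@iota_add x) (proj2 hf)) => a; rewrite /= mulr1n.
by move=> a; move/(@qeq_muln A A (iota x) (qint f) divA (@iota_add x) (proj2 hf)) : h => /(_ a); rewrite /= mulr1n.
Qed.

Lemma endo_order f : hom S f -> exists2 x, O x & endo x f.
Proof. by move=> hf; case: hCM => _ _ _ _ /(_ f hf) [x Ox h]; exists x => //; apply/endo_qeq. Qed.

Lemma order_endo x : O x -> exists f, endo x f.
Proof. by case: hCM => _ _ _ h _ /h [f hf e]; exists f; apply/endo_qeq. Qed.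

Lemma endo_inj x y f : endo x f -> endo y f -> x = y.
Proof.
move=> [hf hx] [_ hy]; case: hCM => -[_ inj] _ _ _ _; apply: inj.
by apply/(qeq_muln divA (@iota_add x) (@iota_add y)) => a; rewrite hx hy -!mulrnA mulnC.
Qed.

Lemma endo_fun x f g : endo x f -> endo x g -> f =1 g.
Proof.
move=> [[_ af] hf] [[_ ag] hg] a; case: (iota_wf x) => _ n0; case: (divA n0 a) => b <-.
by rewrite !additive_muln // -hf -hg.
Qed.

Lemma endo_in_order x f : endo x f -> O x.
Proof.
by move=> ex; case: (endo_order (proj1 ex)) => y Oy ey; rewrite (endo_inj ex ey).
Qed.

Lemma endo1 : endo 1 id.
Proof. by apply/endo_qeq; split; [apply: hom_id|case: hCM]. Qed.

Lemma endo_add x y f g : endo x f -> endo y g -> endo (x + y) (fun a => f a + g a).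
Proof.
move=> [hf ex] [hg ey]; have hfg := hom_add hS aA hf hg; split=> // a.
case: hCM => _ _ [hadd _] _ _.
have [_ x0] := iota_wf x; have [_ y0] := iota_wf y; have n0 : (0 < (iota x).2 * (iota y).2)%N by rewrite muln_gt0 x0.
have aq : {morph (qadd (iota x) (iota y)).1 : a b / a + b}.
  by move=> u v /=; rewrite !iota_add !mulrnDl addrACA.
have := hadd x y; move/(qeq_muln divA (@iota_add _) aq) => /=.
case: (divA n0 a) => b <- /(_ b); rewrite (additive_muln (@iota_add _)) => ->.
congr (_ *+ _); rewrite (additive_muln (proj2 hf)) (additive_muln (proj2 hg)) ex ey -!mulrnA.
by rewrite [((iota y).2 * _)%N]mulnC.
Qed.

Lemma endo_mul x y f g : endo x f -> endo y g -> endo (x * y) (fun a => f (g a)).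
Proof.
move=> [hf ex] [hg ey]; have hfg := hom_comp hS aA aA hg hf; split=> // a.
case: hCM => _ _ [_ hmul] _ _.
have [_ x0] := iota_wf x; have [_ y0] := iota_wf y; have n0 : (0 < (iota x).2 * (iota y).2)%N by rewrite muln_gt0 x0.
have aq : {morph (qcomp (iota x) (iota y)).1 : a b / a + b}.
  by move=> u v /=; rewrite !iota_add.
have := hmul x y; move/(qeq_muln divA (@iota_add _) aq) => /=.
case: (divA n0 a) => b <- /(_ b); rewrite (additive_muln (@iota_add _)) => ->.
rewrite (additive_muln (proj2 hfg)) ex ey (additive_muln (proj2 hf)) -!mulrnA; congr (_ *+ _); lia.
Qed.

Lemma endo_muln x f n : endo x f -> endo (x *+ n) (fun a => f a *+ n).
Proof.
move=> ex; elim: n => [|n IH]; last first.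
  have := endo_add ex IH; rewrite -mulrS; congr endo; apply: boolp.funext => a; by rewrite mulrS.
have h0 : hom S (fun a => f a *+ 0) by apply: hom_muln; case: ex.
case: (endo_order h0) => y _ ey; have := endo_add ex ey.
have -> : (fun a => f a + f a *+ 0) = f by apply: boolp.funext => a; rewrite mulr0n addr0.
move=> ex2; have := endo_inj ex2 ex => e.
by rewrite mulr0n (_ : 0 = y) //; apply: (@addrI _ x); rewrite e addr0.
Qed.

Lemma endo_opp x f : endo x f -> endo (- x) (fun a => - f a).
Proof.
move=> ex; have h0 : hom S (fun a => - f a) by apply: hom_opp; case: ex.
case: (endo_order h0) => y _ ey; have := endo_add ex ey.
have := endo_muln 0 ex.
have -> : (fun a => f a + - f a) = (fun a => f a *+ 0) by apply: boolp.funext => a; rewrite mulr0n subrr.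
move=> e0 e1; have := endo_inj e0 e1; rewrite mulr0n => e.
by rewrite (_ : - x = y) //; apply: (@addrI _ x); rewrite subrr.
Qed.

Lemma endo_nat n : endo n%:R (fun a => a *+ n).
Proof. exact: endo_muln endo1. Qed.

Lemma endo_denominator x : endo (x *+ (iota x).2) (iota x).1.
Proof.
have [hx x0] := iota_wf x; split=> // a; set n := (iota x).2.
have [_ en] := endo_nat n.
case: hCM => _ _ [_ hmul] _ _; have [_ y0] := iota_wf n%:R.
have aq : {morph (qcomp (iota x) (iota n%:R)).1 : a b / a + b}.
  by move=> u v /=; rewrite !iota_add.
have := hmul x n%:R; rewrite mulr_natr; move/(qeq_muln divA (@iota_add _) aq) => /=.
have n0 : (0 < n * (iota n%:R).2)%N by rewrite muln_gt0 x0.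
case: (divA n0 a) => b <- /(_ b); rewrite (additive_muln (@iota_add _)) => ->.
by rewrite en -mulrnA.
Qed.

Lemma endo_comm x y f g : endo x f -> endo y g -> forall a, f (g a) = g (f a).
Proof. by move=> ex ey; apply: endo_fun (endo_mul ex ey) _; rewrite mulrC; apply: endo_mul. Qed.
End Endomorphisms.

Lemma fibre_adjoint_sym (L : closedFieldType) (S : L -> Prop) (A B : pavar L) (MA : lbdata (asp A)) (MB : lbdata (asp B)) f g :
  polarized S MA -> polarized S MB -> @morph L anyL (asp A) (asp B) f -> {morph f : x y / x + y} ->
  fibre_adjoint f g -> fibre_adjoint g f.
Proof.
move=> hA hB mf af h; have [mg ad] := fibre_adjoint_adjoint hA hB mf (additive0 af) h.
exact: (adjoint_fibre hB hA mg mf (adjoint_sym hA hB ad)).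
Qed.

Section Rosati.
Variables (k : finFieldType) (L : closedFieldType) (e : {rmorphism k -> L}).
Hypothesis hL : forall x : L, algebraicOver e x.
Notation S := (in_base e).
Variables (A : pavar L) (MA : lbdata (asp A)).
Hypothesis hA : polarized S MA.
Variables (K : fieldExtType rat) (O : K -> Prop) (iota : K -> qhom A A).
Hypothesis hCM : has_CM S O iota.
Hypothesis divA : forall n, (0 < n)%N -> forall y : A, exists x, x *+ n = y.
Let aA : abelian_variety S A := pol_av hA.
Let hS : scalars S := in_base_scalars e.
Let eA := pol_embedded hA.
Notation endo := (endo S iota).

Lemma rosati_ex (f : A -> A) : hom S f -> exists2 g, hom S g & fibre_adjoint f g.
Proof.
move=> [mf af]; have [g [mg ag h]] := adjoint_ex hA hA (morph_any mf) af.
by exists g => //; split=> //; apply: (rosati_descent hL hA hA mf mg h).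
Qed.

Lemma adjoint_nat n : (0 < n)%N -> fibre_adjoint (fun x : A => x *+ n) (fun x : A => x *+ n).
Proof.
have mn j : @morph L anyL (asp A) (asp A) (fun x => x *+ j).
  by apply: (morph_muln eA (pol_add hA)); apply: morph_id.
have mi := morph_id anyL_scalars eA.
have a1 : adjoint MA MA (id : A -> A) id.
  by have [] := fibre_adjoint_adjoint hA hA mi (erefl : id (0 : A) = 0) (fibre_adjoint_id hA).
move=> n0; apply: (adjoint_fibre hA hA (mn n) (mn n)).
case: n n0 => // n _; elim: n => [//|n IH].
have := adjoint_add hA hA mi (mn n.+1) mi (mn n.+1) a1 IH.
by congr adjoint; apply: boolp.funext => x; rewrite [in RHS]mulrS.
Qed.

Lemma adjoint_muln (f g : A -> A) n : (0 < n)%N -> hom S f -> {morph g : x y / x + y} -> fibre_adjoint f g ->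
  fibre_adjoint (fun x => f x *+ n) (fun x => g x *+ n).
Proof.
move=> n0 [mf af] ag h; have := fibre_adjoint_comp hA hA (morph_any mf) h (adjoint_nat n0).
by congr fibre_adjoint; apply: boolp.funext => x; rewrite additive_muln.
Qed.

(** The graph of the Rosati involution on [K], with denominators cleared because only endomorphisms
    have adjoints here. *)
Definition conjugate_elements (x y : K) := exists n f g,
  [/\ (0 < n)%N, endo (x *+ n) f, endo (y *+ n) g & fibre_adjoint f g].
Notation R := conjugate_elements.

Lemma conjugate_ex x : exists y, R x y.
Proof.
have [hf n0] := iota_wf hCM x; have ef := endo_denominator hS aA hCM divA x.
case: (rosati_ex hf) => g hg adj; case: (endo_order hCM divA hg) => z _ ez.
exists (z / (iota x).2%:R), (iota x).2, (iota x).1, g; split=> //.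
suff -> : z / (iota x).2%:R *+ (iota x).2 = z by [].
by rewrite -[LHS]mulr_natr divfK ?natF_neq0.
Qed.

Lemma conjugate_scale x f n m : endo (x *+ n) f -> endo (x *+ (n * m)) (fun a => f a *+ m).
Proof. by move=> ef; rewrite mulrnA; apply: (endo_muln hS aA hCM divA). Qed.

Lemma conjugate_fun x y y' : R x y -> R x y' -> y = y'.
Proof.
move=> [n [f [g [n0 ef eg h]]]] [n' [f' [g' [n'0 ef' eg' h']]]].
have e1 := conjugate_scale n' ef; have := conjugate_scale n ef'; rewrite mulnC => e2.
have h1 := adjoint_muln n'0 (proj1 ef) (proj2 (proj1 eg)) h.
have h2 := adjoint_muln n0 (proj1 ef') (proj2 (proj1 eg')) h'.
have E : (fun a => f a *+ n') = (fun a => f' a *+ n).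
  by apply: boolp.funext; apply: (endo_fun hCM divA e1 e2).
rewrite -E in h2; have := fibre_adjoint_unique hA hA (morph_any (proj1 (proj1 e1))) h1 h2.
move/boolp.funext => E'; have e3 := conjugate_scale n' eg; have := conjugate_scale n eg'; rewrite mulnC -E' => e4.
by have := endo_inj hCM divA e3 e4; apply: mulrn_injF; rewrite muln_gt0 n0.
Qed.

Lemma conjugate_add x y u v : R x y -> R u v -> R (x + u) (y + v).
Proof.
move=> [n [f [g [n0 ef eg h]]]] [n' [f' [g' [n'0 ef' eg' h']]]].
have e1 := conjugate_scale n' ef; have := conjugate_scale n ef'; rewrite mulnC => e2.
have e3 := conjugate_scale n' eg; have := conjugate_scale n eg'; rewrite mulnC => e4.
have h1 := adjoint_muln n'0 (proj1 ef) (proj2 (proj1 eg)) h.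
have h2 := adjoint_muln n0 (proj1 ef') (proj2 (proj1 eg')) h'.
exists (n * n')%N, (fun a => f a *+ n' + f' a *+ n), (fun a => g a *+ n' + g' a *+ n); split.
- by rewrite muln_gt0 n0.
- by rewrite mulrnDl; apply: (endo_add hS aA hCM divA).
- by rewrite mulrnDl; apply: (endo_add hS aA hCM divA).
have [m1 a1] := proj1 e1; have [m2 a2] := proj1 e2; have [m3 a3] := proj1 e3; have [m4 a4] := proj1 e4.
have ad1 := proj2 (fibre_adjoint_adjoint hA hA (morph_any m1) (additive0 a1) h1).
have ad2 := proj2 (fibre_adjoint_adjoint hA hA (morph_any m2) (additive0 a2) h2).
have := adjoint_add hA hA (morph_any m1) (morph_any m2) (morph_any m3) (morph_any m4) ad1 ad2.
apply: (adjoint_fibre hA hA); apply: (morph_add eA (pol_add hA)); exact: morph_any.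
Qed.

Lemma conjugate_mul x y u v : R x y -> R u v -> R (x * u) (y * v).
Proof.
move=> [n [f [g [n0 ef eg h]]]] [n' [f' [g' [n'0 ef' eg' h']]]].
exists (n * n')%N, (fun a => f' (f a)), (fun a => g (g' a)); split.
- by rewrite muln_gt0 n0.
- have -> : (x * u) *+ (n * n') = (u *+ n') * (x *+ n) by rewrite mulrnAl mulrnAr -mulrnA [u * x]mulrC.
  exact: (endo_mul hS aA hCM divA).
- have -> : (y * v) *+ (n * n') = (y *+ n) * (v *+ n') by rewrite mulrnAl mulrnAr -mulrnA mulnC.
  exact: (endo_mul hS aA hCM divA).
exact: (fibre_adjoint_comp hA hA (morph_any (proj1 (proj1 ef))) h h').
Qed.

Lemma conjugate_sym x y : R x y -> R y x.
Proof.
move=> [n [f [g [n0 ef eg h]]]]; exists n, g, f; split=> //.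
have [mf af] := proj1 ef; exact: (fibre_adjoint_sym hA hA (morph_any mf) af h).
Qed.

Lemma conjugate_one : R 1 1.
Proof.
have E : endo (1 *+ 1) id by rewrite mulr1n; exact: (endo1 hS aA hCM divA).
by exists 1%N, id, id; split=> //; apply: (fibre_adjoint_id hA).
Qed.

Lemma self_adjoint (K0 : {subfield K}) x f : quartic_CM K0 -> primitive_CM K -> x \in K0 ->
  endo x f -> fibre_adjoint f f.
Proof.
move=> q4 prim xK0 ef.
have /boolp.choice [s0 hs0] := conjugate_ex.
have sD u v : s0 (u + v) = s0 u + s0 v by apply: conjugate_fun (hs0 _) (conjugate_add (hs0 u) (hs0 v)).
have [s hs] := @rmorphism_of K K s0 (additiveB sD) (conjugate_fun (hs0 1) conjugate_one)
  (fun u v => conjugate_fun (hs0 (u * v)) (conjugate_mul (hs0 u) (hs0 v))).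
have inv : involutive s by move=> y; rewrite !hs; apply: conjugate_fun (hs0 _) (conjugate_sym (hs0 y)).
have Rxx : R x x by have := hs0 x; rewrite -hs (involution_real q4 prim inv xK0).
case: Rxx => n [g [g' [n0 eg eg' h]]].
have E : g' = g by apply: boolp.funext; apply: (endo_fun hCM divA eg' eg).
have e1 := endo_muln hS aA hCM divA n ef.
have E' : g = fun a => f a *+ n by apply: boolp.funext; apply: (endo_fun hCM divA eg e1).
have [hf _] := ef; case: (rosati_ex hf) => f' hf' h'.
have h2 := adjoint_muln n0 hf (proj2 hf') h'.
rewrite E E' in h; have := fibre_adjoint_unique hA hA (morph_any (proj1 (proj1 e1))) h2 h => fn.
suff E2 : f' = f by rewrite E2 in h'.
apply: boolp.funext => a; case: (divA n0 a) => b <-.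
by rewrite !additive_muln ?fn //; [case: hf|case: hf'].
Qed.
End Rosati.

(** * Orders of the kernels *)

Section Listings.

Definition listing (T : eqType) (P : T -> Prop) s := uniq s /\ forall x, x \in s <-> P x.

Lemma listing_sub (T : eqType) (P : T -> Prop) (t : seq T) : (forall x, P x -> x \in t) -> exists s, listing P s.
Proof.
move=> h; exists (undup [seq x <- t | boolp.asbool (P x)]); split; first exact: undup_uniq.
move=> x; rewrite mem_undup mem_filter; split=> [/andP [/boolp.asboolP]//|Px].
by apply/andP; split; [apply/boolp.asboolP|apply: h].
Qed.

Lemma listing_fibre (A B : zmodType) (P : A -> Prop) (Q : B -> Prop) (f : A -> B) X G H :
  {morph f : x y / x + y} -> (forall x y, P x -> P y -> P (x + y)) -> (forall x, P x -> P (- x)) ->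
  (forall b, Q b <-> exists2 a, P a & f a = b) ->
  listing P X -> listing (fun x => P x /\ f x = 0) G -> listing Q H -> size X = (size H * size G)%N.
Proof.
move=> af PD PN hQ [uX hX] [uG hG] [uH hH].
have [s hs] : exists s : B -> A, forall b, b \in H -> P (s b) /\ f (s b) = b.
  suff /boolp.choice [s hs] : forall b, exists a, b \in H -> P a /\ f a = b by exists s.
  move=> b; case: (boolP (b \in H)) => [/hH /hQ [a Pa fa]|_]; [by exists a|by exists 0].
rewrite -(size_allpairs (fun h g => s h + g)); apply/perm_size/uniq_perm => //.
  apply: allpairs_uniq => // -[h g] [h' g'] /allpairsP [[u v] /= [uh vg [-> ->]]] /allpairsP [[u' v'] /= [uh' vg' [-> ->]]] /= e.
  have [_ su] := hs _ uh; have [_ su'] := hs _ uh'; have [_ v0] := proj1 (hG _) vg; have [_ v0'] := proj1 (hG _) vg'.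
  have uu : u = u' by have := congr1 f e; rewrite !af su su' v0 v0' !addr0.
  by rewrite uu in e *; move/addrI: e => ->.
move=> x; apply/idP/idP => [/hX Px|/allpairsP [[h g] /= [hh gg ->]]].
  have fxH : f x \in H by apply/hH/hQ; exists x.
  have [Ps es] := hs _ fxH; apply/allpairsP; exists (f x, x - s (f x)); split=> //=; last by rewrite addrC subrK.
  by apply/hG; split; [apply: PD => //; apply: PN|rewrite (additiveB af) es subrr].
by apply/hX; apply: PD; [case: (hs _ hh)|case/hG: gg].
Qed.

Lemma listing_cyclic (A : zmodType) (P : A -> Prop) l s g : prime l ->
  (forall x y, P x -> P y -> P (x + y)) -> P 0 -> P g -> g *+ l = 0 -> g != 0 -> listing P s ->
  [/\ (l <= size s)%N, forall n, g *+ n = 0 <-> (l %| n)%N &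
    size s = l -> forall x, P x <-> exists n, x = g *+ n].
Proof.
move=> pl PD P0 Pg gl g0 [us hs].
have Pn n : P (g *+ n) by elim: n => [|n IH]; rewrite ?mulr0n // mulrS; apply: PD.
have hn n : g *+ n = 0 <-> (l %| n)%N.
  split=> [gn|/dvdnP [q ->]]; last by rewrite mulnC mulrnA gl mul0rn.
  apply: contraNT g0 => nd; have co : coprime n l by rewrite coprime_sym prime_coprime.
  have n0 : (0 < n)%N by case: n nd {gn co} => //; rewrite dvdn0.
  case: (egcdnP l n0) => u v e _; rewrite (eqP co) in e.
  have : g *+ (u * n) = 0 by rewrite mulnC mulrnA gn mul0rn.
  by rewrite e mulrnDr mulnC mulrnA gl mul0rn add0r mulr1n => ->.
have inj : {in [pred n | (n < l)%N] &, injective (fun n => g *+ n)}.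
  suff w n m : (n <= m)%N -> (m < l)%N -> g *+ n = g *+ m -> n = m.
    move=> n m; rewrite !inE => nl ml e; case/orP: (leq_total n m) => h; first exact: w.
    by apply/esym; apply: w.
  move=> nm ml e; have : g *+ (m - n) = 0 by rewrite mulrnBr // e subrr.
  move/hn => d; apply/eqP; rewrite eqn_leq nm -subn_eq0; case: (m - n)%N (leq_subr n m) d => // k kl /dvdn_leq.
  by move=> /(_ isT); rewrite leqNgt (leq_ltn_trans kl ml).
have um : uniq (mkseq (fun n => g *+ n) l).
  rewrite map_inj_in_uniq ?iota_uniq // => n m; rewrite !mem_iota !add0n /= => nl ml; exact: inj.
have sub : {subset mkseq (fun n => g *+ n) l <= s} by move=> _ /mapP [n _ ->]; apply/hs.
split=> //; first by have := uniq_leq_size um sub; rewrite size_mkseq.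
move=> sl x; split=> [/hs|[n ->]]; last exact: Pn.
have le : (size s <= size (mkseq (fun n => g *+ n) l))%N by rewrite size_mkseq sl.
have [_ e] := uniq_min_size um sub le; rewrite -e => /mapP [n _ ->]; by exists n.
Qed.
End Listings.

Lemma coprime_inverse m l : (0 < m)%N -> coprime m l -> exists w t, (m * m * w = t * l + 1)%N.
Proof.
move=> m0 co; have co2 : coprime (m * m) l by rewrite coprimeMl co.
have mm0 : (0 < m * m)%N by rewrite muln_gt0 m0.
by case: (egcdnP l mm0) => u v e _; exists u, v; rewrite mulnC e (eqP co2).
Qed.

(** The relations ab = l and ax + by = 1 for endomorphisms that represent m times a, b, x and y,
    whence the factor [m * m]. *)
Record splitting (A : zmodType) (l m : nat) (al be xi eta : A -> A) : Prop := Splitting {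
  sp_addal : {morph al : x y / x + y}; sp_addbe : {morph be : x y / x + y};
  sp_addxi : {morph xi : x y / x + y}; sp_addeta : {morph eta : x y / x + y};
  sp_albe : forall x, al (be x) = x *+ (m * m * l); sp_beal : forall x, be (al x) = x *+ (m * m * l);
  sp_xial : forall x, xi (al x) = al (xi x); sp_etabe : forall x, eta (be x) = be (eta x);
  sp_one : forall x, al (xi x) + be (eta x) = x *+ (m * m) }.

Lemma splitting_swap (A : zmodType) l m (al be xi eta : A -> A) :
  splitting l m al be xi eta -> splitting l m be al eta xi.
Proof. by case=> *; split=> // x; rewrite addrC. Qed.

Section SplitTorsion.
Variables (A : zmodType) (l m : nat) (al be xi eta : A -> A).
Hypothesis sp : splitting l m al be xi eta.
Hypotheses (m0 : (0 < m)%N) (co : coprime m l).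

(** [w] inverts the square of m modulo l; on l-torsion the two terms are then complementary
    projections. *)
Lemma split_unit : exists w, forall x : A, x *+ l = 0 -> al (xi (x *+ w)) + be (eta (x *+ w)) = x.
Proof.
case: (coprime_inverse m0 co) => w [t e]; exists w => x xl.
by rewrite (sp_one sp) -mulrnA mulnC e mulrnDr mulnC mulrnA xl mul0rn add0r.
Qed.

Lemma split_al_kill x : x *+ l = 0 -> be (al x) = 0.
Proof. by move=> xl; rewrite (sp_beal sp) mulnC mulrnA xl mul0rn. Qed.

Lemma split_torsion_size tA tal tbe : listing (fun x : A => x *+ l = 0) tA ->
  listing (fun x : A => x *+ l = 0 /\ al x = 0) tal -> listing (fun x : A => x *+ l = 0 /\ be x = 0) tbe ->
  size tA = (size tbe * size tal)%N.
Proof.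
move=> hT hal hbe; have [w hw] := split_unit.
have amul (u : A -> A) x n : {morph u : x y / x + y} -> u (x *+ n) = u x *+ n by move=> au; exact: additive_muln.
have hal' : listing (fun x : A => x *+ l = 0 /\ al (xi x) = 0) tal.
  case: hal => ut ht; split=> // x; rewrite ht; split=> -[xl e]; split=> //.
    by rewrite -(sp_xial sp) e (additive0 (sp_addxi sp)).
  rewrite -(hw x xl) (sp_addal sp) (sp_albe sp) (amul xi) ?(amul al); try by [exact: sp_addal sp|exact: sp_addxi sp].
  rewrite e (additive0 (sp_addal sp)) mul0rn add0r mulnC mulrnA (amul eta); last exact: sp_addeta sp.
  have el : eta x *+ l = 0 by rewrite -(additive_muln (sp_addeta sp)) xl (additive0 (sp_addeta sp)).
  by rewrite [eta x *+ w *+ l]mulrnAC el !mul0rn.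
apply: (listing_fibre (f := fun x => al (xi x)) (P := fun x : A => x *+ l = 0) (Q := fun x : A => x *+ l = 0 /\ be x = 0)) => //.
- by move=> x y; rewrite (sp_addxi sp) (sp_addal sp).
- by move=> x y xl yl; rewrite mulrnDl xl yl addr0.
- by move=> x xl; rewrite mulNrn xl oppr0.
move=> b; split=> [[bl b0]|[a al0 <-]].
  exists (b *+ w); first by rewrite -mulrnA mulnC mulrnA bl mul0rn.
  have := hw b bl; rewrite -(sp_etabe sp) (amul be) ?b0 ?mul0rn ?(additive0 (sp_addeta sp)) ?addr0 //.
  exact: sp_addbe sp.
have xl : xi a *+ l = 0 by rewrite -(additive_muln (sp_addxi sp)) al0 (additive0 (sp_addxi sp)).
split; last exact: split_al_kill.
by rewrite -(additive_muln (sp_addal sp)) xl (additive0 (sp_addal sp)).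
Qed.
End SplitTorsion.

Section SplitKernel.
Variables (A B : zmodType) (l m : nat) (al be xi eta : A -> A) (alB beB xiB etaB : B -> B).
Hypotheses (spA : splitting l m al be xi eta) (spB : splitting l m alB beB xiB etaB).
Hypotheses (m0 : (0 < m)%N) (co : coprime m l).
Variables (f : A -> B) (g : B -> A).
Hypotheses (addf : {morph f : x y / x + y}) (gf : forall x, g (f x) = x *+ l).
Hypotheses (fal : forall x, f (al x) = alB (f x)) (fbe : forall x, f (be x) = beB (f x)).
Hypotheses (fxi : forall x, f (xi x) = xiB (f x)) (feta : forall x, f (eta x) = etaB (f x)).
Hypotheses (addg : {morph g : x y / x + y}) (fsurj : forall b, exists a, f a = b).

Lemma split_kernel x : f x = 0 -> exists x1 x2, [/\ x = x1 + x2, f x1 = 0, f x2 = 0, al x1 = 0 & be x2 = 0].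
Proof.
move=> fx; have xl : x *+ l = 0 by rewrite -gf fx (additive0 addg).
have [w hw] := split_unit spA m0 co; exists (be (eta (x *+ w))), (al (xi (x *+ w))).
have fw : f (x *+ w) = 0 by rewrite (additive_muln addf) fx mul0rn.
have kill (u : A -> A) : {morph u : x y / x + y} -> u (x *+ w) *+ l = 0.
  by move=> au; rewrite -(additive_muln au) -mulrnA mulnC mulrnA xl mul0rn (additive0 au).
split; first by rewrite addrC hw.
- by rewrite fbe feta fw (additive0 (sp_addeta spB)) (additive0 (sp_addbe spB)).
- by rewrite fal fxi fw (additive0 (sp_addxi spB)) (additive0 (sp_addal spB)).
- by apply: (split_al_kill (splitting_swap spA)); apply: kill; apply: sp_addeta spA.
by apply: (split_al_kill spA); apply: kill; apply: sp_addxi spA.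
Qed.

(** f maps the part of A[l] killed by [al] onto the part of the kernel of g killed by [alB]; the
    correction by [be (eta _)] makes a preimage lie in the right part. *)
Lemma split_kernel_size tal tG tH : listing (fun x : A => x *+ l = 0 /\ al x = 0) tal ->
  listing (fun x : A => f x = 0 /\ al x = 0) tG -> listing (fun y : B => g y = 0 /\ alB y = 0) tH ->
  size tal = (size tH * size tG)%N.
Proof.
move=> hal hG hH; have [w hw] := split_unit spA m0 co.
apply: (listing_fibre (f := f) (P := fun x : A => x *+ l = 0 /\ al x = 0) (Q := fun y : B => g y = 0 /\ alB y = 0)) => //.
- by move=> x y [xl ax] [yl ay]; rewrite mulrnDl (sp_addal spA) xl yl ax ay !addr0.
- by move=> x [xl ax]; rewrite mulNrn (additive_opp (sp_addal spA)) xl ax !oppr0.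
- move=> b; split=> [[gb ab]|[a [al0 aa] <-]]; last by rewrite gf -fal aa (additive0 addf).
  case: (fsurj b) => a e; have al0 : a *+ l = 0 by rewrite -gf e.
  exists (be (eta (a *+ w))).
    have el : eta (a *+ w) *+ l = 0.
      by rewrite -(additive_muln (sp_addeta spA)) -mulrnA mulnC mulrnA al0 mul0rn (additive0 (sp_addeta spA)).
    split; last exact: (split_al_kill (splitting_swap spA)).
    by rewrite -(additive_muln (sp_addbe spA)) el (additive0 (sp_addbe spA)).
  have := congr1 f (hw a al0); rewrite addf e -[in X in X + _](sp_xial spA) fxi fal (additive_muln addf) e.
  by rewrite (additive_muln (sp_addal spB)) ab mul0rn (additive0 (sp_addxi spB)) add0r.
case: hG => uG hG; split=> // x; rewrite hG; split=> [[fx ax]|[[xl ax] fx]] //.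
by split=> //; split=> //; rewrite -gf fx (additive0 addg).
Qed.
End SplitKernel.

Section DivideHom.
Variables (k : finFieldType) (L : closedFieldType) (e : {rmorphism k -> L}).
Hypothesis hL : forall x : L, algebraicOver e x.
Notation S := (in_base e).
Variables (A B : avar L).
Hypotheses (aA : abelian_variety S A) (aB : abelian_variety S B).
Hypothesis divA : forall n, (0 < n)%N -> forall y : A, exists x, x *+ n = y.

(** Multiplication by l is a quotient map by [etale_quotient], which gives [f'] geometrically;
    commuting with Frobenius, it is defined over the base field. *)
Lemma divide_hom (f : A -> B) l : hom S f -> (0 < l)%N -> l%:R != 0 :> L ->
  (forall x, x *+ l = 0 -> f x = 0) -> exists2 f', hom S f' & forall x, f x = f' (x *+ l).
Proof.
move=> [mf af] l0 li fl; case: (abelian_varietyP aA) => pA irrA mA _.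
have eA := av_embedded aA; have eB := av_embedded aB.
have ml : @morph L anyL (asp A) (asp A) (fun x => x *+ l) by apply: (morph_muln eA mA); apply: morph_id.
have mi : @morph L anyL (asp A) (asp A) id by apply: morph_id.
have addl : {morph (fun x : A => x *+ l) : x y / x + y} by move=> x y; rewrite mulrnDl.
have [ker hker] := torsion_finite pA mA li.
have [pB _ _ _] := abelian_varietyP aB.
have := etale_quotient pA irrA mA eA ml mi addl (fun x => erefl) li hker (divA l0).
move/(_ (asp B) f (projective_quasi pB) (morph_any mf)) => [|f' mf' hf'].
  move=> x y xy; have : f (x - y) = 0 by apply: fl; rewrite mulrnBl xy subrr.
  by rewrite (additiveB af) => /eqP; rewrite subr_eq0 => /eqP.
exists f'; last exact: hf'.
split; last first.
  move=> x y; case: (divA l0 x) => u <-; case: (divA l0 y) => v <-.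
  by rewrite -mulrnDl -!hf' af.
have pA' : projective S (asp A) by case: aA.
have pB' : projective S (asp B) by case: aB.
have fx := @base_fixed k L e 1.
have [FA cA] := conjugates_ex fx pA'; have [FB cB] := conjugates_ex fx pB'.
apply: (descent hL pA' eB cA cB mf') => x; case: (divA l0 x) => u <-.
have mlS : @morph L S (asp A) (asp A) (fun x => x *+ l).
  by apply: (morphS_muln (in_base_scalars e) aA); apply: (morph_id (in_base_scalars e)).
rewrite -hf' -(morph_conj fx eB cA cB mf u) hf'; congr f'.
by rewrite (morph_conj fx eA cA cA mlS u).
Qed.
End DivideHom.

Section ComponentNonzero.
Variables (k : finFieldType) (L : closedFieldType) (e : {rmorphism k -> L}).
Hypothesis hL : forall x : L, algebraicOver e x.
Notation S := (in_base e).
Variables (K : fieldExtType rat) (A : avar L) (O : K -> Prop) (iota : K -> qhom A A).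
Hypotheses (aA : abelian_variety S A) (hCM : has_CM S O iota).
Hypothesis divA : forall n, (0 < n)%N -> forall y : A, exists x, x *+ n = y.

Lemma component_nonzero l m (al be xi eta : A -> A) (b z : K) : (0 < l)%N -> l%:R != 0 :> L ->
  (0 < m)%N -> coprime m l -> splitting l m al be xi eta -> endo S iota b be -> b = z *+ l -> ~ O z ->
  exists2 x, x *+ l = 0 /\ al x = 0 & x != 0.
Proof.
move=> l0 li m0 co sp eb bz nOz; apply: boolp.contrapT => no; apply: nOz.
have [w hw] := split_unit sp m0 co.
have inj x : x *+ l = 0 -> al x = 0 -> x = 0.
  by move=> xl ax; apply/eqP/negPn/negP => x0; apply: no; exists x.
have bel x : x *+ l = 0 -> be x = 0.
  move=> xl; rewrite -(hw x xl) (sp_addbe sp).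
  have kl (u : A -> A) : {morph u : x y / x + y} -> u (x *+ w) *+ l = 0.
    by move=> au; rewrite -(additive_muln au) mulrnAC xl mul0rn (additive0 au).
  have -> : be (eta (x *+ w)) = 0.
    apply: inj; last by apply: (split_al_kill (splitting_swap sp)); apply/kl/sp_addeta/sp.
    by rewrite -(additive_muln (sp_addbe sp)) (kl _ (sp_addeta sp)) (additive0 (sp_addbe sp)).
  by rewrite (additive0 (sp_addbe sp)) addr0; apply: (split_al_kill sp); apply/kl/sp_addxi/sp.
have [b' hb' bb'] := divide_hom hL aA aA divA (proj1 eb) l0 li bel.
case: (endo_order hCM divA hb') => y Oy ey.
have := endo_muln (in_base_scalars e) aA hCM divA l ey.
have -> : (fun a => b' a *+ l) = be by apply: boolp.funext => a; rewrite bb' (additive_muln (proj2 hb')).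
move=> eyl; have := endo_inj hCM divA eyl eb; rewrite bz => /(mulrn_injF l0) E; by rewrite -E.
Qed.
End ComponentNonzero.

Section Components.
Variables (L : closedFieldType) (S : L -> Prop) (A B : pavar L).
Variables (MA : lbdata (asp A)) (MB : lbdata (asp B)).
Hypotheses (hA : polarized S MA) (hB : polarized S MB).
Variables (f : A -> B) (g : B -> A) (l m : nat).
Hypotheses (l_prime : prime l) (l_inv : l%:R != 0 :> L) (m0 : (0 < m)%N) (co : coprime m l).
Hypotheses (mf : @morph L anyL (asp A) (asp B) f) (mg : @morph L anyL (asp B) (asp A) g).
Hypotheses (addf : {morph f : x y / x + y}) (addg : {morph g : x y / x + y}) (adj : fibre_adjoint f g).
Hypotheses (gf : forall x, g (f x) = x *+ l) (fsurj : forall b, exists a, f a = b).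
Hypothesis divA : forall n, (0 < n)%N -> forall y : A, exists x, x *+ n = y.

Lemma dual_isogeny_compl b : f (g b) = b *+ l.
Proof. by case: (fsurj b) => a <-; rewrite gf (additive_muln addf). Qed.

Lemma dual_isogeny_surj a : exists b, g b = a.
Proof. by case: (divA (prime_gt0 l_prime) a) => x <-; exists (f x); rewrite gf. Qed.

Lemma dual_isogeny_comm (u : A -> A) (v : B -> B) : {morph u : x y / x + y} -> (forall x, f (u x) = v (f x)) ->
  forall b, g (v b) = u (g b).
Proof. by move=> au h b; case: (fsurj b) => a <-; rewrite -h !gf (additive_muln au). Qed.

Section OneComponent.
Variables (al be xi eta : A -> A) (alB beB xiB etaB : B -> B).
Hypotheses (spA : splitting l m al be xi eta) (spB : splitting l m alB beB xiB etaB).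
Hypotheses (fal : forall x, f (al x) = alB (f x)) (fbe : forall x, f (be x) = beB (f x)).
Hypotheses (fxi : forall x, f (xi x) = xiB (f x)) (feta : forall x, f (eta x) = etaB (f x)).
Hypotheses (mbe : @morph L anyL (asp A) (asp A) be) (mbeB : @morph L anyL (asp B) (asp B) beB).
Hypotheses (selfA : fibre_adjoint be be) (selfB : fibre_adjoint beB beB).

(** Counting characters gives only an inequality. The other one is the same bound with f and g
    exchanged. *)
Lemma component_size tG tH : listing (fun x : A => f x = 0 /\ al x = 0) tG ->
  listing (fun y : B => g y = 0 /\ alB y = 0) tH -> size tH = size tG.
Proof.
move=> [uG hG] [uH hH].
have gal := dual_isogeny_comm (sp_addal spA) fal; have gbe := dual_isogeny_comm (sp_addbe spA) fbe.
have gxi := dual_isogeny_comm (sp_addxi spA) fxi; have geta := dual_isogeny_comm (sp_addeta spA) feta.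
apply/eqP; rewrite eqn_leq; apply/andP; split.
  apply: (pairing_bound hA hB mf mg addf adj gf l_inv fsurj mbe mbeB fbe selfB _ hG (sp_addal spA) (sp_addbe spA) uH).
  - by move=> x; apply: (split_kernel spA spB).
  - move=> b /hH [gb ab]; split=> //; have [w hw] := split_unit spB m0 co.
    have bl : b *+ l = 0 by rewrite -dual_isogeny_compl gb (additive0 addf).
    exists (etaB (b *+ w)).
      by rewrite geta (additive_muln addg) gb mul0rn (additive0 (sp_addeta spA)).
    have := hw b bl; rewrite -(sp_xial spB) (additive_muln (sp_addal spB)) ab mul0rn.
    by rewrite (additive0 (sp_addxi spB)) add0r.
  by move=> b b' /hH [h1 h2] /hH [h3 h4]; apply/hH; rewrite (additiveB addg) (additiveB (sp_addal spB)) h1 h2 h3 h4 !subrr.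
have adj' := fibre_adjoint_sym hA hB mf addf adj.
apply: (pairing_bound hB hA mg mf addg adj' dual_isogeny_compl l_inv dual_isogeny_surj mbeB mbe gbe selfA _ hH (sp_addal spB) (sp_addbe spB) uG).
- by move=> x; apply: (split_kernel spB spA _ _ _ dual_isogeny_compl).
- move=> b /hG [fb ab]; split=> //; have [w hw] := split_unit spA m0 co.
  have bl : b *+ l = 0 by rewrite -gf fb (additive0 addg).
  exists (eta (b *+ w)).
    by rewrite feta (additive_muln addf) fb mul0rn (additive0 (sp_addeta spB)).
  have := hw b bl; rewrite -(sp_xial spA) (additive_muln (sp_addal spA)) ab mul0rn.
  by rewrite (additive0 (sp_addxi spA)) add0r.
by move=> b b' /hG [h1 h2] /hG [h3 h4]; apply/hG; rewrite (additiveB addf) (additiveB (sp_addal spA)) h1 h2 h3 h4 !subrr.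
Qed.

Lemma component_square tA tG : listing (fun x : A => x *+ l = 0 /\ al x = 0) tA ->
  listing (fun x : A => f x = 0 /\ al x = 0) tG -> size tA = (size tG * size tG)%N.
Proof.
move=> hT hG; have [tH hH] : exists tH, listing (fun y : B => g y = 0 /\ alB y = 0) tH.
  apply: (@listing_sub _ _ [seq f a | a <- tA]) => b [gb ab]; case: (fsurj b) => a e.
  have al0 : a *+ l = 0 by rewrite -gf e.
  have [w hw] := split_unit spA m0 co; have := hw a al0; move/(congr1 f); rewrite addf e.
  rewrite -[in X in X + _](sp_xial spA) fxi fal (additive_muln addf) e (additive_muln (sp_addal spB)) ab mul0rn.
  rewrite (additive0 (sp_addxi spB)) add0r => <-; apply: map_f; apply/(proj2 hT).
  have el : eta (a *+ w) *+ l = 0.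
    by rewrite -(additive_muln (sp_addeta spA)) mulrnAC al0 mul0rn (additive0 (sp_addeta spA)).
  split; last exact: (split_al_kill (splitting_swap spA)).
  by rewrite -(additive_muln (sp_addbe spA)) el (additive0 (sp_addbe spA)).
by rewrite (split_kernel_size spA spB m0 co addf gf fal fxi addg fsurj hT hG hH) (component_size hG hH).
Qed.
End OneComponent.
End Components.

Lemma order_muln (K : fieldExtType rat) (O : K -> Prop) x n : order_of O -> O x -> O (x *+ n).
Proof.
move=> [_ _ [b _ hO]] /hO [c ->]; apply/hO; exists (fun i => c i *+ n).
by rewrite -sumrMnl; apply: eq_bigr => i _; rewrite -[c i *+ n]mulr_natr natz mulrzA -pmulrn.
Qed.

Lemma coprime_killed (A : zmodType) (x : A) m l : coprime m l -> x *+ m = 0 -> x *+ l = 0 -> x = 0.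
Proof.
move=> co xm xl; case: m co xm => [|m] co xm.
  by move: co; rewrite /coprime gcd0n => /eqP l1; rewrite l1 in xl.
case: (@egcdnP m.+1 l isT) => u v e _; rewrite (eqP co) in e.
have : x *+ (u * m.+1) = x *+ (v * l) + x by rewrite e mulrnDr.
by rewrite mulnC mulrnA xm mul0rn [(v * l)%N]mulnC mulrnA xl mul0rn add0r.
Qed.

Lemma common_multiplier (K : fieldExtType rat) (K0 : {subfield K}) l (O O' : K -> Prop) : prime l ->
  order_of O -> order_of O' -> loc_max_RM K0 l O -> loc_max_RM K0 l O' ->
  forall s : seq (subvs_of K0), (forall x, x \in s -> integer_of x) ->
  exists m, [/\ (0 < m)%N, coprime m l & forall x, x \in s -> O (vsval x *+ m) /\ O' (vsval x *+ m)].
Proof.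
move=> pl o o' h h'; elim=> [|x s IH] hs; first by exists 1%N; rewrite coprime1n.
have pos m : ~~ (l %| m)%N -> (0 < m)%N by case: m => //; rewrite dvdn0.
have ix : integer_of x by apply: hs; rewrite mem_head.
case: IH => [y ys|m [m0 co hm]]; first by apply: hs; rewrite inE ys orbT.
have [a na Oa] := h x ix; have [b nb Ob] := h' x ix.
have cop n : ~~ (l %| n)%N -> coprime n l by rewrite coprime_sym prime_coprime.
exists (a * b * m)%N; split.
- by rewrite !muln_gt0 (pos a na) (pos b nb) m0.
- by rewrite !coprimeMl (cop a na) (cop b nb) co.
move=> y; rewrite inE => /orP [/eqP ->|/hm [h1 h2]].
  split; first by rewrite -mulnA mulrnA; apply: order_muln.
  by rewrite [(a * b)%N]mulnC -mulnA mulrnA; apply: order_muln.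
by split; rewrite mulnC mulrnA; apply: order_muln.
Qed.

Section CMSplitting.
Variables (L : closedFieldType) (S : L -> Prop) (K : fieldExtType rat) (A : avar L).
Variables (O : K -> Prop) (iota : K -> qhom A A).
Hypotheses (hS : scalars S) (aA : abelian_variety S A) (hCM : has_CM S O iota).
Hypothesis divA : forall n, (0 < n)%N -> forall y : A, exists x, x *+ n = y.
Notation endo := (endo S iota).

Lemma cm_splitting (a b x y : K) l m (al be xi eta : A -> A) : a * b = l%:R -> a * x + b * y = 1 ->
  endo (a *+ m) al -> endo (b *+ m) be -> endo (x *+ m) xi -> endo (y *+ m) eta ->
  splitting l m al be xi eta.
Proof.
move=> ab axby ea eb ex ey;
have M := endo_mul hS aA hCM divA; have N n := endo_nat hS aA hCM divA n.
have ad z h (ez : endo z h) : {morph h : u v / u + v} := proj2 (proj1 ez).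
split; try by [exact: ad ea|exact: ad eb|exact: ad ex|exact: ad ey].
- have := M _ _ _ _ ea eb; have -> : a *+ m * (b *+ m) = (m * m * l)%:R by rewrite mulrnAl mulrnAr ab -!mulrnA; congr (_ *+ _); lia.
  by move=> h z; apply: (endo_fun hCM divA h (N _)).
- have := M _ _ _ _ eb ea; have -> : b *+ m * (a *+ m) = (m * m * l)%:R by rewrite mulrC mulrnAl mulrnAr ab -!mulrnA; congr (_ *+ _); lia.
  by move=> h z; apply: (endo_fun hCM divA h (N _)).
- exact: (endo_comm hS aA hCM divA ex ea).
- exact: (endo_comm hS aA hCM divA ey eb).
have := endo_add hS aA hCM divA (M _ _ _ _ ea ex) (M _ _ _ _ eb ey).
have -> : a *+ m * (x *+ m) + b *+ m * (y *+ m) = (m * m)%:R.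
  by rewrite !mulrnAl !mulrnAr -!mulrnDl axby -mulrnA.
by move=> h z; apply: (endo_fun hCM divA h (N _)).
Qed.
End CMSplitting.

Lemma compatible_endo (L : closedFieldType) (S : L -> Prop) (K : fieldExtType rat) (A B : avar L)
  (OA OB : K -> Prop) (iA : K -> qhom A A) (iB : K -> qhom B B) (f : A -> B) x u v :
  has_CM S OA iA -> has_CM S OB iB -> (forall n, (0 < n)%N -> forall y : A, exists x, x *+ n = y) ->
  {morph f : x y / x + y} -> compatible iA iB f -> endo S iA x u -> endo S iB x v -> forall a, f (u a) = v (f a).
Proof.
move=> hA hB divA af comp [[_ au] hu] [[_ av] hv] a.
have [[_ aA] A0] := iota_wf hA x; have [[_ aB] B0] := iota_wf hB x.
have c1 : {morph (qcomp (qint f) (iA x)).1 : a b / a + b} by move=> y z /=; rewrite aA af.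
have c2 : {morph (qcomp (iB x) (qint f)).1 : a b / a + b} by move=> y z /=; rewrite af aB.
have := comp x; move/(qeq_muln divA c1 c2) => /= h.
have n0 : (0 < (iA x).2 * (iB x).2)%N by rewrite muln_gt0 A0.
case: (divA _ n0 a) => b <-; have := h b; rewrite hu hv mul1n muln1 (additive_muln af).
by rewrite (additive_muln au) !(additive_muln af) (additive_muln av) -!mulrnA [((iB x).2 * _)%N]mulnC.
Qed.

Section DualIsogeny.
Variables (L : closedFieldType) (S : L -> Prop) (A B : pavar L).
Variables (MA : lbdata (asp A)) (MB : lbdata (asp B)).
Hypotheses (hS : scalars S) (hA : polarized S MA) (hB : polarized S MB).

Lemma ell_isogeny_dual l (f : A -> B) : ell_isogeny S l f ->
  exists g, [/\ hom S g, fibre_adjoint f g & forall a, g (f a) = a *+ l].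
Proof.
move=> [[[mf af] _ _] [fd [hfd hlb] fdp]].
have [mu hmu [muK Kmu]] := pol_inverse hA.
have hpol : hom S (@polar L B) by case: (pol_pp hB).
have av (C : pavar L) (M : lbdata (asp C)) : polarized S M -> abelian_variety S (pdual C).
  by case/pol_dual => -[].
exists (fun b => mu (fd (polar b))); split.
- have h1 := hom_comp hS (av _ _ hB) (av _ _ hA) hpol hfd.
  exact: (hom_comp hS (av _ _ hA) (pol_av hA) h1 hmu).
- move=> b; rewrite Kmu; have eA := pol_embedded hA; have eB := pol_embedded hB.
  have lA := fibre_local eA (fd (polar b) : asp (pdual A)) (pol_dual_embedded hA) (poincare_local (pol_dual hA)).
  have lB := fibre_local eB (polar b : asp (pdual B)) (pol_dual_embedded hB) (poincare_local (pol_dual hB)).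
  have := hlb (polar b); move/(lb_isoP lA (lb_pull_local eB (morph_any mf) lB)) => h.
  by apply: Tr_near (TrV h) => x; apply: near_all => y; rewrite invf_div.
by move=> a; rewrite fdp (additive_muln (proj2 hmu)) muK.
Qed.
End DualIsogeny.

Section KernelCyclic.
Variables (L : closedFieldType) (S : L -> Prop) (A B : pavar L).
Variables (MA : lbdata (asp A)) (MB : lbdata (asp B)).
Hypotheses (hA : polarized S MA) (hB : polarized S MB).
Variables (f : A -> B) (g : B -> A) (l m : nat).
Hypotheses (l_prime : prime l) (l_inv : l%:R != 0 :> L) (m0 : (0 < m)%N) (co : coprime m l).
Hypotheses (mf : @morph L anyL (asp A) (asp B) f) (mg : @morph L anyL (asp B) (asp A) g).
Hypotheses (addf : {morph f : x y / x + y}) (addg : {morph g : x y / x + y}) (adj : fibre_adjoint f g).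
Hypotheses (gf : forall x, g (f x) = x *+ l) (fsurj : forall b, exists a, f a = b).
Hypothesis divA : forall n, (0 < n)%N -> forall y : A, exists x, x *+ n = y.
Hypothesis dA : ~ dim_ge (asp A) 3.
Variables (al be xi eta : A -> A) (alB beB xiB etaB : B -> B).
Hypotheses (spA : splitting l m al be xi eta) (spB : splitting l m alB beB xiB etaB).
Hypotheses (fal : forall x, f (al x) = alB (f x)) (fbe : forall x, f (be x) = beB (f x)).
Hypotheses (fxi : forall x, f (xi x) = xiB (f x)) (feta : forall x, f (eta x) = etaB (f x)).
Hypotheses (mal : @morph L anyL (asp A) (asp A) al) (malB : @morph L anyL (asp B) (asp B) alB).
Hypotheses (mbe : @morph L anyL (asp A) (asp A) be) (mbeB : @morph L anyL (asp B) (asp B) beB).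
Hypotheses (sal : fibre_adjoint al al) (salB : fibre_adjoint alB alB).
Hypotheses (sbe : fibre_adjoint be be) (sbeB : fibre_adjoint beB beB).
Hypotheses (nal : exists2 x, x *+ l = 0 /\ al x = 0 & x != 0) (nbe : exists2 x, x *+ l = 0 /\ be x = 0 & x != 0).

Lemma kernel_component_cyclic :
  exists g1, (forall n, g1 *+ n = 0 <-> (l %| n)%N) /\
    forall x, f x = 0 /\ al x = 0 <-> exists n, x = g1 *+ n.
Proof.
have [tA [uA hT szA]] := torsion_bound (pol_av hA) (pol_pp hA) dA (prime_gt1 l_prime) l_inv.
have lT : listing (fun x : A => x *+ l = 0) tA by split=> // x; rewrite hT; split=> /eqP.
have [ta ha] : exists t, listing (fun x : A => x *+ l = 0 /\ al x = 0) t.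
  by apply: (@listing_sub _ _ tA) => x [xl _]; apply/(proj2 lT).
have [tb hb] : exists t, listing (fun x : A => x *+ l = 0 /\ be x = 0) t.
  by apply: (@listing_sub _ _ tA) => x [xl _]; apply/(proj2 lT).
have kl x : f x = 0 -> x *+ l = 0 by move=> fx; rewrite -gf fx (additive0 addg).
have [ga hga] : exists t, listing (fun x : A => f x = 0 /\ al x = 0) t.
  by apply: (@listing_sub _ _ tA) => x [fx _]; apply/(proj2 lT)/kl.
have [gb hgb] : exists t, listing (fun x : A => f x = 0 /\ be x = 0) t.
  by apply: (@listing_sub _ _ tA) => x [fx _]; apply/(proj2 lT)/kl.
have e1 := split_torsion_size spA m0 co lT ha hb.
have e2 := component_square hA hB l_prime l_inv m0 co mf mg addf addg adj gf fsurj divA spA spB fal fbe fxi feta mbe mbeB sbe sbeB ha hga.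
have e3 := component_square hA hB l_prime l_inv m0 co mf mg addf addg adj gf fsurj divA (splitting_swap spA) (splitting_swap spB) fbe fal feta fxi mal malB sal salB hb hgb.
have closed (u : A -> A) : {morph u : x y / x + y} ->
    (forall x y, f x = 0 /\ u x = 0 -> f y = 0 /\ u y = 0 -> f (x + y) = 0 /\ u (x + y) = 0) /\ (f 0 = 0 /\ u 0 = 0).
  move=> au; split; last by rewrite (additive0 addf) (additive0 au).
  by move=> x y [fx ux] [fy uy]; rewrite addf au fx ux fy uy !addr0.
have nontriv (u : A -> A) t s : {morph u : x y / x + y} -> (exists2 x, x *+ l = 0 /\ u x = 0 & x != 0) ->
    listing (fun x : A => x *+ l = 0 /\ u x = 0) t -> listing (fun x : A => f x = 0 /\ u x = 0) s ->
    size t = (size s * size s)%N -> exists2 g, f g = 0 /\ u g = 0 & g != 0.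
  move=> au [x xP x0] [ut ht] [us hs] e; apply: boolp.contrapT => no.
  have : (size [:: x; 0%R] <= size t)%N.
    apply: uniq_leq_size; first by rewrite /= inE x0.
    move=> y; rewrite !inE => /orP [] /eqP ->; apply/ht => //.
    by rewrite mul0rn (additive0 au).
  have : (size s <= size [:: 0%R : A])%N.
    apply: uniq_leq_size => // y /hs hy; rewrite inE; apply/negPn/negP => y0; by apply: no; exists y.
  by rewrite e /=; case: (size s) => [|[|]].
have [g1 g1P g10] := nontriv _ _ _ (sp_addal spA) nal ha hga e2.
have [g2 g2P g20] := nontriv _ _ _ (sp_addbe spA) nbe hb hgb e3.
have [c1 z1] := closed _ (sp_addal spA); have [c2 z2] := closed _ (sp_addbe spA).
have [l1 h1 h1'] := listing_cyclic l_prime c1 z1 g1P (kl _ (proj1 g1P)) g10 hga.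
have [l2 _ _] := listing_cyclic l_prime c2 z2 g2P (kl _ (proj1 g2P)) g20 hgb.
(* Both components have order at least l and the square of the product of their orders is at most
   l^4, so neither order can exceed l. *)
exists g1; split=> //; apply: h1'; apply/eqP; rewrite eqn_leq l1 andbT leqNgt; apply/negP => lt.
move: szA; rewrite leqNgt => /negP; apply; rewrite e1 e2 e3.
have lp := prime_gt0 l_prime.
have q1 : (l * l < size ga * size ga)%N by apply: ltn_mul.
have q2 : (l * l <= size gb * size gb)%N by apply: leq_mul.
rewrite (expnS l 3) (expnS l 2) (expnS l 1) expn1 !mulnA -mulnA.
apply: leq_ltn_trans (leq_mul q2 (leqnn _)) _.
by rewrite -[X in (_ < X)%N]mulnA ltn_pmul2l // (leq_trans _ q2) // muln_gt0 lp.
Qed.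
End KernelCyclic.

(** * The intermediate surface *)

Section ClosedSets.
Variables (L : closedFieldType) (S : L -> Prop).
Hypothesis hS : scalars S.

(** The equations are the minors for all pairs of local representations at once: they vanish
    wherever f = g, and at each point one pair has nonzero factors. *)
Lemma zclosed_equalizer (X Y : pspace L) (f g : X -> Y) : embedded Y ->
  morph S f -> morph S g -> zclosed S (fun x => f x = g x).
Proof.
move=> eY /(morphP _ _ eY) mf /(morphP _ _ eY) mg; apply/zclosedP.
exists (fun u => exists d e c b i j, [/\ mrep S f d c, mrep S g e b &
  u = fun x => (c x * crd (f x) 0 i) * (b x * crd (g x) 0 j) - (c x * crd (f x) 0 j) * (b x * crd (g x) 0 i)]).
split=> [_ [d [e [c [b [i [j [hc hb ->]]]]]]]|x].
  by exists (d + e)%N; apply: (hfunB hS); apply: (hfunM hS).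
split=> [fg _ [d [e [c [b [i [j [hc hb ->]]]]]]]|h]; first by rewrite fg; ring.
case: (mf x) => d [c [cx hc]]; case: (mg x) => e [b [bx hb]]; apply: (proj2 eY).
case: (crd_neq0 eY (g x)) => j gj.
have minor i : crd (f x) 0 i * crd (g x) 0 j = crd (f x) 0 j * crd (g x) 0 i.
  apply: (mulfI (mulf_neq0 cx bx)); apply/eqP; rewrite -subr_eq0; apply/eqP.
  have := h _ (ex_intro _ d (ex_intro _ e (ex_intro _ c (ex_intro _ b (ex_intro _ i (ex_intro _ j (And3 hc hb erefl))))))).
  by move=> <-; ring.
have fj : crd (f x) 0 j != 0.
  apply/negP => /eqP fj; case: (crd_neq0 eY (f x)) => i; move: (minor i); rewrite fj mul0r => /eqP.
  by rewrite mulf_eq0 (negPf gj) orbF => ->.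
exists (crd (f x) 0 j / crd (g x) 0 j); first by rewrite mulf_neq0 ?invr_neq0.
by apply/rowP => i; rewrite mxE mulrAC -minor mulfK.
Qed.

Lemma zclosed_and (X : pspace L) (Z Z' : X -> Prop) : zclosed S Z -> zclosed S Z' -> zclosed S (fun x => Z x /\ Z' x).
Proof.
move=> [E [fE hE]] [E' [fE' hE']]; exists (fun p => E p \/ E' p); split; first by move=> p [/fE|/fE'].
move=> x; split=> [[zx zx'] p [Ep|Ep]|h]; first by move/hE: zx; apply.
  by move/hE': zx'; apply.
by split; [apply/hE|apply/hE'] => p Ep; apply: h; [left|right].
Qed.

End ClosedSets.

Section ImageGroup.
Variables (V W : zmodType) (h : {additive V -> W}).
Definition image_pred : {pred W} := fun w => boolp.asbool (exists v, h v = w).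

Lemma image_predP w : reflect (exists v, h v = w) (w \in image_pred).
Proof. exact: boolp.asboolP. Qed.

Lemma image_pred_closed : zmod_closed image_pred.
Proof.
split; first by apply/image_predP; exists 0; rewrite raddf0.
by move=> _ _ /image_predP [x <-] /image_predP [y <-]; apply/image_predP; exists (x - y); rewrite raddfB.
Qed.
HB.instance Definition _ := GRing.isZmodClosed.Build W image_pred image_pred_closed.

Record image_of := ImageOf { image_val : W; _ : image_val \in image_pred }.
HB.instance Definition _ := [isSub for image_val].
HB.instance Definition _ := [Choice of image_of by <:].
HB.instance Definition _ := [SubChoice_isSubZmodule of image_of by <:].

Definition to_image (v : V) : image_of := ImageOf (introT (image_predP (h v)) (ex_intro _ v erefl)).

Lemma to_imageD : {morph to_image : x y / x + y}.
Proof. by move=> x y; apply: val_inj; rewrite /= raddfD. Qed.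

Lemma to_image_surj c : exists v, to_image v = c.
Proof. by case: c => w hw; case/image_predP: (hw) => v e; exists v; apply: val_inj. Qed.
End ImageGroup.

Lemma additive_of (V W : zmodType) (g : V -> W) : {morph g : x y / x + y} ->
  exists h : {additive V -> W}, h =1 g.
Proof.
move=> gD; pose gA := GRing.isZmodMorphism.Build V W g (additiveB gD).
by pose h : {additive V -> W} := HB.pack g gA; exists h.
Qed.

Section ImageVariety.
Variables (L : closedFieldType) (S : L -> Prop) (A B X : avar L).
Hypothesis hS : scalars S.
Hypotheses (aA : abelian_variety S A) (aB : abelian_variety S B) (aX : abelian_variety S X).
Variable h : {additive X -> B * A}.
Hypotheses (m1 : @morph L S (asp X) (asp B) (fun x => (h x).1)) (m2 : @morph L S (asp X) (asp A) (fun x => (h x).2)).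
Hypothesis cl : @zclosed L S (pprod (asp B) (asp A)) (fun w => exists x, h x = w).
Let W := pprod (asp B) (asp A).
Let eA := av_embedded aA.
Let eB := av_embedded aB.
Let eW : embedded W := pprod_embedded eB eA.

Definition image_avar : avar L := @AVar L (image_of h) _ (fun c => @crd L W (image_val c)).
Notation C := image_avar.

Lemma image_projective_avar : projective S (asp C).
Proof.
have pW : projective S W by apply: pprod_projective => //; [case: aB|case: aA].
have := @embed_projective L S W (image_of h) (@image_val _ _ h) pW val_inj; apply.
move: cl; congr zclosed; apply: boolp.funext => w; apply: boolp.propext; split=> [[x <-]|[c <-]].
  by exists (to_image h x).
by case: (to_image_surj c) => x <-; exists x.
Qed.
Let eC : embedded (asp C) := proj1 image_projective_avar.

(* C carries the coordinates of B x A, so maps to C are morphisms when their composites with the inclusion are. *)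
Lemma morph_to_image (Z : pspace L) (f : Z -> C) : @morph L S Z W (fun z => image_val (f z)) -> @morph L S Z (asp C) f.
Proof. by []. Qed.

Lemma morph_image_val : @morph L S (asp C) W (@image_val _ _ h).
Proof. exact: (@morph_id L S (asp C) hS eC). Qed.

Lemma image_val_fst : @morph L S (asp C) (asp B) (fun c => (image_val c).1).
Proof. exact: (@morph_comp L S (asp C) W (asp B) _ fst hS eW eB morph_image_val (morph_fst hS eB eA)). Qed.

Lemma image_val_snd : @morph L S (asp C) (asp A) (fun c => (image_val c).2).
Proof. exact: (@morph_comp L S (asp C) W (asp A) _ snd hS eW eA morph_image_val (morph_snd hS eB eA)). Qed.

Lemma image_morph (Z : pspace L) (f : Z -> C) : @morph L S Z (asp B) (fun z => (image_val (f z)).1) ->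
  @morph L S Z (asp A) (fun z => (image_val (f z)).2) -> @morph L S Z (asp C) f.
Proof.
move=> mf mg; apply: morph_to_image; have := morph_pair hS eB eA mf mg; congr morph.
by apply: boolp.funext => z; case: (image_val (f z)).
Qed.

Lemma to_image_morph : @morph L S (asp X) (asp C) (to_image h).
Proof. exact: image_morph. Qed.

Lemma image_abelian_variety : abelian_variety S C.
Proof.
have mfst := @morph_fst L S hS (asp C) (asp C) eC eC; have msnd := @morph_snd L S hS (asp C) (asp C) eC eC.
pose CC := pprod (asp C) (asp C).
have comp (Z Y : pspace L) (q : Z -> C) (t : C -> Y) : embedded Y -> @morph L S Z (asp C) q -> @morph L S (asp C) Y t ->
  @morph L S Z Y (fun z => t (q z)) := fun eY mq mt => @morph_comp L S Z (asp C) Y q t hS eC eY mq mt.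
split.
- exact: image_projective_avar.
- have irrX : @irreducible L (asp X) (fun=> True) by case: aX.
  have := irreducible_image eC (morph_any to_image_morph) irrX; congr irreducible.
  apply: boolp.funext => c; apply: boolp.propext; split=> // _; case: (to_image_surj c) => x; by exists x.
- case: aA => _ _ [v pv Sv] _ _; case: aB => _ _ [u pu Su] _ _.
  exists (mxvec (u^T *m v)); last first.
    by move=> k; case/mxvec_indexP: k => i j; rewrite mxvecE mxE big_ord1 mxE; apply: (scalM hS).
  case: pv => c c0 ->; case: pu => d d0 ->; exists (d * c); first exact: mulf_neq0.
  rewrite -[RHS]/((d * c) *: mxvec ((av_crd (0 : B))^T *m av_crd (0 : A))).
  by apply/rowP => k; case/mxvec_indexP: k => i j; rewrite mxE !mxvecE !mxE !big_ord1 !mxE; ring.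
- apply: image_morph.
    have p1 : @morph L S CC (asp B) (fun u => (image_val u.1).1) by exact: (comp CC (asp B) fst _ eB mfst image_val_fst).
    have p2 : @morph L S CC (asp B) (fun u => (image_val u.2).1) by exact: (comp CC (asp B) snd _ eB msnd image_val_fst).
    exact: (morphS_add hS aB p1 p2).
  have p1 : @morph L S CC (asp A) (fun u => (image_val u.1).2) by exact: (comp CC (asp A) fst _ eA mfst image_val_snd).
  have p2 : @morph L S CC (asp A) (fun u => (image_val u.2).2) by exact: (comp CC (asp A) snd _ eA msnd image_val_snd).
  exact: (morphS_add hS aA p1 p2).
apply: image_morph.
  exact: (morphS_opp hS aB image_val_fst).
exact: (morphS_opp hS aA image_val_snd).
Qed.
End ImageVariety.

Section Isogenies.
Variables (L : closedFieldType) (S : L -> Prop) (X Y : avar L) (q : X -> Y) (g : Y -> X) (l : nat).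
Hypotheses (aX : abelian_variety S X) (aY : abelian_variety S Y).
Hypotheses (hq : hom S q) (mg : hom S g) (gq : forall x, g (q x) = x *+ l) (l_inv : l%:R != 0 :> L).

Lemma isogeny_kernel : exists s : seq X, forall x, q x = 0 -> x \in s.
Proof.
case: (abelian_varietyP aX) => pX _ mX _.
exact: (kernel_finite pX mX (av_embedded aY) (morph_any (proj1 hq)) (morph_any (proj1 mg)) gq l_inv (proj2 hq)).
Qed.

Lemma isogeny_quotient : (forall y, exists x, q x = y) -> isogeny S q /\ quotient_by_kernel q.
Proof.
move=> surj; have [s hs] := isogeny_kernel; split; first by split=> //; exists s.
case: (abelian_varietyP aX) => pX irrX mX _.
exact: (etale_quotient pX irrX mX (av_embedded aY) (morph_any (proj1 hq)) (morph_any (proj1 mg)) (proj2 hq) gq l_inv hs surj).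
Qed.

(** Only strictness of the image chain needs an argument. It uses that the kernel is finite and
    killed by [l]. *)
Lemma dim_ge_isogeny d : dim_ge (asp X) d -> dim_ge (asp Y) d.
Proof.
case: (abelian_varietyP aX) => pX _ mX _; have [s hs] := isogeny_kernel.
have eX := av_embedded aX; have eY := av_embedded aY; have [mq aq] := hq.
move=> [Z [h1 h2]]; exists (fun i y => exists2 x, Z i x & q x = y); split=> [i /h1 [cZ iZ]|i id].
  split; first exact: (closed_image_of pX eY (morph_any mq) cZ).
  exact: (irreducible_image eY (morph_any mq) iZ).
have [sub [x0 zx0 nx0]] := h2 i id; have [cZ _] := h1 i (ltnW id); have [_ iZ'] := h1 i.+1 id.
split=> [y [x zx <-]|]; first by exists x => //; apply: sub.
apply: boolp.contrapT => no; apply: nx0.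
have covered x : Z i.+1 x -> exists2 k, k \in [seq k <- s | boolp.asbool (q k = 0)] & Z i (x - k).
  move=> zx; case: (boolp.pselect (exists2 x', Z i x' & q x' = q x)) => [[x' zx' e]|n]; last first.
    by case: no; exists (q x) => //; exists x.
  have q0 : q (x - x') = 0 by rewrite (additiveB aq) e subrr.
  by exists (x - x'); [rewrite mem_filter hs // andbT; apply/boolp.asboolP|rewrite opprB addrC subrK].
(* The list [s] may contain points outside the kernel; replacing them by 0 makes every translation
   in the family compatible with q. *)
pose t (k : X) := if boolp.asbool (q k = 0) then k else 0.
have qt k : q (t k) = 0 by rewrite /t; case: boolp.asboolP => // _; apply: additive0.
have covered' x : Z i.+1 x -> exists2 k, k \in s & Z i (x - t k).
  by move=> /covered [k]; rewrite mem_filter => /andP [kq ks] zk; exists k => //; rewrite /t kq.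
have [k0 hk0] := @irreducible_cover L (asp X) (Z i.+1) X s
  (fun k x => Z i (x - t k)) iZ' (fun k => zclosed_preimage eX (morph_translate eX mX (- t k)) cZ) covered'.
have hk : q (t k0) = 0 /\ forall x, Z i.+1 x -> Z i (x - t k0) by [].
move: (t k0) hk => k hk.
have [qk sk] := hk; have kl : k *+ l = 0 by rewrite -gq qk (additive0 (proj2 mg)).
(* Translation by -k maps [Z i.+1] into [Z i] and has order dividing [l]; after [l] steps [x0]
   returns to itself, inside [Z i]. *)
have it n : Z i.+1 x0 -> Z i.+1 (x0 - k *+ n).
  move=> z0; elim: n => [|n IH]; first by rewrite mulr0n subr0.
  by rewrite mulrSr opprD addrA; apply/sub/sk.
have l0 : (0 < l)%N by case: (l) l_inv => //; rewrite mulr0n eqxx.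
have := sk _ (it l.-1 zx0); rewrite -addrA -opprD -mulrSr prednK // kl subr0.
by [].
Qed.
End Isogenies.

Section Lattice.
Variables (n : nat) (P : ('I_n -> int) -> Prop) (N : nat).
Hypothesis PB : forall c d z, P c -> P d -> P (fun i => c i - d i * z).
Hypotheses (N_gt0 : (0 < N)%N) (PN : forall j, P (fun i => (i == j)%:Z * N%:Z)).

Definition leading (j : nat) (c : 'I_n -> int) := forall i : 'I_n, (i < j)%N -> c i = 0.

(** Among the vectors whose earlier coordinates vanish, the least positive j-th coordinate divides
    all the others, by Euclidean division. *)
Lemma lattice_pivot (j : 'I_n) : exists w, [/\ P w, leading j w &
  forall c, P c -> leading j c -> exists z, c j = w j * z].
Proof.
pose Q d := boolp.asbool ((0 < d)%N /\ exists c, [/\ P c, leading j c & c j = d%:Z]).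
have exQ : exists d, Q d.
  exists N; apply/boolp.asboolP; split=> //; exists (fun i => (i == j)%:Z * N%:Z); split=> //.
    by move=> i ij; rewrite (_ : i == j = false) ?mul0r //; apply/negbTE; rewrite neq_ltn ij.
  by rewrite eqxx mul1r.
case: (ex_minnP exQ) => d /boolp.asboolP [d0 [w [Pw lw wj]]] dmin; exists w; split=> // c Pc lc.
exists (c j %/ d%:Z)%Z; rewrite wj [in LHS](divz_eq (c j) d%:Z) mulrC.
suff -> : (c j %% d%:Z)%Z = 0 by rewrite addr0.
have d0' : d%:Z != 0 by rewrite eqz_nat -lt0n.
have r0 := modz_ge0 (c j) d0'; have rd : ((c j %% d%:Z)%Z < d%:Z) by rewrite ltz_pmod // ltz_nat.
case E : (c j %% d%:Z)%Z r0 rd => [r|//] _; rewrite ltz_nat => rd; case: r E rd => // r E rd.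
have : Q r.+1.
  apply/boolp.asboolP; split=> //; exists (fun i => c i - w i * (c j %/ d%:Z)%Z); split.
  - exact: PB.
  - by move=> i ij; rewrite lc // lw // mul0r subr0.
  by rewrite wj -E /modz mulrC.
by move/dmin; rewrite leqNgt rd.
Qed.

(** Triangular elimination with the pivots. Linear independence is left to the dimension count in
    [commensurable_order]. *)
Lemma lattice_basis : exists w : 'I_n -> 'I_n -> int, (forall j, P (w j)) /\
  forall c, P c -> exists z : 'I_n -> int, forall i, c i = \sum_j z j * w j i.
Proof.
have /boolp.choice [w hw] := lattice_pivot; exists w; split=> [j|c Pc]; first by case: (hw j).
have main m : (m <= n)%N -> forall c, P c -> leading (n - m) c ->
    exists z : 'I_n -> int, forall i, c i = \sum_j z j * w j i.
  elim: m => [|m IH] mn c0 Pc0 lc0.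
    exists (fun=> 0) => i; rewrite big1 => [|j _]; last by rewrite mul0r.
    by apply: lc0; rewrite subn0.
  have jn : (n - m.+1 < n)%N by rewrite ltn_subrL /=; case: (n) mn.
  pose j := Ordinal jn; have [Pw lw dv] := hw j; case: (dv c0 Pc0 lc0) => z0 e0.
  case: (IH (ltnW mn) (fun i => c0 i - w j i * z0)) => [||z hz].
  - exact: PB.
  - move=> i; have -> : (n - m)%N = (n - m.+1).+1 by rewrite subnS prednK // subn_gt0.
    rewrite ltnS leq_eqVlt => /orP [/eqP ij|ij]; last by rewrite lc0 // lw // mul0r subr0.
    by have -> : i = j by [apply: val_inj]; rewrite e0 subrr.
  exists (fun i => z i + (i == j)%:Z * z0) => i.
  rewrite -[LHS](subrK (w j i * z0)) hz [X in _ = X](_ : _ = \sum_k (z k * w k i + (k == j)%:Z * z0 * w k i)); last first.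
    by apply: eq_bigr => k _; rewrite mulrDl.
  rewrite big_split /=; congr (_ + _); rewrite (bigD1 j) //= big1 => [|k /negPf ->]; last by rewrite !mul0r.
  by rewrite eqxx mul1r addr0 mulrC.
by apply: (main n (leqnn n) c Pc) => i; rewrite subnn.
Qed.
End Lattice.

Lemma commensurable_order (K : fieldExtType rat) (O M : K -> Prop) (N : nat) : order_of O -> (0 < N)%N ->
  M 1 -> (forall x y, M x -> M y -> M (x * y)) -> (forall x y, M x -> M y -> M (x - y)) ->
  (forall x, O x -> M (x *+ N)) -> (forall x, M x -> O (x *+ N)) -> order_of M.
Proof.
move=> oO N0 M1 MM MB OM MO; split=> //; have [_ _ [b bb hO]] := oO; set n := \dim {:K} in b bb hO.
pose v (c : 'I_n -> int) := \sum_(i < n) b`_i *~ c i.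
have M0 : M 0 by have := MB _ _ M1 M1; rewrite subrr.
have MD x y : M x -> M y -> M (x + y).
  by move=> mx my; have := MB _ _ mx (MB _ _ M0 my); rewrite sub0r opprK.
have Mn x k : M x -> M (x *+ k).
  by move=> mx; elim: k => [|k IH]; rewrite ?mulr0n // mulrS; apply: MD.
have Mz x (z : int) : M x -> M (x *~ z).
  move=> mx; case: z => k; first exact: Mn.
  by rewrite NegzE mulrNz -[- _]sub0r; apply: MB => //; apply: Mn.
have Ob (i : 'I_n) : O b`_i.
  apply/hO; exists (fun j => (j == i)%:Z); rewrite (bigD1 i) //= eqxx mulr1z big1 ?addr0 // => j /negPf ->.
  by rewrite mulr0z.
pose P c := exists x, M x /\ x *+ N = v c.
have vB c d z : v (fun i => c i - d i * z) = v c - v d *~ z.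
  rewrite /v mulrz_suml -sumrB; apply: eq_bigr => i _; by rewrite mulrzBr mulrzA.
have zn (u : K) (z : int) : u *~ z *+ N = u *+ N *~ z by rewrite !pmulrn mulrzAC.
have PB c d z : P c -> P d -> P (fun i => c i - d i * z).
  move=> [x [mx ex]] [y [my ey]]; exists (x - y *~ z); split; first by apply: MB => //; apply: Mz.
  by rewrite vB mulrnBl ex zn ey.
(* [P] records the coordinates of N times the elements of [M], and N b_j is such an element; hence
   the square of N. *)
have PN j : P (fun i => (i == j)%:Z * (N * N)%:Z).
  exists (b`_j *+ N); split; first exact/OM.
  rewrite /v (bigD1 j) //= eqxx mul1r big1 ?addr0 => [|i /negPf ->]; last by rewrite mul0r mulr0z.
  by rewrite -mulrnA.
have NN0 : (0 < N * N)%N by rewrite muln_gt0 N0.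
have [w [Pw hw]] := lattice_basis PB NN0 PN.
have /boolp.choice [x hx] := Pw.
pose t := [tuple x i | i < n].
have tE (i : 'I_n) : t`_i = x i by rewrite -tnth_nth tnth_mktuple.
have MP y : M y <-> exists c : 'I_n -> int, y = \sum_(i < n) t`_i *~ c i.
  split=> [my|[c ->]]; last first.
    elim/big_rec: _ => // i z _ mz; apply: MD => //; rewrite tE; apply: Mz; by case: (hx i).
  have /hO [c hc] := MO _ my; have Pc : P c by exists y.
  have [z hz] := hw c Pc; exists z; apply: (mulrn_injF N0); rewrite hc -sumrMnl.
  transitivity (\sum_(j < n) v (w j) *~ z j); last first.
    by apply: eq_bigr => j _; case: (hx j) => _ e; rewrite tE zn e.
  rewrite /v [RHS](_ : _ = \sum_(j < n) \sum_(i < n) b`_i *~ (z j * w j i)); last first.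
    by apply: eq_bigr => j _; rewrite mulrz_suml; apply: eq_bigr => i _; rewrite mulrC mulrzA.
  by rewrite exchange_big /=; apply: eq_bigr => i _; rewrite hz mulrz_sumr.
exists t => //; rewrite basisEdim size_tuple leqnn andbT.
apply: (@subv_trans _ _ <<b>>%VS); first by rewrite (span_basis bb).
apply/span_subvP => y /(nthP 0) [i]; rewrite size_tuple => ib <-.
have := OM _ (Ob (Ordinal ib)); move/MP => [c /= e].
have -> : b`_i = N%:R^-1 *: (\sum_(i < n) t`_i *~ c i).
  by rewrite -e -scaler_nat scalerA mulVf ?scale1r // pnatr_eq0 -lt0n.
apply: memvZ; apply: memv_suml => j _; rewrite -scaler_int; apply/memvZ/memv_span/mem_nth.
by rewrite size_tuple.
Qed.

Section Transport.
Variables (L : closedFieldType) (S : L -> Prop) (K : fieldExtType rat) (X Y : avar L).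
Variables (O : K -> Prop) (iX : K -> qhom X X).
Hypotheses (hS : scalars S) (aX : abelian_variety S X) (aY : abelian_variety S Y) (hCM : has_CM S O iX).
Hypothesis divX : forall n, (0 < n)%N -> forall y : X, exists x, x *+ n = y.
Variables (q : X -> Y) (g : Y -> X) (l : nat).
Hypotheses (hq : hom S q) (hg : hom S g) (l0 : (0 < l)%N).
Hypotheses (gq : forall x, g (q x) = x *+ l) (surj : forall y, exists x, q x = y).

(** Conjugation of the action by q, whose inverse up to isogeny is g divided by l; this puts l into
    the denominator. *)
Definition transport (x : K) : qhom Y Y := (fun c => q ((iX x).1 (g c)), ((iX x).2 * l)%N).
Definition transport_order (x : K) := exists2 f, hom S f & qeq (transport x) (qint f).
Notation iY := transport.
Notation OY := transport_order.

Lemma divisible_image n : (0 < n)%N -> forall y : Y, exists x, x *+ n = y.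
Proof.
move=> n0 y; case: (surj y) => x <-; case: (divX n0 x) => z <-.
by exists (q z); rewrite (additive_muln (proj2 hq)).
Qed.
Let divY := divisible_image.

Lemma transport_dual y : q (g y) = y *+ l.
Proof. by case: (surj y) => x <-; rewrite gq (additive_muln (proj2 hq)). Qed.

Lemma transport_hom x : hom S (iY x).1 /\ (0 < (iY x).2)%N.
Proof.
have [hx n0] := iota_wf hCM x; split; last by rewrite muln_gt0 n0.
have h1 := hom_comp hS aX aX hg hx; exact: (hom_comp hS aX aY h1 hq).
Qed.

(** A criterion with a multiplier t, for an x that acts on [X] only after multiplication by t
    although it acts on [Y]. *)
Lemma transport_endo x t h phi : hom S phi -> (0 < t)%N -> endo S iX (x *+ t) h ->
  (forall a, q (h a) = phi (q a) *+ t) -> endo S iY x phi.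
Proof.
move=> hphi t0 eh hh; split=> // c; case: (surj c) => a <- /=; rewrite gq.
have [_ n0] := iota_wf hCM x.
have e1 := endo_muln hS aX hCM divX t (endo_denominator hS aX hCM divX x).
have e2 := endo_muln hS aX hCM divX (iX x).2 eh.
have E : x *+ (iX x).2 *+ t = x *+ t *+ (iX x).2 by rewrite mulrnAC.
rewrite E in e1; have F := endo_fun hCM divX e1 e2.
case: (divX t0 a) => b <-; rewrite -mulrnA [(t * l)%N]mulnC mulrnA !(additive_muln (iota_add hCM x)) in F *.
rewrite [_ *+ l *+ t]mulrnAC F !(additive_muln (proj2 hq)) (additive_muln (proj2 hphi)) hh -!mulrnA; congr (_ *+ _); lia.
Qed.

Lemma cancel_muln (Z : avar L) (u v : X -> Z) n : (0 < n)%N -> {morph u : x y / x + y} -> {morph v : x y / x + y} ->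
  (forall a, u a *+ n = v a *+ n) -> u =1 v.
Proof. by move=> n0 au av h a; case: (divX n0 a) => b <-; rewrite !additive_muln. Qed.

Lemma transport_CM : has_CM S OY iY.
Proof.
have ai x := iota_add hCM x; have n0 x : (0 < (iX x).2)%N by case: (iota_wf hCM x).
have [aq ag] := (proj2 hq, proj2 hg); have mq := additive_muln aq; have mg := additive_muln ag.
have mi x := additive_muln (ai x); have [[_ inj] _ [hadd hmul] _ _] := hCM.
have aY1 x : {morph (iY x).1 : a b / a + b} by move=> a b /=; rewrite ag ai aq.
have hom_endo phi : hom S phi -> exists x, endo S iY x phi.
  move=> hphi; have h1 := hom_comp hS aY aY hq hphi; have h2 := hom_comp hS aY aX h1 hg.
  have [z _ ez] := endo_order hCM divX h2; exists (z / l%:R).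
  apply: (transport_endo (t := l) hphi l0 (h := fun a => g (phi (q a)))); last by move=> a; rewrite transport_dual.
  by suff -> : z / l%:R *+ l = z by []; rewrite -[LHS]mulr_natr divfK ?natF_neq0.
split.
- split=> [x|x y]; first exact: transport_hom.
  move/(qeq_muln divY (aY1 x) (aY1 y)) => h; apply: inj; apply/(qeq_muln divX (ai x) (ai y)).
  apply: (cancel_muln (n := l * l * l)).
  + by rewrite !muln_gt0 l0.
  + by move=> a b; rewrite ai mulrnDl.
  + by move=> a b; rewrite ai mulrnDl.
  move=> a; have := congr1 g (h (q a)); rewrite /= !gq !mg !gq !mi -!mulrnA.
  rewrite (_ : (l * (l * ((iX y).2 * l)) = (iX y).2 * (l * l * l))%N); last lia.
  by rewrite (_ : (l * (l * ((iX x).2 * l)) = (iX x).2 * (l * l * l))%N); last lia.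
- have [_ e1] := endo1 hS aX hCM divX; exists 1%N => // a.
  by rewrite /= e1 mq transport_dual -!mulrnA; congr (_ *+ _); lia.
- have aqadd x y : {morph (qadd (iY x) (iY y)).1 : a b / a + b}.
    by move=> a b /=; rewrite !ag !ai !aq !mulrnDl addrACA.
  have aqadd' x y : {morph (qadd (iX x) (iX y)).1 : a b / a + b}.
    by move=> a b /=; rewrite !ai !mulrnDl addrACA.
  have aqcomp x y : {morph (qcomp (iY x) (iY y)).1 : a b / a + b} by move=> a b; rewrite /= ag ai aq ag ai aq.
  have aqcomp' x y : {morph (qcomp (iX x) (iX y)).1 : a b / a + b} by move=> a b; rewrite /= !ai.
  split=> x y.
    apply/(qeq_muln divY (aY1 _) (aqadd x y)) => c /=.
    have := hadd x y; move/(qeq_muln divX (ai _) (aqadd' x y)) => /(_ (g c)) /= /(congr1 q).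
    rewrite !mq aq !mq => /(congr1 (fun u => u *+ (l * l))); rewrite -!mulrnA !mulrnDl -!mulrnA => E.
    rewrite (_ : ((iX x).2 * l * ((iX y).2 * l) = (iX x).2 * (iX y).2 * (l * l))%N); last lia.
    rewrite E; congr (_ *+ _ + _ *+ _); lia.
  apply/(qeq_muln divY (aY1 _) (aqcomp x y)) => c /=; rewrite gq mi.
  have := hmul x y; move/(qeq_muln divX (ai _) (aqcomp' x y)) => /(_ (g c)) /= /(congr1 q).
  rewrite !mq => /(congr1 (fun u => u *+ (l * l))); rewrite -!mulrnA => E.
  rewrite (_ : ((iX x).2 * l * ((iX y).2 * l) = (iX x).2 * (iX y).2 * (l * l))%N); last lia.
  rewrite E; congr (_ *+ _); lia.
- by [].
move=> phi hphi; have [x [_ ex]] := hom_endo phi hphi; exists x; last by exists 1%N => // a; have := ex a; rewrite /= !mul1n.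
by exists phi => //; exists 1%N => // a; have := ex a; rewrite /= !mul1n.
Qed.

(** Multiplication by l carries each order into the other: l x acts on [Y] as q f g, and on [X] as g
    phi q. *)
Lemma transport_order_of : order_of O -> order_of OY.
Proof.
move=> oO; have hY := transport_CM.
have toE x : OY x -> exists f, endo S iY x f := order_endo hY divY (x := x).
have ofE x f : endo S iY x f -> OY x := endo_in_order hY divY (x := x) (f := f).

apply: (commensurable_order (N := l) oO l0).
- exact: ofE (endo1 hS aY hY divY).
- by move=> x y /toE [f ef] /toE [h eh]; exact: ofE (endo_mul hS aY hY divY ef eh).
- by move=> x y /toE [f ef] /toE [h eh]; exact: ofE (endo_add hS aY hY divY ef (endo_opp hS aY hY divY eh)).
- move=> x /(order_endo hCM divX) [f ef]; have eh := endo_muln hS aX hCM divX l ef.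
  have h1 := hom_comp hS aX aX hg (proj1 ef); have h2 := hom_comp hS aX aY h1 hq.
  apply: (ofE _ (fun c => q (f (g c)))); apply: (transport_endo (t := 1) h2 _ eh) => // a.
  by rewrite gq (additive_muln (proj2 (proj1 ef))).
move=> x /toE [phi [hphi ephi]].
have h1 := hom_comp hS aY aY hq hphi; have h2 := hom_comp hS aY aX h1 hg.
have [z Oz ez] := endo_order hCM divX h2; suff -> : x *+ l = z by [].
have e1 := transport_endo (x := z / l%:R) (t := l) hphi l0 (h := fun a => g (phi (q a))).
have E : z / l%:R *+ l = z by rewrite -[LHS]mulr_natr divfK ?natF_neq0.
rewrite E in e1; have e2 := e1 ez (fun a => transport_dual _).
by rewrite (endo_inj hY divY (conj hphi ephi) e2) E.
Qed.

Lemma transport_compatible : compatible iX iY q.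
Proof.
move=> x; exists 1%N => // a; rewrite /= gq (additive_muln (iota_add hCM x)) (additive_muln (proj2 hq)) -mulrnA.
congr (_ *+ _); lia.
Qed.

Lemma transport_compatible_out (Z : avar L) (iZ : K -> qhom Z Z) (f : X -> Z) (r : Y -> Z) :
  {morph f : x y / x + y} -> (forall a, f a = r (q a)) -> compatible iX iZ f -> compatible iY iZ r.
Proof.
move=> af fr h x; case: (h x) => t t0 e; exists t => // c; case: (surj c) => a <- /=.
rewrite gq -!fr (additive_muln (iota_add hCM x)) (additive_muln af).
have := congr1 (fun u => u *+ l) (e a); rewrite /= -!mulrnA => E.
rewrite (_ : (l * (t * ((iZ x).2 * 1)) = t * ((iZ x).2 * 1) * l)%N); last lia.
rewrite E; congr (_ *+ _); lia.
Qed.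

(** The kernel of q is killed by l, prime to p, so q is injective on p-torsion; g and a Bezout
    relation give surjectivity. *)
Lemma ordinary_image p : coprime p l -> ordinary_surface p X -> ordinary_surface p Y.
Proof.
move=> co [s [us sz hs]]; have mq := additive_muln (proj2 hq).
exists [seq q x | x <- s]; split; last 1 first.
- move=> c; split=> [/mapP [x /hs xp ->]|cp]; first by rewrite -mq xp (additive0 (proj2 hq)).
  have gp : g c *+ p = 0 by rewrite -(additive_muln (proj2 hg)) cp (additive0 (proj2 hg)).
  case: p co cp gp hs {sz} => [|p] co cp gp hs.
    move: co; rewrite /coprime gcd0n => /eqP l1; case: (surj c) => a <-; apply: map_f; apply/hs.
    by rewrite mulr0n.
  case: (@egcdnP l p.+1 l0) => u v e _; rewrite gcdnC (eqP co) in e.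
  apply/mapP; exists (g c *+ u); first by apply/hs; rewrite mulrnAC gp mul0rn.
  by rewrite mq transport_dual -mulrnA mulnC e mulrnDr mulnC mulrnA cp mul0rn add0r.
- rewrite map_inj_in_uniq // => x y /hs xp /hs yp e; apply/eqP; rewrite -subr_eq0; apply/eqP.
  apply: (coprime_killed co); first by rewrite mulrnBl xp yp subrr.
  by rewrite -gq (additiveB (proj2 hq)) e subrr (additive0 (proj2 hg)).
by rewrite size_map.
Qed.
End Transport.

Section Quotient.
Variables (L : closedFieldType) (S : L -> Prop) (A B : avar L).
Hypotheses (hS : scalars S) (aA : abelian_variety S A) (aB : abelian_variety S B).
Variables (f : A -> B) (g : B -> A) (l m : nat).
Variables (al be xi eta : A -> A) (alB beB xiB etaB : B -> B).
Hypotheses (l_inv : l%:R != 0 :> L) (m0 : (0 < m)%N) (co : coprime m l).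
Hypotheses (hf : hom S f) (hg : hom S g).
Hypotheses (gf : forall x, g (f x) = x *+ l) (fsurj : forall b, exists a, f a = b).
Hypotheses (spA : splitting l m al be xi eta) (spB : splitting l m alB beB xiB etaB).
Hypotheses (hal : hom S al) (hbe : hom S be) (halB : hom S alB).
Hypotheses (fal : forall x, f (al x) = alB (f x)).
Hypotheses (fxi : forall x, f (xi x) = xiB (f x)).
Variable h : {additive A -> B * A}.
Hypothesis hE : forall x, h x = (f x, al x).
Let eA := av_embedded aA.
Let eB := av_embedded aB.

Lemma component_image k : f k = 0 -> be k = 0 -> exists2 t, f t = 0 & al t = k.
Proof.
move=> fk bk; have [w hw] := split_unit spA m0 co.
have kl : k *+ l = 0 by rewrite -gf fk (additive0 (proj2 hg)).
exists (xi (k *+ w)); first by rewrite fxi (additive_muln (proj2 hf)) fk mul0rn (additive0 (sp_addxi spB)).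
have := hw k kl; rewrite -(sp_etabe spA) (additive_muln (sp_addbe spA)) bk mul0rn.
by rewrite (additive0 (sp_addeta spA)) addr0.
Qed.

(** Given a pair (b, a) satisfying the equations and x with f x = b, the difference a - al x lies in
    the kernels of f and [be]. By [component_image] it is al t with t in the kernel of f, and x + t
    is the required preimage. *)
Lemma pair_imageP (w : B * A) : (exists x, h x = w) <-> alB w.1 = f w.2 /\ be w.2 = g w.1 *+ (m * m).
Proof.
case: w => b a /=; split=> [[x]|[e1 e2]].
  by rewrite hE => -[<- <-]; rewrite -fal (sp_beal spA) gf -mulrnA mulnC.
case: (fsurj b) => x fx; case: (@component_image (a - al x)) => [||t ft at0].
- by rewrite (additiveB (proj2 hf)) fal fx e1 subrr.
- by rewrite (additiveB (proj2 hbe)) e2 (sp_beal spA) -fx gf -mulrnA mulnC subrr.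
by exists (x + t); rewrite hE (proj2 hf) ft addr0 fx (proj2 hal) at0 addrC subrK.
Qed.

Let W := pprod (asp B) (asp A).

Lemma pair_image_closed : @zclosed L S W (fun w => exists x, h x = w).
Proof.
have mf : @morph L S W (asp B) fst by apply: morph_fst. have ms : @morph L S W (asp A) snd by apply: morph_snd.
have e1 := zclosed_equalizer hS eB (@morph_comp L S W (asp B) (asp B) fst alB hS eB eB mf (proj1 halB))
  (@morph_comp L S W (asp A) (asp B) snd f hS eA eB ms (proj1 hf)).
have gm := morphS_muln hS aA (m * m) (@morph_comp L S W (asp B) (asp A) fst g hS eB eA mf (proj1 hg)).
have e2 := zclosed_equalizer hS eA (@morph_comp L S W (asp A) (asp A) snd be hS eA eA ms (proj1 hbe)) gm.
have := zclosed_and e1 e2; congr zclosed; apply: boolp.funext => w.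
by apply: boolp.propext; apply: iff_sym; exact: pair_imageP.
Qed.

Let m1 : @morph L S (asp A) (asp B) (fun x => (h x).1).
Proof. by have := proj1 hf; congr morph; apply: boolp.funext => x; rewrite hE. Qed.
Let m2 : @morph L S (asp A) (asp A) (fun x => (h x).2).
Proof. by have := proj1 hal; congr morph; apply: boolp.funext => x; rewrite hE. Qed.
Notation C := (image_avar h).
Notation f1 := (to_image h).

Lemma pair_abelian : abelian_variety S C.
Proof. exact: (image_abelian_variety hS aA aB aA m1 m2 pair_image_closed). Qed.

Lemma pair_map_hom : hom S (f1 : A -> C).
Proof. by split; [exact: (to_image_morph hS aA aB m1 m2)|exact: to_imageD]. Qed.

Definition pair_fst (c : C) : B := (image_val c).1.
Definition pair_dual (c : C) : A := g (pair_fst c).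

Lemma pair_fst_hom : hom S pair_fst.
Proof. by split=> //; exact: (image_val_fst hS aA aB pair_image_closed). Qed.

Lemma pair_fstE x : pair_fst (f1 x) = f x. Proof. by rewrite /pair_fst /= hE. Qed.

Lemma pair_dual_hom : hom S pair_dual.
Proof. exact: (hom_comp hS aB aA pair_fst_hom hg). Qed.

Lemma pair_dualE x : pair_dual (f1 x) = x *+ l. Proof. by rewrite /pair_dual pair_fstE gf. Qed.

Lemma pair_map_surj (c : C) : exists x, f1 x = c. Proof. exact: to_image_surj. Qed.

Lemma pair_map_dual c : f1 (pair_dual c) = c *+ l.
Proof. by case: (pair_map_surj c) => x <-; rewrite pair_dualE (additive_muln (proj2 pair_map_hom)). Qed.

Lemma pair_kernel x : (f1 x = 0 :> C) <-> f x = 0 /\ al x = 0.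
Proof.
split=> [/(congr1 (@image_val _ _ h)) /=|[fx ax]]; first by rewrite hE => -[].
by apply: val_inj; rewrite /= hE fx ax.
Qed.

Lemma pair_fst_surj b : exists c, pair_fst c = b.
Proof. by case: (fsurj b) => x fx; exists (f1 x); rewrite pair_fstE. Qed.

Lemma pair_fst_quotient : isogeny S pair_fst /\ quotient_by_kernel pair_fst.
Proof.
have hq : hom S (fun b => f1 (g b) : C) := hom_comp hS aA pair_abelian hg pair_map_hom.
exact: (isogeny_quotient pair_abelian aB pair_fst_hom hq pair_map_dual l_inv pair_fst_surj).
Qed.

Lemma pair_map_quotient : isogeny S (f1 : A -> C) /\ quotient_by_kernel (f1 : A -> C).
Proof. exact: (isogeny_quotient aA pair_abelian pair_map_hom pair_dual_hom pair_dualE l_inv pair_map_surj). Qed.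

Lemma pair_dim : has_dim (asp A) 2 -> has_dim (asp C) 2.
Proof.
move=> [d2 d3]; split.
  exact: (dim_ge_isogeny aA pair_abelian pair_map_hom pair_dual_hom pair_dualE l_inv d2).
move=> d; apply: d3.
exact: (dim_ge_isogeny pair_abelian aA pair_dual_hom pair_map_hom pair_map_dual l_inv d).
Qed.

(** The product map of v and u preserves the image of h, because u commutes with [al] and is
    compatible with v. *)
Lemma pair_lift (u : A -> A) (v : B -> B) : hom S u -> hom S v -> (forall x, f (u x) = v (f x)) ->
  (forall x, al (u x) = u (al x)) -> exists2 phi : C -> C, hom S phi & forall x, phi (f1 x) = f1 (u x).
Proof.
move=> hu hv fu au.
have /boolp.choice [phi hphi] (c : C) : exists c' : C, image_val c' = (v (image_val c).1, u (image_val c).2).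
  by case: (pair_map_surj c) => x <-; exists (f1 (u x)); rewrite /= !hE /= fu au.
have E x : phi (f1 x) = f1 (u x) by apply: val_inj; rewrite [LHS]hphi /= !hE /= fu au.
exists phi => //; split; last first.
  move=> c d; case: (pair_map_surj c) => x <-; case: (pair_map_surj d) => y <-.
  by rewrite -to_imageD !E -to_imageD (proj2 hu).

have i1 := image_val_fst hS aA aB pair_image_closed; have i2 := image_val_snd hS aA aB pair_image_closed.
apply: (image_morph hS aA aB).
  have := @morph_comp L S (asp C) (asp B) (asp B) _ v hS eB eB i1 (proj1 hv).
  by congr morph; apply: boolp.funext => c; rewrite hphi.
have := @morph_comp L S (asp C) (asp A) (asp A) _ u hS eA eA i2 (proj1 hu).
by congr morph; apply: boolp.funext => c; rewrite hphi.
Qed.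

Section PairKernel.
Variable g2 : A.
Hypothesis g2n : forall n, g2 *+ n = 0 <-> (l %| n)%N.
Hypothesis g2P : forall x, f x = 0 /\ be x = 0 <-> exists n, x = g2 *+ n.

Lemma pair_fst_kernel (c : C) : pair_fst c = 0 <-> exists n, c = f1 g2 *+ n.
Proof.
have f1n := additive_muln (proj2 pair_map_hom); have f1D := proj2 pair_map_hom.
have [fg bg] : f g2 = 0 /\ be g2 = 0 by apply/g2P; exists 1%N.
split=> [|[n ->]]; last by rewrite -f1n pair_fstE (additive_muln (proj2 hf)) fg mul0rn.
case: (pair_map_surj c) => x <-; rewrite pair_fstE => fx.
have [x1 [x2 [-> fx1 fx2 ax1 bx2]]] : exists x1 x2, [/\ x = x1 + x2, f x1 = 0, f x2 = 0, al x1 = 0 & be x2 = 0].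
  have xl : x *+ l = 0 by rewrite -gf fx (additive0 (proj2 hg)).
  have [w hw] := split_unit spA m0 co; have kk (u : A -> A) : {morph u : x y / x + y} -> u (x *+ w) *+ l = 0.
    by move=> au; rewrite -(additive_muln au) mulrnAC xl mul0rn (additive0 au).
  have fa : f (al (xi (x *+ w))) = 0.
    by rewrite fal fxi (additive_muln (proj2 hf)) fx mul0rn (additive0 (sp_addxi spB)) (additive0 (sp_addal spB)).
  exists (be (eta (x *+ w))), (al (xi (x *+ w))); split=> //; first by rewrite addrC hw.
  - by have := congr1 f (hw x xl); rewrite (proj2 hf) fa add0r fx.
  - by apply: (split_al_kill (splitting_swap spA)); apply/kk/sp_addeta/spA.
  by apply: (split_al_kill spA); apply/kk/sp_addxi/spA.
have [n e] : exists n, x2 = g2 *+ n by apply/g2P.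
by exists n; rewrite f1D (proj2 (pair_kernel x1)) // add0r e f1n.
Qed.

(** The two components of the kernel meet only in 0, so that f1 is injective on multiples of g2. *)
Lemma pair_generator_order n : f1 g2 *+ n = 0 :> C <-> (l %| n)%N.
Proof.
have f1n := additive_muln (proj2 pair_map_hom); rewrite -f1n; split=> [/pair_kernel [fx ax]|/g2n ->]; last first.
  exact: (additive0 (proj2 pair_map_hom)).
have [_ bx] : f (g2 *+ n) = 0 /\ be (g2 *+ n) = 0 by apply/g2P; exists n.
apply/g2n; have xl : g2 *+ n *+ l = 0 by rewrite -gf fx (additive0 (proj2 hg)).
have [w hw] := split_unit spA m0 co; rewrite -(hw _ xl) -(sp_xial spA) -(sp_etabe spA).
rewrite (additive_muln (sp_addal spA)) ax (additive_muln (sp_addbe spA)) bx !mul0rn.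
by rewrite (additive0 (sp_addxi spA)) (additive0 (sp_addeta spA)) addr0.
Qed.
End PairKernel.
End Quotient.

(** An element a z of the ideal that acts as u satisfies (m n) u = v al with v representing n z. So
    u x is killed by m n, prime to l, and by l. *)
Lemma ideal_torsion_generator (L : closedFieldType) (S : L -> Prop) (K : fieldExtType rat) (K0 : {subfield K}) (A : avar L)
  (O : K -> Prop) (iota : K -> qhom A A) (I : subvs_of K0 -> Prop) (a : subvs_of K0) l m (al : A -> A) (x : A) :
  scalars S -> abelian_variety S A -> has_CM S O iota -> (forall n, (0 < n)%N -> forall y : A, exists x, x *+ n = y) ->
  prime l -> loc_max_RM K0 l O -> coprime m l -> (forall z, I z <-> principal a z) ->
  endo S iota (vsval a *+ m) al -> al x = 0 -> x *+ l = 0 -> ideal_torsion S I iota x.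
Proof.
move=> hS aA hCM divA pl lm co hI ea ax xl b u /hI [z iz bz] hu qu.
have [n ln On] := lm z iz; case: (order_endo hCM divA On) => v ev.
have eb : endo S iota (vsval b) u by apply/(endo_qeq hCM divA).
have e1 := endo_muln hS aA hCM divA (m * n) eb; have e2 := endo_mul hS aA hCM divA ev ea.
have E : vsval b *+ (m * n) = vsval z *+ n * (vsval a *+ m).
  by rewrite bz rmorphM /= mulrnAl mulrnAr -mulrnA [vsval z * _]mulrC mulnC.
rewrite E in e1; have k := endo_fun hCM divA e1 e2 x; rewrite /= ax (additive0 (proj2 (proj1 ev))) in k.
have kl : u x *+ l = 0 by rewrite -(additive_muln (proj2 hu)) xl (additive0 (proj2 hu)).
by apply: (coprime_killed _ k kl); rewrite coprimeMl co coprime_sym prime_coprime.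
Qed.

(** Were the quotient integral, m would be a multiple of a and lie in the prime ideal together with
    l, to which it is coprime. *)
Lemma cofactor_not_in_order (K : fieldExtType rat) (K0 : {subfield K}) (O : K -> Prop) (I : subvs_of K0 -> Prop)
  (a b : subvs_of K0) l m : order_of O -> prime_ideal_of I -> (forall z, I z <-> principal a z) -> integer_of b ->
  a * b = l%:R -> (0 < l)%N -> coprime m l -> ~ O (vsval b *+ m / l%:R).
Proof.
move=> oO pI hI ib ab l0 co Oz.
have l0' := natF_neq0 (subvs_of K0) l0.
have e : vsval b *+ m / l%:R = vsval (b *+ m / l%:R) by rewrite fmorph_div /= rmorphMn rmorph_nat.
have iz : integer_of (b *+ m / l%:R) by apply: integer_vsval; rewrite -e; apply: (order_integral oO).
have Il : I l%:R by apply/hI; exists b.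
apply: (@ideal_coprime _ I l m pI Il); first by rewrite coprime_sym.
by apply/hI; exists (b *+ m / l%:R) => //; rewrite mulrA mulrnAr ab -[l%:R *+ m]mulr_natr mulrAC mulfV // mul1r.
Qed.

Theorem proposition33
  (K : fieldExtType rat) (K0 : {subfield K})
  (hCM : quartic_CM K0) (hprim : primitive_CM K)
  (hcl : class_number_one (subvs_of K0))
  (l : nat) (l_prime : prime l) (l_ge3 : (3 <= l)%N)
  (l1 l2 : subvs_of K0 -> Prop)
  (hl1 : prime_ideal_of l1) (hl2 : prime_ideal_of l2)
  (hl12 : ~ (forall x, l1 x <-> l2 x))
  (hl : forall x, principal (l%:R : subvs_of K0) x <-> ideal_mul l1 l2 x)
  (hN1 : ideal_norm l1 l) (hN2 : ideal_norm l2 l)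
  (hgen1 : exists a : subvs_of K0,
     [/\ integer_of a, totally_positive a & forall x, l1 x <-> principal a x])
  (hgen2 : exists a : subvs_of K0,
     [/\ integer_of a, totally_positive a & forall x, l2 x <-> principal a x])
  (k : finFieldType) (p : nat) (hp : p \in [pchar k]) (hpl : p <> l)
  (L : closedFieldType) (e : {rmorphism k -> L})
  (hL : forall x : L, algebraicOver e x)
  (A B : pavar L)
  (hA : principally_polarized (in_base e) A)
  (hB : principally_polarized (in_base e) B)
  (OA OB : K -> Prop) (iA : K -> qhom A A) (iB : K -> qhom B B)
  (hcA : cm_surface (in_base e) p l K0 OA iA)
  (hcB : cm_surface (in_base e) p l K0 OB iB)
  (f : A -> B) (hf : ell_isogeny (in_base e) l f) (hfc : compatible iA iB f) :
  exists (C : avar L) (OC : K -> Prop) (iC : K -> qhom C C)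
         (f1 : A -> C) (f2 : C -> B),
    [/\ cm_surface (in_base e) p l K0 OC iC,
        ideal_isogeny (in_base e) l l1 iA f1 /\ compatible iA iC f1,
        ideal_isogeny (in_base e) l l2 iC f2 /\ compatible iC iB f2 &
        forall a, f a = f2 (f1 a)].
Proof.
have hS := in_base_scalars e; have l0 := prime_gt0 l_prime.
have pL : p \in [pchar L] by rewrite (fmorph_pchar e).
have pp := pcharf_prime pL.
have li : l%:R != 0 :> L.
  by rewrite -(dvdn_pcharf pL) dvdn_prime2 //; apply/eqP.
have cpl : coprime p l by rewrite prime_coprime // dvdn_prime2 //; apply/eqP.
have [[aA dA] oA ordA rmA cmA] := hcA; have [[aB dB] oB ordB rmB cmB] := hcB.
have [MA pA] := polarized_ex aA hA; have [MB pB] := polarized_ex aB hB.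
have divA := ordinary_divisible aA (proj2 dA) pL oA; have divB := ordinary_divisible aB (proj2 dB) pL oB.
have [g [hg adj gf]] := ell_isogeny_dual hS pA pB hf.
have [[hf0 fsurj _] _] := hf.
have [a [ia _ ha]] := hgen1; have [b0 [ib0 _ hb0]] := hgen2.
have [b [x [y [ib ix iy hb [ab axby]]]]] := split_generators l0 hl1 hl2 hl12 hl hN1 ia ib0 ha hb0.
(* One multiplier must serve both orders and all four elements, so that the same relations hold on
   [A] and on [B]. *)
have [m [m0 co hm]] : exists m, [/\ (0 < m)%N, coprime m l & forall z, z \in [:: a; b; x; y] -> OA (vsval z *+ m) /\ OB (vsval z *+ m)].
  apply: (common_multiplier l_prime ordA ordB rmA rmB) => z.
  by rewrite !inE => /or4P [] /eqP ->.
have endos (z : subvs_of K0) n : OA (vsval z *+ n) -> OB (vsval z *+ n) -> exists u v,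
    [/\ endo (in_base e) iA (vsval z *+ n) u, endo (in_base e) iB (vsval z *+ n) v & forall t, f (u t) = v (f t)].
  move=> /(order_endo cmA divA) [u eu] /(order_endo cmB divB) [v ev]; exists u, v; split=> //.
  exact: (compatible_endo cmA cmB divA (proj2 hf0) hfc eu ev).
have endos' z : z \in [:: a; b; x; y] -> exists u v,
    [/\ endo (in_base e) iA (vsval z *+ m) u, endo (in_base e) iB (vsval z *+ m) v & forall t, f (u t) = v (f t)].
  by move=> /hm [h1 h2]; apply: endos.
have [al [alB [ea eaB fal]]] : exists u v,
    [/\ endo (in_base e) iA (vsval a *+ m) u, endo (in_base e) iB (vsval a *+ m) v & forall t, f (u t) = v (f t)].
  by apply: endos'; rewrite !inE eqxx.
have [be [beB [eb ebB fbe]]] : exists u v,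
    [/\ endo (in_base e) iA (vsval b *+ m) u, endo (in_base e) iB (vsval b *+ m) v & forall t, f (u t) = v (f t)].
  by apply: endos'; rewrite !inE eqxx !orbT.
have [xi [xiB [ex exB fxi]]] : exists u v,
    [/\ endo (in_base e) iA (vsval x *+ m) u, endo (in_base e) iB (vsval x *+ m) v & forall t, f (u t) = v (f t)].
  by apply: endos'; rewrite !inE eqxx !orbT.
have [eta [etaB [ey eyB feta]]] : exists u v,
    [/\ endo (in_base e) iA (vsval y *+ m) u, endo (in_base e) iB (vsval y *+ m) v & forall t, f (u t) = v (f t)].
  by apply: endos'; rewrite !inE eqxx !orbT.
have abK : vsval a * vsval b = l%:R by rewrite -rmorphM ab rmorph_nat.
have axbyK : vsval a * vsval x + vsval b * vsval y = 1 by rewrite -!rmorphM -rmorphD axby rmorph1.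
have spA := cm_splitting hS aA cmA divA abK axbyK ea eb ex ey.
have spB := cm_splitting hS aB cmB divB abK axbyK eaB ebB exB eyB.
have inK0 (z : subvs_of K0) : vsval z *+ m \in K0 by rewrite rpredMn // subvsP.
have sal := self_adjoint hL pA cmA divA hCM hprim (inK0 a) ea.
have sbe := self_adjoint hL pA cmA divA hCM hprim (inK0 b) eb.
have salB := self_adjoint hL pB cmB divB hCM hprim (inK0 a) eaB.
have sbeB := self_adjoint hL pB cmB divB hCM hprim (inK0 b) ebB.
have lK : l%:R != 0 :> K by apply: natF_neq0.
have quo (z : subvs_of K0) : vsval z *+ m = vsval z *+ m / l%:R *+ l by rewrite -[RHS]mulr_natr divfK.
have ba : b * a = l%:R by rewrite mulrC.
have nal := component_nonzero hL aA cmA divA l0 li m0 co spA eb (quo b) (cofactor_not_in_order ordA hl1 ha ib ab l0 co).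
have nbe := component_nonzero hL aA cmA divA l0 li m0 co (splitting_swap spA) ea (quo a) (cofactor_not_in_order ordA hl2 hb ia ba l0 co).
have mor (Z : avar L) (O : K -> Prop) (iZ : K -> qhom Z Z) z u : endo (in_base e) iZ z u -> @morph L anyL (asp Z) (asp Z) u.
  by case=> -[/morph_any].
have mf := morph_any (proj1 hf0); have mg := morph_any (proj1 hg).
have [g1 [g1n g1P]] := kernel_component_cyclic pA pB l_prime li m0 co mf mg (proj2 hf0) (proj2 hg) adj gf fsurj divA (proj2 dA)
  spA spB fal fbe fxi feta (mor _ OA _ _ _ ea) (mor _ OB _ _ _ eaB) (mor _ OA _ _ _ eb) (mor _ OB _ _ _ ebB)
  sal salB sbe sbeB nal nbe.
have [g2 [g2n g2P]] := kernel_component_cyclic pA pB l_prime li m0 co mf mg (proj2 hf0) (proj2 hg) adj gf fsurj divA (proj2 dA)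
  (splitting_swap spA) (splitting_swap spB) fbe fal feta fxi (mor _ OA _ _ _ eb) (mor _ OB _ _ _ ebB) (mor _ OA _ _ _ ea) (mor _ OB _ _ _ eaB)
  sbe sbeB sal salB nbe nal.
have [hal hbe halB] : [/\ hom (in_base e) al, hom (in_base e) be & hom (in_base e) alB] by case: ea; case: eb; case: eaB.
have hD : {morph (fun z => (f z, al z)) : u v / u + v} by move=> u v; rewrite (proj2 hf0) (proj2 hal).
have [h hE] := additive_of hD.
pose C := image_avar h; pose q : A -> C := to_image h; pose gC : C -> A := @pair_dual L A B g h.
pose r : C -> B := @pair_fst L A B h.
have aC : abelian_variety (in_base e) C := pair_abelian hS aA aB m0 co hf0 hg gf fsurj spA spB hal hbe halB fal fxi hE.
have hq : hom (in_base e) q := pair_map_hom hS aA aB hf0 hal hE.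
have hgC : hom (in_base e) gC := pair_dual_hom hS aA aB m0 co hf0 hg gf fsurj spA spB hal hbe halB fal fxi hE.
have gq : forall z, gC (q z) = z *+ l := pair_dualE gf hE.
have qsurj : forall c, exists z, q z = c := @to_image_surj _ _ h.
have frq z : f z = r (q z) by rewrite [RHS](pair_fstE hE).
have divC := divisible_image divA hq qsurj.
pose iC := transport iA q gC l; pose OC := transport_order (in_base e) iA q gC l.
have cmC : has_CM (in_base e) OC iC := transport_CM hS aA aC cmA divA hq hgC l0 gq qsurj.
(* An endomorphism of [A] from [K] commutes with [al]; if it has a counterpart on [B], it acts on
   [C] and represents the same element there. *)
have lift (z : subvs_of K0) n u v : endo (in_base e) iA (vsval z *+ n) u -> hom (in_base e) v ->
    (forall t, f (u t) = v (f t)) -> exists2 phi : C -> C, endo (in_base e) iC (vsval z *+ n) phi & forall t, phi (q t) = q (u t).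
  move=> eu hv fu; have alu := endo_comm hS aA cmA divA ea eu.
  have [phi hphi ephi] := pair_lift hS aA aB m0 co hf0 hg gf fsurj spA spB hal hbe halB fal fxi hE (proj1 eu) hv fu alu.
  exists phi => //; have E t : q (u t) = phi (q t) *+ 1 by rewrite mulr1n; exact/esym/ephi.
  exact: (transport_endo hS aA cmA divA hq gq qsurj (x := vsval z *+ n) (t := 1) hphi isT eu E).
have rmC : loc_max_RM K0 l OC.
  move=> z iz; have [n1 ln1 On1] := rmA z iz; have [n2 ln2 On2] := rmB z iz.
  exists (n1 * n2)%N; first by rewrite Euclid_dvdM // negb_or ln1.
  have [|| u [v [eu ev fu]]] := endos z (n1 * n2)%N; first by rewrite mulrnA; apply: order_muln.
    by rewrite mulnC mulrnA; apply: order_muln.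
  have [phi ephi _] := lift z _ u v eu (proj1 ev) fu.
  exact: (endo_in_order cmC divC ephi).
(* Membership of [q g2] in the torsion of [l2] on [C] is tested by the lift of m b, which kills
   [q g2] because [be] kills [g2]. *)
have [phib ephib phibE] := lift b m be beB eb (proj1 ebB) fbe.
have g1l : g1 *+ l = 0 by apply/g1n.
have [fg1 ag1] : f g1 = 0 /\ al g1 = 0 by apply/g1P; exists 1%N.
have [fg2 bg2] : f g2 = 0 /\ be g2 = 0 by apply/g2P; exists 1%N.
exists C, OC, iC, q, r; split=> //.
- split=> //.
  + by split=> //; apply: (pair_dim hS aA aB li m0 co hf0 hg gf fsurj spA spB hal hbe halB fal fxi hE).
  + exact: (ordinary_image hq hgC l0 gq qsurj cpl oA).
  + exact: (transport_order_of hS aA aC cmA divA hq hgC l0 gq qsurj ordA).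
- split; last exact: (transport_compatible cmA hq l0 gq).
  have [i1 i2] : isogeny (in_base e) q /\ quotient_by_kernel q :=
    pair_map_quotient hS aA aB li m0 co hf0 hg gf fsurj spA spB hal hbe halB fal fxi hE.
  split=> //; exists g1; split=> //.
    exact: (ideal_torsion_generator hS aA cmA divA l_prime rmA co ha ea ag1 g1l).
  by move=> z; rewrite -g1P; exact: (pair_kernel hE z).
split; last exact: (transport_compatible_out cmA l0 gq qsurj (proj2 hf0) frq hfc).
have [i1 i2] : isogeny (in_base e) r /\ quotient_by_kernel r :=
  pair_fst_quotient hS aA aB li m0 co hf0 hg gf fsurj spA spB hal hbe halB fal fxi hE.
have gen n : q g2 *+ n = 0 <-> (l %| n)%N := pair_generator_order hS aA aB m0 co hf0 hg gf spA hal hE g2n g2P n.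
split=> //; exists (q g2); split=> //.
  apply: (ideal_torsion_generator hS aC cmC divC l_prime rmC co hb ephib); last exact/gen.
  by rewrite phibE bg2 (additive0 (proj2 hq)).
exact: (pair_fst_kernel hS aA aB m0 co hf0 hg gf spA spB hal fal fxi hE g2P).
Qed.
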